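(* Assume (A1) and (A2) (both spelled out in the context), let $u^\infty$ be a steady state solution with $\|\nabla u^\infty\|\le \frac{\nu}{4N}$, let $w_0\in H^1(\Omega)$, and let $w$ be the weak solution of the closed-loop problem with $w(0)=w_0$. Let $0\le\alpha\le \frac{1}{2C_F}\min\{\frac{\nu}{2},\,c_0+\frac{7\nu}{4}\}$. Then for all $t>0$ $$\|\nabla w(t)\|^2+\int_{\partial\Omega}\frac{c_0+\nu+2|u^\infty|}{\nu}\,w(t)^2\,d\Gamma+\frac{1}{9\nu c_0}\|w(t)\|^4_{L^4(\partial\Omega)}+\nu e^{-2\alpha t}\int_0^t\|e^{\alpha s}\Delta w(s)\|^2\,ds\le Ce^{C}e^{-2\alpha t},$$ where $C=C(\|w_0\|_3,\nu,f^\infty)>0$ is a generic constant independent of $t$.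
   Context: Setting. $\Omega\subset\mathbb{R}^2$ is bounded with smooth boundary $\partial\Omega$; $\nu>0$ and $c_0>0$ are constants; $\mathbf 1=(1,1)$; $f^\infty=f^\infty(x)$ is a time-independent force. $(\cdot,\cdot)$ and $\|\cdot\|$ are the inner product and norm of $L^2(\Omega)$, $\|\cdot\|_m$ is the norm of $H^m(\Omega)$, and $\langle\cdot,\cdot\rangle_{\partial\Omega}$ is the inner product of $L^2(\partial\Omega)$. Put $B(v;w,\phi)=\int_\Omega v\,(\nabla w\cdot\mathbf 1)\,\phi\,dx$. $H^1/\mathbb{R}$ is the quotient space of $H^1(\Omega)$ by constants, normed by $\|\nabla v\|$. Put $|||z|||^2=\|\nabla z\|^2+\|z\|_{L^2(\partial\Omega)}^2$, $\|f^\infty\|_{-1}=\sup_{v\in H^1/\mathbb{R}}\frac{(f^\infty,v)}{\|\nabla v\|}$, $N_1=\sup_{v,z,\phi\in H^1/\mathbb{R}}\frac{B(v;z,\phi)}{\|\nabla v\|\,\|\nabla z\|\,\|\nabla\phi\|}$, $N_2=\sup_{v\in H^1/\mathbb{R},\ (z,\phi)\in (H^1(\Omega))^2}\frac{B(v;z,\phi)}{\|\nabla v\|\,|||z|||\,|||\phi|||}$, and $N=\max(N_1,N_2)$. Assumption (A1): $\|f^\infty\|_{-1}\le\frac{3\nu^2}{16N}$. Steady state: $u^\infty\in H^1/\mathbb{R}$ is a weak solution of $-\nu\Delta u^\infty+u^\infty(\nabla u^\infty\cdot\mathbf 1)=f^\infty$ in $\Omega$, $\partial u^\infty/\partial n=0$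 on $\partial\Omega$, i.e. $\nu(\nabla u^\infty,\nabla v)+B(u^\infty;u^\infty,v)=(f^\infty,v)$ for all $v\in H^1/\mathbb{R}$. Closed-loop problem: $w_t-\nu\Delta w+u^\infty(\nabla w\cdot\mathbf 1)+w(\nabla u^\infty\cdot\mathbf 1)+w(\nabla w\cdot\mathbf 1)=0$ in $\Omega\times(0,\infty)$, with feedback law $\frac{\partial w}{\partial n}=v_2:=-\frac1\nu\big((c_0+\nu+2|u^\infty|)w+\frac{2}{9c_0}w^3\big)$ on $\partial\Omega\times(0,\infty)$ and $w(0)=w_0$. Its weak formulation is: for all $v\in H^1(\Omega)$, $$(w_t,v)+\nu(\nabla w,\nabla v)+B(u^\infty;w,v)+B(w;u^\infty,v)+B(w;w,v)+\Big\langle(c_0+\nu+2|u^\infty|)w+\tfrac{2}{9c_0}w^3,v\Big\rangle_{\partial\Omega}=0.$$ Assumption (A2): $u^\infty\in H^2(\Omega)$, $f^\infty\in L^2(\Omega)$; the compatibility conditions $\frac{\partial w_0}{\partial n}=v_2(x,0)$ and $\frac{\partial w_t}{\partial n}(x,0)=v_{2t}(x,0)$ hold at $t=0$; and there is a unique weak solution $w$, satisfying $\|w(t)\|_2^2+\|w_t(t)\|_1^2+\int_0^t\|w_t(s)\|_2^2\,ds\le C$. $C_F>0$ is the constant in Friedrichs's inequality $\|y\|^2\le C_F(\|\nabla y\|^2+\|y\|^2_{L^2(\partial\Omega)})$, $y\in H^1(\Omega)$. *)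

(* Defs.v *)
From HB Require Import structures.
From mathcomp Require Import all_boot all_order all_algebra.
From mathcomp Require Import all_classical all_reals all_analysis.
Set Implicit Arguments.
Unset Strict Implicit.
Unset Printing Implicit Defensive.
Import Order.TTheory GRing.Theory Num.Theory.
Import numFieldNormedType.Exports.
Local Open Scope classical_set_scope.
Local Open Scope ring_scope.

(* A function class such as L^2(Om) or H^m(Om) is a predicate on representatives
   R * R -> R; only their values almost everywhere on Om matter. *)

(* The carrier is R * R; this form carries the Borel sigma-algebra for which
   lebesgue_measure is declared. *)
Definition plane (R : realType) := (measurableTypeR R * measurableTypeR R)%type.

Definition leb2 (R : realType) : {measure set (plane R) -> \bar R} :=
  (@lebesgue_measure R \x @lebesgue_measure R)%E.

Section SmoothFunctions.
Context {R : realType}.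

Definition unit_vec (i : 'I_2) : R * R := if i == 0 then (1, 0) else (0, 1).

Definition partial (i : 'I_2) (f : R * R -> R) : R * R -> R :=
  fun x => 'D_(unit_vec i) f x.

(* C^oo: all iterated partial derivatives exist and are continuous. *)
Definition smooth2 (f : R * R -> R) : Prop :=
  forall s : seq 'I_2, let g := foldr partial f s in
    continuous g /\ (forall i x, derivable g x (unit_vec i)).

Definition smooth1 (h : R -> R) : Prop :=
  forall n x, derivable (derive1n n h) x 1.

Definition test_function (Om : set (R * R)) (phi : R * R -> R) : Prop :=
  smooth2 phi /\
  exists K : set (R * R),
    [/\ compact K, K `<=` Om & forall x, ~ K x -> phi x = 0].

End SmoothFunctions.

Section Domains.
Context {R : realType}.

Definition bd (Om : set (R * R)) : set (R * R) := closure Om `\` interior Om.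

Definition relabel (sw : bool) (p : R * R) : R * R :=
  if sw then (p.2, p.1) else p.

(* In the open set U, and up to exchanging the two coordinates (sw) and
   reversing the second one (b), Om is the region above the graph of h. *)
Definition boundary_chart (Om U : set (R * R)) (sw b : bool) (h : R -> R) : Prop :=
  [/\ open U, smooth1 h &
      forall p, U p -> (Om p <->
        0 < (-1) ^+ b * ((relabel sw p).2 - h (relabel sw p).1))].

(* Connectedness is what makes v |-> ||grad v|| a norm on H^1/R. *)
Definition smooth_bounded_domain (Om : set (R * R)) : Prop :=
  [/\ open Om, connected Om, bounded_set Om &
      forall p, bd Om p ->
        exists U sw b h, U p /\ boundary_chart Om U sw b h].

(* The arc length measure dGamma of the boundary, as a Borel measure on the
   plane. It is determined by the two clauses, because the charts cover bd Om. *)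
Definition arclength_measure (Om : set (R * R))
    (sigma : {measure set (plane R) -> \bar R}) : Prop :=
  sigma (~` bd Om) = 0%E /\
  forall U sw b h, boundary_chart Om U sw b h ->
  forall A : set (plane R), measurable A -> A `<=` U ->
    sigma A = (\int[lebesgue_measure]_(s in [set s | A (relabel sw (s, h s))])
                 (Num.sqrt (1 + derive1 h s ^+ 2))%:E)%E.

End Domains.

Section Lebesgue2.
Context {R : realType} (mu : {measure set (plane R) -> \bar R}) (D : set (R * R)).

Definition L2 (u : R * R -> R) : Prop :=
  measurable_fun (D : set (plane R)) u /\
  (\int[mu]_(x in D) (u x ^+ 2)%:E < +oo)%E.

Definition ip (u v : R * R -> R) : R := \int[mu]_(x in D) (u x * v x).

Definition nrm (u : R * R -> R) : R := Num.sqrt (ip u u).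

End Lebesgue2.

Section Sobolev.
Context {R : realType} (Om : set (R * R)).
Notation leb := (leb2 R).

Definition is_weak_derivative (i : 'I_2) (u g : R * R -> R) : Prop :=
  L2 leb Om g /\
  forall phi, test_function Om phi ->
    ip leb Om u (partial i phi) = - ip leb Om g phi.

(* A representative of the weak derivative, if u has one in L^2(Om). *)
Definition wD (i : 'I_2) (u : R * R -> R) : R * R -> R :=
  xget (fun=> 0) [set g | is_weak_derivative i u g].

Fixpoint Hm (m : nat) (u : R * R -> R) : Prop :=
  if m is m'.+1 then
    L2 leb Om u /\
    forall i, exists g, is_weak_derivative i u g /\ Hm m' g
  else L2 leb Om u.

(* The sum is over all multi-indices (j, k - j) of order k <= m. *)
Definition hnorm (m : nat) (u : R * R -> R) : R :=
  Num.sqrt (\sum_(k < m.+1) \sum_(j < k.+1)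
    nrm leb Om (iter j (wD 0) (iter (k - j) (wD 1) u)) ^+ 2).

Definition gip (u v : R * R -> R) : R := \sum_(i < 2) ip leb Om (wD i u) (wD i v).

Definition gnrm (u : R * R -> R) : R := Num.sqrt (gip u u).

Definition lap (u : R * R -> R) : R * R -> R :=
  fun x => \sum_(i < 2) wD i (wD i u) x.

(* H^1/R, each class being represented by its element of mean zero; B and
   (f, v) below depend on the representative. *)
Definition H1modR (v : R * R -> R) : Prop :=
  Hm 1 v /\ \int[leb]_(x in Om) v x = 0.

Definition Btri (v w phi : R * R -> R) : R :=
  \int[leb]_(x in Om) (v x * (wD 0 w x + wD 1 w x) * phi x).

Definition norm_minus1 (f : R * R -> R) : \bar R :=
  ereal_sup [set r : \bar R | exists v, [/\ H1modR v, gnrm v != 0 &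
    r = (ip leb Om f v / gnrm v)%:E]].

End Sobolev.

Section Boundary.
Context {R : realType} (Om : set (R * R)) (sigma : {measure set (plane R) -> \bar R}).
Notation leb := (leb2 R).

(* The trace is the continuous extension to H^1(Om) of the restriction of
   smooth functions to the boundary. *)
Definition is_trace (u g : R * R -> R) : Prop :=
  L2 sigma (bd Om) g /\
  exists phi : nat -> (R * R -> R),
    [/\ forall n, smooth2 (phi n),
        (fun n => hnorm Om 1 (fun x => phi n x - u x)) @ \oo --> (0 : R) &
        (fun n => nrm sigma (bd Om) (fun x => phi n x - g x)) @ \oo --> (0 : R)].

Definition tr (u : R * R -> R) : R * R -> R :=
  xget (fun=> 0) [set g | is_trace u g].

(* dz/dn = q on the boundary, for z in H^1(Om) with Laplacian l in L^2(Om), in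
   the sense of Green's formula; for z in H^2(Om) this is the trace of the
   gradient times the outward normal. *)
Definition normal_derivative (z q : R * R -> R) : Prop :=
  [/\ Hm Om 1 z, L2 sigma (bd Om) q &
      exists l, L2 leb Om l /\
        forall v, Hm Om 1 v ->
          gip Om z v + ip leb Om l v = ip sigma (bd Om) q (tr v)].

(* |||z||| *)
Definition tnrm (z : R * R -> R) : R :=
  Num.sqrt (gnrm Om z ^+ 2 + nrm sigma (bd Om) (tr z) ^+ 2).

(* N1, N2 and N are suprema in [-oo, +oo]. *)
Definition N1 : \bar R :=
  ereal_sup [set r : \bar R | exists v z phi,
    [/\ H1modR Om v, H1modR Om z & H1modR Om phi] /\
    [/\ gnrm Om v != 0, gnrm Om z != 0, gnrm Om phi != 0 &
      r = (Btri Om v z phi / (gnrm Om v * gnrm Om z * gnrm Om phi))%:E]].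

Definition N2 : \bar R :=
  ereal_sup [set r : \bar R | exists v z phi,
    [/\ H1modR Om v, Hm Om 1 z & Hm Om 1 phi] /\
    [/\ gnrm Om v != 0, tnrm z != 0, tnrm phi != 0 &
      r = (Btri Om v z phi / (gnrm Om v * tnrm z * tnrm phi))%:E]].

Definition Nconst : \bar R := Order.max N1 N2.

Definition assumption_A1 (nu : R) (f : R * R -> R) : Prop :=
  (norm_minus1 Om f <= (3 * nu ^+ 2 / 16)%:E / Nconst)%E.

Definition steady_state (nu : R) (f u : R * R -> R) : Prop :=
  H1modR Om u /\
  forall v, H1modR Om v ->
    nu * gip Om u v + Btri Om u u v = ip leb Om f v.

Definition friedrichs_constant (CF : R) : Prop :=
  0 < CF /\
  forall y, Hm Om 1 y ->
    nrm leb Om y ^+ 2 <=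
      CF * (gnrm Om y ^+ 2 + nrm sigma (bd Om) (tr y) ^+ 2).

(* wt t is the derivative of t |-> w t in L^2(Om), one-sided at t = 0. *)
Definition time_derivative (w wt : R -> R * R -> R) : Prop :=
  forall t, 0 <= t -> forall e, 0 < e ->
    \forall h \near (0 : R)^', 0 <= t + h ->
      nrm leb Om (fun x => h^-1 * (w (t + h) x - w t x) - wt t x) < e.

Definition weak_solution (nu c0 : R) (u w0 : R * R -> R)
    (w wt : R -> R * R -> R) : Prop :=
  [/\ forall t, 0 <= t -> Hm Om 1 (w t) /\ L2 leb Om (wt t),
      time_derivative w wt,
      {ae leb, forall x : plane R, Om x -> w 0 x = w0 x} &
      forall t, 0 < t -> forall v, Hm Om 1 v ->
        ip leb Om (wt t) v + nu * gip Om (w t) v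
        + Btri Om u (w t) v + Btri Om (w t) u v + Btri Om (w t) (w t) v
        + ip sigma (bd Om)
            (fun x => (c0 + nu + 2 * `|tr u x|) * tr (w t) x
                      + 2 / (9 * c0) * tr (w t) x ^+ 3)
            (tr v)
        = 0].

Definition feedback (nu c0 : R) (u z : R * R -> R) : R * R -> R :=
  fun x => - nu^-1 * ((c0 + nu + 2 * `|tr u x|) * tr z x
                      + 2 / (9 * c0) * tr z x ^+ 3).

(* The time derivative of the feedback along w = z, w_t = zt. *)
Definition feedback_t (nu c0 : R) (u z zt : R * R -> R) : R * R -> R :=
  fun x => - nu^-1 * ((c0 + nu + 2 * `|tr u x|) * tr zt x
                      + 2 / (9 * c0) * (3 * tr z x ^+ 2 * tr zt x)).

Definition assumption_A2 (nu c0 : R) (f u w0 : R * R -> R)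
    (w wt : R -> R * R -> R) : Prop :=
  [/\ Hm Om 2 u /\ L2 leb Om f,
      normal_derivative w0 (feedback nu c0 u w0),
      normal_derivative (wt 0) (feedback_t nu c0 u w0 (wt 0)),
      weak_solution nu c0 u w0 w wt /\
      (forall w' wt', weak_solution nu c0 u w0 w' wt' ->
         forall t, 0 <= t ->
           {ae leb, forall x : plane R, Om x -> w' t x = w t x}) &
      [/\ forall t, 0 <= t -> Hm Om 2 (w t) /\ Hm Om 1 (wt t),
          {ae lebesgue_measure, forall s : R, 0 <= s -> Hm Om 2 (wt s)} &
          exists K : R, forall t, 0 <= t ->
            ((hnorm Om 2 (w t) ^+ 2 + hnorm Om 1 (wt t) ^+ 2)%:E
             + \int[lebesgue_measure]_(s in `[0%R, t]) (hnorm Om 2 (wt s) ^+ 2)%:E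
             <= K%:E)%E]].

End Boundary.

(* Main.v *)
From HB Require Import structures.
Require Import Defs.
From mathcomp Require Import all_boot all_order all_algebra.
From mathcomp Require Import all_classical all_reals all_analysis.
From mathcomp Require Import measurable_realfun ring lra.
Set Implicit Arguments.
Unset Strict Implicit.
Unset Printing Implicit Defensive.
Import Order.TTheory GRing.Theory Num.Theory.
Import numFieldNormedType.Exports.
Local Open Scope classical_set_scope.
Local Open Scope ring_scope.

(** The steady state is unique up to null sets: the difference d of two solutions
    satisfies nu |grad d|^2 <= (nu/2) |grad d|^2, and Om is connected. A constant
    that depends on nu and f may therefore depend on u.

    Testing the equation with w, and integrating div(u w^2) and div(w^3) to the
    boundary, shows that -(w_t, w) dominates nu/4 times the first three terms of
    the estimate, so these are bounded by |w_t| |w|, and |w| itself by |w_t|. The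
    decay of w_t comes from the difference D = w(t+h) - w(t): the same computation
    gives d/dt |D|^2 <= -lam |D|^2 + C (|grad w(t)|^2 + |grad w(t+h)|^2) |D|^2,
    where the gradients are integrable in time by the energy estimate for w. This
    is integrated without differentiating w_t and divided by h^2. Comparing w(t)
    with the constant w_0, a solution with the force nu lap w_0 minus the
    convection, bounds the initial difference quotients. Finally the Laplacian is
    read off the equation; the term w grad w is controlled by testing with w^3.

    The inequalities used for functions of H^2 (trace, L^4 and sup bounds, and the
    divergence theorem with constant sqrt 2) are proved for smooth functions in
    boundary charts, glued by a partition of unity and extended by density. *)

(** * Square-integrable functions *)

Section PlaneMeasurability.
Context {R : realType}.

(** [wD] and [tr] pick arbitrary representatives, so nothing about them holds pointwise. The steady
    state and each w(t) are therefore replaced by [reg] representatives, uniform limits of smooth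
    functions on the closed domain: there traces are restrictions, products obey the Leibniz rule
    and cubes are admissible test functions. The numerical constants have to fit. The factor sqrt 2
    is the length of (1, 1), and the charts are glued without enlarging it. Half of c_0 z^2 and half
    of the cubic feedback then absorb B(z; z, z) as a perfect square, and the feedback 2 |u|
    dominates sqrt 2 |u|. The gradients in the inequality for D are never integrated in time: |w|^2
    decreases at a rate proportional to |grad w|^2, so exp(k |w|^2) is an integrating factor that
    cancels them, and only derivatives in time occur. The bound may depend on nu, f and the norm of
    w_0 only. For each pair (nu, f) a reference steady state and a reference Friedrichs constant are
    fixed; the given Friedrichs constant affects the decay rate alone. *)

Lemma ltr_dist_itv (x y d : R) : x - d < y -> y < x + d -> `|x - y| < d.
Proof. by move=> h1 h2; rewrite ltr_norml; apply/andP; split; lra. Qed.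

Lemma sqr_normr (x : R) : `|x| ^+ 2 = x ^+ 2.
Proof. by rewrite real_normK ?num_real. Qed.

(** An open set is the countable union, over rational centres and radii 1/(k+1), of the boxes that
    it contains, and boxes are measurable for the product sigma-algebra. *)
Lemma open_plane_measurable (U : set (R * R)) :
  open U -> measurable (U : set (plane R)).
Proof.
move=> oU.
pose box (q : rat * rat * nat) : set (plane R) :=
  ball (ratr q.1.1 : R) (q.2.+1%:R^-1) `*` ball (ratr q.1.2 : R) (q.2.+1%:R^-1).
have mbox q : measurable (box q).
  by apply: measurableX; apply: open_measurable; exact: ball_open.
have -> : U = \bigcup_(n in [set: nat])
    (if unpickle n is Some q then if `[< box q `<=` U >] then box q else set0
     else set0).
  apply/seteqP; split=> [p Up|p [n _]]; last first.
    by case: unpickle => // q; case: asboolP => // + bq; exact.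
  have : nbhs p U by exact: open_nbhs_nbhs.
  move=> /nbhs_ballP[e /= e0 pe].
  have e2 : 0 < e / 2 by rewrite divr_gt0.
  near \oo => k.
  have ke : k.+1%:R^-1 < e / 2.
    by near: k; exact: (near_infty_natSinv_lt (PosNum e2)).
  have rat_near (x : R) : exists q : rat, `|x - ratr q| < k.+1%:R^-1.
    have : x - k.+1%:R^-1 < x + k.+1%:R^-1.
      by rewrite ltrBlDr -addrA ltrDl addr_gt0// invr_gt0.
    move=> /rat_in_itvoo[q]; rewrite in_itv/= => /andP[h1 h2].
    by exists q; exact: ltr_dist_itv.
  have [q1 h1] := rat_near p.1; have [q2 h2] := rat_near p.2.
  exists (pickle (q1, q2, k)); first by []; rewrite pickleK.
  case: asboolP => [_|]; first by split; rewrite /ball/= distrC.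
  case=> -[y1 y2] [/= y1b y2b]; apply: pe; rewrite /ball/= in y1b y2b.
  have tri (x q y d : R) : d < e / 2 -> `|x - q| < d -> `|q - y| < d -> `|x - y| < e.
    move=> de; rewrite !ltr_norml => /andP[? ?] /andP[? ?]; apply/andP; split; lra.
  by split => /=; rewrite /ball/=; [exact: (tri _ (ratr q1) _ _ ke)|exact: (tri _ (ratr q2) _ _ ke)].
by apply: bigcupT_measurable => n; case: unpickle => // q; case: asboolP.
Unshelve. all: by end_near. Qed.

Lemma closed_plane_measurable (U : set (R * R)) :
  closed U -> measurable (U : set (plane R)).
Proof.
by move=> /closed_openC/open_plane_measurable/measurableC; rewrite setCK.
Qed.

Lemma continuous_plane_measurable (f : R * R -> R) (D : set (plane R)) :
  continuous f -> measurable_fun D f.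
Proof.
move=> cf; apply: measurable_funTS => _.
apply: (measurability _ (RGenOpens.measurableE R)) => //.
move=> _ [_ [a [b ->] <-]]; rewrite setTI.
apply: open_plane_measurable; move/continuousP : cf; apply.
exact: interval_open.
Qed.

End PlaneMeasurability.

Section SquareIntegrable.
Context {R : realType} (mu : {measure set (plane R) -> \bar R}) (D : set (R * R)).
Hypothesis mD : measurable (D : set (plane R)).
Local Notation L2 := (L2 mu D).
Local Notation ip := (ip mu D).
Local Notation nrm := (nrm mu D).
Local Notation intg f := (mu.-integrable (D : set (plane R)) (EFin \o f)).
Implicit Types f g h : R * R -> R.

Lemma L2_sqr_integrable f : L2 f -> intg (fun x => f x ^+ 2).
Proof.
move=> [mf fy]; apply/integrableP; split.
  by apply/measurable_EFinP; exact: measurable_funX.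
apply: le_lt_trans fy; apply: ge0_le_integral => //=.
- by apply/measurable_EFinP; apply: measurableT_comp => //; exact: measurable_funX.
- by apply/measurable_EFinP; exact: measurable_funX.
by move=> x _; rewrite lee_fin ger0_norm// sqr_ge0.
Qed.

Lemma sqr_integrable_L2 f : measurable_fun (D : set (plane R)) f ->
  intg (fun x => f x ^+ 2) -> L2 f.
Proof.
move=> mf /integrableP[_ fy]; split=> //; apply: le_lt_trans fy.
apply: ge0_le_integral => //=.
- by move=> x _; rewrite lee_fin sqr_ge0.
- by apply/measurable_EFinP; exact: measurable_funX.
- by apply/measurable_EFinP; apply: measurableT_comp => //; exact: measurable_funX.
- by move=> x _; rewrite lee_fin ger0_norm// sqr_ge0.
Qed.

Lemma L2_mul_integrable f g : L2 f -> L2 g -> intg (fun x => f x * g x).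
Proof.
move=> Lf Lg; have [mf _] := Lf; have [mg _] := Lg.
have : intg (fun x => f x ^+ 2 + g x ^+ 2).
  rewrite (_ : _ \o _ = (EFin \o (fun x => f x ^+ 2)) \+ (EFin \o (fun x => g x ^+ 2)))//.
  by apply: integrableD => //; exact: L2_sqr_integrable.
apply: le_integrable => //.
  by apply/measurable_EFinP; exact: measurable_funM.
move=> x _ /=; rewrite lee_fin [leRHS]ger0_norm ?addr_ge0 ?sqr_ge0//.
by have := sqr_ge0 (f x + g x); have := sqr_ge0 (f x - g x);
  rewrite ler_norml !expr2 => ? ?; apply/andP; split; nra.
Qed.

Lemma le_L2 f g : measurable_fun (D : set (plane R)) f -> L2 g ->
  (forall x, D x -> `|f x| <= `|g x|) -> L2 f.
Proof.
move=> mf Lg fg; apply: sqr_integrable_L2 => //.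
apply: le_integrable (L2_sqr_integrable Lg) => //.
  by apply/measurable_EFinP; exact: measurable_funX.
move=> x Dx /=; rewrite lee_fin !ger0_norm ?sqr_ge0//.
by rewrite -(sqr_normr (f x)) -(sqr_normr (g x)) ler_pXn2r ?nnegrE// fg.
Qed.

Lemma L2_eq f g : (forall x, D x -> f x = g x) -> L2 f -> L2 g.
Proof.
move=> fg Lf; apply: (le_L2 _ Lf) => [|x Dx]; last by rewrite fg.
by apply: eq_measurable_fun Lf.1 => x /set_mem; exact: fg.
Qed.

Lemma L2_0 : L2 (fun=> 0).
Proof.
split; first exact: measurable_cst.
by rewrite (_ : (fun x => _) = cst 0%E) ?integral0// funeqE => x; rewrite expr2 mul0r.
Qed.

Lemma L2D f g : L2 f -> L2 g -> L2 (fun x => f x + g x).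
Proof.
move=> Lf Lg; have [mf _] := Lf; have [mg _] := Lg.
apply: sqr_integrable_L2; first exact: measurable_funD.
have : intg (fun x => 2 * f x ^+ 2 + 2 * g x ^+ 2).
  rewrite (_ : _ \o _ = (fun x => 2%:E * (EFin \o (fun x => f x ^+ 2)%R) x)%E \+
     (fun x => 2%:E * (EFin \o (fun x => g x ^+ 2)%R) x)%E)//.
  by apply: integrableD => //; apply: integrableZl => //; exact: L2_sqr_integrable.
apply: le_integrable => //.
  by apply/measurable_EFinP; apply: measurable_funX; exact: measurable_funD.
move=> x _ /=; rewrite lee_fin.
have := sqr_ge0 (f x); have := sqr_ge0 (g x) => g0 f0.
rewrite !ger0_norm; [|lra|exact: sqr_ge0].
by have := sqr_ge0 (f x - g x); rewrite !expr2 => ?; nra.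
Qed.

Lemma L2Z c f : L2 f -> L2 (fun x => c * f x).
Proof.
move=> Lf; apply: sqr_integrable_L2; first by apply: measurable_funM => //; case: Lf.
rewrite (_ : _ \o _ = (fun x => (c ^+ 2)%:E * (EFin \o (fun x => f x ^+ 2)%R) x)%E).
  by apply: integrableZl => //; exact: L2_sqr_integrable.
by rewrite funeqE => x /=; rewrite -EFinM exprMn.
Qed.

Lemma L2N f : L2 f -> L2 (fun x => - f x).
Proof. by move=> /(L2Z (-1)); under eq_fun do rewrite mulN1r. Qed.

Lemma L2B f g : L2 f -> L2 g -> L2 (fun x => f x - g x).
Proof. by move=> Lf /L2N; exact: L2D. Qed.

Lemma L2_abs f : L2 f -> L2 (fun x => `|f x|).
Proof.
move=> Lf; apply: (le_L2 _ Lf) => [|x _]; last by rewrite normr_id.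
by apply: measurableT_comp => //; case: Lf.
Qed.

Lemma L2_mulr_bounded f g (M : R) : measurable_fun (D : set (plane R)) g ->
  (forall x, D x -> `|g x| <= M) -> L2 f -> L2 (fun x => g x * f x).
Proof.
move=> mg gM Lf; apply: (le_L2 _ (L2Z M Lf)); first by apply: measurable_funM => //; case: Lf.
move=> x Dx; by rewrite !normrM ler_wpM2r// (le_trans (gM _ Dx))// ler_norm.
Qed.

Lemma ipC f g : ip f g = ip g f.
Proof. by rewrite /Defs.ip; under eq_Rintegral do rewrite mulrC. Qed.

Lemma eq_ip f g f' g' : (forall x, D x -> f x = f' x) ->
  (forall x, D x -> g x = g' x) -> ip f g = ip f' g'.
Proof. by move=> ff gg; apply: eq_Rintegral => x /set_mem Dx; rewrite ff// gg. Qed.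

Lemma ipDl f g h : L2 f -> L2 g -> L2 h ->
  ip (fun x => f x + g x) h = ip f h + ip g h.
Proof.
move=> Lf Lg Lh; rewrite /Defs.ip -RintegralD//; [|exact: L2_mul_integrable..].
by apply: eq_Rintegral => x _; rewrite mulrDl.
Qed.

Lemma ipZl c f h : L2 f -> L2 h -> ip (fun x => c * f x) h = c * ip f h.
Proof.
move=> Lf Lh; rewrite /Defs.ip -RintegralZl//; last exact: L2_mul_integrable.
by apply: eq_Rintegral => x _; rewrite mulrA.
Qed.

Lemma ipNl f h : L2 f -> L2 h -> ip (fun x => - f x) h = - ip f h.
Proof.
by move=> Lf Lh; rewrite -mulN1r -ipZl//; apply: eq_ip => // x _; rewrite mulN1r.
Qed.

Lemma ipBl f g h : L2 f -> L2 g -> L2 h ->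
  ip (fun x => f x - g x) h = ip f h - ip g h.
Proof. by move=> Lf Lg Lh; rewrite ipDl ?ipNl//; exact: L2N. Qed.

Lemma ipDr f g h : L2 f -> L2 g -> L2 h ->
  ip h (fun x => f x + g x) = ip h f + ip h g.
Proof. by move=> *; rewrite ipC ipDl// !(ipC h). Qed.

Lemma ipBr f g h : L2 f -> L2 g -> L2 h ->
  ip h (fun x => f x - g x) = ip h f - ip h g.
Proof. by move=> *; rewrite ipC ipBl// !(ipC h). Qed.

Lemma ipZr c f h : L2 f -> L2 h -> ip h (fun x => c * f x) = c * ip h f.
Proof. by move=> *; rewrite ipC ipZl// (ipC h). Qed.

Lemma ipNr f h : L2 f -> L2 h -> ip h (fun x => - f x) = - ip h f.
Proof. by move=> *; rewrite ipC ipNl// (ipC h). Qed.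

Lemma ip_ge0 f g : (forall x, D x -> 0 <= f x * g x) -> 0 <= ip f g.
Proof. by move=> fg; exact: Rintegral_ge0. Qed.

Lemma ip_self_ge0 f : 0 <= ip f f.
Proof. by apply: ip_ge0 => x _; rewrite -expr2 sqr_ge0. Qed.

Lemma nrm_ge0 f : 0 <= nrm f. Proof. exact: sqrtr_ge0. Qed.

Lemma sqr_nrm f : nrm f ^+ 2 = ip f f.
Proof. by rewrite sqr_sqrtr// ip_self_ge0. Qed.

(** Finiteness of the integral lets [fine] be undone. Integral inequalities that are proved in the
    extended reals come back to norms through this identity. *)
Lemma nrm_EFin f : L2 f -> ((nrm f ^+ 2)%:E = \int[mu]_(x in D) (f x ^+ 2)%:E)%E.
Proof.
move=> Lf; rewrite sqr_nrm /Defs.ip /Rintegral fineK//.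
by apply: integrable_fin_num => //; exact: L2_sqr_integrable.
Qed.

Lemma eq_nrm f g : (forall x, D x -> f x = g x) -> nrm f = nrm g.
Proof. by move=> fg; congr Num.sqrt; exact: eq_ip. Qed.

Lemma nrm0 : nrm (fun=> 0) = 0.
Proof.
rewrite /Defs.nrm /Defs.ip.
by under eq_Rintegral do rewrite mul0r; rewrite Rintegral_cst// mul0r sqrtr0.
Qed.

(** The polynomial |f - t g|^2 in t is nonnegative. Its value at t = (f, g)/|g|^2 gives the
    inequality; |g| = 0 is treated apart. *)
Lemma cauchy_schwarz f g : L2 f -> L2 g -> `|ip f g| <= nrm f * nrm g.
Proof.
move=> Lf Lg; have quad t : 0 <= ip f f - 2 * t * ip f g + t ^+ 2 * ip g g.
  have := ip_self_ge0 (fun x => f x - t * g x).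
  have Ltg := L2Z t Lg.
  rewrite ipBl ?ipBr ?ipZl ?ipZr//; last exact: L2B.
  by rewrite (ipC g f); congr (_ <= _); ring.
rewrite -(@ler_pXn2r _ 2)// ?nnegrE ?mulr_ge0 ?nrm_ge0//.
rewrite real_normK ?num_real// exprMn !sqr_nrm.
have [g0|g0] := eqVneq (ip g g) 0.
  have [->|fg0] := eqVneq (ip f g) 0; first by rewrite expr2 mul0r g0 mulr0.
  (* If (f, g) were nonzero, this t would give the polynomial the value -1. *)
  have := quad ((ip f f + 1) / (2 * ip f g)); rewrite g0 mulr0 addr0.
  rewrite (_ : 2 * _ * _ = ip f f + 1); last by field; rewrite fg0.
  by rewrite opprD addrA subrr add0r => ?; lra.
have gp : 0 < ip g g by rewrite lt_def g0 ip_self_ge0.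
have := quad (ip f g / ip g g).
rewrite (_ : _ + _ = ip f f - ip f g ^+ 2 / ip g g); last by field.
by rewrite subr_ge0 ler_pdivrMr.
Qed.

Lemma le_ip_nrm f g : L2 f -> L2 g -> ip f g <= nrm f * nrm g.
Proof. by move=> Lf Lg; apply: le_trans (cauchy_schwarz Lf Lg); exact: ler_norm. Qed.

Lemma nrmZ c f : L2 f -> nrm (fun x => c * f x) = `|c| * nrm f.
Proof.
move=> Lf; rewrite /Defs.nrm ipZl ?ipZr//; last exact: L2Z.
by rewrite mulrA -expr2 sqrtrM ?sqr_ge0// sqrtr_sqr.
Qed.

Lemma nrmN f : nrm (fun x => - f x) = nrm f.
Proof. by congr Num.sqrt; apply: eq_Rintegral => x _; rewrite mulrNN. Qed.

Lemma nrm_abs f : nrm (fun x => `|f x|) = nrm f.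
Proof. by congr Num.sqrt; apply: eq_Rintegral => x _; rewrite -!expr2 sqr_normr. Qed.

Lemma ler_nrmD f g : L2 f -> L2 g -> nrm (fun x => f x + g x) <= nrm f + nrm g.
Proof.
move=> Lf Lg; rewrite -(@ler_pXn2r _ 2)// ?nnegrE ?addr_ge0 ?nrm_ge0//.
have LD := L2D Lf Lg.
rewrite sqr_nrm ipDl ?ipDr// (ipC g f) sqrrD !sqr_nrm.
by have := le_ip_nrm Lf Lg; lra.
Qed.

Lemma ler_nrmB f g : L2 f -> L2 g -> nrm (fun x => f x - g x) <= nrm f + nrm g.
Proof. by move=> Lf Lg; rewrite -(nrmN g); apply: ler_nrmD => //; exact: L2N. Qed.

Lemma nrmBC f g : nrm (fun x => f x - g x) = nrm (fun x => g x - f x).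
Proof. by rewrite -nrmN; apply: eq_nrm => x _; rewrite opprB. Qed.

Lemma ler_nrm_tri f g h : L2 f -> L2 g -> L2 h ->
  nrm (fun x => f x - h x) <= nrm (fun x => f x - g x) + nrm (fun x => g x - h x).
Proof.
move=> Lf Lg Lh; apply: le_trans (ler_nrmD (L2B Lf Lg) (L2B Lg Lh)).
by rewrite le_eqVlt; apply/orP; left; apply/eqP; apply: eq_nrm => x _; ring.
Qed.

Lemma ler_nrm_dist f g : L2 f -> L2 g -> `|nrm f - nrm g| <= nrm (fun x => f x - g x).
Proof.
move=> Lf Lg; have h1 := ler_nrmD (L2B Lf Lg) Lg.
have h2 := ler_nrmD (L2B Lg Lf) Lf.
rewrite (@eq_nrm _ f) in h1; last by move=> x _; rewrite subrK.
rewrite (@eq_nrm _ g) in h2; last by move=> x _; rewrite subrK.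
rewrite (nrmBC g f) in h2.
by rewrite ler_norml; apply/andP; split; lra.
Qed.

Lemma ler_nrm f g : measurable_fun (D : set (plane R)) f -> L2 g ->
  (forall x, D x -> `|f x| <= `|g x|) -> nrm f <= nrm g.
Proof.
move=> mf Lg fg; have Lf := le_L2 mf Lg fg.
apply: ler_wsqrtr; apply: le_Rintegral => //; [exact: L2_mul_integrable..|].
by move=> x Dx; rewrite -!expr2 -(sqr_normr (f x)) -(sqr_normr (g x)) ler_pXn2r ?nnegrE// fg.
Qed.

Lemma le_ip f g f' g' : L2 f -> L2 g -> L2 f' -> L2 g' ->
  (forall x, D x -> f x * g x <= f' x * g' x) -> ip f g <= ip f' g'.
Proof. by move=> *; apply: le_Rintegral => //; exact: L2_mul_integrable. Qed.

(** Equality of classes: weak derivatives and traces are determined only up to this relation. *)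
Definition aeq f g : Prop := {ae mu, forall x : plane R, D x -> f x = g x}.

Lemma aeq_sym f g : aeq f g -> aeq g f.
Proof. by apply: filterS => x h Dx; rewrite h. Qed.

Lemma aeq_refl f : aeq f f.
Proof. exact: aeW. Qed.

Lemma aeq_trans f g h : aeq f g -> aeq g h -> aeq f h.
Proof. by apply: filterS2 => x h1 h2 Dx; rewrite h1// h2. Qed.

Lemma aeq_EFin f g : aeq f g -> ae_eq mu (D : set (plane R)) (EFin \o f) (EFin \o g).
Proof. by apply: filterS => x h Dx /=; rewrite h. Qed.

Lemma aeq_Rintegral f g : measurable_fun (D : set (plane R)) f ->
  measurable_fun (D : set (plane R)) g -> aeq f g ->
  \int[mu]_(x in D) f x = \int[mu]_(x in D) g x.
Proof.
move=> mf mg fg; congr fine; apply: ae_eq_integral => //; [exact/measurable_EFinP..|].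
exact: aeq_EFin.
Qed.

Lemma aeq_ip f g f' g' : L2 f -> L2 g -> L2 f' -> L2 g' ->
  aeq f f' -> aeq g g' -> ip f g = ip f' g'.
Proof.
move=> [mf _] [mg _] [mf' _] [mg' _] ff gg.
apply: aeq_Rintegral; [exact: measurable_funM..|].
by apply: filterS2 ff gg => x h1 h2 Dx; rewrite h1// h2.
Qed.

Lemma aeq_nrm f g : L2 f -> L2 g -> aeq f g -> nrm f = nrm g.
Proof. by move=> *; congr Num.sqrt; exact: aeq_ip. Qed.

Lemma nrm0_aeq f : L2 f -> nrm f = 0 -> aeq f (fun=> 0).
Proof.
move=> Lf f0; have := nrm_EFin Lf; rewrite f0 expr2 mul0r => /esym h.
have : (\int[mu]_(x in D) `|(EFin \o (fun x => f x ^+ 2)%R) x| = 0)%E.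
  by rewrite -[RHS]h; apply: eq_integral => x _ /=; rewrite ger0_norm// sqr_ge0.
move/(ae_eq_integral_abs mu mD) => h2.
have : measurable_fun (D : set (plane R)) (EFin \o (fun x => f x ^+ 2)).
  by apply/measurable_EFinP; apply: measurable_funX; case: Lf.
move=> /h2; apply: filterS => x /= + Dx => /(_ Dx)[] /eqP.
by rewrite sqrf_eq0 => /eqP.
Qed.

Lemma nrmB0_aeq f g : L2 f -> L2 g -> nrm (fun x => f x - g x) = 0 -> aeq f g.
Proof.
move=> Lf Lg /(nrm0_aeq (L2B Lf Lg)); apply: filterS => x h Dx.
by apply/eqP; rewrite -subr_eq0 h.
Qed.

Lemma nrm_cvg_lim (f_ : nat -> R * R -> R) f : (forall n, L2 (f_ n)) -> L2 f ->
  nrm (fun x => f_ n x - f x) @[n --> \oo] --> (0 : R) ->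
  nrm (f_ n) @[n --> \oo] --> nrm f.
Proof.
move=> Lf_ Lf h; apply/cvgrPdist_lt => e e0.
move/cvgrPdist_lt : h => /(_ _ e0); apply: filterS => n.
rewrite sub0r normrN (ger0_norm (nrm_ge0 _)); apply: le_lt_trans.
by rewrite distrC; exact: ler_nrm_dist.
Qed.

Lemma ip_cvg (f_ g_ : nat -> R * R -> R) f g : (forall n, L2 (f_ n)) -> L2 f ->
  (forall n, L2 (g_ n)) -> L2 g ->
  nrm (fun x => f_ n x - f x) @[n --> \oo] --> (0 : R) ->
  nrm (fun x => g_ n x - g x) @[n --> \oo] --> (0 : R) ->
  ip (f_ n) (g_ n) @[n --> \oo] --> ip f g.
Proof.
move=> Lf_ Lf Lg_ Lg hf hg.
have hN : nrm (f_ n) @[n --> \oo] --> nrm f by exact: nrm_cvg_lim.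
have : nrm (f_ n) * nrm (fun x => g_ n x - g x) +
  nrm (fun x => f_ n x - f x) * nrm g @[n --> \oo] --> (nrm f * 0 + 0 * nrm g).
  by apply: cvgD; apply: cvgM => //; exact: cvg_cst.
rewrite mulr0 mul0r addr0 => h0.
apply/cvgrPdist_lt => e e0; move/cvgrPdist_lt : h0 => /(_ _ e0).
apply: filterS => n; rewrite sub0r normrN; apply: le_lt_trans.
apply: le_trans (ler_norm _); rewrite distrC.
have -> : ip (f_ n) (g_ n) - ip f g =
    ip (f_ n) (fun x => g_ n x - g x) + ip (fun x => f_ n x - f x) g.
  by rewrite ipBr ?ipBl//; ring.
apply: le_trans (ler_normD _ _) _.
by apply: lerD; apply: cauchy_schwarz => //; exact: L2B.
Qed.

(** Dominated convergence for the squared differences, followed by continuity of the square root at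
    0. *)
Lemma L2_dominated (f_ : nat -> R * R -> R) f g : (forall n, L2 (f_ n)) -> L2 f -> L2 g ->
  (forall n x, D x -> `|f_ n x - f x| <= g x) ->
  (forall x, D x -> f_ n x @[n --> \oo] --> f x) ->
  nrm (fun x => f_ n x - f x) @[n --> \oo] --> (0 : R).
Proof.
move=> Lf_ Lf Lg fg cf.
have Ln n := L2B (Lf_ n) Lf.
have mn n : measurable_fun (D : set (plane R)) (fun x => ((f_ n x - f x) ^+ 2)%:E).
  by apply/measurable_EFinP; apply: measurable_funX; case: (Ln n).
have cv x : D x -> ((f_ n x - f x) ^+ 2)%:E @[n --> \oo] --> (0%R)%:E.
  move=> Dx; apply: cvg_EFin; first exact: nearW.
  have : (f_ n x - f x) ^+ 2 @[n --> \oo] --> (f x - f x) ^+ 2.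
    rewrite (_ : (fun n => _) = (fun n => (f_ n x - f x) * (f_ n x - f x))).
      rewrite expr2; apply: cvgM; apply: cvgB; try exact: cvg_cst; exact: cf.
    by rewrite funeqE => n; rewrite expr2.
  by rewrite subrr expr2 mul0r.
have ig := L2_sqr_integrable Lg.
have dom n x : D x -> (`|((f_ n x - f x) ^+ 2)%:E| <= (g x ^+ 2)%:E)%E.
  move=> Dx; rewrite /= lee_fin ger0_norm ?sqr_ge0// -(sqr_normr (f_ n x - f x)).
  by rewrite lerXn2r ?nnegrE ?fg// (le_trans _ (fg n _ Dx)).
have := @dominated_cvg _ _ _ mu _ mD (fun n x => ((f_ n x - f x) ^+ 2)%:E) (fun=> (0%R)%:E)
  (EFin \o (fun x => g x ^+ 2)) mn cv (fun _ _ => isT) ig dom.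
rewrite integral0 => h.
have : nrm (fun x => f_ n x - f x) ^+ 2 @[n --> \oo] --> (0 : R).
  move/fine_cvg : h => /=; apply: cvg_trans; apply: near_eq_cvg; apply: nearW => n /=.
  by rewrite -nrm_EFin.
move/(@cvg_comp _ _ _ _ (@Num.sqrt R) _ _ _) => /(_ (nbhs (Num.sqrt (0 : R)))).
move/(_ (@sqrt_continuous _ 0)); rewrite sqrtr0.
by apply: cvg_trans; apply: near_eq_cvg; apply: nearW => n /=; rewrite sqrtr_sqr ger0_norm ?nrm_ge0.
Qed.

End SquareIntegrable.

(** * Smooth functions of one variable *)

Section Smooth1.
Context {R : realType}.
Implicit Types f g : R -> R.

(** The recursion is on the function and not on its n-th derivative: an induction on [n] then proves
    the product, inverse and affine rules without higher Leibniz formulas. *)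
Fixpoint dern (n : nat) f : Prop :=
  if n is n'.+1 then (forall x, derivable f x 1) /\ dern n' (derive1 f) else True.

Lemma smooth1P f : smooth1 f <-> forall n, dern n f.
Proof.
split=> [sf n|df].
  elim: n f sf => // n IH f sf /=; split; first exact: (sf 0%N).
  by apply: IH => m x; rewrite -derive1Sn; exact: sf.
move=> n; elim: n f df => [|n IH] f df x; first by have [+ _] := df 1%N; exact.
by rewrite derive1Sn; apply: IH => m; have [_] := df m.+1.
Qed.

Lemma dernW n f : dern n.+1 f -> dern n f.
Proof. by elim: n f => // n IH f [df h]; split=> //; exact: IH. Qed.

Lemma dern_cst n (c : R) : dern n (fun=> c).
Proof.
elim: n c => // n IH c; split; first by move=> x; exact: derivable_cst.
by rewrite (_ : derive1 _ = fun=> 0)// funeqE => x; rewrite derive1_cst.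
Qed.

Lemma dernD n f g : dern n f -> dern n g -> dern n (fun x => f x + g x).
Proof.
elim: n f g => // n IH f g [df hf] [dg hg]; split; first by move=> x; exact: derivableD.
rewrite (_ : derive1 _ = fun x => derive1 f x + derive1 g x); first exact: IH.
by rewrite funeqE => x; rewrite !derive1E deriveD.
Qed.

Lemma dernM n f g : dern n f -> dern n g -> dern n (fun x => f x * g x).
Proof.
elim: n f g => // n IH f g hf hg; have [df df'] := hf; have [dg dg'] := hg.
split; first by move=> x; exact: derivableM.
rewrite (_ : derive1 _ = fun x => f x * derive1 g x + g x * derive1 f x).
  by apply: dernD; apply: IH => //; exact: dernW.
by rewrite funeqE => x; rewrite !derive1E deriveM.
Qed.

Lemma dernZ n c f : dern n f -> dern n (fun x => c * f x).
Proof. by move=> hf; apply: dernM => //; exact: dern_cst. Qed.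

Lemma dern_affine n f (a b : R) : dern n f -> dern n (fun x => f (a * x + b)).
Proof.
elim: n f => // n IH f [df hf].
have h (x : R) : is_derive x 1 (fun x => f (a * x + b)) (derive1 f (a * x + b) * a).
  apply: (@is_derive1_comp _ f (fun x => a * x + b)).
    by apply: DeriveDef; [exact: df|rewrite derive1E].
  rewrite [X in is_derive _ _ _ X](_ : a = a *: 1 + 0); last by rewrite addr0 /GRing.scale/= mulr1.
  by apply: is_deriveD.
split; first by move=> x; have [] := h x.
rewrite (_ : derive1 _ = fun x => derive1 f (a * x + b) * a).
  by apply: dernM; [exact: IH|exact: dern_cst].
by rewrite funeqE => x; rewrite derive1E; have [_ ->] := h x.
Qed.

Lemma is_derive_inv f (x : R) : derivable f x 1 -> f x != 0 ->
  is_derive x 1 (fun x => (f x)^-1) (- (derive1 f x * (f x)^-1 * (f x)^-1)).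
Proof.
move=> df f0; apply: is_derive_eq.
  by apply: (is_deriveV f0); apply: DeriveDef; [exact: df|reflexivity].
by rewrite derive1E /GRing.scale/=; field.
Qed.

Lemma dernV n f : (forall x, f x != 0) -> dern n f -> dern n (fun x => (f x)^-1).
Proof.
move=> f0; elim: n => // n IH hf; have [df df'] := hf.
split; first by move=> x; have [] := is_derive_inv (df x) (f0 x).
rewrite (_ : derive1 _ = fun x => -1 * (derive1 f x * (f x)^-1 * (f x)^-1)).
  by apply: dernZ; apply: dernM; [apply: dernM => //|]; apply: IH; exact: dernW.
rewrite funeqE => x; rewrite derive1E; have [_ ->] := is_derive_inv (df x) (f0 x).
by rewrite mulN1r.
Qed.

Lemma smooth1_continuous f : smooth1 f -> continuous f.
Proof.
by move=> sf x; apply: differentiable_continuous; apply/derivable1_diffP; exact: (sf 0%N).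
Qed.

Lemma smooth1_derive f : smooth1 f -> smooth1 (derive1 f).
Proof. by move=> sf n x; rewrite -derive1Sn; exact: sf. Qed.

Lemma smooth1_is_derive f (x : R) : smooth1 f -> is_derive x 1 f (derive1 f x).
Proof. by move=> sf; apply: DeriveDef; [exact: (sf 0%N)|rewrite derive1E]. Qed.

Lemma smooth1M f g : smooth1 f -> smooth1 g -> smooth1 (fun x => f x * g x).
Proof. by move=> /smooth1P hf /smooth1P hg; apply/smooth1P => n; exact: dernM. Qed.

Lemma smooth1_cst c : smooth1 (fun _ : R => c).
Proof. by apply/smooth1P => n; exact: dern_cst. Qed.

Lemma smooth1_affine f a b : smooth1 f -> smooth1 (fun x => f (a * x + b)).
Proof. by move=> /smooth1P hf; apply/smooth1P => n; exact: dern_affine. Qed.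

Lemma derive1_affine f (a b x : R) : smooth1 f ->
  derive1 (fun x => f (a * x + b)) x = a * derive1 f (a * x + b).
Proof.
move=> sf; have h : is_derive x 1 (fun x => f (a * x + b)) (derive1 f (a * x + b) * a).
  apply: (@is_derive1_comp _ f (fun x => a * x + b)); first exact: smooth1_is_derive.
  rewrite [X in is_derive _ _ _ X](_ : a = a *: 1 + 0); last by rewrite addr0 /GRing.scale/= mulr1.
  by apply: is_deriveD.
by rewrite derive1E; have [_ ->] := h; rewrite mulrC.
Qed.

End Smooth1.
Arguments smooth1_affine {R f} a b _ _ _.

(** * Flat functions and the smooth step *)

Section FlatFunction.
Context {R : realType}.

(** The functions x^(-k) e^(-1/x), extended by 0. The derivative of one is a combination of two
    others, so smoothness, also at 0, follows by induction. *)
Definition flatn (k : nat) (x : R) : R :=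
  if 0 < x then x^-1 ^+ k * expR (- x^-1) else 0.

Lemma flatn_ge0 k x : 0 <= flatn k x.
Proof.
by rewrite /flatn; case: ifPn => // x0; rewrite mulr_ge0 ?expR_ge0// exprn_ge0// invr_ge0 ltW.
Qed.

Lemma flatn_le0 k x : x <= 0 -> flatn k x = 0.
Proof. by rewrite /flatn ltNge => ->. Qed.

(** From e^y >= (y/(k+1))^(k+1) at y = 1/x. A linear bound at 0 is what the difference quotient
    there requires. *)
Lemma flatn_bound k x : 0 < x -> flatn k x <= k.+1%:R ^+ k.+1 * x.
Proof.
move=> x0; rewrite /flatn x0; set y := x^-1; have y0 : 0 < y by rewrite invr_gt0.
have e1 : (y / k.+1%:R) ^+ k.+1 <= expR y.
  have -> : expR y = expR (y / k.+1%:R) ^+ k.+1.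
    by rewrite -expRM_natl mulrC -mulrA mulVf ?mulr1// pnatr_eq0.
  rewrite lerXn2r ?nnegrE ?expR_ge0 ?divr_ge0 ?ltW//.
  by apply: lt_le_trans (expR_ge1Dx _); rewrite ltrDr.
rewrite expRN ler_pdivrMr ?expR_gt0//.
have -> : y ^+ k = k.+1%:R ^+ k.+1 * x * (y / k.+1%:R) ^+ k.+1.
  rewrite expr_div_n mulrAC mulrCA -mulrA (mulrC _ x) mulfV ?mulr1 ?expf_neq0 ?pnatr_eq0//.
  by rewrite exprSr -mulrA /y mulVf ?mulr1// gt_eqF.
by rewrite ler_wpM2l// mulr_ge0 ?ltW// exprn_gt0.
Qed.

Lemma is_derive_flatn k (x : R) :
  is_derive x 1 (flatn k) (flatn k.+2 x - k%:R * flatn k.+1 x).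
Proof.
have [x0|x0|->] := ltgtP x 0.
- rewrite !flatn_le0 ?ltW// mulr0 subr0.
  apply: (@near_eq_is_derive _ _ _ (fun=> 0)) => //; rewrite ?oner_eq0//.
  near=> y; rewrite flatn_le0// ltW//; near: y.
  exact: lt_nbhsl.
- apply: (@near_eq_is_derive R R R (fun x : R => x^-1 ^+ k * expR (- x^-1)) (flatn k)).
    near=> y; rewrite /flatn; suff -> : 0 < y by [].
    by rewrite -oppr_lt0; near: y; apply: Nlt_nbhsl; rewrite oppr_lt0.
  have dV : is_derive x 1 (fun x : R => x^-1) (- (x^-1 * x^-1)).
    apply: is_derive_eq; first by apply: (@is_deriveV _ id); rewrite gt_eqF.
    by rewrite /GRing.scale/= mulr1 -expr2 exprVn.
  have dN := is_deriveN dV.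
  have dE : is_derive x 1 (fun x : R => expR (- x^-1)) (expR (- x^-1) * (x^-1 * x^-1)).
    by apply: is_derive_eq; rewrite opprK.
  have dX : is_derive x 1 (fun x : R => x^-1 ^+ k) ((k%:R * x^-1 ^+ k.-1) *: - (x^-1 / x)).
    rewrite (_ : (fun x : R => x^-1 ^+ k) = (@GRing.inv R : R -> R) ^+ k); first exact: is_deriveX.
    by rewrite exprfctE.
  apply: (is_derive_eq (is_deriveM dX dE)).
  rewrite /flatn x0 /GRing.scale/= !exprS.
  case: k dX => [|k] _; first by rewrite !expr0 mulr0n; ring.
  by rewrite !exprS; ring.
- rewrite !flatn_le0// mulr0 subr0.
  have h : (fun h : R => h^-1 *: (flatn k (h *: 1 + 0) - flatn k 0)) @ 0^' --> (0 : R).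
    apply/cvgrPdist_le => e e0; near=> h.
    rewrite sub0r normrN addr0 {1}/GRing.scale/= (_ : h *: 1 = h); last by rewrite /GRing.scale/= mulr1.
    rewrite (flatn_le0 _ (lexx 0)) subr0.
    have [h0|h0] := leP h 0; first by rewrite flatn_le0// mulr0 normr0 ltW.
    (* Division by [h] raises the index by one, and the linear bound then gives the limit 0. *)
    have -> : h^-1 * flatn k h = flatn k.+1 h by rewrite /flatn h0 exprS mulrA.
    rewrite ger0_norm ?flatn_ge0// (le_trans (flatn_bound _ h0))//.
    rewrite mulrC -ler_pdivlMr ?exprn_gt0//; apply: le_trans (ler_norm _) _.
    near: h; apply: dnbhs0_le; rewrite divr_gt0// exprn_gt0//.
  by apply: DeriveDef; [apply/cvg_ex; exists 0; exact: h|apply: cvg_lim => //; exact: h].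
Unshelve. all: by end_near. Qed.

Lemma dern_flatn n k : dern n (flatn k).
Proof.
elim: n k => // n IH k; split; first by move=> x; have [] := is_derive_flatn k x.
rewrite (_ : derive1 _ = fun x => flatn k.+2 x + (- k%:R) * flatn k.+1 x).
  by apply: dernD => //; exact: dernZ.
by rewrite funeqE => x; rewrite derive1E mulNr; have [_ ->] := is_derive_flatn k x.
Qed.

Definition step_den (x : R) := flatn 0 x + flatn 0 (-1 * x + 1).

Lemma step_den_gt0 x : 0 < step_den x.
Proof.
rewrite /step_den; have [x0|x0] := ltP 0 x.
  by rewrite ltr_pwDl ?flatn_ge0// /flatn x0 mul1r expR_gt0.
by rewrite ltr_wpDl ?flatn_ge0// /flatn ifT ?mul1r ?expR_gt0//; lra.
Qed.

(** The quotient a(x)/(a(x) + a(1 - x)) with a(x) = e^(-1/x), a smooth passage from 0 to 1 on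
    [0, 1]. Products of it give the cut-offs, its derivative the averaging kernels. *)
Definition smoothstep (x : R) : R := flatn 0 x * (step_den x)^-1.

Lemma smooth1_step : smooth1 smoothstep.
Proof.
apply/smooth1P => n; apply: dernM; first exact: dern_flatn.
apply: dernV; first by move=> x; rewrite gt_eqF// step_den_gt0.
by apply: dernD; [exact: dern_flatn|apply: dern_affine; exact: dern_flatn].
Qed.

Lemma step_le0 x : x <= 0 -> smoothstep x = 0.
Proof. by move=> x0; rewrite /smoothstep flatn_le0// mul0r. Qed.

Lemma step_ge1 x : 1 <= x -> smoothstep x = 1.
Proof.
move=> x1; rewrite /smoothstep /step_den [X in _ + X]flatn_le0 ?addr0; last lra.
by rewrite mulfV// /flatn ifT ?mul1r ?gt_eqF ?expR_gt0//; lra.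
Qed.

Lemma step_ge0 x : 0 <= smoothstep x.
Proof. by rewrite mulr_ge0 ?flatn_ge0// invr_ge0 ltW// step_den_gt0. Qed.

Lemma step_le1 x : smoothstep x <= 1.
Proof.
rewrite ler_pdivrMr ?step_den_gt0// mul1r /step_den lerDl; exact: flatn_ge0.
Qed.

Lemma step_derive1E x : derive1 smoothstep x = (flatn 2 x * flatn 0 (-1 * x + 1) +
  flatn 0 x * flatn 2 (-1 * x + 1)) * step_den x ^- 2.
Proof.
have d0 (y : R) : is_derive y 1 (flatn 0) (flatn 2 y).
  by apply: is_derive_eq; [exact: is_derive_flatn|rewrite mul0r subr0].
have dd : is_derive x 1 step_den (flatn 2 x - flatn 2 (-1 * x + 1)).
  apply: is_derive_eq.
  by rewrite addr0 /GRing.scale/= mulr1 mulrN1.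
have dV := is_deriveV (lt0r_neq0 (step_den_gt0 x)) dd.
rewrite derive1E; have [_ ->] := is_deriveM (d0 x) dV.
rewrite /GRing.scale/=.
by have := lt0r_neq0 (step_den_gt0 x); rewrite /step_den => ?; field.
Qed.

Lemma step_derive_ge0 x : 0 <= derive1 smoothstep x.
Proof.
rewrite step_derive1E; apply: mulr_ge0; last by rewrite invr_ge0 exprn_ge0// ltW ?step_den_gt0.
by apply: addr_ge0; apply: mulr_ge0; exact: flatn_ge0.
Qed.

Lemma step_derive_out x : x <= 0 \/ 1 <= x -> derive1 smoothstep x = 0.
Proof.
rewrite step_derive1E => -[x0|x1].
  by rewrite !(@flatn_le0 _ x)// !mul0r addr0 mul0r.
rewrite (@flatn_le0 _ (-1 * x + 1)) ?(@flatn_le0 2 (-1 * x + 1)) ?mulr0 ?addr0 ?mul0r//; lra.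
Qed.

End FlatFunction.

(** * Smooth functions of two variables *)

Section Smooth2.
Context {R : realType}.
Implicit Types f g : R * R -> R.

Fixpoint dern2 (n : nat) f : Prop :=
  continuous f /\ if n is n'.+1 then
    (forall i x, derivable f x (unit_vec i)) /\ forall i, dern2 n' (partial i f)
  else True.

Lemma dern2S n f : dern2 n.+1 f -> [/\ continuous f,
  forall i x, derivable f x (unit_vec i) & forall i, dern2 n (partial i f)].
Proof. by case=> ? [? ?]; split. Qed.

Lemma smooth2_partial i f : smooth2 f -> smooth2 (partial i f).
Proof.
move=> sf s; have := sf (rcons s i); rewrite -cats1 foldr_cat /=; exact.
Qed.

Lemma smooth2P f : smooth2 f <-> forall n, dern2 n f.
Proof.
split=> [sf n|df].
  elim: n f sf => [|n IH] f sf /=; have [/= cf df] := sf [::]; first by split.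
  by split=> //; split=> // i; apply: IH; exact: smooth2_partial.
move=> s; elim/last_ind: s f df => [|s i IH] f df.
  by have /= [cf [dfi _]] := df 1%N; split.
rewrite -cats1 foldr_cat /=; apply: IH => n.
by have /= [_ [_]] := df n.+1; exact.
Qed.

Lemma smooth2_continuous f : smooth2 f -> continuous f.
Proof. by move=> sf; have [] := sf [::]. Qed.

Lemma smooth2_derivable f i x : smooth2 f -> derivable f x (unit_vec i).
Proof. by move=> sf; have [_] := sf [::]; exact. Qed.

Lemma dern2_continuous n f : dern2 n f -> continuous f.
Proof. by case: n => [|n] []. Qed.

Lemma dern2W n f : dern2 n.+1 f -> dern2 n f.
Proof.
elim: n f => [|n IH] f /dern2S[cf df h]; first by split.
by split; [exact: cf|split; [exact: df|move=> i; exact: IH (h i)]].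
Qed.

Lemma partialD i f g x : derivable f x (unit_vec i) -> derivable g x (unit_vec i) ->
  partial i (fun x => f x + g x) x = partial i f x + partial i g x.
Proof. by move=> df dg; rewrite /partial (deriveD df dg). Qed.

Lemma partialM i f g x : derivable f x (unit_vec i) -> derivable g x (unit_vec i) ->
  partial i (fun x => f x * g x) x = f x * partial i g x + g x * partial i f x.
Proof. by move=> df dg; rewrite /partial (deriveM df dg). Qed.

Lemma dern2_cst n (c : R) : dern2 n (fun=> c).
Proof.
elim: n c => [|n IH] c; (split; first exact: cst_continuous) => //.
split; first by move=> *; exact: derivable_cst.
by move=> i; rewrite (_ : partial i _ = fun=> 0)// funeqE => x; rewrite /partial derive_cst.
Qed.

Lemma dern2D n f g : dern2 n f -> dern2 n g -> dern2 n (fun x => f x + g x).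
Proof.
have cD f' g' : continuous f' -> continuous g' -> continuous (fun x : R * R => f' x + g' x : R).
  by move=> cf cg x; apply: cvgD; [exact: cf|exact: cg].
elim: n f g => [|n IH] f g hf hg; have cf := dern2_continuous hf; have cg := dern2_continuous hg.
  by split=> //; exact: cD.
have [_ df hf'] := dern2S hf; have [_ dg hg'] := dern2S hg.
split; first exact: cD.
split=> i; first by move=> x; exact: derivableD (df i x) (dg i x).
rewrite (_ : partial i _ = fun x => partial i f x + partial i g x).
  exact: IH (hf' i) (hg' i).
by rewrite funeqE => x; rewrite (partialD (df i x) (dg i x)).
Qed.

Lemma dern2M n f g : dern2 n f -> dern2 n g -> dern2 n (fun x => f x * g x).
Proof.
have cM f' g' : continuous f' -> continuous g' -> continuous (fun x : R * R => f' x * g' x : R).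
  by move=> cf cg x; apply: cvgM; [exact: cf|exact: cg].
elim: n f g => [|n IH] f g hf hg; have cf := dern2_continuous hf; have cg := dern2_continuous hg.
  by split=> //; exact: cM.
have [_ df hf'] := dern2S hf; have [_ dg hg'] := dern2S hg.
split; first exact: cM.
split=> i; first by move=> x; exact: derivableM (df i x) (dg i x).
rewrite (_ : partial i _ = fun x => f x * partial i g x + g x * partial i f x).
  exact: dern2D (IH _ _ (dern2W hf) (hg' i)) (IH _ _ (dern2W hg) (hf' i)).
by rewrite funeqE => x; rewrite (partialM (df i x) (dg i x)).
Qed.

Lemma smooth2D f g : smooth2 f -> smooth2 g -> smooth2 (fun x => f x + g x).
Proof. by move=> /smooth2P hf /smooth2P hg; apply/smooth2P => n; exact: dern2D. Qed.

Lemma smooth2M f g : smooth2 f -> smooth2 g -> smooth2 (fun x => f x * g x).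
Proof. by move=> /smooth2P hf /smooth2P hg; apply/smooth2P => n; exact: dern2M. Qed.

Lemma smooth2_cst c : smooth2 (fun _ : R * R => c).
Proof. by apply/smooth2P => n; exact: dern2_cst. Qed.

Lemma smooth2Z c f : smooth2 f -> smooth2 (fun x => c * f x).
Proof. by move=> sf; exact: (smooth2M (smooth2_cst c) sf). Qed.

Lemma smooth2N f : smooth2 f -> smooth2 (fun x => - f x).
Proof.
move=> /(smooth2Z (-1)); rewrite (_ : (fun x => -1 * f x) = fun x => - f x)//.
by rewrite funeqE => x; rewrite mulN1r.
Qed.

Lemma smooth2B f g : smooth2 f -> smooth2 g -> smooth2 (fun x => f x - g x).
Proof. by move=> sf sg; exact: smooth2D sf (smooth2N sg). Qed.

Lemma smooth2_sum (I : Type) (r : seq I) (F : I -> R * R -> R) :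
  (forall i, smooth2 (F i)) -> smooth2 (fun x => \sum_(i <- r) F i x).
Proof.
move=> sF; elim: r => [|i r IH].
  rewrite (_ : (fun x => _) = fun=> 0); first exact: smooth2_cst.
  by rewrite funeqE => x; rewrite big_nil.
rewrite (_ : (fun x => _) = fun x => F i x + \sum_(j <- r) F j x).
  exact: smooth2D (sF i) IH.
by rewrite funeqE => x; rewrite big_cons.
Qed.

Lemma smooth2_partialD i f g : smooth2 f -> smooth2 g ->
  partial i (fun x => f x + g x) = fun x => partial i f x + partial i g x.
Proof.
by move=> sf sg; rewrite funeqE => x; rewrite (partialD (@smooth2_derivable f i x sf) (@smooth2_derivable g i x sg)).
Qed.

Lemma smooth2_partialM i f g : smooth2 f -> smooth2 g ->
  partial i (fun x => f x * g x) = fun x => f x * partial i g x + g x * partial i f x.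
Proof.
by move=> sf sg; rewrite funeqE => x; rewrite (partialM (@smooth2_derivable f i x sf) (@smooth2_derivable g i x sg)).
Qed.

Lemma partial_cst i c : partial i (fun _ : R * R => c) = fun=> 0.
Proof. by rewrite funeqE => x; rewrite /partial derive_cst. Qed.

Lemma smooth2_partialZ i c f : smooth2 f ->
  partial i (fun x => c * f x) = fun x => c * partial i f x.
Proof.
move=> sf; rewrite (smooth2_partialM i (smooth2_cst c) sf).
by rewrite partial_cst funeqE => x; rewrite mulr0 addr0.
Qed.

Lemma smooth2_partialB i f g : smooth2 f -> smooth2 g ->
  partial i (fun x => f x - g x) = fun x => partial i f x - partial i g x.
Proof.
move=> sf sg; rewrite (smooth2_partialD i sf (smooth2N sg)).
rewrite (_ : (fun x => - g x) = fun x => -1 * g x); last by rewrite funeqE => x; rewrite mulN1r.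
by rewrite (smooth2_partialZ i (-1) sg) funeqE => x; rewrite mulN1r.
Qed.

Lemma smooth2_partial_sum i (I : Type) (r : seq I) (F : I -> R * R -> R) :
  (forall i, smooth2 (F i)) ->
  partial i (fun x => \sum_(j <- r) F j x) = fun x => \sum_(j <- r) partial i (F j) x.
Proof.
move=> sF; elim: r => [|j r IH].
  rewrite (_ : (fun x => \sum_(j <- [::]) F j x) = fun=> 0).
    by rewrite partial_cst funeqE => x; rewrite big_nil.
  by rewrite funeqE => x; rewrite big_nil.
rewrite (_ : (fun x => _) = fun x => F j x + \sum_(j <- r) F j x).
  rewrite (smooth2_partialD i (sF j) (smooth2_sum r sF)) IH.
  by rewrite funeqE => x; rewrite big_cons.
by rewrite funeqE => x; rewrite big_cons.
Qed.

(** Kernels and cut-offs are all of this form, which reduces their smoothness to one variable. *)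
Definition tensor (a b : R -> R) : R * R -> R := fun x => a x.1 * b x.2.

Lemma is_derive_line f x (v : R * R) (df : R) :
  is_derive (0 : R) 1 (fun t : R => f (x + t *: v)) df -> is_derive x v f df.
Proof.
have E : (fun h : R => h^-1 *: (((fun t : R => f (x + t *: v)) \o shift 0) (h *: 1) - f (x + 0 *: v)))
    = (fun h : R => h^-1 *: ((f \o shift x) (h *: v) - f x)).
  rewrite funeqE => h; rewrite scale0r addr0 (_ : h *: 1 = h) ?/GRing.scale/= ?mulr1//.
  by rewrite addr0 (addrC x).
move=> [d e]; apply: DeriveDef.
  by rewrite /derivable -E.
by rewrite /derive -E.
Qed.

Lemma derivable_line f x i : derivable f x (unit_vec i) ->
  is_derive (0 : R) 1 (fun t : R => f (x + t *: unit_vec i)) (partial i f x).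
Proof.
have E : (fun h : R => h^-1 *: (((fun t : R => f (x + t *: unit_vec i)) \o shift 0) (h *: 1) - f (x + 0 *: unit_vec i)))
    = (fun h : R => h^-1 *: ((f \o shift x) (h *: unit_vec i) - f x)).
  rewrite funeqE => h; rewrite scale0r addr0 (_ : h *: 1 = h) ?/GRing.scale/= ?mulr1//.
  by rewrite addr0 (addrC x).
by move=> d; apply: DeriveDef; [rewrite /derivable E|rewrite /partial /derive E].
Qed.

Lemma is_derive_tensor (a b : R -> R) x i : smooth1 a -> smooth1 b ->
  is_derive x (unit_vec i) (tensor a b)
    (if i == 0 then derive1 a x.1 * b x.2 else a x.1 * derive1 b x.2).
Proof.
move=> sa sb; apply: is_derive_line; rewrite /tensor /unit_vec.
have da (c : R) : is_derive (0 : R) 1 (fun t : R => a (1 * t + c)) (derive1 a c).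
  apply: DeriveDef; first exact: (smooth1_affine 1 c sa 0%N 0).
  by rewrite -derive1E derive1_affine// mulr0 add0r mul1r.
have db (c : R) : is_derive (0 : R) 1 (fun t : R => b (1 * t + c)) (derive1 b c).
  apply: DeriveDef; first exact: (smooth1_affine 1 c sb 0%N 0).
  by rewrite -derive1E derive1_affine// mulr0 add0r mul1r.
case: ifP => _.
- rewrite (_ : (fun t => _) = (fun t : R => a (1 * t + x.1)) * cst (b x.2)); last first.
    rewrite funeqE => t /=; rewrite !fctE /= /GRing.scale/= mulr0 addr0 mulr1 mul1r (addrC t).
    by [].
  apply: is_derive_eq.
  by rewrite /GRing.scale/= mulr0 add0r mulrC.
- rewrite (_ : (fun t => _) = cst (a x.1) * (fun t : R => b (1 * t + x.2))); last first.
    rewrite funeqE => t /=; rewrite !fctE /= /GRing.scale/= mulr0 addr0 mulr1 mul1r (addrC t).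
    by [].
  apply: is_derive_eq.
  by rewrite /GRing.scale/= mulr0 addr0.
Qed.

Lemma partial_tensor (a b : R -> R) i : smooth1 a -> smooth1 b ->
  partial i (tensor a b) = if i == 0 then tensor (derive1 a) b else tensor a (derive1 b).
Proof.
move=> sa sb; rewrite funeqE => x; rewrite /partial.
by have [_ ->] := is_derive_tensor x i sa sb; case: ifP.
Qed.

Lemma smooth2_tensor (a b : R -> R) : smooth1 a -> smooth1 b -> smooth2 (tensor a b).
Proof.
move=> sa sb; apply/smooth2P => n; elim: n a b sa sb => [|n IH] a b sa sb.
  split; last by []. 
  move=> x; apply: cvgM.
    by apply: (@cvg_comp _ _ _ fst a _ (nbhs x.1)); [exact: cvg_fst|exact: smooth1_continuous].
  by apply: (@cvg_comp _ _ _ snd b _ (nbhs x.2)); [exact: cvg_snd|exact: smooth1_continuous].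
split; first exact: (@dern2_continuous n) (IH _ _ sa sb).
split=> i; first by move=> x; have [] := is_derive_tensor x i sa sb.
rewrite (partial_tensor i sa sb); case: ifP => _.
  exact: IH (smooth1_derive sa) sb.
exact: IH sa (smooth1_derive sb).
Qed.

End Smooth2.
Arguments smooth2_derivable {R} f i x _.

Lemma addr_shift (V : zmodType) (x z a b : V) : x + a - z = x + b - z + (a - b).
Proof. by rewrite [RHS]addrACA -opprD (addrAC x b) (addrC z b) opprD addrA addrK. Qed.

(** * Mollification *)

Section LineIntegrals.
Context {R : realType}.
Notation leb1 := (@lebesgue_measure R).
Implicit Types (f F : R -> R) (lo hi : R).

Lemma FTC_itv F f lo hi : lo < hi -> (forall x : R, is_derive x 1 F (f x)) ->
  continuous f -> (\int[leb1]_(x in `[lo, hi]) (f x)%:E = (F hi - F lo)%:E)%E.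
Proof.
move=> lh dF cf; have cF : continuous F.
  by move=> x; apply: differentiable_continuous; apply/derivable1_diffP; have [] := dF x.
rewrite (@continuous_FTC2 _ f F)//; first exact: continuous_subspaceT.
- split; first by move=> x _; have [] := dF x.
    by apply: cvg_at_right_filter; exact: cF.
  by apply: cvg_at_left_filter; exact: cF.
- by move=> x _; rewrite derive1E; have [_ ->] := dF x.
Qed.

Lemma FTC_line F f lo hi : lo < hi -> (forall x : R, is_derive x 1 F (f x)) ->
  continuous f -> (forall x, ~ (lo <= x <= hi) -> f x = 0) ->
  (\int[leb1]_x (f x)%:E = (F hi - F lo)%:E)%E.
Proof.
move=> lh dF cf f0; rewrite -(FTC_itv lh dF cf) [RHS]integral_mkcond.
apply: eq_integral => x _; rewrite patchE; case: ifPn => //.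
by rewrite notin_setE/= in_itv/= => /f0 ->.
Qed.

Lemma FTC_half F f hi : 0 < hi -> (forall x : R, is_derive x 1 F (f x)) ->
  continuous f -> (forall x, hi < x -> f x = 0) ->
  (\int[leb1]_(x in `]0%R, +oo[) (f x)%:E = (F hi - F 0)%:E)%E.
Proof.
move=> lh dF cf f0; rewrite -(FTC_itv lh dF cf).
have mf D : measurable_fun D (fun x => (f x)%:E).
  by apply/measurable_EFinP; apply: measurable_funTS; exact: continuous_measurable_fun.
rewrite integral_itv_obnd_cbnd// [LHS]integral_mkcond [RHS]integral_mkcond.
apply: eq_integral => x _; rewrite !patchE !mem_setE !in_itv/= andbT.
case: (leP 0 x) => //= x0; case: (leP x hi) => //.
by move=> /f0 ->.
Qed.

Lemma integral_abs_FTC F f lo hi (y : R) : lo < hi -> (forall x : R, is_derive x 1 F (f x)) ->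
  continuous f -> (forall x, ~ (lo <= x <= hi) -> f x = 0) ->
  (forall x, ~ (lo <= x <= hi) -> F x = 0) ->
  ((`|F y|)%:E <= \int[leb1]_x (`|f x|)%:E)%E.
Proof.
move=> lh dF cf f0 F0.
have mf D : measurable_fun D (fun x => (f x)%:E).
  by apply/measurable_EFinP; apply: measurable_funTS; exact: continuous_measurable_fun.
have yl : y - `|y| - `|lo| - 1 < y.
  by have := normr_ge0 y; have := normr_ge0 lo; lra.
have Fl : F (y - `|y| - `|lo| - 1) = 0.
  apply: F0 => /andP[h _]; have := ler_norm y; have := ler_norm (- lo).
  by rewrite normrN; lra.
have := FTC_itv yl dF cf; rewrite Fl subr0 => h.
rewrite -[X in (X <= _)%E]/(`|(F y)%:E|%E) -h.
apply: le_trans (le_abse_integral _ _ _) _ => //; first exact: mf.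
have -> : (\int[leb1]_x `|f x|%:E = \int[leb1]_x `|(f x)%:E|)%E by [].
by apply: ge0_subset_integral => //; apply: measurableT_comp => //; exact: mf.
Qed.

End LineIntegrals.

Section Kernels.
Context {R : realType}.
Notation leb1 := (@lebesgue_measure R).

(** A bump on [a, a + e] of integral 1, the rescaled derivative of [smoothstep]. The offset [a] is
    free because averages near the boundary must be one-sided. *)
Definition kern (a e : R) (t : R) : R := e^-1 * derive1 smoothstep (e^-1 * t + (- (a / e))).

Lemma smooth1_kern a e : smooth1 (kern a e).
Proof.
apply: smooth1M; first exact: smooth1_cst.
by apply: smooth1_affine; apply: smooth1_derive; exact: smooth1_step.
Qed.

Lemma kern_ge0 (a e t : R) : 0 < e -> 0 <= kern a e t.
Proof. by move=> e0; rewrite mulr_ge0 ?step_derive_ge0// invr_ge0 ltW. Qed.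

Lemma kern_out (a e t : R) : 0 < e -> ~ (a <= t <= a + e) -> kern a e t = 0.
Proof.
move=> e0 nt; rewrite /kern step_derive_out ?mulr0//.
rewrite (_ : _ + _ = (t - a) / e); last by field; rewrite gt_eqF.
rewrite ler_pdivrMr// ler_pdivlMr// mul0r mul1r.
have [|h] := leP t a; [by left; lra|right; rewrite leNgt; apply/negP => h2; apply: nt; lra].
Qed.

Lemma kern_int (a e x : R) : 0 < e -> (\int[leb1]_z (kern a e (x - z))%:E = 1)%E.
Proof.
move=> e0.
have dF (z : R) : is_derive z 1 (fun z => - smoothstep (- e^-1 * z + (x - a) / e)) (kern a e (x - z)).
  have d := smooth1_is_derive z (smooth1_affine (- e^-1) ((x - a) / e) (@smooth1_step R)).
  apply: (is_derive_eq (is_deriveN d)); rewrite derive1_affine; last exact: smooth1_step.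
  by rewrite mulNr opprK /kern; congr (_ * (derive1 (smoothstep : R -> R) _)); field; rewrite gt_eqF.
rewrite (@FTC_line _ _ _ (x - a - e - 1) (x - a + 1) _ dF); first last.
- by move=> z nz; apply: kern_out => // h; apply: nz; lra.
- apply: smooth1_continuous; rewrite (_ : (fun z => _) = fun z => kern a e (-1 * z + x)).
    by apply: smooth1_affine; exact: smooth1_kern.
  by rewrite funeqE => z; rewrite mulN1r addrC.
- by lra.
rewrite (_ : - e^-1 * _ + _ = - (1 / e)); last by field; rewrite gt_eqF.
rewrite (_ : - e^-1 * _ + _ = 1 + 1 / e); last by field; rewrite gt_eqF.
have e1 : 0 < 1 / e by rewrite divr_gt0.
by rewrite step_le0 ?step_ge1; [congr EFin; lra|lra|lra].
Qed.

Lemma kern_int' (a e z : R) : 0 < e -> (\int[leb1]_x (kern a e (x - z))%:E = 1)%E.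
Proof.
move=> e0.
have dF (x : R) : is_derive x 1 (fun x => smoothstep (e^-1 * x + (- z - a) / e)) (kern a e (x - z)).
  have d := smooth1_is_derive x (smooth1_affine (e^-1) ((- z - a) / e) (@smooth1_step R)).
  apply: (is_derive_eq d); rewrite derive1_affine; last exact: smooth1_step.
  by rewrite /kern; congr (_ * (derive1 (smoothstep : R -> R) _)); field; rewrite gt_eqF.
rewrite (@FTC_line _ _ _ (z + a - 1) (z + a + e + 1) _ dF); first last.
- by move=> x nx; apply: kern_out => // h; apply: nx; lra.
- apply: smooth1_continuous; rewrite (_ : (fun x => _) = fun x => kern a e (1 * x - z)).
    by apply: smooth1_affine; exact: smooth1_kern.
  by rewrite funeqE => x; rewrite mul1r.
- by lra.
rewrite (_ : e^-1 * _ + _ = 1 + 1 / e); last by field; rewrite gt_eqF.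
rewrite (_ : e^-1 * _ + _ = - (1 / e)); last by field; rewrite gt_eqF.
have e1 : 0 < 1 / e by rewrite divr_gt0.
by rewrite step_ge1 ?step_le0; [congr EFin; lra|lra|lra].
Qed.

End Kernels.

(** * Lebesgue measure on the plane *)

Section SigmaFinitePlane.
Context {R : realType}.
Notation leb1 := (@lebesgue_measure R).

Lemma leb2_rect (A B : set R) : measurable A -> measurable B ->
  (leb2 R (A `*` B) = leb1 A * leb1 B)%E.
Proof. by move=> mA mB; rewrite /leb2/= product_measure1E. Qed.

Lemma leb2_sigma_finite : sigma_finite setT (leb1 \x leb1)%E.
Proof.
exists (fun n => (`[- n%:R, n%:R] `*` `[- n%:R, n%:R])%classic).
  apply/seteqP; split => // -[x y] _.
  near \oo => n; exists n => //=; rewrite /= !in_itv/= -!ler_norml.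
  by split; near: n; exact: nbhs_infty_ger.
move=> n; split; first exact: measurableX.
have h : (leb1 (`[- n%:R, n%:R]%classic : set R)%R < +oo)%E.
  by rewrite lebesgue_measure_itv/=; case: ifP => _; rewrite ?ltry.
rewrite product_measure1E//; apply: lte_mul_pinfty => //.
by rewrite ge0_fin_numE.
Unshelve. all: by end_near. Qed.

(** The same measure as [leb2], whose declared type forgets sigma-finiteness; Tonelli's theorem on
    pairs of points of the plane uses this copy. *)
Definition lebp : set (plane R) -> \bar R := (leb1 \x leb1)%E.
HB.instance Definition _ := Measure.on lebp.
HB.instance Definition _ := @Measure_isSigmaFinite.Build _ _ _ lebp leb2_sigma_finite.

Lemma leb2_tonelli (f : plane R * plane R -> \bar R) :
  measurable_fun setT f -> (forall x, 0 <= f x)%E ->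
  (\int[leb2 R]_x \int[leb2 R]_y f (x, y) = \int[leb2 R]_y \int[leb2 R]_x f (x, y))%E.
Proof. by move=> mf f0; exact: (@fubini_tonelli _ _ _ _ _ lebp lebp f mf f0). Qed.

Lemma measurable_leb2_section (f : plane R * plane R -> \bar R) :
  measurable_fun setT f -> (forall x, 0 <= f x)%E ->
  measurable_fun setT (fun x => \int[leb2 R]_y f (x, y))%E.
Proof. by move=> mf f0; exact: (@measurable_fun_fubini_tonelli_F _ _ _ _ _ lebp f mf f0). Qed.

Lemma leb2_iter (f : plane R -> \bar R) :
  measurable_fun setT f -> (forall x, 0 <= f x)%E ->
  (\int[leb2 R]_x f x = \int[leb1]_s \int[leb1]_t f (s, t))%E.
Proof. by move=> mf f0; exact: fubini_tonelli1. Qed.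

Lemma leb2_iter_swap (f : plane R -> \bar R) :
  measurable_fun setT f -> (forall x, 0 <= f x)%E ->
  (\int[leb2 R]_x f x = \int[leb1]_t \int[leb1]_s f (s, t))%E.
Proof. by move=> mf f0; exact: fubini_tonelli2. Qed.

Lemma bounded_set_box (A : set (R * R)) : bounded_set A ->
  exists2 M : R, 0 < M & forall p, A p -> `|p.1| <= M /\ `|p.2| <= M.
Proof.
move=> [M [Mr hM]]; exists (`|M| + 1); first by rewrite ltr_pwDr.
move=> p Ap; have := hM (`|M| + 1).
rewrite (le_lt_trans (ler_norm M)) ?ltrDl// => /(_ isT _ Ap).
by rewrite /= {1}/Num.norm/= ge_max => /andP[].
Qed.

Lemma leb2_bounded (A : set (R * R)) : measurable (A : set (plane R)) ->
  bounded_set A -> (leb2 R A < +oo)%E.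
Proof.
move=> mA /bounded_set_box[M M0 hM].
have h : (leb1 (`[- M, M]%classic : set R)%R < +oo)%E.
  by rewrite lebesgue_measure_itv/=; case: ifP => _; rewrite ?ltry.
apply: (@le_lt_trans _ _ (leb2 R (`[- M, M] `*` `[- M, M])%classic)).
  apply: le_measure; rewrite ?inE//; first exact: measurableX.
  by move=> p /hM[h1 h2]; split; rewrite /= in_itv/= -ler_norml.
rewrite leb2_rect//; apply: lte_mul_pinfty => //.
by rewrite ge0_fin_numE.
Qed.

End SigmaFinitePlane.

Section FiniteDomain.
Context {R : realType} (mu : {measure set (plane R) -> \bar R}) (D : set (R * R)).
Hypothesis mD : measurable (D : set (plane R)).
Hypothesis fD : (mu D < +oo)%E.

Lemma L2_bounded (f : R * R -> R) (M : R) : measurable_fun (D : set (plane R)) f ->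
  (forall x, D x -> `|f x| <= M) -> L2 mu D f.
Proof.
move=> mf fM; apply: sqr_integrable_L2 => //.
apply: measurable_bounded_integrable => //; first exact: measurable_funX.
exists (M ^+ 2); split; first exact: num_real.
move=> N MN x Dx /=; rewrite normrX (le_trans _ (ltW MN))//.
have := fM _ Dx; have := normr_ge0 (f x).
by move=> h1 h2; rewrite lerXn2r// nnegrE// (le_trans h1).
Qed.

Lemma L2_cst c : L2 mu D (fun=> c).
Proof. by apply: (@L2_bounded _ `|c|) => //; exact: measurable_cst. Qed.

Lemma L2_integrable f : L2 mu D f -> mu.-integrable (D : set (plane R)) (EFin \o f).
Proof.
move=> Lf; have := L2_mul_integrable mD Lf (L2_cst 1).
by apply: eq_integrable => // x _ /=; rewrite mulr1.
Qed.

Lemma nrm_le_bounded (f : R * R -> R) (M : R) : measurable_fun (D : set (plane R)) f ->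
  (forall x, D x -> `|f x| <= M) -> nrm mu D f <= `|M| * nrm mu D (fun=> 1).
Proof.
move=> mf fM; rewrite -(nrmZ mD M (L2_cst 1)); apply: ler_nrm => //.
  exact: (L2Z mD M (L2_cst 1)).
by move=> x Dx; rewrite mulr1 (le_trans (fM _ Dx))// ler_norm.
Qed.

End FiniteDomain.

Section Bumps.
Context {R : realType}.
Implicit Types a b : R -> R.

Definition bump1 a := smooth1 a /\ exists M, forall t, M < `|t| -> a t = 0.

Lemma bump1_bounded a : bump1 a -> exists2 B, 0 <= B & forall t, `|a t| <= B.
Proof.
move=> [sa [M aM]].
have M0 : - `|M| <= `|M| by have := normr_ge0 M; lra.
have ca : {within `[- `|M|, `|M|], continuous (fun t => `|a t|)}.
  apply: continuous_subspaceT => t; apply: (@cvg_comp _ _ _ a Num.norm _ (nbhs (a t))).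
    exact: smooth1_continuous.
  exact: norm_continuous.
have [c _ h] := EVT_max M0 ca.
exists `|a c| => // t; have [tM|tM] := leP `|t| `|M|.
  by apply: h; rewrite in_itv/= -ler_norml.
by rewrite aM ?normr0// (le_lt_trans (ler_norm M)).
Qed.

Lemma bump1_derive a : bump1 a -> bump1 (derive1 a).
Proof.
move=> [sa [M aM]]; split; first exact: smooth1_derive.
exists M => t Mt; rewrite derive1E.
have h : is_derive t 1 a 0.
  apply: (@near_eq_is_derive R R R (fun=> 0)) => //.
  near=> s; rewrite aM//; near: s.
  have : `|s| @[s --> t] --> `|t| by exact: norm_continuous.
  by move/cvgr_gt; exact.
by have [_ ->] := h.
Unshelve. all: by end_near. Qed.

Lemma bump1_lip a : bump1 a -> exists2 L, 0 <= L & forall s t, `|a s - a t| <= L * `|s - t|.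
Proof.
move=> ba; have [L L0 hL] := bump1_bounded (bump1_derive ba).
exists L => // s t; wlog st : s t / s <= t.
  by move=> h; have [/h//|/ltW/h] := leP s t; rewrite distrC (distrC t).
have [->|nst] := eqVneq s t; first by rewrite !subrr normr0 mulr0.
have lst : s < t by rewrite lt_neqAle nst.
have [c _ e] := @MVT _ a (derive1 a) s t lst (fun x _ => smooth1_is_derive x ba.1)
  (continuous_subspaceT (smooth1_continuous ba.1)).
by rewrite distrC e normrM (distrC s) ler_wpM2r.
Qed.

Lemma bump1_kern (c e : R) : 0 < e -> bump1 (kern c e).
Proof.
move=> e0; split; first exact: smooth1_kern.
exists (`|c| + e) => t h; apply: kern_out => // /andP[h1 h2].
have := ler_norm c; have := ler_norm (- c); rewrite normrN => h3 h4.
move: h; apply/negP; rewrite -leNgt ler_norml; apply/andP; split; lra.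
Qed.

Lemma bump1_shift a (c : R) : bump1 a -> bump1 (fun t => a (c - t)).
Proof.
move=> [sa [M aM]]; split.
  rewrite (_ : (fun t => _) = fun t => a (-1 * t + c)); first exact: smooth1_affine.
  by rewrite funeqE => t; rewrite mulN1r addrC.
exists (M + `|c|) => t h; apply: aM; have := ler_distD c t 0.
by rewrite !subr0 (distrC t); lra.
Qed.

End Bumps.

(** * Convolution with smooth kernels *)

Section Convolution.
Context {R : realType} (D : set (R * R)).
Hypothesis mD : measurable (D : set (plane R)).
Hypothesis fD : (leb2 R D < +oo)%E.
Notation leb := (leb2 R).
Notation L2 := (L2 leb D).
Notation ip := (ip leb D).
Notation nrm := (nrm leb D).

(** The integral runs over [D] only, so [f] is tacitly extended by 0. *)
Definition conv (k f : R * R -> R) (x : R * R) : R := ip f (fun z => k (x - z)).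

Lemma smooth2_reflect (a b : R -> R) x : smooth1 a -> smooth1 b ->
  smooth2 (fun z => tensor a b (x - z)).
Proof.
move=> sa sb; rewrite (_ : (fun z => _) = tensor (fun t => a (-1 * t + x.1)) (fun t => b (-1 * t + x.2))).
  by apply: smooth2_tensor; exact: smooth1_affine.
by rewrite funeqE => z; rewrite /tensor/= !mulN1r (addrC x.1) (addrC x.2).
Qed.

Lemma tensor_bounded (a b : R -> R) : bump1 a -> bump1 b ->
  exists2 B, 0 <= B & forall x, `|tensor a b x| <= B.
Proof.
move=> /bump1_bounded[A A0 hA] /bump1_bounded[B B0 hB].
by exists (A * B); [exact: mulr_ge0|move=> x; rewrite normrM ler_pM].
Qed.

Lemma L2_kernel (a b : R -> R) x : bump1 a -> bump1 b -> L2 (fun z => tensor a b (x - z)).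
Proof.
move=> ba bb; have [B B0 hB] := tensor_bounded ba bb.
apply: (L2_bounded mD fD (M := B)) => //.
by apply: continuous_plane_measurable; apply: smooth2_continuous; apply: smooth2_reflect; [case: ba|case: bb].
Qed.

(** The kernel is Lipschitz and [D] has finite measure, so Cauchy-Schwarz bounds the increments. *)
Lemma conv_continuous (a b : R -> R) f : bump1 a -> bump1 b -> L2 f ->
  continuous (conv (tensor a b) f).
Proof.
move=> ba bb Lf.
have [A A0 hA] := bump1_bounded ba; have [B B0 hB] := bump1_bounded bb.
have [LA LA0 hLA] := bump1_lip ba; have [LB LB0 hLB] := bump1_lip bb.
pose K := nrm f * nrm (fun=> 1); have K0 : 0 <= K by rewrite mulr_ge0 ?nrm_ge0.
have lip x y : `|conv (tensor a b) f x - conv (tensor a b) f y| <=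
    K * (LA * `|x.1 - y.1| * B + A * (LB * `|x.2 - y.2|)).
  have Lx := L2_kernel x ba bb; have Ly := L2_kernel y ba bb.
  rewrite /conv -ipBr//; apply: le_trans (cauchy_schwarz mD Lf (L2B mD Lx Ly)) _.
  rewrite /K -mulrA; apply: ler_wpM2l; first exact: nrm_ge0.
  rewrite mulrC; set M := _ + _; have M0 : 0 <= M by rewrite addr_ge0// !mulr_ge0.
  rewrite -(ger0_norm M0); apply: nrm_le_bounded => //; first by case: (L2B mD Lx Ly).
  move=> z _; rewrite /tensor/=.
  rewrite (_ : _ - _ = (a (x.1 - z.1) - a (y.1 - z.1)) * b (x.2 - z.2) +
     a (y.1 - z.1) * (b (x.2 - z.2) - b (y.2 - z.2))); last by ring.
  apply: le_trans (ler_normD _ _) _; rewrite !normrM.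
  apply: lerD; apply: ler_pM => //.
    by apply: le_trans (hLA _ _) _; rewrite opprB addrA subrK.
  by apply: le_trans (hLB _ _) _; rewrite opprB addrA subrK.
move=> x; apply/cvgrPdist_le => e e0.
have h : K * (LA * `|x.1 - y.1| * B + A * (LB * `|x.2 - y.2|)) @[y --> x] --> (0 : R).
  rewrite [X in _ --> X](_ : _ = K * (LA * `|x.1 - x.1| * B + A * (LB * `|x.2 - x.2|))); last first.
    by rewrite !subrr normr0 !mulr0 mul0r addr0 mulr0.
  have c1 : `|x.1 - y.1| @[y --> x] --> `|x.1 - x.1|.
    by apply: cvg_norm; apply: cvgB; [exact: cvg_cst|exact: cvg_fst].
  have c2 : `|x.2 - y.2| @[y --> x] --> `|x.2 - x.2|.
    by apply: cvg_norm; apply: cvgB; [exact: cvg_cst|exact: cvg_snd].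
  apply: cvgM; first exact: cvg_cst.
  apply: cvgD; apply: cvgM; try exact: cvg_cst.
    by apply: cvgM; [exact: cvg_cst|].
  by apply: cvgM; [exact: cvg_cst|].
move/cvgrPdist_le : h => /(_ _ e0); apply: filterS => y.
by rewrite sub0r normrN; apply: le_trans; apply: le_trans (lip x y) _; exact: ler_norm.
Qed.

(** Differentiation under the integral sign along a line through [x]. The derivative of the kernel
    is bounded by some B, and B |f| is an integrable majorant because [D] has finite measure. *)
Lemma conv_partial (a b : R -> R) f x i : bump1 a -> bump1 b -> L2 f ->
  is_derive x (unit_vec i) (conv (tensor a b) f)
    (conv (if i == 0 then tensor (derive1 a) b else tensor a (derive1 b)) f x).
Proof.
move=> ba bb Lf; apply: is_derive_line.
pose k' := if i == 0 then tensor (derive1 a) b else tensor a (derive1 b).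
pose F (t : R) (z : plane R) : R := f z * tensor a b (x + t *: unit_vec i - z).
have dF (t : R) z : is_derive t 1 (F ^~ z) (f z * k' (x + t *: unit_vec i - z)).
  have d : is_derive t 1 (fun t : R => tensor a b (x + t *: unit_vec i - z)) (k' (x + t *: unit_vec i - z)).
    have st := smooth2_tensor ba.1 bb.1.
    have := derivable_line (smooth2_derivable (tensor a b) i (x + t *: unit_vec i - z) st).
    rewrite (partial_tensor i ba.1 bb.1) (_ : (if _ then _ else _) = k')// => d0.
    have := @is_derive1_comp R (fun s : R => tensor a b (x + t *: unit_vec i - z + s *: unit_vec i))
      (fun s : R => s - t) t (k' (x + t *: unit_vec i - z)) 1.
    rewrite mulr1 subrr => /(_ d0) h.
    rewrite (_ : (fun t => _) = (fun s : R => tensor a b (x + t *: unit_vec i - z + s *: unit_vec i)) \o (fun s : R => s - t)).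
      by apply: h; apply: is_derive_eq; rewrite subr0.
    rewrite funeqE => s /=; congr (tensor a b _).
    by rewrite scalerBl; exact: addr_shift.
  by apply: is_derive_eq.
have d1 (t : R) z : partial1of2 F t z = f z * k' (x + t *: unit_vec i - z).
  by rewrite partial1of2E; have [_ ->] := dF t z.
have bk' : exists2 B, 0 <= B & forall x, `|k' x| <= B.
  by rewrite /k'; case: ifP => _; apply: tensor_bounded => //; exact: bump1_derive.
have [B B0 hB] := bk'.
have I0 : `]-1, 1[%classic (0 : R) by rewrite /= in_itv/=; apply/andP; split; lra.
have intF (t : R) : `]-1, 1[%classic t -> leb.-integrable (D : set (plane R)) (EFin \o F t).
  by move=> _; apply: L2_mul_integrable => //; exact: L2_kernel.
have derF (t : R) z : `]-1, 1[%classic t -> D z -> derivable (F ^~ z) t 1.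
  by move=> _ _; have [] := dF t z.
pose G z := B * `|f z|.
have G0 z : 0 <= G z by rewrite mulr_ge0.
have intG : leb.-integrable (D : set (plane R)) (EFin \o G).
  by apply: L2_integrable => //; apply: L2Z => //; exact: L2_abs.
have Gub (t : R) z : `]-1, 1[%classic t -> D z -> `|partial1of2 F t z| <= G z.
  by move=> _ _; rewrite d1 normrM mulrC ler_wpM2r.
apply: DeriveDef.
  exact: (derivable_under_integral mD I0 intF derF G0 intG Gub).
rewrite -derive1E.
have := differentiation_under_integral mD I0 intF derF G0 intG Gub.
rewrite /conv /Defs.ip => ->; apply: eq_Rintegral => z _.
by rewrite d1 scale0r addr0.
Qed.

Lemma smooth2_conv (a b : R -> R) f : bump1 a -> bump1 b -> L2 f ->
  smooth2 (conv (tensor a b) f).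
Proof.
move=> ba bb Lf; apply/smooth2P => n; elim: n a b ba bb => [|n IH] a b ba bb.
  by split=> //; exact: conv_continuous.
split; first exact: conv_continuous.
split; first by move=> i x; have [] := conv_partial x i ba bb Lf.
move=> i; rewrite (_ : partial i _ = conv (if i == 0 then tensor (derive1 a) b else tensor a (derive1 b)) f).
  by case: ifP => _; apply: IH => //; exact: bump1_derive.
by rewrite funeqE => x; rewrite /partial; have [_ ->] := conv_partial x i ba bb Lf.
Qed.

(** The derivative in [x] is moved to the integration variable at the price of a sign; this is the
    form to which the definition of a weak derivative applies. *)
Lemma partial_conv (a b : R -> R) f i x : bump1 a -> bump1 b -> L2 f ->
  partial i (conv (tensor a b) f) x = - ip f (partial i (fun z => tensor a b (x - z))).
Proof.
move=> ba bb Lf; rewrite /partial; have [_ ->] := conv_partial x i ba bb Lf.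
have -> : (fun z => 'D_(unit_vec i) (fun z => tensor a b (x - z)) z) =
  (fun z => - (if i == 0 then tensor (derive1 a) b else tensor a (derive1 b)) (x - z)).
  have -> : (fun z => tensor a b (x - z)) = tensor (fun t => a (-1 * t + x.1)) (fun t => b (-1 * t + x.2)).
    by rewrite funeqE => z; rewrite /tensor/= !mulN1r (addrC x.1) (addrC x.2).
  have s1 := smooth1_affine (-1) x.1 ba.1; have s2 := smooth1_affine (-1) x.2 bb.1.
  rewrite funeqE => z; rewrite -[LHS]/(partial i _ z) (partial_tensor i s1 s2).
  case: ifP => _; rewrite /tensor/=.
    by rewrite (derive1_affine _ _ _ ba.1) !mulN1r mulNr (addrC x.1) (addrC x.2).
  by rewrite (derive1_affine _ _ _ bb.1) !mulN1r mulrN (addrC x.1) (addrC x.2).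
rewrite ipNr ?opprK//.
by case: ifP => _; apply: L2_kernel => //; exact: bump1_derive.
Qed.

End Convolution.

(** Rectangles are intersections of preimages under the two projections, which are continuous. As
    the open sets are stable under intersection, an induction over measurable sets can start from
    them. *)
Lemma measurable_plane_open (R : realType) :
  (measurable : set (set (plane R))) = <<s [set U : set (R * R) | open U] >>.
Proof.
apply/seteqP; split; last first.
  by apply: smallest_sub; [exact: sigma_algebra_measurable|move=> U; exact: open_plane_measurable].
rewrite measurable_prod_measurableType; apply: smallest_sub; first exact: smallest_sigma_algebra.
pose O2 := g_sigma_algebraType [set U : set (R * R) | open U].
have m1 : measurable_fun setT (fst : O2 -> measurableTypeR R).
  apply: (measurability _ (RGenOpens.measurableE R)) => //.
  move=> _ [_ [a [b ->] <-]]; rewrite setTI; apply: sub_sigma_algebra.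
  by apply: (open_comp (f := fst)); [move=> x _; exact: cvg_fst|exact: interval_open].
have m2 : measurable_fun setT (snd : O2 -> measurableTypeR R).
  apply: (measurability _ (RGenOpens.measurableE R)) => //.
  move=> _ [_ [a [b ->] <-]]; rewrite setTI; apply: sub_sigma_algebra.
  by apply: (open_comp (f := snd)); [move=> x _; exact: cvg_snd|exact: interval_open].
move=> _ [A mA [B mB <-]].
have h1 := m1 measurableT A mA; have h2 := m2 measurableT B mB.
rewrite !setTI in h1 h2.
rewrite (_ : A `*` B = fst @^-1` A `&` snd @^-1` B)//.
exact: (@measurableI _ O2 _ _ h1 h2).
Qed.

(** * Convergence of averages in L^2 *)

Section Mollifier.
Context {R : realType} (D : set (R * R)).
Hypothesis oD : open D.
Let mD : measurable (D : set (plane R)) := open_plane_measurable oD.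
Hypothesis fD : (leb2 R D < +oo)%E.
Notation leb := (leb2 R).
Notation L2 := (L2 leb D).
Notation ip := (ip leb D).
Notation nrm := (nrm leb D).
Notation par := ((R * R) * (R * R))%type.

(* Convolution with [moll p] averages over the translates of the box
   [a1, a1 + e1] x [a2, a2 + e2], which need not contain the origin. *)
Definition moll (p : par) : R * R -> R := tensor (kern p.1.1 p.1.2) (kern p.2.1 p.2.2).

Definition ok_par (p : par) := 0 < p.1.2 /\ 0 < p.2.2.

Definition rad (p : par) : R := `|p.1.1| + p.1.2 + (`|p.2.1| + p.2.2).

Lemma moll_ge0 p x : ok_par p -> 0 <= moll p x.
Proof. by move=> [p1 p2]; rewrite mulr_ge0 ?kern_ge0. Qed.

Lemma moll_out p x : ok_par p ->
  ~ (p.1.1 <= x.1 <= p.1.1 + p.1.2 /\ p.2.1 <= x.2 <= p.2.1 + p.2.2) -> moll p x = 0.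
Proof.
move=> [p1 p2] nx; rewrite /moll /tensor.
have [h|/negP h] := boolP (p.1.1 <= x.1 <= p.1.1 + p.1.2); last by rewrite kern_out ?mul0r.
by rewrite (@kern_out _ p.2.1) ?mulr0// => h2; apply: nx.
Qed.

Lemma measurable_moll_sub p : measurable_fun setT (fun w : plane R * plane R => moll p (w.1 - w.2)).
Proof.
rewrite /moll /tensor; apply: measurable_funM.
  apply: (@measurableT_comp _ _ _ _ _ _ (kern p.1.1 p.1.2) _ (fun w : plane R * plane R => w.1.1 - w.2.1)).
    by apply: continuous_measurable_fun; apply: smooth1_continuous; exact: smooth1_kern.
  by apply: measurable_funB; apply: measurableT_comp; [exact: measurable_fst|exact: measurable_fst|exact: measurable_fst|exact: measurable_snd].
apply: (@measurableT_comp _ _ _ _ _ _ (kern p.2.1 p.2.2) _ (fun w : plane R * plane R => w.1.2 - w.2.2)).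
  by apply: continuous_measurable_fun; apply: smooth1_continuous; exact: smooth1_kern.
by apply: measurable_funB; apply: measurableT_comp; [exact: measurable_snd|exact: measurable_fst|exact: measurable_snd|exact: measurable_snd].
Qed.

Lemma moll_int p x : ok_par p -> (\int[leb]_z (moll p (x - z))%:E = 1)%E.
Proof.
move=> okp; have [p1 p2] := okp; rewrite leb2_iter; last 2 first.
- apply/measurable_EFinP; apply: (@measurableT_comp _ _ _ _ _ _ (fun w : plane R * plane R => moll p (w.1 - w.2)) _ (fun z => (x, z))).
    exact: measurable_moll_sub.
  by apply: measurable_fun_pair => //; exact: measurable_cst.
- by move=> z; rewrite lee_fin moll_ge0.
under eq_integral => s _.
  rewrite /moll /tensor/=; under eq_integral do rewrite EFinM.
  rewrite ge0_integralZl_EFin ?kern_ge0//; last 2 first.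
  - by move=> t _; rewrite lee_fin kern_ge0.
  - apply/measurable_EFinP; apply: continuous_measurable_fun; apply: smooth1_continuous.
    by have [] := bump1_shift x.2 (bump1_kern p.2.1 p2).
  rewrite kern_int// mule1; over.
exact: kern_int.
Qed.

Lemma moll_int' p z : ok_par p -> (\int[leb]_x (moll p (x - z))%:E = 1)%E.
Proof.
move=> okp; have [p1 p2] := okp; rewrite leb2_iter; last 2 first.
- apply/measurable_EFinP; apply: (@measurableT_comp _ _ _ _ _ _ (fun w : plane R * plane R => moll p (w.1 - w.2)) _ (fun x => (x, z))).
    exact: measurable_moll_sub.
  by apply: measurable_fun_pair => //; exact: measurable_cst.
- by move=> x; rewrite lee_fin moll_ge0.
under eq_integral => s _.
  rewrite /moll /tensor/=; under eq_integral do rewrite EFinM.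
  rewrite ge0_integralZl_EFin ?kern_ge0//; last 2 first.
  - by move=> t _; rewrite lee_fin kern_ge0.
  - apply/measurable_EFinP; apply: continuous_measurable_fun; apply: smooth1_continuous.
    rewrite (_ : (fun t => _) = fun t => kern p.2.1 p.2.2 (1 * t - z.2)).
      by apply: smooth1_affine; exact: smooth1_kern.
    by rewrite funeqE => t; rewrite mul1r.
  rewrite kern_int'// mule1; over.
exact: kern_int'.
Qed.

Lemma moll_near p x z e : ok_par p -> rad p < e -> moll p (x - z) != 0 -> ball x e z.
Proof.
move=> okp re /eqP nz; have [p1 p2] := okp.
have : p.1.1 <= x.1 - z.1 <= p.1.1 + p.1.2 /\ p.2.1 <= x.2 - z.2 <= p.2.1 + p.2.2.
  by apply: contrapT => h; apply: nz; exact: moll_out.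
move: re; rewrite /rad => re [/andP[h1 h2] /andP[h3 h4]].
have := ler_norm p.1.1; have := ler_norm (- p.1.1); have := ler_norm p.2.1; have := ler_norm (- p.2.1).
rewrite !normrN => k1 k2 k3 k4.
by split; rewrite /ball/= ltr_norml; apply/andP; split; lra.
Qed.

Lemma L2_moll p x : ok_par p -> L2 (fun z => moll p (x - z)).
Proof. by move=> [p1 p2]; apply: L2_kernel => //; exact: bump1_kern. Qed.

Definition avg (p : par) f := conv D (moll p) f.

Lemma smooth2_avg p f : ok_par p -> L2 f -> smooth2 (avg p f).
Proof. by move=> [p1 p2] Lf; apply: smooth2_conv => //; exact: bump1_kern. Qed.

Lemma L2_smooth2_dom f M : smooth2 f -> (forall x, D x -> `|f x| <= M) -> L2 f.
Proof.
move=> sf; apply: L2_bounded => //; apply: continuous_plane_measurable.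
exact: smooth2_continuous.
Qed.

Lemma L2_avg_pre p f : ok_par p -> L2 f -> L2 (avg p f).
Proof.
move=> okp Lf; have [p1 p2] := okp.
have [B B0 hB] := tensor_bounded (bump1_kern p.1.1 p1) (bump1_kern p.2.1 p2).
apply: (@L2_smooth2_dom _ (nrm f * (`|B| * nrm (fun=> 1)))); first exact: smooth2_avg.
move=> x Dx; apply: le_trans (cauchy_schwarz mD Lf (L2_moll x okp)) _.
apply: ler_wpM2l; first exact: nrm_ge0.
apply: nrm_le_bounded => // [|z _]; last exact: hB.
by case: (L2_moll x okp).
Qed.

Lemma moll_mass_le1 p x : ok_par p -> ip (fun z => moll p (x - z)) (fun=> 1) <= 1.
Proof.
move=> okp; rewrite -lee_fin /Defs.ip /Rintegral fineK.
  under eq_integral do rewrite mulr1.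
  rewrite -(moll_int x okp); apply: ge0_subset_integral => //.
    by apply/measurable_EFinP; apply: (@measurableT_comp _ _ _ _ _ _ (fun w : plane R * plane R => moll p (w.1 - w.2)) _ (fun z => (x, z)));
     [exact: measurable_moll_sub|apply: measurable_fun_pair => //; exact: measurable_cst].
  by move=> z _; rewrite lee_fin moll_ge0.
apply: integrable_fin_num => //; apply: L2_mul_integrable => //; first exact: L2_moll.
exact: L2_cst.
Qed.

Lemma L2_moll_mul p x f : ok_par p -> L2 f -> L2 (fun z => moll p (x - z) * f z).
Proof.
move=> okp Lf; have [p1 p2] := okp.
have [B B0 hB] := tensor_bounded (bump1_kern p.1.1 p1) (bump1_kern p.2.1 p2).
apply: (L2_mulr_bounded mD (M := B)) => // [|z _]; last exact: hB.
by case: (L2_moll x okp).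
Qed.

(** Jensen's inequality for a kernel of mass at most 1 on [D]: the integral of the kernel times (f -
    c)^2, with c the average, is nonnegative and is expanded. *)
Lemma avg_jensen p x f : ok_par p -> L2 f ->
  avg p f x ^+ 2 <= ip (fun z => moll p (x - z) * f z) f.
Proof.
move=> okp Lf; set c := avg p f x.
have L1 := L2_cst mD fD 1.
have Lc : L2 (fun z => f z - c) by apply: L2B => //; exact: L2_cst.
have : 0 <= ip (fun z => moll p (x - z) * (f z - c)) (fun z => f z - c).
  by apply: ip_ge0 => z _; rewrite -mulrA mulr_ge0 ?moll_ge0// -expr2 sqr_ge0.
have E : ip (fun z => moll p (x - z) * (f z - c)) (fun z => f z - c) =
   ip (fun z => moll p (x - z) * f z) f - 2 * c * c + c ^+ 2 * ip (fun z => moll p (x - z)) (fun=> 1).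
  have Lm := L2_moll x okp; have Lmf := L2_moll_mul x okp Lf; have Lmc := L2Z mD c Lm.
  have -> : ip (fun z => moll p (x - z) * (f z - c)) (fun z => f z - c) =
     ip (fun z => moll p (x - z) * f z - c * moll p (x - z)) (fun z => f z - c * 1).
    by apply: eq_ip => z _; ring.
  have L1c := L2Z mD c L1.
  rewrite ipBl// ?ipBr//; last exact: L2B.
  rewrite !ipZr// !ipZl//.
  have -> : ip (fun z => moll p (x - z) * f z) (fun=> 1) = c.
    by rewrite /c /avg /conv; apply: eq_Rintegral => z _; ring.
  have -> : ip (fun z => moll p (x - z)) f = c by rewrite /c /avg /conv ipC.
  by ring.
rewrite E => h; have := moll_mass_le1 x okp; have := sqr_ge0 c; nra.
Qed.

Lemma moll_tonelli_le p (g : plane R -> R) : ok_par p ->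
  measurable_fun setT g -> (forall z, 0 <= g z) ->
  (\int[leb]_(x in D) \int[leb]_(z in D) (moll p (x - z) * g z)%:E <=
   \int[leb]_(z in D) (g z)%:E)%E.
Proof.
move=> okp mg g0.
have mm : measurable_fun setT (fun w : plane R * plane R => (moll p (w.1 - w.2) * (g \_ D) w.2)%:E).
  apply/measurable_EFinP; apply: measurable_funM; first exact: measurable_moll_sub.
  apply: (@measurableT_comp _ _ _ _ _ _ (g \_ D) _ snd); last exact: measurable_snd.
  apply/(measurable_restrictT _ mD); exact: measurable_funTS.
have gD0 z : 0 <= (g \_ D) z by rewrite patchE; case: ifP.
apply: (@le_trans _ _ (\int[leb]_x \int[leb]_z (moll p (x - z) * (g \_ D) z)%:E)%E).
  apply: (@le_trans _ _ (\int[leb]_(x in D) \int[leb]_z (moll p (x - z) * (g \_ D) z)%:E)%E).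
    rewrite le_eqVlt; apply/orP; left; apply/eqP; apply: eq_integral => x _.
    rewrite integral_mkcond; apply: eq_integral => z _; rewrite !patchE; case: ifP => //.
    by rewrite mulr0.
  apply: ge0_subset_integral => //.
    by apply: (measurable_leb2_section mm) => w; rewrite lee_fin mulr_ge0 ?moll_ge0.
  by move=> x _; apply: integral_ge0 => z _; rewrite lee_fin mulr_ge0 ?moll_ge0.
rewrite (leb2_tonelli mm); last by move=> w; rewrite lee_fin mulr_ge0 ?moll_ge0.
rewrite [leRHS]integral_mkcond le_eqVlt; apply/orP; left; apply/eqP.
apply: eq_integral => z _.
have -> : (\int[leb]_x (moll p ((x, z).1 - (x, z).2) * (g \_ D) (x, z).2)%:E =
    \int[leb]_x (((g \_ D) z)%:E * (moll p (x - z))%:E))%E.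
  by apply: eq_integral => x _; rewrite /= -EFinM mulrC.
rewrite ge0_integralZl_EFin//; last 2 first.
- by move=> x _; rewrite lee_fin moll_ge0.
- apply/measurable_EFinP; apply: (@measurableT_comp _ _ _ _ _ _ (fun w : plane R * plane R => moll p (w.1 - w.2)) _ (fun x => (x, z))).
    exact: measurable_moll_sub.
  by apply: measurable_fun_pair => //; exact: measurable_cst.
by rewrite moll_int'// mule1 restrict_EFin.
Qed.

(** Jensen at each point, then Tonelli: the kernel has mass 1 in either variable. *)
Lemma nrm_avg_le p f : ok_par p -> L2 f -> nrm (avg p f) <= nrm f.
Proof.
move=> okp Lf; rewrite -(@ler_pXn2r _ 2)// ?nnegrE ?nrm_ge0// -lee_fin.
rewrite !nrm_EFin//; last exact: L2_avg_pre.
have mf2 : measurable_fun setT ((fun z => (f z ^+ 2)) \_ D : plane R -> R).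
  by apply/(measurable_restrictT _ mD); apply: measurable_funX; case: Lf.
have f20 z : 0 <= ((fun z => (f z ^+ 2)) \_ D) z by rewrite patchE; case: ifP => // _; exact: sqr_ge0.
have := moll_tonelli_le okp mf2 f20.
have -> : (\int[leb]_(z in D) (((fun z => f z ^+ 2) \_ D) z)%:E = \int[leb]_(z in D) (f z ^+ 2)%:E)%E.
  by apply: eq_integral => z zD; rewrite patchE zD.
apply: le_trans; apply: ge0_le_integral => //.
- by move=> x _; rewrite lee_fin sqr_ge0.
- by apply/measurable_EFinP; apply: measurable_funX; case: (L2_avg_pre okp Lf).
- rewrite (_ : (fun x => _) = (fun x => \int[leb]_z (moll p (x - z) * (((fun z => f z ^+ 2) \_ D) \_ D) z)%:E)%E).
    apply: measurable_funTS; apply: (@measurable_leb2_section R (fun w : plane R * plane R =>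
      (moll p (w.1 - w.2) * (((fun z => f z ^+ 2) \_ D) \_ D) w.2)%:E)).
      apply/measurable_EFinP; apply: measurable_funM; first exact: measurable_moll_sub.
      apply: (@measurableT_comp _ _ _ _ _ _ (((fun z => f z ^+ 2) \_ D) \_ D) _ snd); last exact: measurable_snd.
      by apply/(measurable_restrictT _ mD); exact: measurable_funTS.
    by move=> w; rewrite lee_fin mulr_ge0 ?moll_ge0// patchE; case: ifP.
  rewrite funeqE => x; rewrite integral_mkcond; apply: eq_integral => z _.
  by rewrite patchE [in RHS]patchE; case: ifP => //; rewrite mulr0.
- move=> x Dx; apply: (@le_trans _ _ (ip (fun z => moll p (x - z) * f z) f)%:E).
    by rewrite lee_fin avg_jensen.
  rewrite /Defs.ip /Rintegral fineK.
    by rewrite le_eqVlt; apply/orP; left; apply/eqP; apply: eq_integral => z zD; rewrite patchE zD -mulrA -expr2.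
  by apply: integrable_fin_num => //; apply: L2_mul_integrable => //; exact: L2_moll_mul.
Qed.

Lemma L2_avg p f : ok_par p -> L2 f -> L2 (avg p f).
Proof. exact: L2_avg_pre. Qed.

Lemma avg_local p f g x e : ok_par p -> rad p < e ->
  (forall z, D z -> ball x e z -> f z = g z) -> avg p f x = avg p g x.
Proof.
move=> okp re fg; apply: eq_Rintegral => z /set_mem Dz.
have [->|nz] := eqVneq (moll p (x - z)) 0; first by rewrite !mulr0.
by rewrite (fg _ Dz (moll_near okp re nz)).
Qed.

Lemma avg_cst1 p x e : ok_par p -> rad p < e -> ball x e `<=` D -> avg p (fun=> 1) x = 1.
Proof.
move=> okp re xD; rewrite /avg /conv /Defs.ip /Rintegral.
under eq_integral do rewrite mul1r.
rewrite integral_mkcond (_ : (\int[_]_z _)%E = 1%E)// -(moll_int x okp).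
apply: eq_integral => z _; rewrite patchE; case: ifPn => //; rewrite notin_setE => nD.
have [->//|nz] := eqVneq (moll p (x - z)) 0.
by exfalso; apply: nD; apply: xD; exact: moll_near nz.
Qed.

Lemma avgD p f g x : ok_par p -> L2 f -> L2 g ->
  avg p (fun z => f z + g z) x = avg p f x + avg p g x.
Proof. by move=> okp Lf Lg; apply: ipDl => //; exact: L2_moll. Qed.

Lemma avgZ p c f x : ok_par p -> L2 f -> avg p (fun z => c * f z) x = c * avg p f x.
Proof. by move=> okp Lf; apply: ipZl => //; exact: L2_moll. Qed.

Section Converge.
Variable p_ : nat -> par.
Hypothesis okp : forall n, ok_par (p_ n).
Hypothesis rad0 : rad (p_ n) @[n --> \oo] --> (0 : R).

(** The functions whose averages converge in L^2 form a closed subspace, because averaging is a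
    contraction. It contains the indicators of open sets, then those of measurable sets, then the
    simple functions, hence all of L^2. *)
Definition good f := L2 f /\ nrm (fun x => avg (p_ n) f x - f x) @[n --> \oo] --> (0 : R).

Lemma goodP f : L2 f -> (forall e, 0 < e -> \forall n \near \oo,
  nrm (fun x => avg (p_ n) f x - f x) <= e) -> good f.
Proof.
move=> Lf h; split=> //; apply/cvgrPdist_le => e e0; apply: filterS (h e e0) => n.
by rewrite sub0r normrN ger0_norm ?nrm_ge0.
Qed.

Lemma good_near f e : good f -> 0 < e ->
  \forall n \near \oo, nrm (fun x => avg (p_ n) f x - f x) <= e.
Proof.
move=> [_ h] e0; move/cvgrPdist_le : h => /(_ _ e0); apply: filterS => n.
by rewrite sub0r normrN ger0_norm ?nrm_ge0.
Qed.

Lemma goodD f g : good f -> good g -> good (fun x => f x + g x).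
Proof.
move=> gf gg; have [Lf _] := gf; have [Lg _] := gg; apply: goodP; first exact: L2D.
move=> e e0; have e2 : 0 < e / 2 by rewrite divr_gt0.
apply: filterS2 (good_near gf e2) (good_near gg e2) => n h1 h2.
have LA := L2B mD (L2_avg (okp n) Lf) Lf; have LB := L2B mD (L2_avg (okp n) Lg) Lg.
rewrite (@eq_nrm _ _ _ _ (fun x => (avg (p_ n) f x - f x) + (avg (p_ n) g x - g x))); last first.
  by move=> x _; rewrite avgD//; ring.
by apply: le_trans (ler_nrmD mD LA LB) _; rewrite (splitr e) lerD.
Qed.

Lemma goodZ c f : good f -> good (fun x => c * f x).
Proof.
move=> gf; have [Lf _] := gf; apply: goodP; first exact: L2Z.
move=> e e0; have ec : 0 < e / (`|c| + 1) by rewrite divr_gt0// ltr_wpDl.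
apply: filterS (good_near gf ec) => n h1.
have LA := L2B mD (L2_avg (okp n) Lf) Lf.
rewrite (@eq_nrm _ _ _ _ (fun x => c * (avg (p_ n) f x - f x))); last first.
  by move=> x _; rewrite avgZ//; ring.
rewrite nrmZ//; apply: le_trans (ler_wpM2l (normr_ge0 c) h1) _.
rewrite mulrA ler_pdivrMr ?ltr_wpDl// mulrDr mulr1 mulrC.
by rewrite lerDl ltW.
Qed.

Lemma goodB f g : good f -> good g -> good (fun x => f x - g x).
Proof.
move=> gf /(goodZ (-1)) gg; have := goodD gf gg.
by rewrite (_ : (fun x => f x + -1 * g x) = fun x => f x - g x)// funeqE => x; rewrite mulN1r.
Qed.

Lemma good_approx f : L2 f ->
  (forall e, 0 < e -> exists g, good g /\ nrm (fun x => f x - g x) <= e) -> good f.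
Proof.
move=> Lf h; apply: goodP => // e e0; have e3 : 0 < e / 3 by rewrite divr_gt0.
have [g [gg fg]] := h _ e3; have [Lg _] := gg.
apply: filterS (good_near gg e3) => n h1.
have Lfg := L2B mD Lf Lg; have LA := L2_avg (okp n) Lf; have LB := L2_avg (okp n) Lg.
have LAfg := L2_avg (okp n) Lfg.
rewrite (@eq_nrm _ _ _ _ (fun x => avg (p_ n) (fun x => f x - g x) x + ((avg (p_ n) g x - g x) - (f x - g x)))); last first.
  move=> x _; rewrite (_ : (fun x => f x - g x) = fun x => f x + -1 * g x); last first.
    by rewrite funeqE => y; rewrite mulN1r.
  by rewrite avgD ?avgZ//; [ring|exact: L2Z].
have LC := L2B mD LB Lg; have LE := L2B mD LC Lfg.
apply: le_trans (ler_nrmD mD LAfg LE) _.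
have h2 := ler_nrmB mD LC Lfg; have h3 := nrm_avg_le (okp n) Lfg.
by lra.
Qed.

Lemma eq_good f g : (forall x, D x -> f x = g x) -> good f -> good g.
Proof.
move=> fg [Lf h]; split; first exact: L2_eq Lf.
apply: cvg_trans h; apply: near_eq_cvg; apply: nearW => n; apply: eq_nrm => x Dx.
by rewrite -fg//; congr (_ - _); rewrite /avg /conv; apply: eq_ip => // z Dz; rewrite fg.
Qed.

Lemma L2_indic (A : set (plane R)) : measurable A -> L2 (\1_A).
Proof.
move=> mA; apply: (@L2_bounded _ _ _ mD fD _ 1); first exact: measurable_indic.
by move=> x _; rewrite indicE; case: (_ \in _); rewrite ?normr1 ?normr0.
Qed.

(* The averages of an indicator are at most 1 and eventually equal to 1 at each
   point of the open set, so they converge weakly; the norms do not increase,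
   which turns this into strong convergence. *)
Lemma good_open (A : set (R * R)) : open A -> good (\1_A : plane R -> R).
Proof.
move=> oA; have mA := open_plane_measurable oA; have LA := L2_indic mA.
have L1 := L2_cst mD fD 1.
have Ln n := L2_avg (okp n) LA.
have h : ip (fun x => 1 - avg (p_ n) (\1_A) x) (\1_A) @[n --> \oo] --> (0 : R).
  have avg01 n x : 0 <= avg (p_ n) (\1_A) x <= 1.
    apply/andP; split.
      by apply: ip_ge0 => z _; rewrite mulr_ge0 ?moll_ge0// indicE.
    apply: le_trans (moll_mass_le1 x (okp n)); apply: le_ip => //; [exact: L2_moll|exact: L2_moll|].
    move=> z _; rewrite indicE mulr1 -[leRHS]mul1r ler_wpM2r ?moll_ge0//.
    by case: (_ \in _).
  have mf n : measurable_fun (D : set (plane R)) (fun x => ((1 - avg (p_ n) (\1_A) x) * \1_A x)%:E).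
    apply/measurable_EFinP; apply: measurable_funM; first apply: measurable_funB.
    - exact: measurable_cst.
    - by case: (Ln n).
    - exact: measurable_indic.
  have cv x : D x -> ((1 - avg (p_ n) (\1_A) x) * \1_A x)%:E @[n --> \oo] --> (0%E : \bar R).
    move=> Dx; rewrite indicE; have [Ax|Ax] := boolP (x \in A); last first.
      by under eq_fun do rewrite mulr0; exact: cvg_cst.
    have : nbhs x (D `&` A) by apply: open_nbhs_nbhs; split; [exact: openI|split => //; exact: set_mem].
    move=> /nbhs_ballP[e /= e0 xe]; apply: cvg_near_cst.
    have : \forall n \near \oo, rad (p_ n) < e by exact: (cvgr_lt 0).
    apply: filterS => n re; rewrite mulr1.
    rewrite (avg_local (g := fun=> 1) (okp n) re) ?(avg_cst1 (okp n) re) ?subrr//.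
      by move=> z /xe[].
    by move=> z _ /xe[_ Az]; rewrite indicE mem_set.
  have dom n x : D x -> (`|((1 - avg (p_ n) (\1_A) x) * \1_A x)%:E| <= 1%:E)%E.
    move=> Dx; have /andP[a0 a1] := avg01 n x; rewrite lee_fin indicE.
    by case: (_ \in _); rewrite ?mulr0 ?normr0// mulr1 ger0_norm; lra.
  have i1 : leb.-integrable (D : set (plane R)) (fun=> 1%:E).
    have := L2_mul_integrable mD L1 L1; apply: eq_integrable => // x _ /=; by rewrite mulr1.
  have := @dominated_cvg _ _ _ leb _ mD _ _ (fun=> 1%:E) mf cv (fun _ _ => isT) i1 dom.
  by rewrite integral0 => /fine_cvg.
split => //.
have h2 n : nrm (fun x => avg (p_ n) (\1_A) x - \1_A x) ^+ 2 <=
   2 * ip (fun x => 1 - avg (p_ n) (\1_A) x) (\1_A).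
  have LnA := L2B mD (Ln n) LA.
  have e1 : ip (\1_A) (\1_A) = ip (fun=> 1) (\1_A).
    by apply: eq_Rintegral => x _; rewrite indicE; case: (_ \in _); rewrite ?mulr1 ?mulr0.
  have := nrm_avg_le (okp n) LA; rewrite -(@ler_pXn2r _ 2)// ?nnegrE ?nrm_ge0// !sqr_nrm.
  rewrite ipBl// ipBr// ipBr// ipBl// (ipC _ _ (\1_A) (avg _ _)) e1 => ?; lra.
apply/cvgrPdist_le => e e0.
have e2 : 0 < e ^+ 2 / 2 by rewrite divr_gt0// exprn_gt0.
move/cvgrPdist_le : h => /(_ _ e2); apply: filterS => n.
rewrite !sub0r !normrN => h; rewrite (ger0_norm (nrm_ge0 _ _ _)).
rewrite -(@ler_pXn2r _ 2)// ?nnegrE ?nrm_ge0 ?(ltW e0)//.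
apply: le_trans (h2 n) _; have := ler_norm (ip (fun x => 1 - avg (p_ n) (\1_A) x) (\1_A)).
by lra.
Qed.

(** The measurable sets with a good indicator form a Dynkin class: complements are differences, and
    a disjoint union is an L^2 limit of finite sums. *)
Lemma good_measurable (A : set (plane R)) : measurable A -> good (\1_A).
Proof.
move=> mA.
have mE := measurable_plane_open R.
apply: (@dynkin_induction _ (plane R) [set U : set (R * R) | open U] (fun A => good (\1_A))) => //.
- by move=> U V oU oV; exact: openI.
- by apply: good_open; exact: openT.
- by move=> U; exact: good_open.
- move=> S mS gS; have := goodB (good_open openT) gS; apply: eq_good => x _.
  by rewrite !indicE in_setT in_setC; case: (_ \in _) => /=; rewrite ?subrr ?subr0.
- move=> F mF tF gF; have mU : measurable (\bigcup_k F k) by exact: bigcup_measurable.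
  have gm m : good (\1_(\big[setU/set0]_(k < m) F k) : plane R -> R).
    elim: m => [|m IH].
      rewrite big_ord0; have := good_open open0; apply: eq_good => x _; by [].
    have := goodD IH (gF m); apply: eq_good => x _.
    rewrite big_ord_recr /= !indicE in_setU.
    have [x1|x1] := boolP (x \in \big[setU/set0]_(k < m) F k); have [x2|x2] := boolP (x \in F m) => /=; rewrite ?addr0 ?add0r//.
    exfalso; move: (set_mem x1); rewrite -bigcup_mkord => -[k /= km Fkx].
    have := tF k m I I (ex_intro _ x (conj Fkx (set_mem x2))).
    by move=> kem; rewrite kem ltnn in km.
  apply: good_approx; first exact: L2_indic.
  move=> e e0.
  have LU := L2_indic mU; have Lm m : L2 (\1_(\big[setU/set0]_(k < m) F k) : plane R -> R).
    by apply: L2_indic; exact: bigsetU_measurable.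
  have : nrm (fun x => \1_(\big[setU/set0]_(k < m) F k) x - \1_(\bigcup_k F k) x) @[m --> \oo] --> (0 : R).
    apply: (L2_dominated mD Lm LU (L2_cst mD fD 1)) => [n x _|x _].
      by rewrite !indicE; do 2 case: (_ \in _); rewrite ?subrr ?sub0r ?subr0 ?normrN ?normr1 ?normr0.
    apply: cvg_near_cst; rewrite indicE; have [xU|xU] := boolP (x \in _).
      have [k _ Fkx] := set_mem xU; exists k.+1 => // m /= km.
      rewrite indicE mem_set//; apply: (bigsetU_sup (i := Ordinal km)) => //.
    apply: nearW => m; rewrite indicE (_ : (_ \in _) = false)//.
    apply/negP => /set_mem; rewrite -bigcup_mkord => -[k _ Fkx].
    by move/negP : xU; apply; apply: mem_set; exists k.
  move/cvgrPdist_le => /(_ _ e0)[m _ /(_ m (leqnn m))].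
  rewrite sub0r normrN ger0_norm ?nrm_ge0// => h.
  exists (\1_(\big[setU/set0]_(k < m) F k)); split; first exact: gm.
  by rewrite nrmBC.
- by move: mA; rewrite mE.
Qed.

Import HBSimple HBNNSimple.

Lemma good_simple (g : {sfun plane R >-> R}) : good g.
Proof.
have -> : (g : plane R -> R) = fun x => \sum_(y <- finmap.enum_fset (fset_set (range g))) y * \1_(g @^-1` [set y]) x.
  by rewrite funeqE => x; rewrite fimfunE fsbig_finite.
elim: (finmap.enum_fset _) => [|y s IH].
  rewrite (_ : (fun x => _) = (fun x => 0 * \1_(setT : set (plane R)) x)); first by apply: goodZ; exact: good_measurable.
  by rewrite funeqE => x; rewrite big_nil mul0r.
rewrite (_ : (fun x => _) = (fun x => y * \1_(g @^-1` [set y]) x + \sum_(y <- s) y * \1_(g @^-1` [set y]) x)).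
  by apply: goodD => //; apply: goodZ; apply: good_measurable; exact: measurable_sfunP.
by rewrite funeqE => x; rewrite big_cons.
Qed.

Lemma avg_cvg f : L2 f -> nrm (fun x => avg (p_ n) f x - f x) @[n --> \oo] --> (0 : R).
Proof.
suff gp g : L2 g -> (forall x, D x -> 0 <= g x) -> good g.
  move=> Lf; suff [] : good f by [].
  have Lp : L2 (f^\+) by apply: (le_L2 mD _ Lf) => [|x _]; [apply: measurable_funrpos; case: Lf|rewrite ger0_norm ?funrpos_ge0// /funrpos ge_max ler_norm normr_ge0].
  have Ln : L2 (f^\-) by apply: (le_L2 mD _ Lf) => [|x _]; [apply: measurable_funrneg; case: Lf|rewrite ger0_norm ?funrneg_ge0// /funrneg ge_max -normrN ler_norm normr_ge0].
  have := goodB (gp _ Lp (fun x _ => funrpos_ge0 f x)) (gp _ Ln (fun x _ => funrneg_ge0 f x)).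
  by apply: eq_good => x _; rewrite -[in RHS](funrposBneg f).
move=> Lg g0; have mg : measurable_fun (D : set (plane R)) (EFin \o g) by apply/measurable_EFinP; case: Lg.
have g0' (x : plane R) : D x -> (0 <= (EFin \o g) x)%E by move=> Dx; rewrite lee_fin g0.
pose s_ := nnsfun_approx mD mg.
have sg n x : D x -> s_ n x <= g x.
  by move=> Dx; rewrite -lee_fin /s_ nnsfun_approxE; exact: (le_approx n g0' Dx).
apply: good_approx => // e e0.
have Ls n : L2 (s_ n) by case: (good_simple (s_ n)).
have : nrm (fun x => s_ n x - g x) @[n --> \oo] --> (0 : R).
  apply: (L2_dominated mD Ls Lg Lg) => [n x Dx|x Dx].
    have := sg n x Dx; have : 0 <= s_ n x by [].
    by move=> h1 h2; rewrite distrC ger0_norm; lra.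
  by have /fine_cvg := cvg_nnsfun_approx mD mg g0' Dx.
move/cvgrPdist_le => /(_ _ e0)[m _ /(_ m (leqnn m))].
rewrite sub0r normrN ger0_norm ?nrm_ge0// => h.
by exists (s_ m); split; [exact: good_simple|rewrite nrmBC].
Qed.

End Converge.

End Mollifier.

(** * Weak derivatives *)

Section CompactSupport.
Context {R : realType}.
Notation leb := (leb2 R).
Notation leb1 := (@lebesgue_measure R).

Definition csupp (f : R * R -> R) : Prop :=
  exists M : R, forall p, M < `|p.1| \/ M < `|p.2| -> f p = 0.

Lemma compact_box (a b c d : R) : compact (`[a, b] `*` `[c, d] : set (R * R)).
Proof. by apply: compact_setX; exact: segment_compact. Qed.

Lemma continuous_box_bounded (f : R * R -> R) (M : R) : continuous f ->
  exists2 B, 0 <= B & forall p, `|p.1| <= M -> `|p.2| <= M -> `|f p| <= B.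
Proof.
move=> cf; have := @compact_box (- M) M (- M) M => cb.
have : compact (f @` (`[- M, M] `*` `[- M, M])).
  by apply: continuous_compact => //; exact: continuous_subspaceT.
move=> /compact_bounded[B [_ hB]]; exists (`|B| + 1); first by rewrite addr_ge0.
move=> p p1 p2; apply: hB; first by rewrite (le_lt_trans (ler_norm B))// ltrDl.
by exists p => //; split; rewrite /= in_itv/= -ler_norml.
Qed.

Lemma csupp_bounded (f : R * R -> R) : continuous f -> csupp f ->
  exists2 B, 0 <= B & forall p, `|f p| <= B.
Proof.
move=> cf [M hM]; have [B B0 hB] := continuous_box_bounded M cf.
exists B => // p; have [p1|p1] := leP `|p.1| M; last by rewrite hM ?normr0//; left.
by have [p2|p2] := leP `|p.2| M; [exact: hB|rewrite hM ?normr0//; right].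
Qed.

Lemma csupp_integrable (f : R * R -> R) : continuous f -> csupp f ->
  leb.-integrable setT (EFin \o f).
Proof.
move=> cf sf; have [B B0 hB] := csupp_bounded cf sf; have [M hM] := sf.
pose Q : set (plane R) := (`[- M, M] `*` `[- M, M])%classic.
have mQ : measurable Q by exact: measurableX.
have Qf : (leb Q < +oo)%E.
  have h : (leb1 (`[- M, M]%classic : set R)%R < +oo)%E.
    by rewrite lebesgue_measure_itv/=; case: ifP => _; rewrite ?ltry.
  by rewrite leb2_rect//; apply: lte_mul_pinfty => //; rewrite ge0_fin_numE.
have : leb.-integrable Q (EFin \o f).
  apply: measurable_bounded_integrable => //; first exact: continuous_plane_measurable.
  exists B; split; first exact: num_real.
  by move=> N BN p _ /=; rewrite (le_trans (hB p)) ?ltW.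
move/(integrable_mkcond _ mQ); apply: eq_integrable => // p _.
rewrite patchE; case: ifPn => //; rewrite notin_setE => nQ /=; rewrite hM//.
apply: contrapT => /not_orP[/negP h1 /negP h2]; apply: nQ; move: h1 h2; rewrite -!leNgt => h1 h2.
by split; rewrite /= in_itv/= -ler_norml.
Qed.

Lemma csupp_fubini (f : R * R -> R) : continuous f -> csupp f ->
  (\int[leb]_p (f p)%:E = \int[leb1]_s \int[leb1]_t (f (s, t))%:E)%E.
Proof.
move=> cf sf; have i := csupp_integrable cf sf.
by rewrite (@integral12_prod_meas1 _ _ _ _ _ leb1 leb1 (EFin \o f) i).
Qed.

Lemma csupp_fubini_swap (f : R * R -> R) : continuous f -> csupp f ->
  (\int[leb]_p (f p)%:E = \int[leb1]_t \int[leb1]_s (f (s, t))%:E)%E.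
Proof.
move=> cf sf; have i := csupp_integrable cf sf.
by rewrite (@integral21_prod_meas1 _ _ _ _ _ leb1 leb1 (EFin \o f) i).
Qed.

Lemma smooth2_is_derive_fst f (s t : R) : smooth2 f ->
  is_derive s 1 (fun s => f (s, t)) (partial 0 f (s, t)).
Proof.
move=> sf; have := derivable_line (smooth2_derivable f 0 (s, t) sf) => d.
have := @is_derive1_comp R (fun r : R => f ((s, t) + r *: unit_vec 0)) (fun r : R => r - s) s
  (partial 0 f (s, t)) 1.
rewrite mulr1 subrr => /(_ d) h.
rewrite (_ : (fun s => f (s, t)) = (fun r : R => f ((s, t) + r *: unit_vec 0)) \o (fun r : R => r - s)).
  by apply: h; apply: is_derive_eq; rewrite subr0.
rewrite funeqE => r /=; congr f; rewrite /unit_vec/=; congr pair => /=.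
  by rewrite /GRing.scale/= mulr1 addrC subrK.
by rewrite /GRing.scale/= mulr0 addr0.
Qed.

Lemma smooth2_is_derive_snd f (s t : R) : smooth2 f ->
  is_derive t 1 (fun t => f (s, t)) (partial 1 f (s, t)).
Proof.
move=> sf; have := derivable_line (smooth2_derivable f 1 (s, t) sf) => d.
have := @is_derive1_comp R (fun r : R => f ((s, t) + r *: unit_vec 1)) (fun r : R => r - t) t
  (partial 1 f (s, t)) 1.
rewrite mulr1 subrr => /(_ d) h.
rewrite (_ : (fun t => f (s, t)) = (fun r : R => f ((s, t) + r *: unit_vec 1)) \o (fun r : R => r - t)).
  by apply: h; apply: is_derive_eq; rewrite subr0.
rewrite funeqE => r /=; congr f; rewrite /unit_vec/=; congr pair => /=.
  by rewrite /GRing.scale/= mulr0 addr0.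
by rewrite /GRing.scale/= mulr1 addrC subrK.
Qed.

Lemma smooth2_partial_eq0 f i (U : set (R * R)) : open U -> (forall p, U p -> f p = 0) ->
  forall p, U p -> partial i f p = 0.
Proof.
move=> oU f0 p Up.
have h : is_derive p (unit_vec i) f 0.
  apply: (@near_eq_is_derive R (R * R)%type R (fun=> 0)) => //.
  have : nbhs p U by exact: open_nbhs_nbhs.
  by apply: filterS => q Uq; rewrite f0.
by rewrite /partial; have [_ ->] := h.
Qed.

Lemma open_far (M : R) : open [set p : R * R | M < `|p.1| \/ M < `|p.2|].
Proof.
have op (f : R * R -> R) : continuous f -> open [set p | M < `|f p|].
  move=> cf; apply: (open_comp (f := fun p => `|f p|) (D := [set x | M < x])); last exact: open_gt.
  by move=> p _; apply: (@cvg_comp _ _ _ f Num.norm _ (nbhs (f p))); [exact: cf|exact: norm_continuous].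
rewrite (_ : [set p | _] = [set p : R * R | M < `|p.1|] `|` [set p | M < `|p.2|])//.
by apply: openU; apply: op => p; [exact: cvg_fst|exact: cvg_snd].
Qed.

Lemma csupp_partial f i : csupp f -> csupp (partial i f).
Proof.
move=> [M hM]; have H := @smooth2_partial_eq0 f i [set p : R * R | M < `|p.1| \/ M < `|p.2|] (@open_far M) hM.
by exists M => p hp; exact: (H p hp).
Qed.

Lemma continuous_fst_line (f : R * R -> R) t : continuous f -> continuous (fun s => f (s, t)).
Proof.
move=> cf s; apply: (@cvg_comp _ _ _ (fun s => (s, t)) f _ (nbhs (s, t))); last exact: cf.
move=> P [[A B] /= [As Bt] ABP]; apply: filterS As => y Ay; apply: ABP; split=> //=.
exact: nbhs_singleton Bt.
Qed.

Lemma continuous_snd_line (f : R * R -> R) s : continuous f -> continuous (fun t => f (s, t)).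
Proof.
move=> cf t; apply: (@cvg_comp _ _ _ (fun t => (s, t)) f _ (nbhs (s, t))); last exact: cf.
move=> P [[A B] /= [As Bt] ABP]; apply: filterS Bt => y By; apply: ABP; split=> //=.
exact: nbhs_singleton As.
Qed.

(** Fubini with the differentiated variable innermost, where the integral is a difference of two
    values outside the support. *)
Lemma integral_partial f i : smooth2 f -> csupp f -> (\int[leb]_p (partial i f p)%:E = 0)%E.
Proof.
move=> sf cf; have [M hM] := cf.
have cp : continuous (partial i f) by apply: smooth2_continuous; exact: smooth2_partial.
have hM' := csupp_partial i cf.
pose N := `|M| + 1; have N0 : - N < N by rewrite /N; have := normr_ge0 M; lra.
have MN : M < N by rewrite /N (le_lt_trans (ler_norm M))// ltrDl.
have out (x : R) : ~ (- N <= x <= N) -> M < `|x|.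
  move=> h; apply: lt_trans MN _; rewrite ltNge; apply/negP; rewrite ler_norml => h'.
  exact: h.
have NN : M < `|N| by rewrite ger0_norm ?MN//; rewrite /N addr_ge0.
have [hi|hi] : i = 0 \/ i = 1.
  by case: i {cp hM'} => -[|[|//]] hi; [left|right]; exact: val_inj.
- rewrite csupp_fubini_swap// integral0_eq// => t _.
  have ds (s : R) : is_derive s 1 (fun s => f (s, t)) (partial i f (s, t)).
    by rewrite hi; exact: smooth2_is_derive_fst.
  rewrite (FTC_line N0 ds); first last.
  + by move=> s /out h; apply: (@smooth2_partial_eq0 f i [set p : R * R | M < `|p.1| \/ M < `|p.2|] (@open_far M) hM (s, t)); left.
  + exact: continuous_fst_line.
  by rewrite !hM ?subrr//; left => //=; rewrite normrN.
- rewrite csupp_fubini// integral0_eq// => s _.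
  have ds (t : R) : is_derive t 1 (fun t => f (s, t)) (partial i f (s, t)).
    by rewrite hi; exact: smooth2_is_derive_snd.
  rewrite (FTC_line N0 ds); first last.
  + by move=> t /out h; apply: (@smooth2_partial_eq0 f i [set p : R * R | M < `|p.1| \/ M < `|p.2|] (@open_far M) hM (s, t)); right.
  + exact: continuous_snd_line.
  by rewrite !hM ?subrr//; right => //=; rewrite normrN.
Qed.

Lemma compact_csupp (K : set (R * R)) f : compact K -> (forall p, ~ K p -> f p = 0) -> csupp f.
Proof.
move=> cK fK; have [M M0 hM] := bounded_set_box (compact_bounded cK).
exists M => p h; apply: fK => /hM[h1 h2]; case: h; lra.
Qed.

End CompactSupport.

Section WeakDerivatives.
Context {R : realType} (Om : set (R * R)).
Hypothesis oOm : open Om.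
Hypothesis bOm : bounded_set Om.
Notation leb := (leb2 R).
Notation L2 := (L2 leb Om).
Notation ip := (ip leb Om).
Notation nrm := (nrm leb Om).
Notation aeq := (aeq leb Om).
Notation wder := (is_weak_derivative Om).

Lemma measurable_dom : measurable (Om : set (plane R)).
Proof. exact: open_plane_measurable. Qed.

Lemma finite_dom : (leb Om < +oo)%E.
Proof. by apply: leb2_bounded => //; exact: measurable_dom. Qed.

Let mD := measurable_dom.
Let fD := finite_dom.

Lemma smooth2_bounded f : smooth2 f -> exists2 B, 0 <= B & forall p, Om p -> `|f p| <= B.
Proof.
move=> sf; have [M M0 hM] := bounded_set_box bOm.
have [B B0 hB] := continuous_box_bounded M (smooth2_continuous sf).
by exists B => // p /hM[p1 p2]; exact: hB.
Qed.

Lemma L2_smooth2 f : smooth2 f -> L2 f.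
Proof.
move=> sf; have [B B0 hB] := smooth2_bounded sf.
apply: (L2_bounded mD fD (M := B)) => //; apply: continuous_plane_measurable.
exact: smooth2_continuous.
Qed.

Lemma L2_smooth2M f g : smooth2 f -> L2 g -> L2 (fun x => f x * g x).
Proof.
move=> sf Lg; have [B B0 hB] := smooth2_bounded sf.
apply: (L2_mulr_bounded mD (M := B)) => //; by case: (L2_smooth2 sf).
Qed.

Definition seqpar (n : nat) : (R * R) * (R * R) := ((0, n.+1%:R^-1), (0, n.+1%:R^-1)).

Lemma ok_seqpar n : ok_par (seqpar n).
Proof. by split; rewrite /= invr_gt0. Qed.

Lemma rad_seqpar : rad (seqpar n) @[n --> \oo] --> (0 : R).
Proof.
rewrite /rad/= (_ : (fun n => _) = (fun n => n.+1%:R^-1 + n.+1%:R^-1)); last first.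
  by rewrite funeqE => n; rewrite normr0 !add0r.
by rewrite -[X in _ --> X](addr0 (0 : R)); apply: cvgD; exact: cvg_harmonic.
Qed.

Lemma test_moll p x e : ok_par p -> rad p < e -> ball x e `<=` Om ->
  test_function Om (fun z => moll p (x - z)).
Proof.
move=> okp re xO; split; first by apply: smooth2_reflect; exact: smooth1_kern.
have [p1 p2] := okp.
exists (`[x.1 - p.1.1 - p.1.2, x.1 - p.1.1] `*` `[x.2 - p.2.1 - p.2.2, x.2 - p.2.1]); split.
- exact: compact_box.
- move=> z [/= z1 z2]; apply: xO; rewrite !in_itv/= in z1 z2.
  have /andP[h1 h2] := z1; have /andP[h3 h4] := z2.
  have := ler_norm p.1.1; have := ler_norm (- p.1.1); have := ler_norm p.2.1; have := ler_norm (- p.2.1).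
  move: re; rewrite !normrN /rad => re k1 k2 k3 k4.
  by split; rewrite /ball/= ltr_norml; apply/andP; split; lra.
- move=> z nz; apply: moll_out => // -[/andP[h1 h2] /andP[h3 h4]]; apply: nz.
  by split; rewrite /= in_itv/=; apply/andP; move: h1 h2 h3 h4 => /= *; split; lra.
Qed.

(** The average of [g] vanishes at a point as soon as the kernel fits into [Om], and the averages
    converge to [g] in L^2. The first convergence is only pointwise; truncation by 1 supplies a
    majorant, so min(|g|, 1) is an L^2 limit of functions whose norms tend to 0. *)
Lemma du_Bois_Reymond g : L2 g ->
  (forall phi, test_function Om phi -> ip g phi = 0) -> aeq g (fun=> 0).
Proof.
move=> Lg g0.
pose f_ n x := Num.min `|avg Om (seqpar n) g x - g x| 1.
pose f x := Num.min `|g x| 1.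
have LA n : L2 (avg Om (seqpar n) g) by apply: L2_avg => //; exact: ok_seqpar.
have LB n := L2B mD (LA n) Lg.
have minP (a : R) : [/\ 0 <= Num.min `|a| 1, Num.min `|a| 1 <= `|a| & Num.min `|a| 1 <= 1].
  by have := normr_ge0 a; rewrite /Num.min; case: ltP => h ?; split; lra.
have min1 (a : R) : `|Num.min `|a| 1| <= `|a|.
  by have [h1 h2 h3] := minP a; rewrite ger0_norm.
have Lf_ n : L2 (f_ n).
  apply: (le_L2 mD _ (LB n)) => [|x _]; last exact: min1.
  by apply: measurable_minr; [apply: measurableT_comp => //; case: (LB n)|exact: measurable_cst].
have Lf : L2 f.
  apply: (le_L2 mD _ Lg) => [|x _]; last exact: min1.
  by apply: measurable_minr; [apply: measurableT_comp => //; case: Lg|exact: measurable_cst].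
have c1 : nrm (fun x => f_ n x - f x) @[n --> \oo] --> (0 : R).
  apply: (L2_dominated mD Lf_ Lf (L2_cst mD fD 1)) => [n x Ox|x Ox].
    rewrite /f_ /f ler_norml.
    have [h1 _ h3] := minP (avg Om (seqpar n) g x - g x); have [h2 _ h4] := minP (g x).
    by apply/andP; split; lra.
  have : nbhs x Om by exact: open_nbhs_nbhs.
  move=> /nbhs_ballP[e /= e0 xe]; apply: cvg_near_cst.
  have : \forall n \near \oo, rad (seqpar n) < e by exact: (cvgr_lt 0 rad_seqpar).
  apply: filterS => n re; rewrite /f_ /avg /conv g0 ?sub0r ?normrN//.
  exact: (test_moll (ok_seqpar n) re xe).
have c2 := nrm_cvg_lim mD Lf_ Lf c1.
have c3 := avg_cvg oOm fD ok_seqpar rad_seqpar Lg.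
have f0 : nrm f = 0.
  apply/eqP; rewrite eq_le nrm_ge0 andbT.
  apply: (@ler_cvg_to _ _ _ _ (fun n => nrm (f_ n)) (fun n => nrm (fun x => avg Om (seqpar n) g x - g x)) _ _ c2 c3).
  by apply: nearW => n; apply: ler_nrm => // [|x _]; [case: (Lf_ n)|exact: min1].
have := nrm0_aeq mD Lf f0; apply: filterS => x h Ox.
apply/eqP; rewrite -normr_eq0; apply/eqP; move: (h Ox); rewrite /f /Num.min; case: ifP => // _.
by move=> /eqP; rewrite oner_eq0.
Qed.

Lemma test_smooth phi : test_function Om phi -> smooth2 phi.
Proof. by case. Qed.

Lemma L2_test phi : test_function Om phi -> L2 phi.
Proof. by move=> [sphi _]; exact: L2_smooth2. Qed.

Lemma L2_test_partial i phi : test_function Om phi -> L2 (partial i phi).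
Proof. by move=> [sphi _]; apply: L2_smooth2; exact: smooth2_partial. Qed.

Lemma weq_of_ip f g : L2 f -> L2 g ->
  (forall phi, test_function Om phi -> ip f phi = ip g phi) -> aeq f g.
Proof.
move=> Lf Lg fg.
have : aeq (fun x => f x - g x) (fun=> 0).
  apply: du_Bois_Reymond; first exact: L2B.
  by move=> phi tp; rewrite ipBl ?fg ?subrr//; exact: L2_test.
by apply: filterS => x h Ox; apply/eqP; rewrite -subr_eq0 h.
Qed.

Lemma wder_unique i u g g' : wder i u g -> wder i u g' -> aeq g g'.
Proof.
move=> [Lg hg] [Lg' hg']; apply: weq_of_ip => // phi tp.
by apply: oppr_inj; rewrite -hg// -hg'.
Qed.

Lemma wder_wD i u g : wder i u g -> wder i u (wD Om i u).
Proof. by move=> h; rewrite /wD; apply: xgetPex; exists g. Qed.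

Lemma wD_aeq i u g : wder i u g -> aeq (wD Om i u) g.
Proof. by move=> h; apply: (wder_unique (wder_wD h) h). Qed.

Lemma wder_aeq i u u' g g' : L2 u -> L2 u' -> L2 g' -> aeq u u' -> aeq g g' ->
  wder i u g -> wder i u' g'.
Proof.
move=> Lu Lu' Lg' uu gg [Lg h]; split=> // phi tp.
have L1 := L2_test tp; have L2' := L2_test_partial i tp.
rewrite -(@aeq_ip _ _ _ mD u (partial i phi))//; [|exact: aeq_refl].
rewrite h//; congr (- _); apply: aeq_ip => //; exact: aeq_refl.
Qed.

Lemma wderD i u v g h : L2 u -> L2 v -> wder i u g -> wder i v h ->
  wder i (fun x => u x + v x) (fun x => g x + h x).
Proof.
move=> Lu Lv [Lg hg] [Lh hh]; split; first exact: L2D.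
move=> phi tp; have L1 := L2_test tp; have L2' := L2_test_partial i tp.
by rewrite ipDl// ipDl// hg// hh// opprD.
Qed.

Lemma wderZ i c u g : L2 u -> wder i u g -> wder i (fun x => c * u x) (fun x => c * g x).
Proof.
move=> Lu [Lg hg]; split; first exact: L2Z.
move=> phi tp; have L1 := L2_test tp; have L2' := L2_test_partial i tp.
by rewrite ipZl// ipZl// hg// mulrN.
Qed.

Lemma wderB i u v g h : L2 u -> L2 v -> wder i u g -> wder i v h ->
  wder i (fun x => u x - v x) (fun x => g x - h x).
Proof.
move=> Lu Lv hu /(wderZ (-1) Lv) hv.
have := wderD Lu (L2Z mD (-1) Lv) hu hv.
rewrite (_ : (fun x => u x + -1 * v x) = fun x => u x - v x); last by rewrite funeqE => x; rewrite mulN1r.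
by rewrite (_ : (fun x => g x + -1 * h x) = fun x => g x - h x)//; rewrite funeqE => x; rewrite mulN1r.
Qed.

Lemma test_csupp phi : test_function Om phi -> csupp phi.
Proof. by move=> [_ [K [cK _ hK]]]; exact: compact_csupp hK. Qed.

Lemma test_mul f phi : smooth2 f -> test_function Om phi -> test_function Om (fun x => f x * phi x).
Proof.
move=> sf [sp [K [cK KO hK]]]; split; first exact: smooth2M.
by exists K; split=> // x /hK ->; rewrite mulr0.
Qed.

Lemma test_partial i phi : test_function Om phi -> test_function Om (partial i phi).
Proof.
move=> [sp [K [cK KO hK]]]; split; first exact: smooth2_partial.
exists K; split=> // x nK.
apply: (@smooth2_partial_eq0 _ phi i (~` K)) => //.
by apply: closed_openC; apply: compact_closed => //; exact: norm_hausdorff.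
Qed.

Lemma test_integral_partial i phi : test_function Om phi -> \int[leb]_(x in Om) partial i phi x = 0.
Proof.
move=> tp; have [_ [K [cK KO hK]]] := test_partial i tp.
rewrite /Rintegral integral_mkcond.
rewrite (_ : (\int[leb]_x _)%E = (\int[leb]_x (partial i phi x)%:E)%E).
  by rewrite integral_partial//; [case: tp|exact: test_csupp].
apply: eq_integral => x _; rewrite patchE; case: ifPn => //; rewrite notin_setE => nO.
by rewrite hK// => /KO.
Qed.

(** The product of [f] with a test function is a test function, and its partial derivative
    integrates to 0. *)
Lemma wder_smooth2 i f : smooth2 f -> wder i f (partial i f).
Proof.
move=> sf; have Lf := L2_smooth2 sf; have Lpf := L2_smooth2 (smooth2_partial i sf).
split=> // phi tp; have L1 := L2_test tp; have L2' := L2_test_partial i tp.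
have := test_integral_partial i (test_mul sf tp).
rewrite (smooth2_partialM i sf (test_smooth tp)) RintegralD//; last 2 first.
- exact: L2_mul_integrable.
- exact: L2_mul_integrable.
move/eqP; rewrite addr_eq0 => /eqP; rewrite -[LHS]/(ip f (partial i phi)) => ->.
by congr (- _); rewrite [RHS]ipC.
Qed.

Lemma H1P u : Hm Om 1 u <-> L2 u /\ forall i, wder i u (wD Om i u).
Proof.
split=> [[Lu h]|[Lu h]]; split=> // i; first by have [g [/wder_wD]] := h i.
by exists (wD Om i u); split=> //; case: (h i).
Qed.

Lemma H1_L2 u : Hm Om 1 u -> L2 u. Proof. by move=> /H1P[]. Qed.

Lemma H1_wder i u : Hm Om 1 u -> wder i u (wD Om i u). Proof. by move=> /H1P[_]; exact. Qed.

Lemma H1_L2wD i u : Hm Om 1 u -> L2 (wD Om i u). Proof. by move=> /(H1_wder i)[]. Qed.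

Lemma Hm_aeq m u v : L2 v -> aeq u v -> Hm Om m u -> Hm Om m v.
Proof.
case: m => // m Lv uv [Lu h]; split=> // i; have [g [hg Hg]] := h i.
exists g; split=> //; apply: (wder_aeq Lu Lv _ uv (aeq_refl _ _ _) hg).
by case: hg.
Qed.

Lemma H2_H1 u : Hm Om 2 u -> Hm Om 1 u.
Proof. by move=> [Lu h]; split=> // i; have [g [hg [Lg _]]] := h i; exists g. Qed.

Lemma H2_wD i u : Hm Om 2 u -> Hm Om 1 (wD Om i u).
Proof.
move=> Hu; have [Lu h] := Hu; have [g [hg Hg]] := h i.
apply: (@Hm_aeq _ g) => //; first by apply: H1_L2wD; exact: H2_H1.
by apply: aeq_sym; exact: wD_aeq.
Qed.

Lemma H2P u : Hm Om 1 u -> (forall i, Hm Om 1 (wD Om i u)) -> Hm Om 2 u.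
Proof. by move=> H1 h; split; [exact: H1_L2|move=> i; exists (wD Om i u); split; [exact: H1_wder|exact: h]]. Qed.

Lemma H1D u v : Hm Om 1 u -> Hm Om 1 v -> Hm Om 1 (fun x => u x + v x).
Proof.
move=> Hu Hv; split; first by apply: L2D => //; exact: H1_L2.
move=> i; exists (fun x => wD Om i u x + wD Om i v x); split.
  by apply: wderD; [exact: H1_L2|exact: H1_L2|exact: H1_wder|exact: H1_wder].
by apply: L2D => //; exact: H1_L2wD.
Qed.

Lemma H1Z c u : Hm Om 1 u -> Hm Om 1 (fun x => c * u x).
Proof.
move=> Hu; split; first by apply: L2Z => //; exact: H1_L2.
move=> i; exists (fun x => c * wD Om i u x); split.
  by apply: wderZ; [exact: H1_L2|exact: H1_wder].
by apply: L2Z => //; exact: H1_L2wD.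
Qed.

Lemma H1B u v : Hm Om 1 u -> Hm Om 1 v -> Hm Om 1 (fun x => u x - v x).
Proof.
move=> Hu /(H1Z (-1)) Hv; have := H1D Hu Hv.
by rewrite (_ : (fun x => u x + -1 * v x) = fun x => u x - v x)// funeqE => x; rewrite mulN1r.
Qed.

Lemma wD_B i u v : Hm Om 1 u -> Hm Om 1 v ->
  aeq (wD Om i (fun x => u x - v x)) (fun x => wD Om i u x - wD Om i v x).
Proof. by move=> Hu Hv; apply: wD_aeq; apply: wderB; [exact: H1_L2|exact: H1_L2|exact: H1_wder|exact: H1_wder]. Qed.

Lemma wD_Z i c u : Hm Om 1 u -> aeq (wD Om i (fun x => c * u x)) (fun x => c * wD Om i u x).
Proof. by move=> Hu; apply: wD_aeq; apply: wderZ; [exact: H1_L2|exact: H1_wder]. Qed.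

Lemma wD_smooth2 i f : smooth2 f -> aeq (wD Om i f) (partial i f).
Proof. by move=> sf; apply: wD_aeq; exact: wder_smooth2. Qed.

Lemma H1_smooth2 f : smooth2 f -> Hm Om 1 f.
Proof.
move=> sf; split; first exact: L2_smooth2.
by move=> i; exists (partial i f); split; [exact: wder_smooth2|apply: L2_smooth2; exact: smooth2_partial].
Qed.

End WeakDerivatives.

(** * Flattening the boundary by charts *)

Section Charts.
Context {R : realType}.
Notation leb := (leb2 R).
Notation leb1 := (@lebesgue_measure R).

(** The chain rule from partial derivatives: F(r, b r) is split into F(r, b r) - F(s, b r) and F(s,
    b r). The mean value theorem in the first variable and the continuity of [F0] differentiate the
    first part, the usual chain rule the second. *)
Lemma is_derive_graph (F F0 F1 : R * R -> R) (b : R -> R) (s b' : R) :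
  (forall s t : R, is_derive s 1 (fun s => F (s, t)) (F0 (s, t))) ->
  (forall s t : R, is_derive t 1 (fun t => F (s, t)) (F1 (s, t))) ->
  continuous F0 -> is_derive s 1 b b' ->
  is_derive s 1 (fun s => F (s, b s)) (F0 (s, b s) + F1 (s, b s) * b').
Proof.
move=> d0 d1 c0 db.
have cb : {for s, continuous b}.
  by apply: differentiable_continuous; apply/derivable1_diffP; case: db.
have h2 : is_derive s 1 (fun r => F (s, b r)) (F1 (s, b s) * b').
  exact: (@is_derive1_comp _ (fun t => F (s, t)) b s _ _ (d1 s (b s)) db).
have h1 : is_derive s 1 (fun r => F (r, b r) - F (s, b r)) (F0 (s, b s)).
  have lim : (fun h : R => h^-1 *: (((fun r => F (r, b r) - F (s, b r)) \o shift s) (h *: 1)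
       - (F (s, b s) - F (s, b s)))) @ 0^' --> F0 (s, b s).
    apply/cvgrPdist_le => e e0.
    move: (c0 (s, b s)) => /cvgrPdist_le/(_ _ e0)/nbhs_ballP[d /= dp hd].
    move: (cb) => /cvgrPdist_lt/(_ _ dp)/nbhs_ballP[d' /= d'p hd'].
    have mp : 0 < Num.min d d' by rewrite lt_min dp.
    near=> h.
    have hn : h != 0 by near: h; exact: nbhs_dnbhs_neq.
    have hm : `|h| < Num.min d d'.
      by near: h; apply: dnbhs0_lt.
    have [hdd hdd'] : `|h| < d /\ `|h| < d' by move: hm; rewrite lt_min => /andP[].
    rewrite /= subrr subr0 (_ : h *: 1 = h); last by rewrite /GRing.scale/= mulr1.
    have bb : ball (b s) d (b (h + s)).
      apply: hd'; rewrite /ball/= opprD addrCA subrr addr0 normrN//.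
    have mvt : exists2 c, `|c - s| <= `|h| & F (h + s, b (h + s)) - F (s, b (h + s)) = F0 (c, b (h + s)) * h.
      have dF (x : R) : is_derive x 1 (fun r => F (r, b (h + s))) (F0 (x, b (h + s))) by exact: d0.
      have cF : continuous (fun r => F (r, b (h + s))).
        by move=> x; apply: differentiable_continuous; apply/derivable1_diffP; case: (dF x).
      have [hp|hm'|h0] := ltgtP 0 h; last by rewrite -h0 eqxx in hn.
      - have lt : s < h + s by rewrite ltrDr.
        have [c] := MVT lt (fun x _ => dF x) (continuous_subspaceT cF).
        rewrite in_itv/= => /andP[c1 c2] ->; exists c; last by rewrite addrK.
        by rewrite (gtr0_norm hp) ger0_norm; lra.
      - have lt : h + s < s by rewrite gtrDr.
        have [c] := MVT lt (fun x _ => dF x) (continuous_subspaceT cF).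
        rewrite in_itv/= => /andP[c1 c2] ec; exists c.
          by rewrite (ltr0_norm hm') ler0_norm; lra.
        by rewrite -opprB ec opprD addrCA subrr addr0 mulrN opprK.
    have [c hc ->] := mvt.
    rewrite /GRing.scale/= mulrCA mulVf// mulr1.
    apply: hd; split => //=; rewrite /ball/= distrC; exact: le_lt_trans hdd.
  by apply: DeriveDef; [apply/cvg_ex; exists (F0 (s, b s)); exact: lim|apply: cvg_lim => //; exact: lim].
have := is_deriveD h1 h2; rewrite (_ : _ + _ = (fun r => F (r, b r)))//.
by rewrite funeqE => r /=; rewrite !fctE subrK.
Unshelve. all: by end_near. Qed.

Definition sg (b : bool) : R := (-1) ^+ b.

Lemma sg_sqr b : sg b * sg b = 1.
Proof. by rewrite /sg -expr2 sqrr_sign. Qed.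

Lemma sgP b : sg b = 1 \/ sg b = -1.
Proof. by case: b; [right|left]; rewrite /sg ?expr1 ?expr0. Qed.

Lemma norm_sg b : `|sg b| = 1. Proof. exact: normr_sign. Qed.

(** The map that straightens a chart: (s, t) goes to the point at signed height t over the graph,
    with t > 0 on the side of the domain. It is a shear composed with reflections, so it preserves
    area and no Jacobian appears. *)
Definition kappa (sw b : bool) (h : R -> R) (p : R * R) : R * R :=
  relabel sw (p.1, h p.1 + sg b * p.2).

Lemma relabelK sw : involutive (@relabel R sw).
Proof. by case: sw => -[]. Qed.

Lemma kappa_chart Om U sw b h p : boundary_chart Om U sw b h -> U (kappa sw b h p) ->
  Om (kappa sw b h p) <-> 0 < p.2.
Proof.
move=> [_ _ hU] /hU ->; rewrite /kappa relabelK /= addrC addKr mulrA.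
by rewrite -[(-1) ^+ b]/(sg b) sg_sqr mul1r.
Qed.

Lemma leb1_affine (c : R) b (A : set R) : measurable A ->
  leb1 ((fun y : R => c + sg b * y) @^-1` A) = leb1 A.
Proof.
have mf : measurable_fun setT ((fun y : R => c + sg b * y) : measurableTypeR R -> measurableTypeR R).
  by apply: measurable_funD; [exact: measurable_cst|apply: measurable_funM => //; exact: measurable_cst].
move=> mA.
have := @lebesgue_measure_unique R (pushforward leb1 ((fun y : R => c + sg b * y) : measurableTypeR R -> measurableTypeR R)).
move=> /(_ mf _ A mA) h; symmetry; apply: h.
move=> X [[x y] _ <-].
rewrite -[RHS]/(leb1 ((fun y : R => c + sg b * y) @^-1` `]x, y]%classic)); move: (sgP b) {mf}.
case=> ->.
- rewrite (_ : _ @^-1` _ = `]x - c, y - c]%classic).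
    rewrite !lebesgue_measure_itv/= !lte_fin ltrD2r; case: ifP => // _.
    by congr EFin; ring.
  by apply/seteqP; split => t /=; rewrite !in_itv/= mul1r => /andP[h1 h2]; apply/andP; split; lra.
- rewrite (_ : _ @^-1` _ = `[c - y, c - x[%classic).
    rewrite !lebesgue_measure_itv/= !lte_fin ltrD2l ltrN2; case: ifP => // _.
    by congr EFin; ring.
  by apply/seteqP; split => t /=; rewrite !in_itv/= mulN1r => /andP[h1 h2]; apply/andP; split; lra.
Qed.

Lemma continuous_kappa sw b (h : R -> R) : continuous h -> continuous (kappa sw b h).
Proof.
move=> ch.
have c1 : continuous (fun p : R * R => h p.1 + sg b * p.2).
  move=> p; apply: cvgD.
    by apply: (@cvg_comp _ _ _ fst h _ (nbhs p.1)); [exact: cvg_fst|exact: ch].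
  by apply: cvgM; [exact: cvg_cst|exact: cvg_snd].
have pair_c (f g : R * R -> R) : continuous f -> continuous g -> continuous (fun p => (f p, g p)).
  move=> cf cg p P [[A B] /= [Af Bg] ABP].
  move: (cf p) (cg p) => /(_ _ Af) h1 /(_ _ Bg) h2.
  have h1' : \forall q \near p, A (f q) by exact: h1.
  have h2' : \forall q \near p, B (g q) by exact: h2.
  suff : \forall q \near p, P (f q, g q) by [].
  near=> q; apply: ABP; split => /=; near: q; [exact: h1'|exact: h2'].
have c0 : continuous (fun p : R * R => p.1) by move=> p; exact: cvg_fst.
by case: sw; [exact: pair_c c1 c0|exact: pair_c c0 c1].
Unshelve. all: by end_near. Qed.

Lemma measurable_kappa sw b (h : R -> R) : continuous h ->
  measurable_fun setT (kappa sw b h : plane R -> plane R).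
Proof.
move=> ch; apply: (measurability _ (measurable_plane_open R)) => _ [U oU <-].
rewrite setTI; apply: open_plane_measurable.
by apply: open_comp => // p _; exact: continuous_kappa.
Qed.

(** By Tonelli the area is an integral of lengths over the lines s = const, and on each of them the
    map is a translation, possibly with a reflection. *)
Lemma leb2_kappa sw b (h : R -> R) (A : set (plane R)) : continuous h -> measurable A ->
  leb (kappa sw b h @^-1` A) = leb A.
Proof.
move=> ch mA.
have mK : measurable (kappa sw b h @^-1` A).
  by rewrite -[X in measurable X]setTI; exact: measurable_kappa.
have mi (B : set (plane R)) : measurable B -> measurable_fun setT (fun p : plane R => (\1_B p)%:E : \bar R).
  by move=> mB; apply/measurable_EFinP; exact: measurable_indic.
have i0 (B : set (plane R)) p : (0 <= (\1_B p)%:E :> \bar R)%E by rewrite lee_fin indicE.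
have E (B : set (plane R)) : measurable B -> leb B = (\int[leb]_p (\1_B p)%:E)%E.
  by move=> mB; rewrite integral_indic// setIT.
have inner (c : R) (B : set R) (mB : measurable B) :
   (\int[leb1]_t (\1_B (c + sg b * t))%:E = \int[leb1]_t (\1_B t)%:E)%E.
  have mc : measurable_fun setT ((fun y : R => c + sg b * y) : measurableTypeR R -> measurableTypeR R).
    by apply: measurable_funD; [exact: measurable_cst|apply: measurable_funM => //; exact: measurable_cst].
  have mB' : measurable ((fun y : R => c + sg b * y) @^-1` B).
    by rewrite -[X in measurable X]setTI; exact: mc.
  transitivity (\int[leb1]_t (\1_((fun y : R => c + sg b * y) @^-1` B) t)%:E)%E; first by [].
  by rewrite !integral_indic ?setIT//; exact: leb1_affine.
rewrite !E//.
case: sw mK => mK.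
- rewrite [RHS](leb2_iter_swap (mi _ mA) (i0 _)) [LHS](leb2_iter (mi _ mK) (i0 _)).
  apply: eq_integral => s _.
  have mB : measurable ([set x | A (x, s)] : set (measurableTypeR R)).
    have : measurable_fun setT (fun x : measurableTypeR R => (x, s) : plane R).
      by apply: measurable_fun_pair => //; exact: measurable_cst.
    by move=> /(_ measurableT _ mA); rewrite setTI.
  exact: (inner (h s) _ mB).
- rewrite [RHS](leb2_iter (mi _ mA) (i0 _)) [LHS](leb2_iter (mi _ mK) (i0 _)).
  apply: eq_integral => s _.
  have mB : measurable ([set x | A (s, x)] : set (measurableTypeR R)).
    have : measurable_fun setT (fun x : measurableTypeR R => (s, x) : plane R).
      by apply: measurable_fun_pair => //; exact: measurable_cst.
    by move=> /(_ measurableT _ mA); rewrite setTI.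
  exact: (inner (h s) _ mB).
Qed.

Lemma ge0_integral_kappa sw b (h : R -> R) (D : set (plane R)) (f : plane R -> \bar R) :
  continuous h -> measurable D -> measurable_fun D f -> (forall p, 0 <= f p)%E ->
  (\int[leb]_(p in D) f p = \int[leb]_(p in kappa sw b h @^-1` D) f (kappa sw b h p))%E.
Proof.
move=> ch mD mf f0.
have mk := measurable_kappa sw b ch.
have := @ge0_integral_pushforward _ _ _ _ _ _ mk leb D f mD mf (fun p _ => f0 p).
move=> h2; transitivity (\int[pushforward leb (kappa sw b h : plane R -> plane R)]_(p in D) f p)%E; last exact: h2.
by apply: eq_measure_integral => A mA _; symmetry; exact: leb2_kappa.
Qed.

Lemma integral_kappa sw b (h : R -> R) (D : set (plane R)) (f : plane R -> R) :
  continuous h -> measurable D -> measurable_fun setT f ->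
  leb.-integrable D (EFin \o f) ->
  (\int[leb]_(p in D) (f p)%:E = \int[leb]_(p in kappa sw b h @^-1` D) (f (kappa sw b h p))%:E)%E
  /\ leb.-integrable (kappa sw b h @^-1` D) (EFin \o (f \o kappa sw b h)).
Proof.
move=> ch mD mf intf.
have mk := measurable_kappa sw b ch.
have i2 : leb.-integrable (kappa sw b h @^-1` D) (EFin \o (f \o kappa sw b h)).
  apply/integrableP; split.
    apply: measurable_funTS; apply/measurable_EFinP.
    by apply: (@measurableT_comp _ _ _ _ _ _ f _ (kappa sw b h)).
  move/integrableP : intf => [_]; rewrite (ge0_integral_kappa sw b ch mD)//.
  by apply: measurable_funTS; apply: measurableT_comp => //; exact/measurable_EFinP.
split=> //.
have mEf : measurable_fun setT (EFin \o f : plane R -> \bar R) by exact/measurable_EFinP.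
have h2 := @integral_pushforward _ _ _ _ _ _ mk leb D (EFin \o f) mEf i2 mD.
transitivity (\int[pushforward leb (kappa sw b h : plane R -> plane R)]_(p in D) (EFin \o f) p)%E; last exact: h2.
by apply: eq_measure_integral => A mA _; symmetry; exact: leb2_kappa.
Qed.

End Charts.

(** * Inequalities for smooth functions in boundary charts *)

Section HalfPlane.
Context {R : realType}.
Notation leb := (leb2 R).
Notation leb1 := (@lebesgue_measure R).

Definition half : set (R * R) := [set p | 0 < p.2].

Lemma open_half : open half.
Proof.
apply: (@open_comp _ _ (fun p : R * R => p.2) [set x | 0 < x]); last exact: open_gt.
by move=> p _; exact: cvg_snd.
Qed.

Lemma measurable_half : measurable (half : set (plane R)).
Proof. by apply: open_plane_measurable; exact: open_half. Qed.

Lemma patch_half (f : R * R -> R) s t :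
  ((fun p => (f p)%:E) \_ half) (s, t) = ((fun t => (f (s, t))%:E) \_ `]0%R, +oo[%classic) t :> \bar R.
Proof. by rewrite !patchE !mem_setE /half /= in_itv/= andbT. Qed.

Lemma ge0_half_iter (f : R * R -> R) : continuous f -> (forall p, 0 <= f p) ->
  (\int[leb]_(p in half) (f p)%:E = \int[leb1]_s \int[leb1]_(t in `]0%R, +oo[) (f (s, t))%:E)%E.
Proof.
move=> cf f0; rewrite integral_mkcond leb2_iter.
- apply: eq_integral => s _; rewrite [RHS]integral_mkcond.
  by apply: eq_integral => t _; exact: patch_half.
- apply/(measurable_restrictT _ measurable_half); apply/measurable_EFinP.
  exact: continuous_plane_measurable.
- by move=> p; rewrite patchE; case: ifP => // _; rewrite lee_fin.
Qed.

Lemma ge0_half_iter_swap (f : R * R -> R) : continuous f -> (forall p, 0 <= f p) ->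
  (\int[leb]_(p in half) (f p)%:E = \int[leb1]_(t in `]0%R, +oo[) \int[leb1]_s (f (s, t))%:E)%E.
Proof.
move=> cf f0; rewrite integral_mkcond leb2_iter_swap.
- rewrite [RHS]integral_mkcond; apply: eq_integral => t _; rewrite patchE.
  case: ifPn => ht.
    by apply: eq_integral => s _; rewrite patch_half patchE ht.
  by apply: integral0_eq => s _; rewrite patch_half patchE (negbTE ht).
- apply/(measurable_restrictT _ measurable_half); apply/measurable_EFinP.
  exact: continuous_plane_measurable.
- by move=> p; rewrite patchE; case: ifP => // _; rewrite lee_fin.
Qed.

Lemma half_iter (f : R * R -> R) : continuous f -> csupp f ->
  (\int[leb]_(p in half) (f p)%:E = \int[leb1]_s \int[leb1]_(t in `]0%R, +oo[) (f (s, t))%:E)%E.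
Proof.
move=> cf sf; rewrite integral_mkcond -(@integral12_prod_meas1 _ _ _ _ _ leb1 leb1).
  apply: eq_integral => s _; rewrite [RHS]integral_mkcond.
  by apply: eq_integral => t _; exact: patch_half.
apply/(integrable_mkcond _ measurable_half).
by apply: integrableS (csupp_integrable cf sf) => //; exact: measurable_half.
Qed.

Lemma half_iter_swap (f : R * R -> R) : continuous f -> csupp f ->
  (\int[leb]_(p in half) (f p)%:E = \int[leb1]_(t in `]0%R, +oo[) \int[leb1]_s (f (s, t))%:E)%E.
Proof.
move=> cf sf; rewrite integral_mkcond -(@integral21_prod_meas1 _ _ _ _ _ leb1 leb1).
  rewrite [RHS]integral_mkcond; apply: eq_integral => t _; rewrite patchE.
  rewrite /fubini_G; case: ifPn => ht.
    by apply: eq_integral => s _; rewrite patch_half patchE ht.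
  by apply: integral0_eq => s _; rewrite patch_half patchE (negbTE ht).
apply/(integrable_mkcond _ measurable_half).
by apply: integrableS (csupp_integrable cf sf) => //; exact: measurable_half.
Qed.

Variables (P P0 P1 : R * R -> R) (M : R).
Hypothesis cP : continuous P.
Hypothesis cP0 : continuous P0.
Hypothesis cP1 : continuous P1.
Hypothesis d0 : forall s t : R, is_derive s 1 (fun s => P (s, t)) (P0 (s, t)).
Hypothesis d1 : forall s t : R, is_derive t 1 (fun t => P (s, t)) (P1 (s, t)).
Hypothesis M0 : 0 < M.
Hypothesis oP : forall p, M < `|p.1| \/ M < `|p.2| -> [/\ P p = 0, P0 p = 0 & P1 p = 0].

Let out (x : R) : ~ (- M <= x <= M) -> M < `|x|.
Proof. by move=> h; rewrite ltNge; apply/negP; rewrite ler_norml => h'; exact: h. Qed.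

Let outM (x : R) : M < x -> M < `|x|.
Proof. by move=> h; apply: lt_le_trans h (ler_norm x). Qed.

Let M1 : M < M + 1. Proof. by rewrite ltrDl. Qed.
Let NM : - M < M. Proof. by have := M0; lra. Qed.

Lemma half_trace s : (\int[leb1]_(t in `]0%R, +oo[) (P1 (s, t))%:E = (- P (s, 0))%:E)%E.
Proof.
rewrite (@FTC_half _ (fun t => P (s, t)) _ (M + 1)).
- by rewrite (_ : P (s, M + 1) = 0) ?sub0r//; have [] := @oP (s, M + 1) (or_intror (outM M1)).
- by rewrite (lt_trans M0).
- exact: continuous_snd_line.
- by move=> t h; have [] := @oP (s, t) (or_intror (outM (lt_trans M1 h))).
Qed.

Lemma half_line0 t : (\int[leb1]_s (P0 (s, t))%:E = 0)%E.
Proof.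
rewrite (@FTC_line _ (fun s => P (s, t)) _ (- M - 1) (M + 1)).
- have [-> _ _] := @oP (M + 1, t) (or_introl (outM M1)).
  have [|-> _ _] := @oP (- M - 1, t); last by rewrite subrr.
  by left => /=; rewrite -opprD normrN; exact: outM.
- by have := M0; lra.
- exact: continuous_fst_line.
- move=> s h; have [|//] := @oP (s, t); left => /=; apply: out => h'; apply: h.
  by move: h' => /andP[h1 h2]; apply/andP; split; lra.
Qed.

(** The value at height [t] is minus the integral of the normal derivative from [t] up to the end of
    the support. *)
Lemma half_le_up s t : 0 <= t ->
  ((`|P (s, t)|)%:E <= \int[leb1]_(t in `]0%R, +oo[) (`|P1 (s, t)|)%:E)%E.
Proof.
move=> t0.
have mP D : measurable_fun D (fun t : measurableTypeR R => (P1 (s, t))%:E).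
  by apply/measurable_EFinP; apply: measurable_funTS; apply: continuous_measurable_fun; exact: continuous_snd_line.
have [tM|Mt] := leP t M; last first.
  have [-> _ _] := @oP (s, t) (or_intror (outM Mt)).
  by rewrite normr0; apply: integral_ge0 => x _; rewrite lee_fin.
have tM1 : t < M + 1 by lra.
have := FTC_itv tM1 (d1 s) (continuous_snd_line cP1).
have [-> _ _] := @oP (s, M + 1) (or_intror (outM M1)).
rewrite sub0r => e.
have -> : ((`|P (s, t)|)%:E = `|(- P (s, t))%:E|)%E by rewrite /= normrN.
rewrite -e; apply: le_trans (le_abse_integral leb1 _ (mP _)) _ => //.
rewrite integral_itv_obnd_cbnd; last first.
  by apply/measurable_EFinP; apply: measurableT_comp => //; apply/measurable_EFinP; exact: mP.
have -> : (\int[leb1]_(x in `[0%R, +oo[) `|P1 (s, x)|%:E = \int[leb1]_(x in `[0%R, +oo[) `|(P1 (s, x))%:E|)%E by [].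
apply: ge0_subset_integral => //.
  by apply: measurableT_comp => //; exact: mP.
by move=> x /=; rewrite !in_itv/= andbT => /andP[h1 _]; exact: le_trans h1.
Qed.

Lemma half_le_side s t : ((`|P (s, t)|)%:E <= \int[leb1]_s (`|P0 (s, t)|)%:E)%E.
Proof.
apply: (@integral_abs_FTC _ (fun s => P (s, t)) _ (- M) M s NM (d0 ^~ t)).
- exact: continuous_fst_line.
- by move=> x /out h; have [] := @oP (x, t) (or_introl h).
- by move=> x /out h; have [] := @oP (x, t) (or_introl h).
Qed.

(** The tangential derivative integrates to 0 on horizontal lines and the normal one leaves the
    boundary value; the coefficient [c] depends on the first variable only, so it comes out of the
    inner integral. *)
Lemma half_div (c : R -> R) : continuous c ->
  (\int[leb]_(p in half) (P0 p + c p.1 * P1 p)%:E = \int[leb1]_s (- (c s * P (s, 0)))%:E)%E.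
Proof.
move=> cc.
have ccP : continuous (fun p : R * R => c p.1 * P1 p).
  move=> p; apply: cvgM; last exact: cP1.
  by apply: (@cvg_comp _ _ _ fst c _ (nbhs p.1)); [exact: cvg_fst|exact: cc].
have sP0 : csupp P0 by exists M => p /oP[].
have sP1 : csupp (fun p : R * R => c p.1 * P1 p) by exists M => p /oP[_ _ ->]; rewrite mulr0.
have i0 : leb.-integrable (half : set (plane R)) (EFin \o P0).
  by apply: integrableS (csupp_integrable cP0 sP0) => //; exact: measurable_half.
have i1 : leb.-integrable (half : set (plane R)) (EFin \o (fun p : R * R => c p.1 * P1 p)).
  by apply: integrableS (csupp_integrable ccP sP1) => //; exact: measurable_half.
rewrite integralD_EFin//; last exact: measurable_half.
rewrite half_iter_swap// (_ : (\int[leb1]_(t in _) _ = 0)%E) ?add0e; last first.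
  by apply: integral0_eq => t _; exact: half_line0.
rewrite half_iter//; apply: eq_integral => s _ /=.
have i : leb1.-integrable (`]0%R, +oo[%classic : set R) (fun t => (P1 (s, t))%:E).
  have c1 : continuous (fun t => P1 (s, t)) by exact: continuous_snd_line.
  have : leb1.-integrable (`[- M, M]%classic : set R) (EFin \o (fun t => P1 (s, t))).
    apply: continuous_compact_integrable; first exact: segment_compact.
    exact: continuous_subspaceT.
  have mI : measurable (`[- M, M]%classic : set (measurableTypeR R)) by [].
  move/(integrable_mkcond _ mI) => h.
  have : leb1.-integrable setT (EFin \o (fun t => P1 (s, t))).
    apply: eq_integrable h => // t _; rewrite patchE; case: ifPn => //.
    rewrite notin_setE/= in_itv/= => /out ht /=.
    by have [_ _ ->] := @oP (s, t) (or_intror ht).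
  by apply: integrableS.
under eq_integral do rewrite EFinM.
by rewrite integralZl// half_trace -EFinM mulrN.
Qed.

Lemma half_trace_le (c : R -> R) : continuous c -> (forall s, 0 <= c s) ->
  (\int[leb1]_s (`|P (s, 0)| * c s)%:E <= \int[leb]_(p in half) (c p.1 * `|P1 p|)%:E)%E.
Proof.
move=> cc c0.
have ccP : continuous (fun p : R * R => c p.1 * `|P1 p|).
  move=> p; apply: cvgM.
    by apply: (@cvg_comp _ _ _ fst c _ (nbhs p.1)); [exact: cvg_fst|exact: cc].
  by apply: cvg_norm; exact: cP1.
rewrite ge0_half_iter//; last by move=> p; rewrite mulr_ge0.
apply: ge0_le_integral => //.
- by move=> s _; rewrite lee_fin mulr_ge0.
- apply/measurable_EFinP; apply: continuous_measurable_fun => s; apply: cvgM; last exact: cc.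
  by apply: cvg_norm; exact: continuous_fst_line.
- have := @measurable_fun_fubini_tonelli_F _ _ _ _ R leb1 ((fun p : plane R => (c p.1 * `|P1 p|)%:E) \_ half).
  move=> h; rewrite (_ : (fun s => _) = (fubini_F leb1 ((fun p : plane R => (c p.1 * `|P1 p|)%:E) \_ half))).
    apply: h.
      apply/(measurable_restrictT _ measurable_half); apply/measurable_EFinP.
      exact: continuous_plane_measurable.
    by move=> p; rewrite patchE; case: ifP => // _; rewrite lee_fin mulr_ge0.
  rewrite funeqE => s; rewrite /fubini_F [LHS]integral_mkcond; apply: eq_integral => t _.
  by rewrite (patch_half (fun p : R * R => c p.1 * `|P1 p|)).
- move=> s _ /=; under eq_integral do rewrite EFinM.
  rewrite ge0_integralZl_EFin//; last first.
    apply/measurable_EFinP; apply: measurable_funTS; apply: measurableT_comp => //.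
    by apply: continuous_measurable_fun; exact: continuous_snd_line.
  rewrite mulrC EFinM; apply: lee_wpmul2l; first by rewrite lee_fin.
  exact: half_le_up.
Qed.

(* Gagliardo: |P(s, y)|^2 is at most a function of s times a function of y, so
   its integral is at most the product of the two integrals. *)
Lemma half_gagliardo : (\int[leb]_(p in half) (P p ^+ 2)%:E <=
  (\int[leb]_(p in half) (`|P0 p|)%:E) * (\int[leb]_(p in half) (`|P1 p|)%:E))%E.
Proof.
have cn (f : R * R -> R) : continuous f -> continuous (fun p => `|f p|).
  by move=> cf p; apply: cvg_norm; exact: cf.
have cP2 : continuous (fun p => P p ^+ 2).
  by move=> p; rewrite (_ : (fun p => P p ^+ 2) = (fun p => P p * P p)) ?expr2//; apply: cvgM; exact: cP.
pose a s : \bar R := (\int[leb1]_(t in `]0%R, +oo[) (`|P1 (s, t)|)%:E)%E.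
pose b t : \bar R := (\int[leb1]_s (`|P0 (s, t)|)%:E)%E.
have a0 s : (0 <= a s)%E by apply: integral_ge0 => t _; rewrite lee_fin.
have b0 t : (0 <= b t)%E by apply: integral_ge0 => s _; rewrite lee_fin.
have mb : measurable_fun setT b.
  have := @measurable_fun_fubini_tonelli_G _ _ _ _ R leb1 (fun p : plane R => (`|P0 p|)%:E).
  apply; last by move=> p; rewrite lee_fin.
  by apply/measurable_EFinP; apply: continuous_plane_measurable; exact: cn.
have ma : measurable_fun setT a.
  have := @measurable_fun_fubini_tonelli_F _ _ _ _ R leb1 ((fun p : plane R => (`|P1 p|)%:E) \_ half).
  move=> h; rewrite (_ : a = (fubini_F leb1 ((fun p : plane R => (`|P1 p|)%:E) \_ half))).
    apply: h; last by move=> p; rewrite patchE; case: ifP => // _; rewrite lee_fin.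
    apply/(measurable_restrictT _ measurable_half); apply/measurable_EFinP.
    by apply: continuous_plane_measurable; exact: cn.
  rewrite funeqE => s; rewrite /fubini_F /a [LHS]integral_mkcond; apply: eq_integral => t _.
  by rewrite (patch_half (fun p : R * R => `|P1 p|)).
rewrite (ge0_half_iter cP2); last by move=> p; exact: sqr_ge0.
rewrite (ge0_half_iter_swap (cn _ cP0))//.
rewrite (ge0_half_iter (cn _ cP1))//.
have b0' : (0 <= \int[leb1]_(t in `]0%R, +oo[) b t)%E by apply: integral_ge0.
have <- : (\int[leb1]_s ((\int[leb1]_(t in `]0%R, +oo[) b t) * a s) = (\int[leb1]_(t in `]0%R, +oo[) b t) * \int[leb1]_s a s)%E.
  exact: ge0_integralZl.
apply: ge0_le_integral => //.
- by move=> s _; apply: integral_ge0 => t _; rewrite lee_fin sqr_ge0.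
- have := @measurable_fun_fubini_tonelli_F _ _ _ _ R leb1 ((fun p : plane R => (P p ^+ 2)%:E) \_ half).
  move=> h; rewrite (_ : (fun s => _) = (fubini_F leb1 ((fun p : plane R => (P p ^+ 2)%:E) \_ half))).
    apply: h; last by move=> p; rewrite patchE; case: ifP => // _; rewrite lee_fin sqr_ge0.
    apply/(measurable_restrictT _ measurable_half); apply/measurable_EFinP.
    exact: continuous_plane_measurable.
  rewrite funeqE => s; rewrite /fubini_F [LHS]integral_mkcond; apply: eq_integral => t _.
  by rewrite (patch_half (fun p : R * R => P p ^+ 2)).
- by apply: measurable_funeM.
- move=> s _; rewrite muleC -ge0_integralZl//; last by apply: measurable_funTS; exact: mb.
  apply: ge0_le_integral => //.
  + by move=> t _; rewrite lee_fin sqr_ge0.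
  + apply/measurable_EFinP; apply: measurable_funTS; apply: continuous_measurable_fun.
    by apply: (@continuous_snd_line _ (fun p => P p ^+ 2)); exact: cP2.
  + by apply: measurable_funeM; apply: measurable_funTS.
  + move=> t; rewrite /= in_itv/= andbT => t0.
    rewrite -(sqr_normr (P (s, t))) expr2 EFinM; apply: lee_pmul => //.
      by apply: half_le_up; exact: ltW.
    exact: half_le_side.
Qed.

End HalfPlane.

Import HBSimple HBNNSimple.

(** * Arc length and derivatives in charts *)

Section ChartIntegral.
Context {R : realType} (Om : set (R * R)) (sigma : {measure set (plane R) -> \bar R}).
Context (U : set (R * R)) (sw b : bool) (h : R -> R).
Hypothesis hs : arclength_measure Om sigma.
Hypothesis hc : boundary_chart Om U sw b h.
Notation leb := (leb2 R).
Notation leb1 := (@lebesgue_measure R).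

Definition speed (f : R -> R) (s : R) : R := Num.sqrt (1 + derive1 f s ^+ 2).

Lemma continuous_speed f : smooth1 f -> continuous (speed f).
Proof.
move=> sf s; apply: (@cvg_comp _ _ _ (fun s => 1 + derive1 f s ^+ 2) Num.sqrt _ (nbhs (1 + derive1 f s ^+ 2))).
  apply: cvgD; first exact: cvg_cst.
  have c1 := @smooth1_continuous _ _ (smooth1_derive sf).
  by rewrite expr2 (_ : (fun s => _) = (fun s => derive1 f s * derive1 f s)) //; apply: cvgM; exact: c1.
exact: sqrt_continuous.
Qed.

Lemma measurable_graph : measurable_fun setT (fun s : measurableTypeR R => kappa sw b h (s, 0) : plane R).
Proof.
have [_ sh _] := hc.
have := measurable_kappa sw b (@smooth1_continuous _ _ sh) => mk.
apply: (measurableT_comp mk).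
by apply: measurable_fun_pair => //; exact: measurable_cst.
Qed.

(** The arc length measure is prescribed on sets; simple functions and monotone convergence carry
    the formula over to functions. *)
Lemma ge0_integral_sigma_chart (g : plane R -> R) : measurable_fun setT g ->
  (forall p, 0 <= g p) -> (forall p, ~ U p -> g p = 0) ->
  (\int[sigma]_p (g p)%:E = \int[leb1]_s (g (kappa sw b h (s, 0)) * speed h s)%:E)%E.
Proof.
move=> mg g0 gU; have [oU sh _] := hc.
have ms : measurable_fun setT (speed h : measurableTypeR R -> R).
  by apply: continuous_measurable_fun; exact: continuous_speed.
have s0 s : 0 <= speed h s by exact: sqrtr_ge0.
have mEg : measurable_fun setT (EFin \o g : plane R -> \bar R) by exact/measurable_EFinP.
pose f_ := nnsfun_approx measurableT mEg.
have le_f n x : f_ n x <= g x.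
  rewrite -lee_fin /f_ (nnsfun_approxE _ mEg n).
  by apply: (le_approx (D := setT)) => // y _; rewrite lee_fin.
have cf x : EFin \o f_ ^~ x @ \oo --> (g x)%:E.
  by apply: (cvg_nnsfun_approx measurableT mEg) => // y _; rewrite lee_fin.
have nd x : {homo (fun n => f_ n x) : n m / (n <= m)%N >-> n <= m}.
  by move=> n m nm; exact/lefP/nd_nnsfun_approx.
transitivity (limn (fun n => \int[sigma]_x (f_ n x)%:E)%E).
  rewrite -monotone_convergence//.
  - by apply: eq_integral => y _; apply/esym/cvg_lim => //; exact: cf.
  - by move=> n; exact/measurable_EFinP/measurable_funP.
  - by move=> n y _; rewrite lee_fin.
  - by move=> y _ m n mn; rewrite lee_fin; exact: nd.
transitivity (limn (fun n => \int[leb1]_s (f_ n (kappa sw b h (s, 0)) * speed h s)%:E)%E); last first.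
  rewrite -monotone_convergence//.
  - apply: eq_integral => y _; apply/cvg_lim => //.
    under eq_fun do rewrite EFinM.
    rewrite EFinM; apply: cvgeM; [by []|exact: cf|exact: cvg_cst].
  - move=> n; apply/measurable_EFinP; apply: measurable_funM => //.
    have mfn : measurable_fun setT (f_ n : plane R -> R) by exact: measurable_funP.
    by apply: (measurableT_comp mfn); exact: measurable_graph.
  - by move=> n y _; rewrite lee_fin mulr_ge0.
  - by move=> y _ m n mn; rewrite lee_fin ler_wpM2r//; exact: nd.
congr (limn _); apply/funext => n.
have mA r : measurable (f_ n @^-1` [set r] : set (plane R)).
  exact: measurable_sfunP.
have mgA r : measurable ([set s | (f_ n @^-1` [set r]) (kappa sw b h (s, 0))] : set (measurableTypeR R)).
  by have := measurable_graph measurableT (mA r); rewrite setTI.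
have E r s : (\1_(f_ n @^-1` [set r]) (kappa sw b h (s, 0)) * speed h s)%:E =
   ((fun s => (speed h s)%:E) \_ [set s | (f_ n @^-1` [set r]) (kappa sw b h (s, 0))]) s :> \bar R.
  rewrite /patch indicE.
  have -> : (s \in [set s | (f_ n @^-1` [set r]) (kappa sw b h (s, 0))]) = (kappa sw b h (s, 0) \in f_ n @^-1` [set r]).
    by apply/idP/idP; rewrite !inE.
  by case: ifP; rewrite ?mul1r ?mul0r.
have mE r : measurable_fun setT (fun s : measurableTypeR R => (\1_(f_ n @^-1` [set r]) (kappa sw b h (s, 0)) * speed h s)%:E : \bar R).
  apply/measurable_EFinP; apply: measurable_funM => //.
  have mi : measurable_fun setT (\1_(f_ n @^-1` [set r]) : plane R -> R) by exact: measurable_indic.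
  by apply: (measurableT_comp mi); exact: measurable_graph.
have E0 r s : (0 <= (\1_(f_ n @^-1` [set r]) (kappa sw b h (s, 0)) * speed h s)%:E :> \bar R)%E.
  by rewrite lee_fin mulr_ge0// indicE.
rewrite integralT_nnsfun sintegralE.
transitivity (\sum_(r \in range (f_ n)) \int[leb1]_s (r%:E * (\1_(f_ n @^-1` [set r]) (kappa sw b h (s, 0)) * speed h s)%:E))%E.
  apply: eq_fsbigr => r /[!inE] -[x _ fx].
  have r0 : 0 <= r by rewrite -fx.
  rewrite ge0_integralZl_EFin//.
  (* The level 0 contributes nothing, and the other level sets lie in [U], where the chart formula
     for [sigma] applies. *)
  have [->|rn] := eqVneq r 0; first by rewrite !mul0e.
  congr (_ * _)%E.
  under eq_integral do rewrite E.
  rewrite -integral_mkcond (hs.2 U sw b h hc)//.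
    rewrite (_ : [set s : R | (f_ n @^-1` [set r]) (relabel sw (s, h s))] =
      [set s : R | (f_ n @^-1` [set r]) (kappa sw b h (s, 0))])//.
    by apply/seteqP; split => s /=; rewrite /kappa /= mulr0 addr0.
  move=> y /= fy; apply: contrapT => /gU gy; have := le_f n y; rewrite gy fy => rle.
  by move: rn; rewrite eq_le r0 rle.
rewrite -ge0_integral_fsum//.
- apply: eq_integral => s _.
  rewrite fimfunE EFinM -fsumEFin// ge0_mule_fsuml; last first.
    by move=> r; rewrite nnfun_muleindic_ge0.
  by apply: eq_fsbigr => r _; rewrite -!EFinM mulrA.
- by move=> r; apply: measurable_funeM; exact: mE.
- move=> r s _; have [r0|r0] := leP 0 r; first by apply: mule_ge0; [rewrite lee_fin|exact: E0].
  rewrite indicE memNset ?mul0r ?mule0//= => fr.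
  by move: r0; rewrite -fr ltNge => /negP; apply.
Qed.

Lemma measurable_bd : measurable (bd Om : set (plane R)).
Proof.
apply: measurableD; first by apply: closed_plane_measurable; exact: closed_closure.
by apply: open_plane_measurable; exact: open_interior.
Qed.

Lemma ge0_integral_bd (g : plane R -> \bar R) : measurable_fun setT g -> (forall p, 0 <= g p)%E ->
  (\int[sigma]_(p in bd Om) g p = \int[sigma]_p g p)%E.
Proof.
move=> mg g0.
have mC : measurable (~` bd Om : set (plane R)) by apply: measurableC; exact: measurable_bd.
have := @ge0_negligible_integral _ _ _ sigma setT (~` bd Om) g mC measurableT mg (fun p _ => g0 p) hs.1.
by rewrite setTD setCK => ->.
Qed.

Lemma chart_bounded K : compact K -> K `<=` U -> exists2 M : R, 0 < M &
  forall p, M < `|p.1| \/ M < `|p.2| -> ~ K (kappa sw b h p).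
Proof.
move=> cK KU; have [_ sh _] := hc.
have [N N0 hN] := bounded_set_box (compact_bounded cK).
have [B B0 hB] : exists2 B, 0 <= B & forall s, `|s| <= `|N| -> `|h s| <= B.
  have ch : continuous (fun p : R * R => h p.1).
    move=> p; apply: (@cvg_comp _ _ _ fst h _ (nbhs p.1)); [exact: cvg_fst|exact: smooth1_continuous].
  have [B B0 hB] := continuous_box_bounded `|N| ch; exists B => // s hs'.
  by apply: (hB (s, 0)); rewrite //= normr0.
exists (`|N| + B + 1); first by have := normr_ge0 N; lra.
move=> p hp Kp; have := hN _ Kp.
have n1 := ler_norm N.
have key (x y : R) : `|x| <= N -> `|h x + sg b * y| <= N -> ~ (`|N| + B + 1 < `|x| \/ `|N| + B + 1 < `|y|).
  move=> hx hy; have hhx := hB x (le_trans hx n1).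
  have : `|y| <= N + B.
    rewrite -[y]mul1r -(sg_sqr b) -mulrA normrM norm_sg mul1r.
    rewrite -(addKr (h x) (sg b * y)); apply: le_trans (ler_normD _ _) _.
    by rewrite normrN addrC lerD.
  by move=> hyN [|]; lra.
case: sw => /= -[h1 h2]; apply: key hp => //.
Qed.

End ChartIntegral.

Section ChartPull.
Context {R : realType} (sw b : bool) (h : R -> R).
Hypothesis sh : smooth1 h.
Notation kap := (kappa sw b h).

Definition ix0 : 'I_2 := if sw then 1 else 0.
Definition ix1 : 'I_2 := if sw then 0 else 1.

(** [pull0] and [pull1] are the derivatives of [G] composed with [kappa] along the boundary and
    across it. *)
Definition pull0 (G : R * R -> R) p :=
  partial ix0 G (kap p) + partial ix1 G (kap p) * derive1 h p.1.

Definition pull1 (G : R * R -> R) p := sg b * partial ix1 G (kap p).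

Let ch : continuous h. Proof. exact: smooth1_continuous. Qed.

Lemma continuous_pull (f : R * R -> R) : continuous f -> continuous (fun p => f (kap p)).
Proof.
move=> cf p; apply: (@cvg_comp _ _ _ kap f _ (nbhs (kap p))); last exact: cf.
exact: continuous_kappa.
Qed.

Lemma continuous_comp_fst (f : R -> R) : continuous f -> continuous (fun p : R * R => f p.1).
Proof.
by move=> cf p; apply: (@cvg_comp _ _ _ fst f _ (nbhs p.1)); [exact: cvg_fst|exact: cf].
Qed.

Lemma continuous_pull0 G : smooth2 G -> continuous (pull0 G).
Proof.
move=> sG; have c i : continuous (fun p => partial i G (kap p)).
  by apply: continuous_pull; apply: smooth2_continuous; exact: smooth2_partial.
move=> p; apply: cvgD; first exact: c.
apply: cvgM; first exact: c.
by apply: continuous_comp_fst; apply: smooth1_continuous; exact: smooth1_derive.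
Qed.

Lemma continuous_pull1 G : smooth2 G -> continuous (pull1 G).
Proof.
move=> sG p; apply: cvgM; first exact: cvg_cst.
by apply: continuous_pull; apply: smooth2_continuous; exact: smooth2_partial.
Qed.

Lemma sum_ix (V : nmodType) (f : 'I_2 -> V) : f ix0 + f ix1 = f 0 + f 1.
Proof. by rewrite /ix0 /ix1; case: sw => //; rewrite addrC. Qed.

Let d0 G (s t : R) : smooth2 G ->
  is_derive s 1 (fun s => G (relabel sw (s, t))) (partial ix0 G (relabel sw (s, t))).
Proof.
by move=> sG; rewrite /ix0; case: sw; [exact: smooth2_is_derive_snd|exact: smooth2_is_derive_fst].
Qed.

Let d1 G (s t : R) : smooth2 G ->
  is_derive t 1 (fun t => G (relabel sw (s, t))) (partial ix1 G (relabel sw (s, t))).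
Proof.
by move=> sG; rewrite /ix1; case: sw; [exact: smooth2_is_derive_fst|exact: smooth2_is_derive_snd].
Qed.

Lemma is_derive_pull0 G (s t : R) : smooth2 G ->
  is_derive s 1 (fun s => G (kap (s, t))) (pull0 G (s, t)).
Proof.
move=> sG; apply: (@is_derive_graph _ (fun p => G (relabel sw p)) (fun p => partial ix0 G (relabel sw p))
  (fun p => partial ix1 G (relabel sw p)) (fun s => h s + sg b * t)).
- by move=> s' t'; exact: d0.
- by move=> s' t'; exact: d1.
- have cc := @smooth2_continuous _ _ (smooth2_partial ix0 sG).
  move=> p; apply: (@cvg_comp _ _ _ (relabel sw) _ _ (nbhs (relabel sw p))); last exact: cc.
  have E : relabel sw = @kappa R sw false (fun=> 0).
    by rewrite funeqE => q; rewrite /kappa /sg expr0 add0r mul1r -surjective_pairing.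
  by rewrite E; apply: continuous_kappa => x; exact: cvg_cst.
- have := smooth1_is_derive s sh => dh.
  by apply: is_derive_eq; rewrite addr0.
Qed.

Lemma is_derive_pull1 G (s t : R) : smooth2 G ->
  is_derive t 1 (fun t => G (kap (s, t))) (pull1 G (s, t)).
Proof.
move=> sG; rewrite /pull1 mulrC.
have := @is_derive1_comp _ (fun t => G (relabel sw (s, t))) (fun t : R => h s + sg b * t) t _ (sg b) (d1 s (h s + sg b * t) sG).
apply; apply: is_derive_eq.
by rewrite /GRing.scale/= add0r mul1r mulr1.
Qed.

(** The coefficient of [pull1] is, up to sign, 1 - h'. Divided by the speed sqrt(1 + h'^2) it is the
    scalar product of (1, 1) with a unit normal, which is where sqrt 2 will come from. *)
Lemma pull_div G p : partial 0 G (kap p) + partial 1 G (kap p) =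
  pull0 G p + sg b * (1 - derive1 h p.1) * pull1 G p.
Proof.
rewrite -(sum_ix (fun i => partial i G (kap p))) /pull0 /pull1 [sg b * _ * _]mulrACA sg_sqr.
move: (partial ix0 G (kap p)) (partial ix1 G (kap p)) (derive1 h p.1) => x y z; ring.
Qed.

Lemma pull_norm G p : `|pull0 G p| + `|pull1 G p| <=
  (1 + `|derive1 h p.1|) * (`|partial 0 G (kap p)| + `|partial 1 G (kap p)|).
Proof.
rewrite -(sum_ix (fun i => `|partial i G (kap p)|)) /pull0 /pull1 normrM norm_sg mul1r.
move: (partial ix0 G (kap p)) (partial ix1 G (kap p)) (derive1 h p.1) => x y z.
have := ler_normD x (y * z); rewrite normrM.
have : 0 <= `|x| * `|z| by rewrite mulr_ge0.
have := normr_ge0 x.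
lra.
Qed.

End ChartPull.

Section ChartEstimates.
Context {R : realType} (Om : set (R * R)) (sigma : {measure set (plane R) -> \bar R}).
Context (U : set (R * R)) (sw b : bool) (h : R -> R) (K : set (R * R)).
Hypothesis oOm : open Om.
Hypothesis bOm : bounded_set Om.
Hypothesis hs : arclength_measure Om sigma.
Hypothesis hc : boundary_chart Om U sw b h.
Hypothesis cK : compact K.
Hypothesis KU : K `<=` U.
Notation leb := (leb2 R).
Notation leb1 := (@lebesgue_measure R).
Notation kap := (kappa sw b h).

Let sh : smooth1 h. Proof. by case: hc. Qed.
Let ch : continuous h. Proof. exact: smooth1_continuous. Qed.
Let mOm : measurable (Om : set (plane R)). Proof. exact: measurable_dom. Qed.

Definition vanish (f : R * R -> R) := forall p, ~ K p -> f p = 0.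

Lemma vanish_partial i f : vanish f -> vanish (partial i f).
Proof.
move=> vf p Kp; apply: (@smooth2_partial_eq0 _ f i (~` K)) => //.
by apply: closed_openC; apply: compact_closed => //; exact: norm_hausdorff.
Qed.

Let patch_chart f : vanish f ->
  (fun p => (f (kap p))%:E) \_ (kap @^-1` Om) = (fun p => (f (kap p))%:E) \_ half :> (plane R -> \bar R).
Proof.
move=> vf; rewrite funeqE => p; rewrite /patch.
have [Kp|Kp] := pselect (K (kap p)); last by rewrite vf//; case: ifP; case: ifP.
have -> // : (p \in kap @^-1` Om) = (p \in half).
by apply/idP/idP; rewrite !inE /=; apply kappa_chart with (1 := hc); exact: KU.
Qed.

Lemma chart_ge0_integral (f : R * R -> R) : continuous f -> (forall p, 0 <= f p) -> vanish f ->
  (\int[leb]_(p in Om) (f p)%:E = \int[leb]_(p in half) (f (kap p))%:E)%E.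
Proof.
move=> cf f0 vf; rewrite (@ge0_integral_kappa _ sw b h _ (EFin \o f) ch mOm).
- by rewrite integral_mkcond [RHS]integral_mkcond -(patch_chart vf).
- by apply/measurable_EFinP; exact: continuous_plane_measurable.
- by move=> p; rewrite lee_fin.
Qed.

Lemma chart_integral (f : R * R -> R) : continuous f -> vanish f ->
  (\int[leb]_(p in Om) (f p)%:E = \int[leb]_(p in half) (f (kap p))%:E)%E.
Proof.
move=> cf vf.
have i : leb.-integrable (Om : set (plane R)) (EFin \o f).
  by apply: integrableS (csupp_integrable cf (compact_csupp cK vf)).
have [-> _] := @integral_kappa _ sw b h _ f ch mOm (continuous_plane_measurable cf) i.
by rewrite integral_mkcond [RHS]integral_mkcond -(patch_chart vf).
Qed.

Let pull_out G M : vanish G -> (forall p : R * R, M < `|p.1| \/ M < `|p.2| -> ~ K (kap p)) ->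
  forall p : R * R, M < `|p.1| \/ M < `|p.2| -> [/\ G (kap p) = 0, pull0 sw b h G p = 0 & pull1 sw b h G p = 0].
Proof.
move=> vG hM p /hM Kp; split; first exact: vG.
  by rewrite /pull0 !vanish_partial// mul0r addr0.
by rewrite /pull1 vanish_partial// mulr0.
Qed.

Definition dnorm (G : R * R -> R) p := `|partial 0 G p| + `|partial 1 G p|.

Lemma continuous_dnorm G : smooth2 G -> continuous (dnorm G).
Proof.
move=> sG; have c i : continuous (fun p => `|partial i G p|).
  have cp := @smooth2_continuous _ _ (smooth2_partial i sG).
  by move=> p; apply: cvg_norm; exact: cp.
by move=> p; apply: cvgD; exact: c.
Qed.

Lemma dnorm_ge0 G p : 0 <= dnorm G p. Proof. exact: addr_ge0. Qed.

Let cn (f : R * R -> R) : continuous f -> continuous (fun p => `|f p|).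
Proof. by move=> cf p; apply: cvg_norm; exact: cf. Qed.

(** Trace, Gagliardo, sup and divergence bounds for functions supported in one chart. The sup bound
    integrates twice: the derivative across the boundary is integrated along a vertical line, and
    each of its values is bounded by an integral along a horizontal line, which gives second
    derivatives over the domain. *)
Lemma chart_estimates : exists2 L : R, 0 <= L & forall G, smooth2 G -> vanish G ->
  [/\ (\int[sigma]_(p in bd Om) (`|G p|)%:E <= L%:E * \int[leb]_(p in Om) (dnorm G p)%:E)%E,
      (\int[leb]_(p in Om) (G p ^+ 2)%:E <=
         (L%:E * \int[leb]_(p in Om) (dnorm G p)%:E) * (L%:E * \int[leb]_(p in Om) (dnorm G p)%:E))%E,
      forall x, Om x -> ((`|G x|)%:E <= L%:E * \int[leb]_(p in Om) (dnorm (partial 0 G) p)%:E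
                             + L%:E * \int[leb]_(p in Om) (dnorm (partial 1 G) p)%:E)%E &
      (`|\int[leb]_(p in Om) (partial 0 G p + partial 1 G p)%:E| <=
         (Num.sqrt 2)%:E * \int[sigma]_(p in bd Om) (`|G p|)%:E)%E].
Proof.
have [M M0 hM] := chart_bounded hc cK KU.
have sh' : smooth1 (derive1 h) by exact: smooth1_derive.
have ch' : continuous (fun p : R * R => derive1 h p.1).
  by apply: continuous_comp_fst; exact: smooth1_continuous.
have [B B0 hB] := continuous_box_bounded M ch'.
(* One factor bounds the speed, the other the change of coordinates of the gradient. *)
pose L := (1 + B) * (1 + B).
have LL : 1 + B <= L by rewrite /L ler_peMl// ?lerDl//; lra.
have L0 : 0 <= L by apply: le_trans LL; lra.
have sp s : speed h s <= 1 + `|derive1 h s|.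
  rewrite -[leRHS]ger0_norm ?addr_ge0// -sqrtr_sqr ler_wsqrtr//.
  by rewrite sqrrD sqr_normr expr1n; have := normr_ge0 (derive1 h s); lra.
have sp0 s : 0 <= speed h s by exact: sqrtr_ge0.
have hB' p : `|p.1| <= M -> `|derive1 h p.1| <= B.
  by move=> p1; apply: (hB (p.1, 0)) => //=; rewrite normr0; exact: ltW.
have cpu G : smooth2 G -> continuous (fun p => dnorm G (kap p)).
  by move=> sG; apply: continuous_pull => //; exact: continuous_dnorm.
have pt G p : vanish G -> speed h p.1 * (`|pull0 sw b h G p| + `|pull1 sw b h G p|) <= L * dnorm G (kap p).
  move=> vG; have [far|] := pselect (M < `|p.1| \/ M < `|p.2|).
    have [_ -> ->] := pull_out vG hM far.
    by rewrite normr0 addr0 mulr0 mulr_ge0// dnorm_ge0.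
  move=> /not_orP[/negP + _]; rewrite -leNgt => /hB' hp.
  apply: (@le_trans _ _ ((1 + B) * ((1 + B) * dnorm G (kap p)))); last by rewrite mulrA.
  apply: ler_pM => //.
    by apply: le_trans (sp _) _; rewrite lerD2l.
  apply: le_trans (pull_norm sw b h G p) _.
  by apply: ler_wpM2r; [exact: dnorm_ge0|lra].
have sp1 s : 1 <= speed h s.
  by rewrite -[leLHS]sqrtr1 ler_wsqrtr// lerDl sqr_ge0.
have pt' G p : vanish G -> `|pull0 sw b h G p| + `|pull1 sw b h G p| <= L * dnorm G (kap p).
  by move=> vG; apply: le_trans (pt G p vG); rewrite ler_peMl// addr_ge0.
have mh (f : R * R -> R) : continuous f -> measurable_fun (half : set (plane R)) (fun p : plane R => (f p)%:E : \bar R).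
  by move=> cf; apply/measurable_EFinP; exact: continuous_plane_measurable.
have intL G (f : R * R -> R) : smooth2 G -> vanish G -> continuous f -> (forall p, 0 <= f p) ->
    (forall p, f p <= L * dnorm G (kap p)) ->
    (\int[leb]_(p in half) (f p)%:E <= L%:E * \int[leb]_(p in Om) (dnorm G p)%:E)%E.
  move=> sG vG cf f0 fL.
  rewrite chart_ge0_integral; first last.
  - by move=> p Kp; rewrite /dnorm !vanish_partial// normr0 addr0.
  - exact: dnorm_ge0.
  - exact: continuous_dnorm.
  rewrite -ge0_integralZl_EFin//; first last.
  - by apply: mh; exact: cpu.
  - by move=> p _; rewrite lee_fin dnorm_ge0.
  - exact: measurable_half.
  apply: ge0_le_integral.
  - exact: measurable_half.
  - by move=> p _; rewrite lee_fin.
  - exact: mh.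
  - by apply: measurable_funeM; apply: mh; exact: cpu.
  - by move=> p _; rewrite -EFinM lee_fin.
exists L => // G sG vG.
have c0 := @continuous_pull0 _ sw b h sh G sG.
have c1 := @continuous_pull1 _ sw b h sh G sG.
have cG : continuous (fun p => G (kap p)) by apply: continuous_pull => //; exact: smooth2_continuous.
have cs : continuous (speed h) by exact: continuous_speed.
have cfst (f : R -> R) : continuous f -> continuous (fun p : R * R => f p.1) := @continuous_comp_fst _ f.
have bdG : (\int[sigma]_(p in bd Om) (`|G p|)%:E = \int[leb1]_s (`|G (kap (s, 0))| * speed h s)%:E)%E.
  have mG : measurable_fun setT (fun p : plane R => `|G p|).
    by apply: continuous_plane_measurable; apply: cn; exact: smooth2_continuous.
  rewrite (ge0_integral_bd hs); last 2 first.
  - exact/measurable_EFinP.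
  - by move=> p; rewrite lee_fin.
  rewrite (ge0_integral_sigma_chart hs hc mG)// => p Up.
  by rewrite vG ?normr0// => /KU.
have i0 := fun s t : R => is_derive_pull0 sw b sh s t sG.
have i1 := fun s t : R => @is_derive_pull1 _ sw b h G s t sG.
have out := pull_out vG hM.
split.
- rewrite bdG; apply: le_trans (half_trace_le cG c1 i1 out cs sp0) _.
  apply: (intL G) => //.
  + by move=> p; apply: cvgM; [exact: (cfst _ cs)|exact: (cn c1)].
  + by move=> p; rewrite mulr_ge0.
  + by move=> p; apply: le_trans (pt G p vG); rewrite ler_wpM2l// lerDr.
- rewrite chart_ge0_integral; first last.
  + by move=> p Kp; rewrite vG// expr0n.
  + by move=> p; exact: sqr_ge0.
  + have cG' := @smooth2_continuous _ _ sG.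
    by move=> p; rewrite (_ : (fun p => G p ^+ 2) = (fun p => G p * G p)) ?expr2//; apply: cvgM; exact: cG'.
  apply: le_trans (half_gagliardo cG c0 c1 i0 i1 M0 out) _.
  apply: lee_pmul; [by apply: integral_ge0 => p _; rewrite lee_fin..| |]; apply: (intL G) => //.
  + exact: (cn c0).
  + by move=> p; apply: le_trans (pt' G p vG); rewrite lerDl.
  + exact: (cn c1).
  + by move=> p; apply: le_trans (pt' G p vG); rewrite lerDr.
- move=> x Ox; set rhs := (X in (_ <= X)%E).
  have rhs0 : (0 <= rhs)%E.
    by apply: adde_ge0; apply: mule_ge0; rewrite ?lee_fin//; apply: integral_ge0 => p _; rewrite lee_fin dnorm_ge0.
  have [Kx|Kx] := pselect (K x); last by rewrite vG// normr0.
  pose p : R * R := ((relabel sw x).1, sg b * ((relabel sw x).2 - h (relabel sw x).1)).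
  have xp : x = kap p.
    rewrite /kappa /p /= mulrA sg_sqr mul1r addrCA subrr addr0 -surjective_pairing.
    by rewrite relabelK.
  have p2 : 0 < p.2 by apply/(kappa_chart hc); rewrite -xp//; exact: KU.
  pose G1 := partial (ix1 sw) G.
  have sG1 : smooth2 G1 by exact: smooth2_partial.
  have vG1 : vanish G1 by exact: vanish_partial.
  have c01 := @continuous_pull0 _ sw b h sh G1 sG1.
  apply: (@le_trans _ _ (\int[leb]_(p in half) (`|pull0 sw b h G1 p|)%:E)%E); last first.
    apply: (@le_trans _ _ (L%:E * \int[leb]_(p in Om) (dnorm G1 p)%:E)%E).
      apply: (intL G1) => //; first exact: (cn c01).
      by move=> q; apply: le_trans (pt' G1 q vG1); rewrite lerDl.
    have J0 i : (0 <= L%:E * \int[leb]_(p in Om) (dnorm (partial i G) p)%:E)%E.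
      by apply: mule_ge0; rewrite ?lee_fin//; apply: integral_ge0 => q _; rewrite lee_fin dnorm_ge0.
    rewrite /G1 /rhs /ix1; case: (sw); [exact: leeDl|exact: leeDr].
  rewrite xp (surjective_pairing p).
  apply: le_trans (half_le_up c1 i1 out _ (ltW p2)) _.
  rewrite (ge0_half_iter_swap (cn c01))//.
  have mb : measurable_fun setT (fun t : measurableTypeR R => \int[leb1]_s (`|pull0 sw b h G1 (s, t)|)%:E)%E.
    have := @measurable_fun_fubini_tonelli_G _ _ _ _ R leb1 (fun p : plane R => (`|pull0 sw b h G1 p|)%:E).
    apply; last by move=> q; rewrite lee_fin.
    by apply/measurable_EFinP; apply: continuous_plane_measurable; exact: (cn c01).
  apply: ge0_le_integral => //.
  + apply/measurable_EFinP; apply: measurable_funTS; apply: continuous_measurable_fun.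
    by apply: (@continuous_snd_line _ (fun q => `|pull1 sw b h G q|)); exact: (cn c1).
  + by apply: measurable_funTS; exact: mb.
  + move=> t _.
    have -> : `|pull1 sw b h G (p.1, t)| = `|G1 (kap (p.1, t))| by rewrite /pull1 normrM norm_sg mul1r.
    exact: (half_le_side c01 (fun s t : R => is_derive_pull0 sw b sh s t sG1) M0 (pull_out vG1 hM)).
- have cd : continuous (fun s => sg b * (1 - derive1 h s)).
    have c' := @smooth1_continuous _ _ sh'.
    by move=> s; apply: cvgM; [exact: cvg_cst|apply: cvgB; [exact: cvg_cst|exact: c']].
  rewrite chart_integral; first last.
  + by move=> p Kp; rewrite !vanish_partial// addr0.
  + move=> p; apply: cvgD; apply: smooth2_continuous; exact: smooth2_partial.
  under eq_integral do rewrite (pull_div sw b h).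
  rewrite (half_div c0 c1 i0 i1 M0 out cd) bdG.
  have mc : continuous (fun s => - (sg b * (1 - derive1 h s) * G (kap (s, 0)))).
    have c' := @continuous_fst_line _ (fun q => G (kap q)) 0 cG.
    by move=> s; apply: cvgN; apply: cvgM; [exact: cd|exact: c'].
  have mE : measurable_fun setT (fun s : measurableTypeR R => (- (sg b * (1 - derive1 h s) * G (kap (s, 0))))%:E : \bar R).
    by apply/measurable_EFinP; exact: continuous_measurable_fun.
  have mS : measurable_fun setT (fun s : measurableTypeR R => (`|G (kap (s, 0))| * speed h s)%:E : \bar R).
    apply/measurable_EFinP; apply: continuous_measurable_fun => s; apply: cvgM; last exact: cs.
    by have c' := @continuous_fst_line _ (fun q => `|G (kap q)|) 0 (cn cG); exact: c'.
  apply: le_trans (le_abse_integral leb1 measurableT mE) _.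
  rewrite -ge0_integralZl_EFin//; last by move=> s _; rewrite lee_fin mulr_ge0.
  apply: ge0_le_integral => //.
  + exact: measurableT_comp.
  + exact: measurable_funeM.
  + move=> s _; rewrite -EFinM lee_fin normrN normrM mulrCA mulrC.
    (* (1 - h')^2 <= 2 (1 + h'^2), the difference being (1 + h')^2. *)
    rewrite normrM norm_sg mul1r ler_wpM2l// /speed -sqrtrM// -sqrtr_sqr ler_wsqrtr//.
    by have := sqr_ge0 (1 + derive1 h s); lra.
Qed.

End ChartEstimates.

Lemma compact_cover_plane (R : realType) (A : set (R * R)) : compact A -> cover_compact A.
Proof.
pose T : ptopologicalType := HB.pack_for ptopologicalType (R * R)%type (isPointed.Build (R * R)%type (0, 0)).
by have := @compact_cover T; move=> /(f_equal (fun f => f A)) /= <-.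
Qed.

(** * Partition of unity *)

Section PartitionOfUnity.
Context {R : realType} (Om : set (R * R)).
Hypothesis hOm : smooth_bounded_domain Om.

Let oOm : open Om. Proof. by case: hOm. Qed.
Let bOm : bounded_set Om. Proof. by case: hOm. Qed.

(** Equal to 1 at distance at most [d] from [c], and to 0 beyond the distance 2d. *)
Definition plateau (c d : R) (t : R) : R :=
  smoothstep (d^-1 * t + (2 - c / d)) * smoothstep (- d^-1 * t + (2 + c / d)).

Lemma smooth1_plateau c d : smooth1 (plateau c d).
Proof. by apply: smooth1M; apply: smooth1_affine; exact: smooth1_step. Qed.

Lemma plateau_itv c d t : 0 <= plateau c d t <= 1.
Proof. by rewrite mulr_ge0 ?step_ge0//= mulr_ile1 ?step_ge0 ?step_le1. Qed.

Lemma plateau_1 c d t : 0 < d -> `|t - c| <= d -> plateau c d t = 1.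
Proof.
move=> d0; rewrite ler_distl => /andP[h1 h2]; rewrite /plateau !step_ge1 ?mulr1//.
  have -> : - d^-1 * t + (2 + c / d) = (c + d - t) / d + 1 by field; exact: lt0r_neq0.
  by rewrite lerDr divr_ge0 ?subr_ge0// ltW.
have -> : d^-1 * t + (2 - c / d) = (t - (c - d)) / d + 1 by field; exact: lt0r_neq0.
by rewrite lerDr divr_ge0 ?subr_ge0// ltW.
Qed.

Lemma plateau_0 c d t : 0 < d -> ~~ (c - 2 * d <= t <= c + 2 * d) -> plateau c d t = 0.
Proof.
move=> d0; rewrite negb_and -!ltNge /plateau => /orP[h|h].
  rewrite step_le0 ?mul0r//.
  have -> : d^-1 * t + (2 - c / d) = (t - (c - 2 * d)) / d by field; exact: lt0r_neq0.
  by rewrite pmulr_lle0 ?invr_gt0// subr_le0 ltW.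
rewrite [X in _ * X]step_le0 ?mulr0//.
have -> : - d^-1 * t + (2 + c / d) = (c + 2 * d - t) / d by field; exact: lt0r_neq0.
by rewrite pmulr_lle0 ?invr_gt0// subr_le0 ltW.
Qed.

Definition localized (zeta : R * R -> R) : Prop := exists U sw b h K,
  [/\ boundary_chart Om U sw b h, compact K, K `<=` U & forall p, ~ K p -> zeta p = 0].

(** A ball of the plane is a square, and the graph is placed along its lower side, where it imposes
    no condition. Interior pieces of the partition are thus handled like boundary pieces. *)
Lemma interior_chart p r : 0 < r -> ball p r `<=` Om ->
  boundary_chart Om (ball p r) false false (fun=> p.2 - r).
Proof.
move=> r0 pO; split; first exact: ball_open.
  exact: smooth1_cst.
move=> q qb; split => [_|_]; last exact: pO.
have [_ /=] := qb; rewrite /ball/= ltr_distl expr0 mul1r => /andP[_ h]; lra.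
Qed.

Lemma closure_chart p : closure Om p -> exists U sw b h, U p /\ boundary_chart Om U sw b h.
Proof.
move=> cp; have [Op|nOp] := pselect (Om p).
  have /nbhs_ballP[r /= r0 hr] : nbhs p Om by exact: open_nbhs_nbhs.
  exists (ball p r), false, false, (fun=> p.2 - r); split; first exact: ballxx.
  exact: interior_chart.
have [_ _ _ hb] := hOm; apply: hb; split => //.
by move=> /interior_subset.
Qed.

Lemma local_bump p : closure Om p -> exists beta W, [/\ smooth2 beta,
  forall x, 0 <= beta x <= 1, localized beta, open W /\ W p & forall x, W x -> beta x = 1].
Proof.
move=> /closure_chart[U [sw [b [h [Up hc]]]]].
have [oU _ _] := hc.
have /nbhs_ballP[r /= r0 hr] : nbhs p U by exact: open_nbhs_nbhs.
pose d := r / 3; have d0 : 0 < d by rewrite divr_gt0.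
exists (tensor (plateau p.1 d) (plateau p.2 d)), (ball p d); split.
- by apply: smooth2_tensor; exact: smooth1_plateau.
- move=> x; have /andP[a0 a1] := plateau_itv p.1 d x.1; have /andP[b0 b1] := plateau_itv p.2 d x.2.
  by rewrite /tensor mulr_ge0//= mulr_ile1.
- exists U, sw, b, h, (`[p.1 - 2 * d, p.1 + 2 * d] `*` `[p.2 - 2 * d, p.2 + 2 * d])%classic; split => //.
  + exact: compact_box.
  + move=> q [/= q1 q2]; apply: hr; move: q1 q2; rewrite !in_itv/= => /andP[h1 h2] /andP[h3 h4].
    have e : d * 3 = r by rewrite /d divfK.
    by split; rewrite /ball/= ltr_distl; apply/andP; split; lra.
  + move=> q; rewrite /tensor => nq; apply/eqP; rewrite mulf_eq0; apply/orP.
    apply: contrapT => /not_orP[n1 n2]; apply: nq; split; rewrite /= in_itv/=.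
      by apply: contrapT => /negP h1; apply: n1; rewrite plateau_0.
    by apply: contrapT => /negP h1; apply: n2; rewrite plateau_0.
- by split; [exact: ball_open|exact: ballxx].
- move=> x [x1 x2]; rewrite /tensor !plateau_1 ?mulr1//.
    by move: x2; rewrite /ball/= distrC => /ltW.
  by move: x1; rewrite /ball/= distrC => /ltW.
Qed.

Lemma localizedM f g : localized f -> localized (fun x => f x * g x).
Proof.
move=> [U [sw [b [h [K [h1 h2 h3 h4]]]]]]; exists U, sw, b, h, K; split => // p Kp.
by rewrite h4// mul0r.
Qed.

Lemma compact_closure_dom : compact (closure Om).
Proof.
have [N N0 hN] := bounded_set_box bOm.
have cb := @compact_box R (- N) N (- N) N.
apply: (subclosed_compact _ cb); first exact: closed_closure.
have clb : closed (`[- N, N] `*` `[- N, N] : set (R * R)).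
  by apply: compact_closed cb; exact: norm_hausdorff.
rewrite [X in _ `<=` X](closure_id _).1//; apply: closure_subset => p /hN[h1 h2].
by split; rewrite /= in_itv/= -ler_norml.
Qed.

Lemma partition_of_unity : exists n (zeta : 'I_n -> R * R -> R),
  (forall k, [/\ smooth2 (zeta k), forall p, 0 <= zeta k p & localized (zeta k)]) /\
  forall p, closure Om p -> \sum_(k < n) zeta k p = 1.
Proof.
have /choice[BW hBW] : forall p : R * R, exists BW : (R * R -> R) * set (R * R), closure Om p ->
    [/\ smooth2 BW.1, forall x, 0 <= BW.1 x <= 1, localized BW.1, open BW.2 /\ BW.2 p &
        forall x, BW.2 x -> BW.1 x = 1].
  move=> p; have [cp|ncp] := pselect (closure Om p); last by exists (fun=> 0, set0).
  by have [B [W h]] := local_bump cp; exists (B, W).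
have := compact_cover_plane compact_closure_dom => /(_ _ (closure Om) (fun p => (BW p).2)).
case=> [p /hBW[_ _ _ []]//|p cp|D hD cov].
  by exists p => //; have [_ _ _ [_ Wp] _] := hBW _ cp.
pose s := finmap.enum_fset D.
pose be (k : nat) := (BW (nth 0 s k)).1.
have inD k : (k < size s)%N -> closure Om (nth 0 s k).
  by move=> ks; have /hD := mem_nth 0 ks; rewrite inE.
(* Telescoping: the sum is 1 minus the product of the factors 1 - be j, and at each point of the
   closure one of these factors vanishes. *)
pose ze (k : nat) x := be k x * \prod_(j < k) (1 - be j x).
have sumz m x : \sum_(k < m) ze k x = 1 - \prod_(j < m) (1 - be j x).
  elim: m => [|m IH]; first by rewrite !big_ord0 subrr.
  rewrite !big_ord_recr /= IH /ze; ring.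
have sprod m : (m <= size s)%N -> smooth2 (fun x => \prod_(j < m) (1 - be j x)).
  elim: m => [_|m IH ms].
    by rewrite (_ : (fun x => _) = fun=> 1) ?funeqE => [|x]; [exact: smooth2_cst|rewrite big_ord0].
  rewrite (_ : (fun x => _) = fun x => (\prod_(j < m) (1 - be j x)) * (1 - be m x)); last first.
    by rewrite funeqE => x; rewrite big_ord_recr.
  apply: smooth2M; first exact: IH (ltnW ms).
  by apply: smooth2B; [exact: smooth2_cst|have [] := hBW _ (inD _ ms)].
exists (size s), (fun k => ze k); split.
- move=> k; have [h1 h2 h3 _ _] := hBW _ (inD _ (ltn_ord k)); split.
  + by apply: (smooth2M h1); apply: sprod; exact: ltnW.
  + move=> p; apply: mulr_ge0; first by have /andP[] := h2 p.
    apply: prodr_ge0 => j _; rewrite subr_ge0.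
    by have [_ /(_ p)/andP[]] := hBW _ (inD _ (ltn_trans (ltn_ord j) (ltn_ord k))).
  + exact: localizedM.
- move=> p /cov[q /= qD Wq]; rewrite sumz.
  have iqs : (index q s < size s)%N by rewrite index_mem.
  rewrite (bigD1 (Ordinal iqs))//= {1}/be nth_index//.
  have cq : closure Om q by have := hD _ qD; rewrite inE.
  by have [_ _ _ _ /(_ _ Wq) ->] := hBW q cq; rewrite subrr mul0r subr0.
Qed.

End PartitionOfUnity.

Section RealInequalities.
Context {R : realType}.

Lemma product_grad_bound (z z0 z1 p p0 p1 B0 B1 B2 : R) :
  `|z| <= B0 -> `|z0| <= B1 -> `|z1| <= B2 ->
  `|z * p0 + p * z0| + `|z * p1 + p * z1| <= (B0 + B1 + B2) * (`|p| + `|p0| + `|p1|).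
Proof.
move=> h0 h1 h2.
have n (a b c d : R) : `|a * b + c * d| <= `|a| * `|b| + `|c| * `|d|.
  by apply: le_trans (ler_normD _ _) _; rewrite !normrM.
apply: le_trans (lerD (n z p0 p z0) (n z p1 p z1)) _.
have := normr_ge0 z; have := normr_ge0 z0; have := normr_ge0 z1.
have := normr_ge0 p; have := normr_ge0 p0; have := normr_ge0 p1.
move: h0 h1 h2; move: `|z| `|z0| `|z1| `|p| `|p0| `|p1| => a a0 a1 b b0 b1 *.
have : a * (b0 + b1) <= B0 * (b0 + b1) by apply: ler_wpM2r => //; lra.
have : a0 * b <= B1 * b by apply: ler_wpM2r.
have : a1 * b <= B2 * b by apply: ler_wpM2r.
have : 0 <= B0 * b by apply: mulr_ge0 => //; lra.
have : 0 <= (B1 + B2) * (b0 + b1) by apply: mulr_ge0; lra.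
lra.
Qed.

Lemma six_terms_bound (B B1 B2 x y z : R) : 0 <= B -> 0 <= B1 -> 0 <= B2 -> 0 <= x -> 0 <= y -> 0 <= z ->
  B1 * x + B * y + (B2 * x + B * z) <= (2 * B + B1 + B2) * (x + y + z).
Proof.
move=> hB h1 h2 hx hy hz.
have := mulr_ge0 hB hx; have := mulr_ge0 hB hy; have := mulr_ge0 hB hz.
have := mulr_ge0 h1 hy; have := mulr_ge0 h1 hz; have := mulr_ge0 h2 hy; have := mulr_ge0 h2 hz.
lra.
Qed.

End RealInequalities.

(** * Gluing the inequalities for smooth functions *)

Section GlobalEstimates.
Context {R : realType} (Om : set (R * R)) (sigma : {measure set (plane R) -> \bar R}).
Hypothesis hOm : smooth_bounded_domain Om.
Hypothesis hs : arclength_measure Om sigma.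
Notation leb := (leb2 R).
Notation L2 := (L2 leb Om).
Notation ip := (ip leb Om).
Notation nrm := (nrm leb Om).

Let oOm : open Om. Proof. by case: hOm. Qed.
Let bOm : bounded_set Om. Proof. by case: hOm. Qed.
Let mOm : measurable (Om : set (plane R)). Proof. exact: measurable_dom. Qed.
Let fOm : (leb Om < +oo)%E. Proof. exact: finite_dom. Qed.

(** [i1], [I1] and [I2] are the norms of L^1, of W^{1,1} and, up to repeated terms, of W^{2,1}. *)
Definition i1 (f : R * R -> R) : R := ip (fun x => `|f x|) (fun=> 1).
Definition I1 f := i1 f + i1 (partial 0 f) + i1 (partial 1 f).
Definition I2 f := I1 f + I1 (partial 0 f) + I1 (partial 1 f).

Let cn (f : R * R -> R) : continuous f -> continuous (fun p => `|f p|).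
Proof. by move=> cf p; apply: cvg_norm; exact: cf. Qed.

Lemma i1_EFin f : L2 f -> (i1 f)%:E = (\int[leb]_(x in Om) (`|f x|)%:E)%E.
Proof.
move=> Lf; rewrite /i1 /ip /Rintegral.
under eq_integral do rewrite mulr1.
rewrite fineK//; apply: integrable_fin_num => //.
by apply: (L2_integrable mOm fOm); exact: L2_abs.
Qed.

Lemma i1_ge0 f : 0 <= i1 f. Proof. by apply: ip_ge0 => x _; rewrite mulr1. Qed.

Lemma I1_ge0 f : 0 <= I1 f. Proof. by rewrite /I1; do 2?apply: addr_ge0; exact: i1_ge0. Qed.

Let sL f : smooth2 f -> L2 f. Proof. exact: L2_smooth2. Qed.

Lemma measurable_smooth2 (D : set (plane R)) f : smooth2 f -> measurable_fun D (fun x => (`|f x|)%:E : \bar R).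
Proof.
by move=> sf; apply/measurable_EFinP; apply: continuous_plane_measurable; apply: cn; exact: smooth2_continuous.
Qed.

Lemma dnormD (f g : R * R -> R) p : smooth2 f -> smooth2 g -> dnorm (fun x => f x + g x) p <= dnorm f p + dnorm g p.
Proof.
move=> sf sg; rewrite /dnorm (smooth2_partialD 0 sf sg) (smooth2_partialD 1 sf sg) addrACA.
by apply: lerD; exact: ler_normD.
Qed.

Lemma dnorm_I1 z : smooth2 z -> exists2 B, 0 <= B & forall psi, smooth2 psi ->
  (\int[leb]_(p in Om) (dnorm (fun x => z x * psi x)%R p)%:E <= (B * I1 psi)%:E)%E.
Proof.
move=> sz.
have [B0 h0 hB0] := smooth2_bounded bOm sz.
have [B1 h1 hB1] := smooth2_bounded bOm (smooth2_partial 0 sz).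
have [B2 h2 hB2] := smooth2_bounded bOm (smooth2_partial 1 sz).
pose B := B0 + B1 + B2; have B_ge0 : 0 <= B by rewrite /B !addr_ge0.
exists B => // psi spsi.
have e : (B * I1 psi)%:E = (\int[leb]_(p in Om) (B%:E * ((`|psi p|)%:E + (`|partial 0 psi p|)%:E + (`|partial 1 psi p|)%:E)))%E.
  have s0 := smooth2_partial 0 spsi; have s1 := smooth2_partial 1 spsi.
  rewrite ge0_integralZl//; last 2 first.
  - by apply: emeasurable_funD; [apply: emeasurable_funD|]; exact: measurable_smooth2.
  - by move=> p _; rewrite -!EFinD lee_fin !addr_ge0.
  rewrite ge0_integralD//; last 3 first.
  - by move=> p _; rewrite -!EFinD lee_fin !addr_ge0.
  - by apply: emeasurable_funD; exact: measurable_smooth2.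
  - exact: measurable_smooth2.
  rewrite ge0_integralD//; try exact: measurable_smooth2.
  by rewrite -(i1_EFin (sL spsi)) -(i1_EFin (sL s0)) -(i1_EFin (sL s1)) -!EFinD -EFinM.
rewrite e; apply: ge0_le_integral => //.
- by move=> p _; rewrite lee_fin dnorm_ge0.
- apply/measurable_EFinP; apply: continuous_plane_measurable; apply: continuous_dnorm.
  exact: smooth2M.
- by apply: measurable_funeM; apply: emeasurable_funD; [apply: emeasurable_funD|]; apply: measurable_smooth2; [exact: spsi|exact: (smooth2_partial 0 spsi)|exact: (smooth2_partial 1 spsi)].
- move=> p Op; rewrite -!EFinD -EFinM lee_fin /dnorm (smooth2_partialM 0 sz spsi) (smooth2_partialM 1 sz spsi).
  exact: product_grad_bound (hB0 p Op) (hB1 p Op) (hB2 p Op).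
Qed.

Definition divg (f : R * R -> R) : R := ip (fun x => partial 0 f x + partial 1 f x) (fun=> 1).

Let L2div f : smooth2 f -> L2 (fun x => partial 0 f x + partial 1 f x).
Proof. by move=> sf; apply: sL; apply: smooth2D; exact: smooth2_partial. Qed.

Lemma divg_sum (I : Type) (r : seq I) (F : I -> R * R -> R) : (forall i, smooth2 (F i)) ->
  divg (fun x => \sum_(i <- r) F i x) = \sum_(i <- r) divg (F i).
Proof.
move=> sF; have L1 : L2 (fun=> 1) by exact: (L2_cst mOm fOm).
elim: r => [|a r IH].
  rewrite big_nil /divg (_ : (fun x => \sum_(i <- [::]) F i x) = fun=> 0); last by rewrite funeqE => x; rewrite big_nil.
  rewrite !partial_cst -[RHS](mul0r (ip (fun=> 1) (fun=> 1))) -(ipZl mOm)//.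
  by apply: eq_ip => // x _; rewrite mul0r addr0.
have ss : smooth2 (fun x => \sum_(i <- r) F i x) by exact: smooth2_sum.
rewrite big_cons -IH -[RHS](ipDl mOm (L2div (sF a)) (L2div ss) L1).
apply: eq_ip => x _ //; rewrite (_ : (fun x => \sum_(i <- a :: r) F i x) = (fun x => F a x + \sum_(i <- r) F i x)); last first.
  by rewrite funeqE => y; rewrite big_cons.
have sa := sF a; by rewrite (smooth2_partialD 0 sa ss) (smooth2_partialD 1 sa ss) addrACA.
Qed.

Lemma ler_nrm_sum (I : Type) (r : seq I) (F : I -> R * R -> R) : (forall i, smooth2 (F i)) ->
  nrm (fun x => \sum_(i <- r) F i x) <= \sum_(i <- r) nrm (F i).
Proof.
move=> sF; elim: r => [|a r IH].
  by rewrite (_ : (fun x => _) = fun=> 0) ?nrm0 ?big_nil// funeqE => x; rewrite big_nil.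
rewrite (_ : (fun x => _) = (fun x => F a x + \sum_(i <- r) F i x)); last first.
  by rewrite funeqE => y; rewrite big_cons.
rewrite big_cons; apply: le_trans (ler_nrmD mOm _ _) _; [exact: sL|by apply: sL; exact: smooth2_sum|].
by rewrite lerD2l.
Qed.

(** Derivatives that fall on [z] are absorbed into the constant, except in the divergence bound,
    which is kept in terms of the product and retains its factor sqrt 2. *)
Lemma local_estimates z : smooth2 z -> localized Om z -> exists2 C : R, 0 <= C & forall psi, smooth2 psi ->
  [/\ nrm (fun x => z x * psi x) <= C * I1 psi,
      (\int[sigma]_(p in bd Om) (`|z p * psi p|)%:E <= (C * I1 psi)%:E)%E,
      forall x, Om x -> `|z x * psi x| <= C * I2 psi &
      ((`|divg (fun x => z x * psi x)|)%:E <= (Num.sqrt 2)%:E * \int[sigma]_(p in bd Om) (`|z p * psi p|)%:E)%E].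
Proof.
move=> sz [U [sw [b [h [K [hc cK KU vz]]]]]].
have [L L0 hL] := chart_estimates oOm hs hc cK KU.
have [B B0 hB] := dnorm_I1 sz.
have [B1 B10 hB1] := dnorm_I1 (smooth2_partial 0 sz).
have [B2 B20 hB2] := dnorm_I1 (smooth2_partial 1 sz).
pose C := L * (2 * B + B1 + B2).
have LB : L * B <= C by rewrite /C ler_wpM2l//; lra.
have C0 : 0 <= C by rewrite mulr_ge0//; lra.
exists C => // psi spsi.
have szp : smooth2 (fun x => z x * psi x) by exact: smooth2M.
have [hD hE hS hF] := hL _ szp (fun p (Kp : ~ K p) => etrans (congr1 (fun t => t * psi p) (vz p Kp)) (mul0r _)).
have i0 := I1_ge0 psi.
have LE : (L%:E * \int[leb]_(p in Om) (dnorm (fun x => z x * psi x)%R p)%:E <= (L * B * I1 psi)%:E)%E.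
  by rewrite -mulrA EFinM; apply: lee_wpmul2l; rewrite ?lee_fin//; exact: hB.
have J0 : (0 <= L%:E * \int[leb]_(p in Om) (dnorm (fun x => z x * psi x)%R p)%:E)%E.
  by apply: mule_ge0; rewrite ?lee_fin//; apply: integral_ge0 => p _; rewrite lee_fin dnorm_ge0.
split.
- have CI0 : 0 <= C * I1 psi := mulr_ge0 C0 i0.
  have LBI0 : 0 <= L * B * I1 psi := mulr_ge0 (mulr_ge0 L0 B0) i0.
  rewrite -(ler_pXn2r (ltn0Sn 1)) ?nnegrE ?nrm_ge0// -lee_fin (nrm_EFin mOm (sL szp)).
  apply: le_trans hE _; apply: (@le_trans _ _ ((L * B * I1 psi)%:E * (L * B * I1 psi)%:E)%E).
    exact: lee_pmul.
  by rewrite -EFinM lee_fin expr2; apply: ler_pM => //; exact: ler_wpM2r.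
- by apply: le_trans hD _; apply: le_trans LE _; rewrite lee_fin ler_wpM2r.
- move=> x Ox; rewrite -lee_fin; apply: le_trans (hS x Ox) _.
  have dd i Bi : (forall psi, smooth2 psi -> (\int[leb]_(p in Om) (dnorm (fun x => partial i z x * psi x)%R p)%:E <= (Bi * I1 psi)%:E)%E) ->
     (L%:E * \int[leb]_(p in Om) (dnorm (partial i (fun x => z x * psi x)%R) p)%:E <= (L * (Bi * I1 psi + B * I1 (partial i psi)))%:E)%E.
    move=> hBi; rewrite EFinM; apply: lee_wpmul2l; first by rewrite lee_fin.
    have si := smooth2_partial i spsi; have zi := smooth2_partial i sz.
    apply: (@le_trans _ _ (\int[leb]_(p in Om) ((dnorm (fun x => partial i z x * psi x)%R p)%:E + (dnorm (fun x => z x * partial i psi x)%R p)%:E))%E).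
      have md f : smooth2 f -> measurable_fun (Om : set (plane R)) (fun p => (dnorm f p)%:E : \bar R).
        by move=> sf; apply/measurable_EFinP; apply: continuous_plane_measurable; exact: continuous_dnorm.
      apply: ge0_le_integral => //.
      + by move=> p _; rewrite lee_fin dnorm_ge0.
      + by apply: md; exact: smooth2_partial.
      + by apply: emeasurable_funD; apply: md; exact: smooth2M.
      + move=> p _; rewrite -EFinD lee_fin.
        have -> : partial i (fun x => z x * psi x) = (fun x => partial i z x * psi x + z x * partial i psi x).
          by rewrite (smooth2_partialM _ sz spsi) funeqE => y; rewrite addrC [psi y * _]mulrC.
        exact: dnormD (smooth2M zi spsi) (smooth2M sz si).
    rewrite ge0_integralD//; first by rewrite EFinD; apply: leeD; [exact: hBi|exact: hB].
    + by move=> p _; rewrite lee_fin dnorm_ge0.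
    + by apply/measurable_EFinP; apply: continuous_plane_measurable; apply: continuous_dnorm; exact: smooth2M.
    + by move=> p _; rewrite lee_fin dnorm_ge0.
    + by apply/measurable_EFinP; apply: continuous_plane_measurable; apply: continuous_dnorm; exact: smooth2M.
  apply: le_trans (leeD (dd 0 B1 hB1) (dd 1 B2 hB2)) _.
  rewrite -EFinD lee_fin -mulrDr /C -mulrA ler_wpM2l// /I2.
  have i2 := I1_ge0 (partial 0 psi); have i3 := I1_ge0 (partial 1 psi).
  exact: six_terms_bound.
- apply: le_trans hF; rewrite le_eqVlt; apply/orP; left; apply/eqP.
  rewrite /divg /ip /Rintegral; under eq_integral do rewrite mulr1.
  rewrite -[X in X = _]/(`|(fine (\int[leb]_(x in Om) (partial 0 (fun x => z x * psi x)%R x + partial 1 (fun x => z x * psi x)%R x)%:E))%:E|)%E.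
  by rewrite fineK//; apply: integrable_fin_num => //; apply: (L2_integrable mOm fOm); exact: L2div.
Qed.

Lemma smooth_estimates : exists2 C : R, 0 <= C & forall psi, smooth2 psi ->
  [/\ nrm psi <= C * I1 psi,
      (\int[sigma]_(p in bd Om) (`|psi p|)%:E <= (C * I1 psi)%:E)%E,
      forall x, Om x -> `|psi x| <= C * I2 psi &
      ((`|divg psi|)%:E <= (Num.sqrt 2)%:E * \int[sigma]_(p in bd Om) (`|psi p|)%:E)%E].
Proof.
have [n [ze [hz sz]]] := partition_of_unity hOm.
have /choice[C hC] : forall k : 'I_n, exists C : R, 0 <= C /\ forall psi, smooth2 psi ->
  [/\ nrm (fun x => ze k x * psi x) <= C * I1 psi,
      (\int[sigma]_(p in bd Om) (`|ze k p * psi p|)%:E <= (C * I1 psi)%:E)%E,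
      forall x, Om x -> `|ze k x * psi x| <= C * I2 psi &
      ((`|divg (fun x => ze k x * psi x)|)%:E <= (Num.sqrt 2)%:E * \int[sigma]_(p in bd Om) (`|ze k p * psi p|)%:E)%E].
  by move=> k; have [h1 _ h3] := hz k; have [C C0 h] := local_estimates h1 h3; exists C.
exists (\sum_(k < n) C k); first by apply: sumr_ge0 => k _; have [] := hC k.
move=> psi spsi.
have sk k : smooth2 (fun x => ze k x * psi x).
  by have [hk _ _] := hz k; exact: smooth2M hk spsi.
have e x : closure Om x -> psi x = \sum_(k < n) ze k x * psi x.
  by move=> cx; rewrite -mulr_suml sz// mul1r.
have eO x : Om x -> psi x = \sum_(k < n) ze k x * psi x by move=> Ox; apply: e; exact: subset_closure.
have mbd := measurable_bd Om.
(* Since the [ze k] are nonnegative with sum 1, the boundary integrals add up exactly; the factor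
   sqrt 2 is therefore not multiplied by the number of charts. *)
have eb : (\int[sigma]_(p in bd Om) (`|psi p|)%:E = \sum_(k < n) \int[sigma]_(p in bd Om) (`|ze k p * psi p|)%:E)%E.
  rewrite -(ge0_integral_sum _ mbd); last 2 first.
  - by move=> k; exact: measurable_smooth2 (sk k).
  - by move=> k p _; rewrite lee_fin.
  apply: eq_integral => p /[!inE] -[cp _]; rewrite sumEFin; congr EFin.
  rewrite -[LHS]mul1r -(sz p cp) mulr_suml; apply: eq_bigr => k _.
  by rewrite normrM ger0_norm//; have [_ + _] := hz k; exact.
split.
- rewrite (eq_nrm _ eO); apply: le_trans (ler_nrm_sum _ sk) _.
  by rewrite mulr_suml; apply: ler_sum => k _; have [_ /(_ psi spsi)[]] := hC k.
- rewrite eb mulr_suml -sumEFin; apply: lee_sum => k _.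
  by have [_ /(_ psi spsi)[]] := hC k.
- move=> x Ox; rewrite (eO x Ox); apply: le_trans (ler_norm_sum _ _ _) _.
  rewrite mulr_suml; apply: ler_sum => k _.
  by have [_ /(_ psi spsi)[_ _ + _]] := hC k; apply.
- have -> : divg psi = \sum_(k < n) divg (fun x => ze k x * psi x).
    rewrite -(divg_sum _ sk); apply: eq_ip => [x Ox|//].
    have ss : smooth2 (fun x => \sum_(k < n) ze k x * psi x) by exact: smooth2_sum.
    have d i : partial i psi x = partial i (fun x => \sum_(k < n) ze k x * psi x) x.
      apply/eqP; rewrite -subr_eq0; apply/eqP.
      have := @smooth2_partial_eq0 _ (fun x => psi x - \sum_(k < n) ze k x * psi x) i Om oOm _ x Ox.
      by rewrite smooth2_partialB//; apply => q Oq; rewrite -eO// subrr.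
    by rewrite !d.
  apply: (@le_trans _ _ (\sum_(k < n) (`|divg (fun x => ze k x * psi x)|)%:E)%E).
    by rewrite sumEFin lee_fin; exact: ler_norm_sum.
  rewrite eb ge0_sume_distrr; last by move=> k _; apply: integral_ge0 => p _; rewrite lee_fin.
  by apply: lee_sum => k _; have [_ /(_ psi spsi)[]] := hC k.
Qed.

(** The trace inequality for the constant 1. *)
Lemma finite_bd : (sigma (bd Om) < +oo)%E.
Proof.
have [C C0 /(_ (fun=> 1))[|_ h _ _]] := smooth_estimates; first exact: smooth2_cst.
apply: le_lt_trans (ltry (C * I1 (fun=> 1))); apply: le_trans h.
rewrite (_ : (fun p => (`|1|)%:E) = cst (1%:E : \bar R)); last by rewrite funeqE => p; rewrite normr1.
by rewrite integral_cst ?mul1e//; exact: measurable_bd.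
Qed.

End GlobalEstimates.

(** * Density of smooth functions *)

Section InwardShift.
Context {R : realType}.

Lemma smooth1_lipschitz (f : R -> R) (M : R) : smooth1 f ->
  exists2 L, 0 <= L & forall s t, `|s| <= M -> `|t| <= M -> `|f s - f t| <= L * `|s - t|.
Proof.
move=> sf.
have cf' : continuous (fun p : R * R => derive1 f p.1).
  by apply: continuous_comp_fst; apply: smooth1_continuous; exact: smooth1_derive.
have [L L0 hL] := continuous_box_bounded M cf'; exists L => // s t; wlog st : s t / s <= t.
  by move=> h sM tM; have [/h|/ltW/h] := leP s t; [exact|rewrite distrC (distrC t); exact].
move=> sM tM; have [->|nst] := eqVneq s t; first by rewrite !subrr normr0 mulr0.
have lst : s < t by rewrite lt_neqAle nst.
have [c cst e] := @MVT _ f (derive1 f) s t lst (fun x _ => smooth1_is_derive x sf)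
  (continuous_subspaceT (@smooth1_continuous _ _ sf)).
rewrite distrC e normrM (distrC s); apply: ler_wpM2r => //.
apply: (hL (c, 0)) => /=; last by rewrite normr0 (le_trans (normr_ge0 s)).
move: cst sM tM; rewrite in_itv/= !ler_norml => /andP[h1 h2] /andP[h3 _] /andP[_ h4].
by apply/andP; split; apply: ltW; [exact: le_lt_trans h3 h1|exact: lt_le_trans h2 h4].
Qed.

(** Compactness in its near-covering form turns the local radii into a uniform one. *)
Lemma compact_thickening (K U : set (R * R)) : compact K -> open U -> K `<=` U ->
  exists2 r : R, 0 < r & forall z, K z -> ball z r `<=` U.
Proof.
move=> /compact_near_coveringP cK oU KU.
have /cK h : forall x, K x -> \forall x' \near x & r \near (0 : R)^'+, ball x' r `<=` U.
  move=> x /KU Ux.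
  have /nbhs_ballP[e /= e0 he] : nbhs x U by exact: open_nbhs_nbhs.
  have e20 : 0 < e / 2 by rewrite divr_gt0.
  near=> x' r; apply: subset_trans he => y.
  have xx' : ball x (e / 2) x' by near: x'; exact: nbhsx_ballx.
  have re : r <= e / 2 by near: r; exact: nbhs_right_le.
  move=> /(le_ball re) yr; rewrite (splitr e); exact: ball_triangle xx' yr.
near (0:R)^'+ => r; exists r; first by near: r; exact: nbhs_right_gt.
near: r; exact: h.
Unshelve. all: by end_near. Qed.

Definition inbox (p : (R * R) * (R * R)) (x : R * R) : Prop :=
  p.1.1 <= x.1 <= p.1.1 + p.1.2 /\ p.2.1 <= x.2 <= p.2.1 + p.2.2.

(* Near a boundary point, mollification kernels supported in small boxes that
   point out of the domain only average over points of the domain. *)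
Lemma local_shift Om zeta : localized Om zeta -> exists K (p : nat -> (R * R) * (R * R)),
  [/\ compact K, forall z, ~ K z -> zeta z = 0, forall n, ok_par (p n),
      rad (p n) @[n --> \oo] --> (0 : R) &
      forall n x z, Om x -> K z -> inbox (p n) (x - z) -> Om z].
Proof.
move=> [U [sw [b [h [K [hc cK KU vz]]]]]]; have [oU sh hU] := hc.
have [r r0 hr] := compact_thickening cK oU KU.
have [N N0 hN] := bounded_set_box (compact_bounded cK).
have [L L0 hL] := smooth1_lipschitz (N + r) sh.
(* The boxes have size e across the boundary and d = e/(L + 1) along it. Over a distance d the graph
   moves by less than e, so a shift between e and 2e across it stays on the inner side. *)
pose e (n : nat) : R := r / (8 * n.+1%:R).
pose d (n : nat) : R := e n / (L + 1).
have L1 : 0 < L + 1 by rewrite ltr_wpDl.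
have e0 n : 0 < e n by rewrite divr_gt0// mulr_gt0// ltr0n.
have d0 n : 0 < d n by rewrite divr_gt0.
have de n : d n <= e n by rewrite ler_pdivrMr// ler_peMr ?lerDr// ltW.
have Ld n : L * d n < e n.
  have e' : (L + 1) * d n = e n by rewrite mulrC divfK// lt0r_neq0.
  by rewrite -e' mulrDl mul1r ltrDl.
have er n : 4 * e n < r.
  rewrite /e mulrA ltr_pdivrMr ?mulr_gt0 ?ltr0n//.
  have : 1 <= n.+1%:R :> R by rewrite ler1n.
  move=> h1; have := ler_pM2l r0 1 n.+1%:R; rewrite h1 => h2.
  by have : r * 1 <= r * n.+1%:R; [rewrite h2|lra].
pose a n : R := if b then e n else - (2 * e n).
pose q1 n := ((0 : R), d n). pose q2 n := (a n, e n).
exists K, (fun n => if sw then (q2 n, q1 n) else (q1 n, q2 n)).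
have an n : `|a n| <= 2 * e n.
  by rewrite /a; case: (b); rewrite ?normrN gtr0_norm ?mulr_gt0//; have := e0 n; lra.
split => //.
- by move=> n; case: (sw); split => /=; [exact: e0|exact: d0|exact: d0|exact: e0].
- have cv : 4 * e n @[n --> \oo] --> (0 : R).
    rewrite -(mulr0 (4 * (r / 8))).
    rewrite (_ : (fun n => 4 * e n) = (fun n => 4 * (r / 8) * harmonic n)).
      by apply: cvgM; [exact: cvg_cst|exact: cvg_harmonic].
    by rewrite funeqE => n; rewrite /e /harmonic /= invfM; ring.
  apply: (squeeze_cvgr _ (cvg_cst 0) cv); near=> n.
  have := an n; have := de n; have := d0 n; have := e0 n; have := normr_ge0 (a n).
  by rewrite /rad; case: (sw); rewrite /q1 /q2 /= normr0; lra.
- move=> n x z Ox Kz hin.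
  pose xr := relabel sw x; pose zr := relabel sw z.
  have [i1 i2] : 0 <= xr.1 - zr.1 <= d n /\ a n <= xr.2 - zr.2 <= a n + e n.
    move: hin; rewrite /inbox -[(x - z).1]/(x.1 - z.1) -[(x - z).2]/(x.2 - z.2) /xr /zr.
    by case: (sw) => /= -[]; rewrite add0r.
  have b1 : `|xr.1 - zr.1| < r.
    move: i1 => /andP[h1 h2]; rewrite ger0_norm//.
    have := er n; have := e0 n; have := de n; lra.
  have b2 : `|xr.2 - zr.2| < r.
    have := er n; have := e0 n => h1 h2.
    move: i2 (an n); rewrite ler_norml => /andP[h3 h4] /andP[h5 h6].
    rewrite ltr_norml; apply/andP; split; lra.
  have Ux : U x.
    apply: hr Kz _ _; rewrite /ball/= /prod_ball /ball/= distrC [X in _ /\ X < _]distrC.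
    by move: b1 b2; rewrite /xr /zr; case: (sw).
  have [zN1 zN2] : `|zr.1| <= N /\ `|zr.2| <= N.
    by have := hN _ Kz; rewrite /zr; case: (sw) => /= -[].
  have hh : `|h xr.1 - h zr.1| <= L * d n.
    apply: (@le_trans _ _ (L * `|xr.1 - zr.1|)).
      apply: hL; last by rewrite (le_trans zN1)// lerDl ltW.
      by rewrite -(subrK zr.1 xr.1) addrC (le_trans (ler_normD _ _))// lerD// ltW.
    by apply: ler_wpM2l => //; move: i1 => /andP[h1 h2]; rewrite ger0_norm.
  apply/(hU z (KU _ Kz)); have /(hU x Ux) := Ox.
  rewrite -/xr -/zr -[(-1) ^+ b]/(sg b).
  move: hh; rewrite ler_norml => /andP[h1 h2].
  have := Ld n; have := e0 n; move: i2; rewrite /a /sg.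
  by case: (b) => /andP[h3 h4] h5 h6; rewrite ?expr1 ?expr0; lra.
Unshelve. all: by end_near. Qed.

End InwardShift.

Section Density.
Context {R : realType} (Om : set (R * R)).
Hypothesis hOm : smooth_bounded_domain Om.
Notation leb := (leb2 R).
Notation L2 := (L2 leb Om).
Notation ip := (ip leb Om).
Notation nrm := (nrm leb Om).

Let oOm : open Om. Proof. by case: hOm. Qed.
Let bOm : bounded_set Om. Proof. by case: hOm. Qed.
Let mOm : measurable (Om : set (plane R)). Proof. exact: measurable_dom. Qed.
Let fOm : (leb Om < +oo)%E. Proof. exact: finite_dom. Qed.

Lemma oppr_eq_add (V : zmodType) (a b c : V) : a + c = - b -> - a = b + c.
Proof. by move=> /(congr1 -%R); rewrite opprK opprD => <-; rewrite subrK. Qed.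

Lemma addr_move_sub (V : zmodType) (a b c d : V) : a + b + c - d = a - d + b + c.
Proof. by rewrite addrAC [a + b - d]addrAC. Qed.

Lemma L2_nrm_sum (I : Type) (r : seq I) (F : I -> R * R -> R) : (forall i, L2 (F i)) ->
  L2 (fun x => \sum_(i <- r) F i x) /\ nrm (fun x => \sum_(i <- r) F i x) <= \sum_(i <- r) nrm (F i).
Proof.
move=> LF; elim: r => [|a r [L IH]].
  have e : (fun x => \sum_(i <- [::]) F i x) = fun=> 0 by rewrite funeqE => x; rewrite big_nil.
  rewrite e big_nil (_ : nrm (fun=> 0) = 0); last by apply: nrm0.
  by split => //; apply: L2_0.
have e : (fun x => \sum_(i <- a :: r) F i x) = (fun x => F a x + \sum_(i <- r) F i x).
  by rewrite funeqE => y; rewrite big_cons.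
rewrite e big_cons; split; first exact: (L2D mOm (LF a) L).
by apply: le_trans (ler_nrmD mOm (LF a) L) _; rewrite lerD2l.
Qed.

Lemma cvgn0D (f g : nat -> R) : f n @[n --> \oo] --> (0 : R) -> g n @[n --> \oo] --> (0 : R) ->
  f n + g n @[n --> \oo] --> (0 : R).
Proof. by move=> cf cg; rewrite -(addr0 (0 : R)); exact: cvgD cf cg. Qed.

Lemma squeeze0 (f g : nat -> R) : (forall n, 0 <= f n) -> (forall n, f n <= g n) ->
  g n @[n --> \oo] --> (0 : R) -> f n @[n --> \oo] --> (0 : R).
Proof.
move=> f0 fg cg; apply: (squeeze_cvgr _ (cvg_cst 0) cg).
by apply: nearW => n; rewrite f0 fg.
Qed.

Section Family.
Variables (N : nat) (K : 'I_N -> set (R * R)) (p : 'I_N -> nat -> (R * R) * (R * R)).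
Hypothesis cK : forall k, compact (K k).
Hypothesis okp : forall k n, ok_par (p k n).
Hypothesis radp : forall k, rad (p k n) @[n --> \oo] --> (0 : R).
Hypothesis shp : forall k n x z, Om x -> K k z -> inbox (p k n) (x - z) -> Om z.

Definition family (eta : 'I_N -> R * R -> R) :=
  forall k, smooth2 (eta k) /\ forall z, ~ K k z -> eta k z = 0.

Lemma family_partial eta i : family eta -> family (fun k => partial i (eta k)).
Proof.
move=> h k; have [h1 h2] := h k; split; first exact: smooth2_partial.
have hv := @vanish_partial R (K k) (@cK k) i (eta k) h2.
move=> z Kz; exact: (hv z Kz).
Qed.

(** Each piece of the partition is averaged with its own shifted kernel. *)
Definition approx_by (eta : 'I_N -> R * R -> R) (n : nat) (v : R * R -> R) : R * R -> R :=
  fun x => \sum_(k < N) avg Om (p k n) (fun z => eta k z * v z) x.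

Let Le eta k v : family eta -> L2 v -> L2 (fun z => eta k z * v z).
Proof. by move=> /(_ k)[h _] Lv; exact: (L2_smooth2M oOm bOm h Lv). Qed.

Lemma smooth2_approx eta n v : family eta -> L2 v -> smooth2 (approx_by eta n v).
Proof.
move=> fe Lv; apply: smooth2_sum => k.
exact: (@smooth2_avg _ _ oOm fOm _ _ (okp k n) (Le k fe Lv)).
Qed.

Lemma approx_cvg eta v : family eta -> L2 v ->
  nrm (fun x => approx_by eta n v x - (\sum_(k < N) eta k x) * v x) @[n --> \oo] --> (0 : R).
Proof.
move=> fe Lv.
have cv k : nrm (fun x => avg Om (p k n) (fun z => eta k z * v z) x - eta k x * v x) @[n --> \oo] --> (0 : R).
  exact: (avg_cvg oOm fOm (okp k) (radp k) (Le k fe Lv)).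
have cs : \sum_(k < N) nrm (fun x => avg Om (p k n) (fun z => eta k z * v z) x - eta k x * v x) @[n --> \oo] --> (0 : R).
  elim: (index_enum 'I_N) => [|k r IH].
    by under eq_fun do rewrite big_nil; exact: cvg_cst.
  under eq_fun do rewrite big_cons.
  by have := cvgD (cv k) IH; rewrite addr0; exact.
apply: (squeeze_cvgr _ (cvg_cst 0) cs); near=> n; rewrite nrm_ge0 /=.
have La k : L2 (fun x => avg Om (p k n) (fun z => eta k z * v z) x - eta k x * v x).
  by apply: (L2B mOm); [apply: (L2_avg oOm fOm (okp k n))|]; exact: Le.
have -> : nrm (fun x => approx_by eta n v x - (\sum_(k < N) eta k x) * v x) =
   nrm (fun x => \sum_(k < N) (avg Om (p k n) (fun z => eta k z * v z) x - eta k x * v x)).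
  by apply: eq_nrm => x _; rewrite /approx_by mulr_suml -sumrB.
by have [] := L2_nrm_sum (index_enum 'I_N) La.
Unshelve. all: by end_near. Qed.

(** The support consists of points of [K k] whose difference with [x] lies in the box, and by [shp]
    these are points of [Om], even when [x] is close to the boundary. *)
Lemma test_kernel eta k n x : family eta -> Om x ->
  test_function Om (fun z => eta k z * moll (p k n) (x - z)).
Proof.
move=> fe Ox; have [se ve] := fe k; have [p1 p2] := okp k n; split.
  by apply: (smooth2M se); exact: (@smooth2_reflect R _ _ x (@smooth1_kern R _ _) (@smooth1_kern R _ _)).
pose q := p k n.
pose box : set (R * R) := `[x.1 - (q.1.1 + q.1.2), x.1 - q.1.1]%classic `*` `[x.2 - (q.2.1 + q.2.2), x.2 - q.2.1]%classic.
have cb : compact box by exact: compact_box.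
have inb z : box z <-> inbox q (x - z).
  rewrite /box /inbox; split=> [[]|[]] /=; rewrite !in_itv/= => /andP[h1 h2] /andP[h3 h4];
    by split; apply/andP; split; lra.
exists (K k `&` box); split.
- apply: (subclosed_compact _ cb); last exact: subIsetr.
  by apply: closedI; apply: compact_closed => //; exact: norm_hausdorff.
- by move=> z [Kz /inb bz]; exact: shp bz.
- move=> z nz; have [Kz|Kz] := pselect (K k z); last by rewrite ve// mul0r.
  by rewrite moll_out ?mulr0// => h; apply: nz; split => //; apply/inb.
Qed.

(** As the kernel times [eta k] is a test function, the derivative of the average can be moved to
    [v] up to the boundary; the product rule leaves an average with the differentiated cut-offs. *)
Lemma partial_approx eta n v i x : family eta -> Hm Om 1 v -> Om x ->
  partial i (approx_by eta n v) x =
    approx_by eta n (wD Om i v) x + approx_by (fun k => partial i (eta k)) n v x.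
Proof.
move=> fe Hv Ox; have Lv := H1_L2 Hv; have Lw := H1_L2wD i Hv.
have fe' := family_partial i fe.
rewrite /approx_by smooth2_partial_sum; last first.
  by move=> k; exact: (@smooth2_avg _ _ oOm fOm _ _ (okp k n) (Le k fe Lv)).
rewrite -big_split /=; apply: eq_bigr => k _.
have [se ve] := fe k; have [p1 p2] := okp k n.
have tk := test_kernel k n fe Ox.
have [_ /(_ _ tk)] := H1_wder i Hv.
set psi := fun z => moll (p k n) (x - z).
have spsi : smooth2 psi := @smooth2_reflect R _ _ x (@smooth1_kern R _ _) (@smooth1_kern R _ _).
have Lpsi f : smooth2 f -> L2 f := L2_smooth2 oOm bOm (f := f).
have si := smooth2_partial i spsi; have sei := smooth2_partial i se.
have -> : partial i (fun z => eta k z * psi z) = fun z => eta k z * partial i psi z + psi z * partial i (eta k) z.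
  by rewrite (smooth2_partialM i se spsi).
rewrite (ipDr mOm (Lpsi _ (smooth2M se si)) (Lpsi _ (smooth2M spsi sei)) Lv) => e.
rewrite /avg (partial_conv mOm fOm i x (bump1_kern _ p1) (bump1_kern _ p2) (Le k fe Lv)).
rewrite -[tensor _ _]/(moll (p k n)) /conv -/psi.
have -> : ip (fun z => eta k z * v z) (partial i psi) = ip v (fun z => eta k z * partial i psi z).
  by apply: eq_Rintegral => z _; rewrite [RHS]mulrCA [RHS]mulrA.
have -> : ip (fun z => eta k z * wD Om i v z) psi = ip (wD Om i v) (fun z => eta k z * psi z).
  by apply: eq_Rintegral => z _; rewrite [RHS]mulrCA [RHS]mulrA.
have -> : ip (fun z => partial i (eta k) z * v z) psi = ip v (fun z => psi z * partial i (eta k) z).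
  by apply: eq_Rintegral => z _; rewrite [RHS]mulrCA [RHS]mulrC; congr (_ * _); exact: mulrC.
exact: oppr_eq_add e.
Qed.

End Family.

(** The same sequence converges in H^1 and, if [v] is in H^2, also in H^2. The second order is what
    the sup bound requires later. *)
Theorem density (v : R * R -> R) : Hm Om 1 v -> exists phi : nat -> R * R -> R,
  [/\ forall n, smooth2 (phi n),
      nrm (fun x => phi n x - v x) @[n --> \oo] --> (0 : R),
      forall i, nrm (fun x => partial i (phi n) x - wD Om i v x) @[n --> \oo] --> (0 : R) &
      Hm Om 2 v -> forall i j,
        nrm (fun x => partial j (partial i (phi n)) x - wD Om j (wD Om i v) x) @[n --> \oo] --> (0 : R)].
Proof.
move=> Hv; have Lv := H1_L2 Hv.
have [N [ze [hz sz]]] := partition_of_unity hOm.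
have /choice[Kp hKp] : forall k : 'I_N, exists Kp : set (R * R) * (nat -> (R * R) * (R * R)),
  [/\ compact Kp.1, forall z, ~ Kp.1 z -> ze k z = 0, forall n, ok_par (Kp.2 n),
      rad (Kp.2 n) @[n --> \oo] --> (0 : R) &
      forall n x z, Om x -> Kp.1 z -> inbox (Kp.2 n) (x - z) -> Om z].
  by move=> k; have [_ _ /local_shift[K [p h]]] := hz k; exists (K, p).
pose K k := (Kp k).1; pose p k := (Kp k).2.
have cK k : compact (K k) by have [] := hKp k.
have okp k n : ok_par (p k n) by have [_ _ h _ _] := hKp k; exact: h.
have radp k : rad (p k n) @[n --> \oo] --> (0 : R) by have [_ _ _ h _] := hKp k; exact: h.
have shp k n x z : Om x -> K k z -> inbox (p k n) (x - z) -> Om z.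
  by have [_ _ _ _] := hKp k; apply.
have fz : family K ze by move=> k; have [s _ _] := hz k; have [_ h _ _ _] := hKp k.
have one x : Om x -> \sum_(k < N) ze k x = 1 by move=> Ox; apply: sz; exact: subset_closure.
have ss : smooth2 (fun x => \sum_(k < N) ze k x) by apply: smooth2_sum => k; have [] := fz k.
(* The differentiated cut-offs sum to 0 on [Om], so the extra terms of [partial_approx] tend to
   0. *)
have zero i x : Om x -> \sum_(k < N) partial i (ze k) x = 0.
  move=> Ox; have := @smooth2_partial_eq0 _ (fun x => \sum_(k < N) ze k x - 1) i Om oOm.
  rewrite (smooth2_partialB i ss (smooth2_cst 1)) partial_cst (smooth2_partial_sum i _ (fun k => proj1 (fz k))).
  by move=> /(_ _ x Ox); rewrite subr0; apply => y Oy; rewrite one// subrr.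
have zero2 i j x : Om x -> \sum_(k < N) partial j (partial i (ze k)) x = 0.
  move=> Ox; have := @smooth2_partial_eq0 _ (fun x => \sum_(k < N) partial i (ze k) x) j Om oOm (zero i) x Ox.
  by rewrite (smooth2_partial_sum j _ (fun k => smooth2_partial i (proj1 (fz k)))).
have fzi i := family_partial cK i fz.
pose A eta := approx_by p eta.
have sA eta n f : family K eta -> L2 f -> smooth2 (A eta n f) by exact: smooth2_approx.
have LA eta n f : family K eta -> L2 f -> L2 (A eta n f).
  by move=> fe Lf; apply: (L2_smooth2 oOm bOm); exact: sA.
have cA1 f : L2 f -> nrm (fun x => A ze n f x - f x) @[n --> \oo] --> (0 : R).
  move=> Lf; have := approx_cvg okp radp fz Lf.
  by apply: cvg_trans; apply: near_eq_cvg; near=> n; apply: eq_nrm => x Ox; rewrite one// mul1r.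
have cA0 eta f : family K eta -> L2 f -> (forall x, Om x -> \sum_(k < N) eta k x = 0) ->
    nrm (A eta n f) @[n --> \oo] --> (0 : R).
  move=> fe Lf h; have := approx_cvg okp radp fe Lf.
  by apply: cvg_trans; apply: near_eq_cvg; near=> n; apply: eq_nrm => x Ox; rewrite h// mul0r subr0.
exists (fun n => A ze n v); split.
- by move=> n; exact: sA.
- exact: cA1.
- move=> i; have Lw := H1_L2wD i Hv.
  have c1 := cA1 _ Lw; have c2 := cA0 _ _ (fzi i) Lv (zero i).
  apply: (squeeze0 _ _ (cvgn0D c1 c2)) => n; first exact: nrm_ge0.
  apply: le_trans _ (ler_nrmD mOm (L2B mOm (LA _ n _ fz Lw) Lw) (LA _ n _ (fzi i) Lv)).
  rewrite le_eqVlt; apply/orP; left; apply/eqP; apply: eq_nrm => x Ox.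
  by rewrite (partial_approx cK okp shp n i fz Hv Ox) addrAC.
- move=> H2v i j; have Hw := H2_wD oOm bOm i H2v; have Lw := H1_L2 Hw; have Lj := H1_L2wD j Hv.
  have Lij := H1_L2wD j Hw.
  have c1 := cA1 _ Lij; have c2 := cA0 _ _ (fzi j) Lw (zero j).
  have c3 := cA0 _ _ (fzi i) Lj (zero i).
  have fij := family_partial cK j (fzi i).
  have c4 := cA0 _ _ fij Lv (zero2 i j).
  apply: (squeeze0 _ _ (cvgn0D (cvgn0D c1 c2) (cvgn0D c3 c4))) => n; first exact: nrm_ge0.
  have L_1 := L2B mOm (LA _ n _ fz Lij) Lij; have L_2 := LA _ n _ (fzi j) Lw.
  have L_3 := LA _ n _ (fzi i) Lj; have L_4 := LA _ n _ fij Lv.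
  apply: le_trans _ (lerD (ler_nrmD mOm L_1 L_2) (ler_nrmD mOm L_3 L_4)).
  apply: le_trans _ (ler_nrmD mOm (L2D mOm L_1 L_2) (L2D mOm L_3 L_4)).
  rewrite le_eqVlt; apply/orP; left; apply/eqP; apply: eq_nrm => x Ox.
  have s2 := sA _ n _ fz Lw; have s3 := sA _ n _ (fzi i) Lv.
  have -> : partial j (partial i (A ze n v)) x = partial j (fun y => A ze n (wD Om i v) y + A (fun k => partial i (ze k)) n v y) x.
    have sAv := sA _ n _ fz Lv.
    apply/eqP; rewrite -subr_eq0; apply/eqP.
    have := @smooth2_partial_eq0 _ (fun y => partial i (A ze n v) y - (A ze n (wD Om i v) y + A (fun k => partial i (ze k)) n v y)) j Om oOm _ x Ox.
    rewrite (smooth2_partialB j (smooth2_partial i sAv) (smooth2D s2 s3)); apply => y Oy.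
    by rewrite (partial_approx cK okp shp n i fz Hv Oy) subrr.
  rewrite (smooth2_partialD j s2 s3).
  rewrite (partial_approx cK okp shp n j fz Hw Ox) (partial_approx cK okp shp n j (fzi i) Hv Ox).
  exact: addr_move_sub.
Unshelve. all: by end_near. Qed.

End Density.

(** * Regular representatives *)

Section UniformLimits.
Context {R : realType} (Om : set (R * R)).
Hypothesis bOm : bounded_set Om.
Implicit Types (phi psi : nat -> R * R -> R) (f g : R * R -> R).

Lemma cvgn_dist (u eps : nat -> R) (l : R) : eps n @[n --> \oo] --> (0 : R) ->
  (forall n, `|u n - l| <= eps n) -> u n @[n --> \oo] --> l.
Proof.
move=> ce h; apply/cvgrPdist_le => e e0; near=> n.
rewrite distrC; apply: le_trans (h n) _; near: n.
exact: (cvgr_le _ ce).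
Unshelve. all: by end_near. Qed.

Lemma cvgn0Z (c : R) (u : nat -> R) : u n @[n --> \oo] --> (0 : R) -> c * u n @[n --> \oo] --> (0 : R).
Proof. by move=> cf; rewrite -(mulr0 c); apply: cvgM => //; exact: cvg_cst. Qed.

Lemma mulr_diff_split (a b c d : R) : a * b - c * d = a * (b - d) + (a - c) * d.
Proof. by ring. Qed.

Lemma closure_bound f B : continuous f -> (forall x, Om x -> `|f x| <= B) ->
  forall x, closure Om x -> `|f x| <= B.
Proof.
move=> cf h x cx.
have cl : closed [set y | `|f y| <= B].
  apply: (@closed_comp _ _ (fun y => `|f y|) [set t | t <= B]); last exact: closed_le.
  by move=> y _; apply: cvg_norm; exact: cf.
have := closure_subset h cx; rewrite -(closure_id _).1//.
Qed.

Lemma smooth2_closure_bounded f : smooth2 f -> exists2 B, 0 <= B & forall x, closure Om x -> `|f x| <= B.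
Proof.
move=> sf; have [B B0 hB] := smooth2_bounded bOm sf; exists B => //.
by apply: closure_bound hB; exact: smooth2_continuous.
Qed.

(** The errors are carried by an explicit sequence. The closure includes the boundary, which is how
    traces are reached. *)
Definition unif phi f : Prop :=
  exists eps : nat -> R, [/\ forall n, 0 <= eps n, eps n @[n --> \oo] --> (0 : R) &
    forall n x, closure Om x -> `|phi n x - f x| <= eps n].

Lemma unif_point phi f x : unif phi f -> closure Om x -> phi n x @[n --> \oo] --> f x.
Proof. by move=> [eps [e0 ce h]] cx; apply: (cvgn_dist ce) => n; exact: h. Qed.

Lemma unif_bounded phi f : (forall n, smooth2 (phi n)) -> unif phi f ->
  exists2 B, 0 <= B & forall x, closure Om x -> `|f x| <= B.
Proof.
move=> sp [eps [e0 ce h]]; have [B B0 hB] := smooth2_closure_bounded (sp 0).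
exists (eps 0 + B); first by rewrite addr_ge0.
move=> x cx; rewrite -(subrK (phi 0 x) (f x)); apply: le_trans (ler_normD _ _) _.
by rewrite distrC lerD// ?h// hB.
Qed.

Lemma unif_bounded_all phi f : (forall n, smooth2 (phi n)) -> unif phi f ->
  exists2 B, 0 <= B & forall n x, closure Om x -> `|phi n x| <= B.
Proof.
move=> sp uf; have [B B0 hB] := unif_bounded sp uf; have [eps [e0 ce h]] := uf.
have [E hE] : exists E, forall n, eps n <= E.
  have := cvg_seq_bounded (cvgP _ ce) => -[M [_ hM]].
  exists (`|M| + 1) => n; apply: le_trans (ler_norm _) _; apply: hM => //.
  by rewrite (le_lt_trans (ler_norm M))// ltrDl.
have E0 : 0 <= E by exact: le_trans (hE 0).
exists (E + B); first by rewrite addr_ge0.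
move=> n x cx; rewrite -(subrK (f x) (phi n x)); apply: le_trans (ler_normD _ _) _.
by rewrite lerD ?hB// (le_trans (h n x cx)).
Qed.

Lemma unif_smooth f : unif (fun=> f) f.
Proof.
exists (fun=> 0); split => //; first exact: cvg_cst.
by move=> n x _; rewrite subrr normr0.
Qed.

Lemma unifD phi f psi g : unif phi f -> unif psi g ->
  unif (fun n x => phi n x + psi n x) (fun x => f x + g x).
Proof.
move=> [e [e0 ce he]] [d [d0 cd hd]]; exists (fun n => e n + d n); split.
- by move=> n; rewrite addr_ge0.
- exact: cvgn0D.
- by move=> n x cx; rewrite opprD addrACA (le_trans (ler_normD _ _))// lerD ?he ?hd.
Qed.

Lemma unifM phi f psi g : (forall n, smooth2 (phi n)) -> (forall n, smooth2 (psi n)) ->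
  unif phi f -> unif psi g ->
  unif (fun n x => phi n x * psi n x) (fun x => f x * g x).
Proof.
move=> sp ss uf ug; have [B B0 hB] := unif_bounded sp uf.
have [C C0 hC] := unif_bounded_all ss ug.
move: uf ug => [e [e0 ce he]] [d [d0 cd hd]]; exists (fun n => C * e n + B * d n); split.
- by move=> n; rewrite addr_ge0// mulr_ge0.
- by apply: cvgn0D; exact: cvgn0Z.
- move=> n x cx.
  have -> : phi n x * psi n x - f x * g x = psi n x * (phi n x - f x) + f x * (psi n x - g x) by ring.
  by rewrite (le_trans (ler_normD _ _))// !normrM lerD// ler_pM// ?hB ?hC ?he ?hd.
Qed.

Section Measure.
Variables (mu : {measure set (plane R) -> \bar R}) (D : set (R * R)).
Hypothesis mD : measurable (D : set (plane R)).
Hypothesis fD : (mu D < +oo)%E.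
Hypothesis DOm : D `<=` closure Om.

Lemma unif_measurable phi f : (forall n, smooth2 (phi n)) -> unif phi f ->
  measurable_fun (D : set (plane R)) f.
Proof.
move=> sp uf; apply: (@measurable_fun_cvg _ _ _ _ (fun n => phi n : plane R -> R)).
  by move=> n; apply: continuous_plane_measurable; exact: smooth2_continuous.
by move=> x /DOm cx; exact: unif_point.
Qed.

Lemma smooth2_L2 f : smooth2 f -> L2 mu D f.
Proof.
move=> sf; have [B B0 hB] := smooth2_closure_bounded sf.
apply: (@L2_bounded _ _ _ mD fD _ B).
  by apply: continuous_plane_measurable; exact: smooth2_continuous.
by move=> x /DOm; exact: hB.
Qed.

Lemma unif_L2 phi f : (forall n, smooth2 (phi n)) -> unif phi f -> L2 mu D f.
Proof.
move=> sp uf; have [B B0 hB] := unif_bounded sp uf.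
apply: (@L2_bounded _ _ _ mD fD _ B); first exact: unif_measurable uf.
by move=> x /DOm; exact: hB.
Qed.

Lemma L2_mul_bdd f (g : R * R -> R) B : measurable_fun (D : set (plane R)) f ->
  (forall x, D x -> `|f x| <= B) -> 0 <= B -> L2 mu D g ->
  L2 mu D (fun x => f x * g x) /\ nrm mu D (fun x => f x * g x) <= B * nrm mu D g.
Proof.
move=> mf fB B0 Lg; have LB := L2Z mD B Lg.
have mfg : measurable_fun (D : set (plane R)) (fun x => f x * g x).
  by apply: measurable_funM => //; case: Lg.
have le x : D x -> `|f x * g x| <= `|B * g x|.
  by move=> Dx; rewrite !normrM ler_wpM2r// (ger0_norm B0) fB.
split; first exact: (le_L2 mD mfg LB le).
by rewrite -(ger0_norm B0) -(nrmZ mD B Lg); exact: ler_nrm.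
Qed.

Lemma unif_nrm phi f : (forall n, smooth2 (phi n)) -> unif phi f ->
  nrm mu D (fun x => phi n x - f x) @[n --> \oo] --> (0 : R).
Proof.
move=> sp uf; have Lf := unif_L2 sp uf; have [e [e0 ce he]] := uf.
apply: (squeeze0 _ _ (cvgn0Z (nrm mu D (fun=> 1)) ce)) => n; first exact: nrm_ge0.
rewrite mulrC -(ger0_norm (e0 n)); apply: (nrm_le_bounded mD fD).
  by apply: measurable_funB; [case: (smooth2_L2 (sp n))|case: Lf].
by move=> x /DOm; exact: he.
Qed.

Lemma unif_mul_cvg phi f (g_ : nat -> R * R -> R) g : (forall n, smooth2 (phi n)) -> unif phi f ->
  (forall n, L2 mu D (g_ n)) -> L2 mu D g ->
  nrm mu D (fun x => g_ n x - g x) @[n --> \oo] --> (0 : R) ->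
  nrm mu D (fun x => phi n x * g_ n x - f x * g x) @[n --> \oo] --> (0 : R).
Proof.
move=> sp uf Lg_ Lg cg; have [C C0 hC] := unif_bounded_all sp uf.
have mf := unif_measurable sp uf; have [e [e0 ce he]] := uf.
have mp n : measurable_fun (D : set (plane R)) (phi n) by case: (smooth2_L2 (sp n)).
apply: (squeeze0 _ _ (cvgn0D (cvgn0Z C cg) (cvgn0Z (nrm mu D g) ce))) => n; first exact: nrm_ge0.
have [L1 n1] := @L2_mul_bdd (phi n) _ C (mp n) (fun x Dx => hC n x (DOm Dx)) C0 (L2B mD (Lg_ n) Lg).
have [L2' n2] := @L2_mul_bdd _ g (e n) (measurable_funB (mp n) mf) (fun x Dx => he n x (DOm Dx)) (e0 n) Lg.
rewrite (mulrC _ (e n)); apply: le_trans _ (lerD n1 n2).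
apply: le_trans _ (ler_nrmD mD L1 L2'); rewrite le_eqVlt; apply/orP; left; apply/eqP.
apply: eq_nrm => x _ /=; exact: mulr_diff_split.
Qed.

End Measure.

End UniformLimits.

Lemma nrm_self_cvg (R : realType) (mu : {measure set (plane R) -> \bar R}) (D : set (R * R))
  (mD : measurable (D : set (plane R))) (f : R * R -> R) :
  nrm mu D (fun x => f x - f x) @[_ --> \oo] --> (0 : R).
Proof.
rewrite (_ : nrm mu D (fun x => f x - f x) = 0); first exact: cvg_cst.
rewrite -[RHS](_ : nrm mu D (fun=> 0) = 0); last by apply: nrm0.
by apply: eq_nrm => x _; rewrite subrr.
Qed.

Section Regular.
Context {R : realType} (Om : set (R * R)) (sigma : {measure set (plane R) -> \bar R}).
Hypothesis hOm : smooth_bounded_domain Om.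
Hypothesis hs : arclength_measure Om sigma.
Notation leb := (leb2 R).
Notation L2 := (L2 leb Om).
Notation ip := (ip leb Om).
Notation nrm := (nrm leb Om).
Notation L2b := (Defs.L2 sigma (bd Om)).
Notation ipb := (Defs.ip sigma (bd Om)).
Notation nrmb := (Defs.nrm sigma (bd Om)).
Notation aeqb := (aeq sigma (bd Om)).
Notation aeq := (aeq leb Om).
Notation wD := (wD Om).
Notation i1 := (i1 Om).

Let oOm : open Om. Proof. by case: hOm. Qed.
Let bOm : bounded_set Om. Proof. by case: hOm. Qed.
Let mOm : measurable (Om : set (plane R)). Proof. exact: measurable_dom. Qed.
Let fOm : (leb Om < +oo)%E. Proof. exact: finite_dom. Qed.
Let OmC : Om `<=` closure Om. Proof. exact: subset_closure. Qed.
Let mbd : measurable (bd Om : set (plane R)). Proof. exact: measurable_bd. Qed.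
Let fbd : (sigma (bd Om) < +oo)%E. Proof. exact: finite_bd. Qed.
Let bdC : bd Om `<=` closure Om. Proof. by move=> x []. Qed.
Let sL f : smooth2 f -> L2 f. Proof. exact: L2_smooth2. Qed.

(* Functions of H^1 that are uniform limits on the closed domain of smooth
   functions converging in H^1; they are their own trace on the boundary. *)
Definition reg (z : R * R -> R) : Prop := Hm Om 1 z /\
  exists phi : nat -> R * R -> R, [/\ forall n, smooth2 (phi n), unif Om phi z &
    forall i, nrm (fun x => partial i (phi n) x - wD i z x) @[n --> \oo] --> (0 : R)].

Lemma wder_limit (f_ : nat -> R * R -> R) i f g : (forall n, smooth2 (f_ n)) -> L2 f -> L2 g ->
  nrm (fun x => f_ n x - f x) @[n --> \oo] --> (0 : R) ->
  nrm (fun x => partial i (f_ n) x - g x) @[n --> \oo] --> (0 : R) ->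
  is_weak_derivative Om i f g.
Proof.
move=> sf Lf Lg cf cg; split=> // phi tphi.
have Lp := L2_test oOm bOm tphi; have Lpi := L2_test_partial oOm bOm i tphi.
have c0 (h : R * R -> R) := nrm_self_cvg leb mOm h.
have e n : ip (f_ n) (partial i phi) = - ip (partial i (f_ n)) phi.
  by have [_] := wder_smooth2 oOm bOm i (sf n); apply.
have l1 := ip_cvg mOm (fun n => sL (sf n)) Lf (fun=> Lpi) Lpi cf (c0 _).
have l2 := cvgN (ip_cvg mOm (fun n => sL (smooth2_partial i (sf n))) Lg (fun=> Lp) Lp cg (c0 _)).
have l3 : ip (f_ n) (partial i phi) @[n --> \oo] --> - ip g phi.
  by under eq_fun do rewrite e; exact: l2.
exact: cvg_unique l1 l3.
Qed.

(** Weak derivatives are stable under L^2 limits. The sum and product rules for [reg] are obtained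
    by feeding sums and products of approximating sequences to this lemma. *)
Lemma reg_limit (phi : nat -> R * R -> R) z (g : 'I_2 -> R * R -> R) : (forall n, smooth2 (phi n)) ->
  unif Om phi z -> (forall i, L2 (g i)) ->
  (forall i, nrm (fun x => partial i (phi n) x - g i x) @[n --> \oo] --> (0 : R)) ->
  reg z /\ forall i, aeq (wD i z) (g i).
Proof.
move=> sp uz Lg cg; have Lz := unif_L2 bOm mOm fOm OmC sp uz.
have w i : is_weak_derivative Om i z (g i).
  by apply: (wder_limit sp Lz (Lg i)) => //; exact: (unif_nrm bOm mOm fOm OmC sp uz).
have ae i : aeq (wD i z) (g i) by exact: (wD_aeq oOm bOm (w i)).
split=> //; split; first by split=> // i; exists (g i); split; [exact: w|exact: Lg].
exists phi; split => // i.
have Lw : L2 (wD i z) by have [] := wder_wD (w i).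
have := cg i; apply: cvg_trans; apply: near_eq_cvg; apply: nearW => n.
apply: (aeq_nrm mOm); try by apply: (L2B mOm) => //; apply: sL; exact: smooth2_partial.
by apply: filterS (ae i) => x h Ox; rewrite h.
Qed.

Lemma reg_H1 z : reg z -> Hm Om 1 z. Proof. by case. Qed.

Lemma reg_bounded z : reg z -> exists2 B, 0 <= B & forall x, closure Om x -> `|z x| <= B.
Proof. by move=> [_ [phi [sp uz _]]]; exact: (unif_bounded bOm sp uz). Qed.

Lemma reg_measurable z : reg z -> measurable_fun (Om : set (plane R)) z.
Proof. by move=> [_ [phi [sp uz _]]]; exact: (unif_measurable OmC sp uz). Qed.

Lemma reg_L2 z : reg z -> L2 z. Proof. by move=> /reg_H1/H1_L2. Qed.

Lemma reg_L2wD i z : reg z -> L2 (wD i z). Proof. by move=> /reg_H1/(H1_L2wD i). Qed.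

Lemma reg_L2b z : reg z -> L2b z.
Proof. by move=> [_ [phi [sp uz _]]]; exact: (unif_L2 bOm mbd fbd bdC sp uz). Qed.

Lemma reg_L2M z f : reg z -> L2 f -> L2 (fun x => z x * f x).
Proof.
move=> rz Lf; have [B B0 hB] := reg_bounded rz.
by have [] := L2_mul_bdd mOm (reg_measurable rz) (fun x Ox => hB x (OmC Ox)) B0 Lf.
Qed.

Lemma regM z w : reg z -> reg w -> reg (fun x => z x * w x) /\
  forall i, aeq (wD i (fun x => z x * w x)) (fun x => z x * wD i w x + w x * wD i z x).
Proof.
move=> rz rw; have [_ [phi [sp uz cz]]] := rz; have [_ [psi [ss uw cw]]] := rw.
apply: (@reg_limit (fun n x => phi n x * psi n x)).
- by move=> n; exact: smooth2M.
- exact: (unifM bOm sp ss uz uw).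
- by move=> i; apply: (L2D mOm); apply: reg_L2M => //; exact: reg_L2wD.
- move=> i; have Lzi := reg_L2wD i rz; have Lwi := reg_L2wD i rw.
  have c1 := unif_mul_cvg bOm mOm fOm OmC sp uz (fun n => sL (smooth2_partial i (ss n))) Lwi (cw i).
  have c2 := unif_mul_cvg bOm mOm fOm OmC ss uw (fun n => sL (smooth2_partial i (sp n))) Lzi (cz i).
  apply: (squeeze0 _ _ (cvgn0D c1 c2)) => n; first exact: nrm_ge0.
  have La : L2 (fun x => phi n x * partial i (psi n) x - z x * wD i w x).
    by apply: (L2B mOm); [apply: sL; apply: smooth2M => //; exact: smooth2_partial|exact: reg_L2M].
  have Lb : L2 (fun x => psi n x * partial i (phi n) x - w x * wD i z x).
    by apply: (L2B mOm); [apply: sL; apply: smooth2M => //; exact: smooth2_partial|exact: reg_L2M].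
  apply: le_trans _ (ler_nrmD mOm La Lb); rewrite le_eqVlt; apply/orP; left; apply/eqP.
  apply: eq_nrm => x _; rewrite (smooth2_partialM i (sp n) (ss n)).
  by rewrite opprD addrACA.
Qed.

Lemma regD z w : reg z -> reg w -> reg (fun x => z x + w x).
Proof.
move=> rz rw; have [_ [phi [sp uz cz]]] := rz; have [_ [psi [ss uw cw]]] := rw.
suff [] : reg (fun x => z x + w x) /\ forall i, aeq (wD i (fun x => z x + w x)) (fun x => wD i z x + wD i w x) by [].
apply: (@reg_limit (fun n x => phi n x + psi n x)).
- by move=> n; exact: smooth2D.
- exact: unifD.
- by move=> i; apply: (L2D mOm); exact: reg_L2wD.
- move=> i; have Lzi := reg_L2wD i rz; have Lwi := reg_L2wD i rw.
  apply: (squeeze0 _ _ (cvgn0D (cz i) (cw i))) => n; first exact: nrm_ge0.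
  have La := L2B mOm (sL (smooth2_partial i (sp n))) Lzi; have Lb := L2B mOm (sL (smooth2_partial i (ss n))) Lwi.
  apply: le_trans _ (ler_nrmD mOm La Lb); rewrite le_eqVlt; apply/orP; left; apply/eqP.
  apply: eq_nrm => x _; rewrite (smooth2_partialD i (sp n) (ss n)).
  by rewrite opprD addrACA.
Qed.

Lemma reg_smooth2 f : smooth2 f -> reg f.
Proof.
move=> sf; have [] // := @reg_limit (fun=> f) f (fun i => partial i f).
- exact: unif_smooth.
- by move=> i; apply: sL; exact: smooth2_partial.
- by move=> i; exact: (nrm_self_cvg leb mOm).
Qed.

Lemma regZ c z : reg z -> reg (fun x => c * z x).
Proof. by move=> rz; have [] := regM (reg_smooth2 (smooth2_cst c)) rz. Qed.

Lemma regB z w : reg z -> reg w -> reg (fun x => z x - w x).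
Proof.
move=> rz rw; have := regD rz (regZ (-1) rw).
by rewrite (_ : (fun x => z x + -1 * w x) = (fun x => z x - w x))// funeqE => x; rewrite mulN1r.
Qed.

Lemma i1_le f : L2 f -> i1 f <= nrm f * nrm (fun=> 1).
Proof.
move=> Lf; rewrite -(nrm_abs leb Om f); apply: (le_ip_nrm mOm); first exact: L2_abs.
exact: (L2_cst mOm fOm).
Qed.

Lemma i1_mul f g : L2 f -> L2 g -> i1 (fun x => f x * g x) <= nrm f * nrm g.
Proof.
move=> Lf Lg; rewrite -(nrm_abs leb Om f) -(nrm_abs leb Om g).
apply: le_trans (le_ip_nrm mOm (L2_abs mOm Lf) (L2_abs mOm Lg)).
rewrite le_eqVlt; apply/orP; left; apply/eqP.
by apply: eq_Rintegral => x _; rewrite mulr1 normrM.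
Qed.

Lemma i1_cvg (f_ : nat -> R * R -> R) f : (forall n, L2 (f_ n)) -> L2 f ->
  nrm (fun x => f_ n x - f x) @[n --> \oo] --> (0 : R) -> i1 (f_ n) @[n --> \oo] --> i1 f.
Proof.
move=> Lf_ Lf cf; have L1 : L2 (fun=> 1) by exact: (L2_cst mOm fOm).
apply: (ip_cvg mOm (fun n => L2_abs mOm (Lf_ n)) (L2_abs mOm Lf) (fun=> L1) L1).
  apply: (squeeze0 _ _ cf) => n; first exact: nrm_ge0.
  apply: (ler_nrm mOm); last 1 first.
  - by move=> x _; exact: ler_dist_dist.
  - by case: (L2B mOm (L2_abs mOm (Lf_ n)) (L2_abs mOm Lf)).
  - exact: (L2B mOm).
exact: (nrm_self_cvg leb mOm (fun=> 1)).
Qed.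

(** The Gagliardo inequality passed to the limit; applied to squares and cubes it yields the L^4 and
    L^6 bounds. *)
Lemma reg_nrm_le : exists2 C : R, 0 <= C & forall z, reg z ->
  nrm z <= C * (i1 z + i1 (wD 0 z) + i1 (wD 1 z)).
Proof.
have [C C0 hC] := smooth_estimates hOm hs; exists C => // z rz.
have [_ [phi [sp uz cz]]] := rz; have Lz := reg_L2 rz.
have cp := unif_nrm bOm mOm fOm OmC sp uz.
have l1 := nrm_cvg_lim mOm (fun n => sL (sp n)) Lz cp.
have Li i := i1_cvg (fun n => sL (smooth2_partial i (sp n))) (reg_L2wD i rz) (cz i).
have l2 : C * I1 Om (phi n) @[n --> \oo] --> C * (i1 z + i1 (wD 0 z) + i1 (wD 1 z)).
  apply: cvgM; first exact: cvg_cst.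
  by apply: cvgD; [apply: cvgD; [exact: (i1_cvg (fun n => sL (sp n)) Lz cp)|exact: Li]|exact: Li].
by apply: (ler_cvg_to l1 l2); apply: nearW => n; have [] := hC _ (sp n).
Qed.

(** Uniform convergence on the boundary carries the divergence bound over with its constant sqrt
    2. *)
Lemma reg_div z : reg z ->
  `|ip (fun x => wD 0 z x + wD 1 z x) (fun=> 1)| <= Num.sqrt 2 * ipb (fun x => `|z x|) (fun=> 1).
Proof.
move=> rz; have [C C0 hC] := smooth_estimates hOm hs.
have [_ [phi [sp uz cz]]] := rz; have Lb := reg_L2b rz.
have L1 : L2 (fun=> 1) by exact: (L2_cst mOm fOm).
have L1b : L2b (fun=> 1) by exact: (L2_cst mbd fbd).
have c0 := nrm_self_cvg leb mOm (fun=> 1).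
have c0b := nrm_self_cvg sigma mbd (fun=> 1).
have Lp i n := sL (smooth2_partial i (sp n)).
have Lpb n : L2b (phi n) by exact: (smooth2_L2 bOm mbd fbd bdC (sp n)).
have l1 : divg Om (phi n) @[n --> \oo] --> ip (fun x => wD 0 z x + wD 1 z x) (fun=> 1).
  apply: (ip_cvg mOm (fun n => L2D mOm (Lp 0 n) (Lp 1 n)) _ (fun=> L1) L1 _ c0).
    exact: (L2D mOm (reg_L2wD 0 rz) (reg_L2wD 1 rz)).
  apply: (squeeze0 _ _ (cvgn0D (cz 0) (cz 1))) => n; first exact: nrm_ge0.
  have La i := L2B mOm (Lp i n) (reg_L2wD i rz).
  apply: le_trans _ (ler_nrmD mOm (La 0) (La 1)); rewrite le_eqVlt; apply/orP; left; apply/eqP.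
  by apply: eq_nrm => x _; rewrite opprD addrACA.
have l2 : ipb (fun x => `|phi n x|) (fun=> 1) @[n --> \oo] --> ipb (fun x => `|z x|) (fun=> 1).
  apply: (ip_cvg mbd (fun n => L2_abs mbd (Lpb n)) (L2_abs mbd Lb) (fun=> L1b) L1b _ c0b).
  apply: (squeeze0 _ _ (unif_nrm bOm mbd fbd bdC sp uz)) => n; first exact: nrm_ge0.
  apply: (ler_nrm mbd); last 1 first.
  - by move=> x _; exact: ler_dist_dist.
  - by case: (L2B mbd (L2_abs mbd (Lpb n)) (L2_abs mbd Lb)).
  - exact: (L2B mbd (Lpb n) Lb).
have l3 : Num.sqrt 2 * ipb (fun x => `|phi n x|) (fun=> 1) @[n --> \oo] --> Num.sqrt 2 * ipb (fun x => `|z x|) (fun=> 1).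
  by apply: cvgM; [exact: cvg_cst|exact: l2].
have l4 : `|divg Om (phi n)| @[n --> \oo] --> `|ip (fun x => wD 0 z x + wD 1 z x) (fun=> 1)| by exact: cvg_norm l1.
apply: (ler_cvg_to l4 l3); apply: nearW => n.
have [_ _ _] := hC _ (sp n); rewrite -lee_fin => h; apply: le_trans h _.
rewrite EFinM; apply: lee_wpmul2l; first by rewrite lee_fin sqrtr_ge0.
rewrite /Defs.ip /Rintegral; under [in leRHS]eq_integral do rewrite mulr1.
rewrite fineK//; apply: integrable_fin_num => //.
by apply: (L2_integrable mbd fbd); exact: L2_abs.
Qed.

End Regular.

(** * Representatives of functions of H^2, traces and L^4 bounds *)

Section RegularOfH2.
Context {R : realType} (Om : set (R * R)) (sigma : {measure set (plane R) -> \bar R}).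
Hypothesis hOm : smooth_bounded_domain Om.
Hypothesis hs : arclength_measure Om sigma.
Notation leb := (leb2 R).
Notation L2 := (L2 leb Om).
Notation ip := (ip leb Om).
Notation nrm := (nrm leb Om).
Notation L2b := (Defs.L2 sigma (bd Om)).
Notation nrmb := (Defs.nrm sigma (bd Om)).
Notation aeqb := (aeq sigma (bd Om)).
Notation aeq := (aeq leb Om).
Notation wD := (wD Om).
Notation i1 := (i1 Om).
Notation reg := (reg Om).
Local Opaque Defs.wD Defs.ip Defs.nrm.

Let oOm : open Om. Proof. by case: hOm. Qed.
Let bOm : bounded_set Om. Proof. by case: hOm. Qed.
Let mOm : measurable (Om : set (plane R)). Proof. exact: measurable_dom. Qed.
Let fOm : (leb Om < +oo)%E. Proof. exact: finite_dom. Qed.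
Let OmC : Om `<=` closure Om. Proof. exact: subset_closure. Qed.
Let mbd : measurable (bd Om : set (plane R)). Proof. exact: measurable_bd. Qed.
Let fbd : (sigma (bd Om) < +oo)%E. Proof. exact: finite_bd. Qed.
Let bdC : bd Om `<=` closure Om. Proof. by move=> x []. Qed.
Let sL f : smooth2 f -> L2 f. Proof. exact: L2_smooth2. Qed.

Lemma nine_sum (x1 x2 x3 x4 x5 x6 x7 x8 x9 a1 a2 a3 a4 a5 a6 a7 a8 a9 b1 b2 b3 b4 b5 b6 b7 b8 b9 c : R) :
  x1 <= (a1 + b1) * c -> x2 <= (a2 + b2) * c -> x3 <= (a3 + b3) * c -> x4 <= (a4 + b4) * c ->
  x5 <= (a5 + b5) * c -> x6 <= (a6 + b6) * c -> x7 <= (a7 + b7) * c -> x8 <= (a8 + b8) * c ->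
  x9 <= (a9 + b9) * c ->
  x1 + x2 + x3 + (x4 + x5 + x6) + (x7 + x8 + x9) <=
  (a1 + a2 + a3 + (a4 + a5 + a6) + (a7 + a8 + a9) + (b1 + b2 + b3 + (b4 + b5 + b6) + (b7 + b8 + b9))) * c.
Proof. by rewrite !mulrDl; lra. Qed.

Lemma mul2r_double (a b : R) : a * b + a * b = 2 * a * b.
Proof. by ring. Qed.

Lemma ord2P (i : 'I_2) : i = 0 \/ i = 1.
Proof. by case: i => -[|[|//]] h; [left|right]; exact: val_inj. Qed.

Lemma sqrt_sum3_le (a b c : R) : 0 <= a -> 0 <= b -> 0 <= c ->
  Num.sqrt (a ^+ 2 + (c ^+ 2 + b ^+ 2)) <= a + b + c.
Proof.
move=> a0 b0 c0; have s0 : 0 <= a + b + c by lra.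
rewrite -[leRHS]ger0_norm// -sqrtr_sqr ler_wsqrtr//.
have := mulr_ge0 a0 b0; have := mulr_ge0 a0 c0; have := mulr_ge0 b0 c0; nra.
Qed.

Lemma le_sqrt_mul (x a c : R) : 0 <= x -> 0 <= a -> 0 <= c -> x ^+ 2 <= c * a ^+ 2 -> x <= Num.sqrt c * a.
Proof.
move=> x0 a0 c0 h; rewrite -(ger0_norm a0) -sqrtr_sqr -sqrtrM// -(ger0_norm x0) -sqrtr_sqr.
exact: ler_wsqrtr.
Qed.

Lemma le_sum3_eq (x a b c a' b' c' : R) : x <= a + b + c -> a = a' -> b = b' -> c = c' -> x <= a' + b' + c'.
Proof. by move=> h <- <- <-. Qed.

Lemma cube_sum_le (s t x d0 d1 : R) : x <= s * t -> forall y0 y1, y0 <= 3 * s * d0 -> y1 <= 3 * s * d1 ->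
  x + y0 + y1 <= s * (t + 3 * d0 + 3 * d1).
Proof. by move=> hx y0 y1 h0 h1; rewrite !mulrDr; lra. Qed.

Lemma five_sqr (x y t a : R) : 0 <= x -> 0 <= y -> 0 <= t -> x <= a -> y <= a -> t <= a ->
  x * x + 2 * x * y + 2 * x * t <= 5 * a ^+ 2.
Proof.
move=> x0 y0 t0 xa ya ta.
have := ler_pM x0 x0 xa xa; have := ler_pM x0 y0 xa ya; have := ler_pM x0 t0 xa ta.
rewrite expr2; lra.
Qed.

Lemma cst_le0 (a : R) (u : nat -> R) : u n @[n --> \oo] --> (0 : R) -> (forall n, a <= u n) -> a <= 0.
Proof.
move=> cu h; apply: (ler_cvg_to (cvg_cst a) cu).
by apply: nearW => n; exact: h.
Qed.

Lemma i1_dist f g h : L2 f -> L2 g -> L2 h ->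
  i1 (fun x => f x - h x) <= (nrm (fun x => f x - g x) + nrm (fun x => h x - g x)) * nrm (fun=> 1).
Proof.
move=> Lf Lg Lh; apply: le_trans (i1_le hOm (L2B mOm Lf Lh)) _.
apply: ler_wpM2r; first exact: nrm_ge0.
by rewrite (nrmBC _ _ h); exact: (ler_nrm_tri mOm Lf Lg Lh).
Qed.

Lemma i1_aeq f g : L2 f -> L2 g -> aeq f g -> i1 f = i1 g.
Proof.
move=> Lf Lg fg; have L1 : L2 (fun=> 1) by exact: (L2_cst mOm fOm).
apply: (aeq_ip mOm (L2_abs mOm Lf) L1 (L2_abs mOm Lg) L1 _ (aeq_refl _ _ _)).
by apply: filterS fg => x h Ox; rewrite h.
Qed.

(** The sup bound by the W^{2,1} norm makes a sequence that converges in H^2 uniformly Cauchy, up to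
    the boundary by continuity. Its limit is the representative. *)
Lemma H2_reg z : Hm Om 2 z -> exists zb, reg zb /\ aeq z zb.
Proof.
move=> Hz; have H1z := H2_H1 Hz; have Lz := H1_L2 H1z.
have [phi [sp cz ci /(_ Hz) cij]] := density hOm H1z.
have [C C0 hC] := smooth_estimates hOm hs.
pose e0 n := nrm (fun x => phi n x - z x).
pose e1 i n := nrm (fun x => partial i (phi n) x - wD i z x).
pose e2 i j n := nrm (fun x => partial j (partial i (phi n)) x - wD j (wD i z) x).
pose E n := e0 n + e1 0 n + e1 1 n + (e1 0 n + e2 0 0 n + e2 0 1 n) + (e1 1 n + e2 1 0 n + e2 1 1 n).
pose c := nrm (fun=> 1).
have cE : E n @[n --> \oo] --> (0 : R) by do !apply: cvgn0D; [exact: cz|exact: ci|exact: ci|exact: ci|exact: cij|exact: cij|exact: ci|exact: cij|exact: cij].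
have E0 n : 0 <= E n by rewrite /E; do !apply: addr_ge0; exact: nrm_ge0.
have I2E n m : I2 Om (fun x => phi n x - phi m x) <= (E n + E m) * c.
  have Hi i := H2_wD oOm bOm i Hz.
  have s1 i k := smooth2_partial i (sp k).
  have L1 i := H1_L2wD i H1z; have L2' i j := H1_L2wD j (Hi i).
  rewrite /I2 /I1 (smooth2_partialB 0 (sp n) (sp m)) (smooth2_partialB 1 (sp n) (sp m)).
  rewrite (smooth2_partialB 0 (s1 0 n) (s1 0 m)) (smooth2_partialB 1 (s1 0 n) (s1 0 m)).
  rewrite (smooth2_partialB 0 (s1 1 n) (s1 1 m)) (smooth2_partialB 1 (s1 1 n) (s1 1 m)).
  have s2 i j k := smooth2_partial j (s1 i k).
  have D0 := i1_dist (sL (sp n)) Lz (sL (sp m)).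
  have D1 i := i1_dist (sL (s1 i n)) (L1 i) (sL (s1 i m)).
  have D2 i j := i1_dist (sL (s2 i j n)) (L2' i j) (sL (s2 i j m)).
  exact: (nine_sum D0 (D1 0) (D1 1) (D1 0) (D2 0 0) (D2 0 1) (D1 1) (D2 1 0) (D2 1 1)).
pose d n := C * c * E n.
have d0 n : 0 <= d n by rewrite /d; do !apply: mulr_ge0 => //; exact: nrm_ge0.
have cd : d n @[n --> \oo] --> (0 : R) by exact: cvgn0Z.
have dist n m x : closure Om x -> `|phi n x - phi m x| <= d n + d m.
  apply: (@closure_bound _ Om (fun x => phi n x - phi m x)).
    by apply: smooth2_continuous; exact: smooth2B.
  move=> y Oy; have [_ _ /(_ y Oy) h _] := hC _ (smooth2B (sp n) (sp m)).
  apply: le_trans h _; rewrite /d -mulrDr -mulrA; apply: ler_wpM2l => //.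
  by rewrite mulrC; exact: I2E.
have cauchyP x : closure Om x -> cvgn (fun n => phi n x).
  move=> cx; apply: cauchy_cvg; apply: cauchy_exP => e e_gt0.
  have e2_gt0 : 0 < e / 2 by rewrite divr_gt0.
  have [N _ hN] := cvgr_lt _ cd _ e2_gt0.
  exists (phi N x).
  have h : \forall n \near \oo, `|phi N x - phi n x| < e.
    exists N => // n /= Nn; apply: le_lt_trans (dist N n x cx) _.
    by rewrite (splitr e) ltrD//; [exact: hN (leqnn N)|exact: hN].
  exact: h.
pose zb x := lim (phi n x @[n --> \oo]).
have uz : unif Om phi zb.
  exists d; split => // n x cx.
  have l1 : phi m x @[m --> \oo] --> zb x by exact: cauchyP.
  have l2 : `|phi n x - phi m x| @[m --> \oo] --> `|phi n x - zb x|.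
    by apply: cvg_norm; apply: cvgB; [exact: cvg_cst|exact: l1].
  have l3 : d n + d m @[m --> \oo] --> d n + 0 by apply: cvgD; [exact: cvg_cst|exact: cd].
  rewrite -[leRHS]addr0; apply: (ler_cvg_to l2 l3); apply: nearW => m; exact: dist.
have [rz _] := reg_limit hOm sp uz (fun i => H1_L2wD i H1z) ci.
exists zb; split=> //.
have Lzb := reg_L2 rz; have cu := unif_nrm bOm mOm fOm OmC sp uz.
apply: (nrmB0_aeq mOm Lz Lzb); apply/eqP; rewrite eq_le nrm_ge0 andbT.
apply: (cst_le0 (cvgn0D cz cu)) => n; rewrite (nrmBC _ _ (phi n) z).
exact: (ler_nrm_tri mOm Lz (sL (sp n)) Lzb).
Qed.

Lemma sum_multi_indices1 (F : nat -> nat -> R) :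
  \sum_(k < 2) \sum_(j < k.+1) F k j = F 0 0 + (F 1 0 + F 1 1).
Proof. by rewrite !big_ord_recl !big_ord0 !addr0. Qed.

Lemma hnorm1E f : hnorm Om 1 f =
  Num.sqrt (nrm f ^+ 2 + (nrm (wD 1 f) ^+ 2 + nrm (wD 0 f) ^+ 2)).
Proof.
exact: (congr1 Num.sqrt (sum_multi_indices1 (fun k j => nrm (iter j (wD 0) (iter (k - j) (wD 1) f)) ^+ 2))).
Qed.

Lemma le_sqrt_sum3 (a b c : R) : 0 <= a -> 0 <= b -> 0 <= c ->
  [/\ a <= Num.sqrt (a ^+ 2 + (b ^+ 2 + c ^+ 2)), b <= Num.sqrt (a ^+ 2 + (b ^+ 2 + c ^+ 2))
    & c <= Num.sqrt (a ^+ 2 + (b ^+ 2 + c ^+ 2))].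
Proof.
move=> a0 b0 c0; have h x y : 0 <= x -> x ^+ 2 <= y -> x <= Num.sqrt y.
  by move=> x0 xy; rewrite -[leLHS]ger0_norm// -sqrtr_sqr ler_wsqrtr.
have := sqr_ge0 a; have := sqr_ge0 b; have := sqr_ge0 c.
by split; apply: h => //; lra.
Qed.

Lemma nrm_le_hnorm1 f : nrm f <= hnorm Om 1 f.
Proof.
rewrite hnorm1E; have [h _ _] := le_sqrt_sum3 (nrm_ge0 leb Om f) (nrm_ge0 leb Om (wD 1 f)) (nrm_ge0 leb Om (wD 0 f)).
exact: h.
Qed.

Lemma nrm_wD_le_hnorm1 i f : nrm (wD i f) <= hnorm Om 1 f.
Proof.
rewrite hnorm1E; have [_ h1 h0] := le_sqrt_sum3 (nrm_ge0 leb Om f) (nrm_ge0 leb Om (wD 1 f)) (nrm_ge0 leb Om (wD 0 f)).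
by case: (ord2P i) => ->; [exact: h0|exact: h1].
Qed.

Lemma hnorm1_le f : hnorm Om 1 f <= nrm f + nrm (wD 0 f) + nrm (wD 1 f).
Proof.
rewrite hnorm1E; exact: (sqrt_sum3_le (nrm_ge0 _ _ _) (nrm_ge0 _ _ _) (nrm_ge0 _ _ _)).
Qed.

Lemma wD_congr i z w : Hm Om 1 z -> L2 w -> aeq z w -> aeq (wD i z) (wD i w).
Proof.
move=> Hz Lw zw; apply: aeq_sym; apply: (wD_aeq oOm bOm).
apply: (wder_aeq oOm bOm (H1_L2 Hz) Lw (H1_L2wD i Hz) zw (aeq_refl _ _ _)).
exact: H1_wder.
Qed.

Lemma I1_sqr psi : smooth2 psi -> I1 Om (fun x => psi x * psi x) <=
  nrm psi * nrm psi + 2 * nrm psi * nrm (partial 0 psi) + 2 * nrm psi * nrm (partial 1 psi).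
Proof.
move=> sp; have Lp := sL sp; have Li i := sL (smooth2_partial i sp).
have h i : i1 (partial i (fun x => psi x * psi x)) <= 2 * nrm psi * nrm (partial i psi).
  have -> : partial i (fun x => psi x * psi x) = (fun x => (2 * psi x) * partial i psi x).
    by rewrite (smooth2_partialM i sp sp) funeqE => x; rewrite mul2r_double.
  apply: le_trans (i1_mul hOm (L2Z mOm 2 Lp) (Li i)) _.
  by rewrite (nrmZ mOm 2 Lp) ger0_norm.
by rewrite /I1; apply: lerD; [apply: lerD; [exact: i1_mul|exact: h]|exact: h].
Qed.

(** The W^{1,1} trace bound applied to psi^2; the factor 5 counts 1 + 2 + 2 for the square and its
    two derivatives. *)
Lemma trace_smooth : exists2 C : R, 0 <= C & forall psi (a : R), smooth2 psi ->
  nrm psi <= a -> nrm (partial 0 psi) <= a -> nrm (partial 1 psi) <= a -> nrmb psi <= C * a.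
Proof.
have [C C0 hC] := smooth_estimates hOm hs; exists (Num.sqrt (C * 5)); first exact: sqrtr_ge0.
move=> psi a sp pa p0a p1a.
have a0 : 0 <= a by apply: le_trans pa; exact: nrm_ge0.
have Lb : L2b psi by exact: (smooth2_L2 bOm mbd fbd bdC sp).
suff h2 : nrmb psi ^+ 2 <= C * 5 * a ^+ 2.
  exact: (le_sqrt_mul (nrm_ge0 _ _ _) a0 (mulr_ge0 C0 (ler0n _ 5)) h2).
rewrite -lee_fin (nrm_EFin mbd Lb).
have [_ h _ _] := hC _ (smooth2M sp sp).
have -> : (\int[sigma]_(x in bd Om) (psi x ^+ 2)%:E = \int[sigma]_(p in bd Om) (`|psi p * psi p|)%:E)%E.
  by apply: eq_integral => x _; rewrite normrM -expr2 sqr_normr.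
apply: le_trans h _; rewrite lee_fin -mulrA; apply: ler_wpM2l => //.
apply: le_trans (I1_sqr sp) _.
by apply: five_sqr => //; exact: nrm_ge0.
Qed.

(** On the boundary, two approximating sequences are compared by [trace_smooth], because both
    converge to [u] in H^1. *)
Lemma trace_unique u g g' : Hm Om 1 u -> is_trace Om sigma u g -> is_trace Om sigma u g' -> aeqb g g'.
Proof.
move=> Hu [Lg [phi [sp ch cg]]] [Lg' [psi [ss dh dg]]].
have [C C0 hC] := trace_smooth; have Lu := H1_L2 Hu.
pose a n := hnorm Om 1 (fun x => phi n x - u x) + hnorm Om 1 (fun x => psi n x - u x).
have ca : C * a n @[n --> \oo] --> (0 : R) by apply: cvgn0Z; exact: cvgn0D.
have Lp n : L2b (phi n) by exact: (smooth2_L2 bOm mbd fbd bdC (sp n)).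
have Ls n : L2b (psi n) by exact: (smooth2_L2 bOm mbd fbd bdC (ss n)).
apply: (nrmB0_aeq mbd Lg Lg'); apply/eqP; rewrite eq_le nrm_ge0 andbT.
apply: (cst_le0 (cvgn0D cg (cvgn0D ca dg))) => n.
apply: le_trans (ler_nrm_tri mbd Lg (Lp n) Lg') _; rewrite (nrmBC _ _ g (phi n)) lerD2l.
apply: le_trans (ler_nrm_tri mbd (Lp n) (Ls n) Lg') _; rewrite lerD2r.
have nh f : smooth2 f -> forall i, nrm (fun x => partial i f x - wD i u x) <= hnorm Om 1 (fun x => f x - u x).
  move=> sf i; have Hf := H1_smooth2 oOm bOm sf.
  apply: le_trans (nrm_wD_le_hnorm1 i (fun x => f x - u x)).
  rewrite le_eqVlt; apply/orP; left; apply/eqP; apply: (aeq_nrm mOm).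
  - exact: (L2B mOm (sL (smooth2_partial i sf)) (H1_L2wD i Hu)).
  - by apply: H1_L2wD; exact: H1B.
  - apply: aeq_sym; apply: aeq_trans (wD_B oOm bOm i Hf Hu) _.
    by apply: filterS (wD_smooth2 oOm bOm i sf) => x hx Ox; rewrite hx.
have hi i : nrm (partial i (fun x => phi n x - psi n x)) <= a n.
  rewrite (smooth2_partialB i (sp n) (ss n)).
  apply: le_trans (ler_nrm_tri mOm (sL (smooth2_partial i (sp n))) (H1_L2wD i Hu) (sL (smooth2_partial i (ss n)))) _.
  by rewrite (nrmBC _ _ (wD i u)); apply: lerD; exact: nh.
apply: hC => //; first exact: smooth2B.
apply: le_trans (ler_nrm_tri mOm (sL (sp n)) Lu (sL (ss n))) _.
by rewrite (nrmBC _ _ u); apply: lerD; exact: nrm_le_hnorm1.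
Qed.

Lemma reg_is_trace u z : Hm Om 1 u -> reg z -> aeq u z -> is_trace Om sigma u z.
Proof.
move=> Hu rz uz; have [_ [phi [sp unz cz]]] := rz; split; first exact: (reg_L2b hOm hs rz).
have Lz := reg_L2 rz; have Lu := H1_L2 Hu.
exists phi; split => //; last exact: (unif_nrm bOm mbd fbd bdC sp unz).
have cu := unif_nrm bOm mOm fOm OmC sp unz.
have h0 n : 0 <= hnorm Om 1 (fun x => phi n x - u x) by exact: sqrtr_ge0.
apply: (squeeze0 h0 _ (cvgn0D (cvgn0D cu (cz 0)) (cz 1))) => n.
have Hp := H1_smooth2 oOm bOm (sp n).
have e i : nrm (wD i (fun x => phi n x - u x)) = nrm (fun x => partial i (phi n) x - wD i z x).
  apply: (aeq_nrm mOm).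
  - by apply: H1_L2wD; exact: H1B.
  - exact: (L2B mOm (sL (smooth2_partial i (sp n))) (reg_L2wD i rz)).
  - apply: aeq_trans (wD_B oOm bOm i Hp Hu) _.
    by apply: filterS2 (wD_smooth2 oOm bOm i (sp n)) (wD_congr i Hu Lz uz) => x h1 h2 Ox; rewrite h1// h2.
have e' : nrm (fun x => phi n x - u x) = nrm (fun x => phi n x - z x).
  apply: (aeq_nrm mOm (L2B mOm (sL (sp n)) Lu) (L2B mOm (sL (sp n)) Lz)).
  by apply: filterS uz => x h Ox; rewrite h.
exact: (le_sum3_eq (hnorm1_le (fun x => phi n x - u x)) e' (e 0) (e 1)).
Qed.

(** Existence of some trace makes the choice in [tr] a trace, and uniqueness identifies it with the
    restriction of the representative. *)
Lemma tr_reg u z : Hm Om 1 u -> reg z -> aeq u z ->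
  L2b (tr Om sigma u) /\ aeqb (tr Om sigma u) z.
Proof.
move=> Hu rz uz; have h := reg_is_trace Hu rz uz.
have ht : is_trace Om sigma u (tr Om sigma u).
  exact: (@xgetPex _ (fun=> 0) [set g | is_trace Om sigma u g] (ex_intro _ z h)).
by split; [case: ht|exact: trace_unique ht h].
Qed.

(** Gagliardo for z^2, whose gradient is 2 z grad z: Ladyzhenskaya's inequality for the L^4 norm. *)
Lemma reg_sqr : exists2 C : R, 0 <= C & forall z, reg z ->
  nrm (fun x => z x * z x) <= C * (nrm z * nrm z + 2 * nrm z * nrm (wD 0 z) + 2 * nrm z * nrm (wD 1 z)).
Proof.
have [C C0 hC] := reg_nrm_le hOm hs; exists C => // z rz.
have [r2 d2] := regM hOm rz rz; have Lz := reg_L2 rz.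
apply: le_trans (hC _ r2) _; apply: ler_wpM2l => //.
have h i : i1 (wD i (fun x => z x * z x)) <= 2 * nrm z * nrm (wD i z).
  have Li := reg_L2wD i rz.
  have e : aeq (wD i (fun x => z x * z x)) (fun x => (2 * z x) * wD i z x).
    by apply: filterS (d2 i) => x hx Ox; rewrite hx// mul2r_double.
  have L' : L2 (fun x => (2 * z x) * wD i z x) by exact: (reg_L2M hOm (regZ hOm 2 rz) Li).
  rewrite (i1_aeq (reg_L2wD i r2) L' e).
  apply: le_trans (i1_mul hOm (L2Z mOm 2 Lz) Li) _.
  by rewrite (nrmZ mOm 2 Lz) ger0_norm.
by apply: lerD; [apply: lerD; [exact: i1_mul|exact: h]|exact: h].
Qed.

(** Gagliardo for z^3, whose gradient is 3 z^2 grad z. *)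
Lemma reg_cube : exists2 C : R, 0 <= C & forall z, reg z ->
  nrm (fun x => z x * (z x * z x)) <= C * (nrm (fun x => z x * z x) *
     (nrm z + 3 * nrm (wD 0 z) + 3 * nrm (wD 1 z))).
Proof.
have [C C0 hC] := reg_nrm_le hOm hs; exists C => // z rz.
have [r2 d2] := regM hOm rz rz; have [r3 d3] := regM hOm rz r2; have Lz := reg_L2 rz; have L2' := reg_L2 r2.
apply: le_trans (hC _ r3) _; apply: ler_wpM2l => //.
have h i : i1 (wD i (fun x => z x * (z x * z x))) <= 3 * nrm (fun x => z x * z x) * nrm (wD i z).
  have Li := reg_L2wD i rz.
  have e : aeq (wD i (fun x => z x * (z x * z x))) (fun x => (3 * (z x * z x)) * wD i z x).
    by apply: filterS2 (d2 i) (d3 i) => x h2 h3 Ox; rewrite h3// h2//; ring.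
  have L' : L2 (fun x => (3 * (z x * z x)) * wD i z x) by exact: (reg_L2M hOm (regZ hOm 3 r2) Li).
  rewrite (i1_aeq (reg_L2wD i r3) L' e).
  apply: le_trans (i1_mul hOm (L2Z mOm 3 L2') Li) _.
  by rewrite (nrmZ mOm 3 L2') ger0_norm.
have h' : i1 (fun x => z x * (z x * z x)) <= nrm (fun x => z x * z x) * nrm z.
  by rewrite mulrC; exact: i1_mul.
exact: (cube_sum_le h' (h 0) (h 1)).
Qed.

(** Cauchy-Schwarz gives |z g|^2 <= |z^2| |g^2|, and |g^2| is bounded by Gagliardo along a smooth
    approximation, since [g] itself need not be [reg]. It serves for [g] a derivative of the steady
    state. *)
Lemma H1_mul_L4 g : Hm Om 1 g -> exists2 K : R, 0 <= K & forall z, reg z ->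
  nrm (fun x => z x * g x) ^+ 2 <= K * nrm (fun x => z x * z x).
Proof.
move=> Hg; have Lg := H1_L2 Hg; have [phi [sp cg ci _]] := density hOm Hg.
have [C C0 hC] := smooth_estimates hOm hs.
have bounded (u : nat -> R) (l : R) : u n @[n --> \oo] --> l -> exists2 M, 0 <= M & forall n, u n <= M.
  move=> cu; have [M [_ hM]] := cvg_seq_bounded (cvgP _ cu).
  exists (`|M| + 1); first by rewrite addr_ge0.
  move=> n; apply: le_trans (ler_norm _) _; apply: hM => //.
  by rewrite (le_lt_trans (ler_norm M))// ltrDl.
have [A A0 hA] := bounded _ _ (nrm_cvg_lim mOm (fun n => sL (sp n)) Lg cg).
have hB i := bounded _ _ (nrm_cvg_lim mOm (fun n => sL (smooth2_partial i (sp n))) (H1_L2wD i Hg) (ci i)).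
have [B B0 hB0] := hB 0; have [B' B'0 hB1] := hB 1.
pose K := C * (A * A + 2 * A * B + 2 * A * B').
have K0 : 0 <= K by rewrite /K mulr_ge0// !addr_ge0// !mulr_ge0.
exists K => // z rz.
have hK n : nrm (fun x => phi n x * phi n x) <= K.
  have [h _ _ _] := hC _ (smooth2M (sp n) (sp n)); apply: le_trans h _.
  apply: ler_wpM2l => //; apply: le_trans (I1_sqr (sp n)) _.
  apply: lerD; [apply: lerD|]; apply: ler_pM; rewrite ?nrm_ge0 ?mulr_ge0 ?nrm_ge0//.
  - by rewrite ler_wpM2l.
  - by rewrite ler_wpM2l.
have r2 := (regM hOm rz rz).1.
have Lzg : L2 (fun x => z x * g x) by exact: (reg_L2M hOm rz Lg).
have Lzp n : L2 (fun x => z x * phi n x) by exact: (reg_L2M hOm rz (sL (sp n))).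
have cc : nrm (fun x => z x * phi n x - z x * g x) @[n --> \oo] --> (0 : R).
  have [M M0 hM] := reg_bounded hOm rz.
  apply: (squeeze0 _ _ (cvgn0Z M cg)) => n; first exact: nrm_ge0.
  have [_] := L2_mul_bdd mOm (reg_measurable rz) (fun x Ox => hM x (OmC Ox)) M0 (L2B mOm (sL (sp n)) Lg).
  apply: le_trans; rewrite le_eqVlt; apply/orP; left; apply/eqP.
  by apply: eq_nrm => x _; rewrite mulrBr.
have l1 := nrm_cvg_lim mOm Lzp Lzg cc.
have l2 : nrm (fun x => z x * phi n x) ^+ 2 @[n --> \oo] --> nrm (fun x => z x * g x) ^+ 2.
  rewrite (_ : (fun n => nrm (fun x => z x * phi n x) ^+ 2) = (fun n => nrm (fun x => z x * phi n x) * nrm (fun x => z x * phi n x))); last first.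
    by rewrite funeqE => n; rewrite expr2.
  by rewrite expr2; apply: cvgM; exact: l1.
apply: (ler_cvg_to l2 (cvg_cst _)); apply: nearW => n.
have Lp2 : L2 (fun x => phi n x * phi n x) by apply: sL; exact: smooth2M.
rewrite sqr_nrm; have -> : ip (fun x => z x * phi n x) (fun x => z x * phi n x) = ip (fun x => z x * z x) (fun x => phi n x * phi n x).
  by apply: eq_Rintegral => x _; rewrite mulrACA.
apply: le_trans (le_ip_nrm mOm (reg_L2 r2) Lp2) _.
by rewrite mulrC; apply: ler_wpM2r; [exact: nrm_ge0|exact: hK].
Qed.

End RegularOfH2.

(** * Uniqueness of the steady state *)

Section Connectedness.
Context {R : realType} (Om : set (R * R)) (sigma : {measure set (plane R) -> \bar R}).
Hypothesis hOm : smooth_bounded_domain Om.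
Hypothesis hs : arclength_measure Om sigma.
Notation leb := (leb2 R).
Notation L2 := (L2 leb Om).
Notation ip := (ip leb Om).
Notation nrm := (nrm leb Om).
Notation aeq := (aeq leb Om).
Notation wD := (wD Om).
Notation gip := (gip Om).
Notation gnrm := (gnrm Om).
Notation reg := (reg Om).

Let oOm : open Om. Proof. by case: hOm. Qed.
Let bOm : bounded_set Om. Proof. by case: hOm. Qed.
Let mOm : measurable (Om : set (plane R)). Proof. exact: measurable_dom. Qed.
Let fOm : (leb Om < +oo)%E. Proof. exact: finite_dom. Qed.
Let OmC : Om `<=` closure Om. Proof. exact: subset_closure. Qed.

Lemma is_derive0_interval (F f : R -> R) (a b s t : R) : (forall x : R, is_derive x 1 F (f x)) ->
  (forall x, a < x < b -> f x = 0) -> a < s < b -> a < t < b -> F s = F t.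
Proof.
move=> dF f0; wlog st : s t / s <= t.
  move=> H hs' ht'; case: (leP s t) => st; first exact: H.
  by symmetry; apply: H => //; exact: ltW.
move=> /andP[as' sb] /andP[at' tb].
have cF : {within `[s, t], continuous F}.
  apply: continuous_subspaceT => x; apply: differentiable_continuous.
  by apply/derivable1_diffP; case: (dF x).
have [c /[!in_itv]/= /andP[sc ct]] := @MVT_segment R F f s t st (fun x _ => dF x) cF.
rewrite (f0 c); last by rewrite (lt_le_trans as' sc) (le_lt_trans ct tb).
by rewrite mul0r => /eqP; rewrite subr_eq0 => /eqP ->.
Qed.

Lemma eventually_eq_lim (u v : nat -> R) (a b : R) N : u n @[n --> \oo] --> a -> v n @[n --> \oo] --> b ->
  (forall n, (N <= n)%N -> u n = v n) -> a = b.
Proof.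
move=> cu cv uv; apply: (cvg_unique _ cu); first exact: Rhausdorff.
by apply: cvg_trans cv; apply: near_eq_cvg; exists N => // n /= Nn; rewrite uv.
Qed.

Lemma smooth2_locally_cst g (x y : R * R) (r : R) : smooth2 g ->
  (forall i z, ball x r z -> partial i g z = 0) -> ball x r y -> g y = g x.
Proof.
move=> sg h [/= y1 y2].
have r0 : 0 < r by exact: le_lt_trans (normr_ge0 _) y1.
have B (a c d : R) : c - r < a < c + r -> `|c - a| < r.
  by move=> /andP[h1 h2]; rewrite ltr_norml; apply/andP; split; lra.
have Bi (a c : R) : `|c - a| < r -> c - r < a < c + r.
  by rewrite ltr_norml => /andP[h1 h2]; apply/andP; split; lra.
have cc (c : R) : c - r < c < c + r by apply/andP; split; lra.
have e1 : g (y.1, y.2) = g (x.1, y.2).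
  apply: (@is_derive0_interval (fun s => g (s, y.2)) (fun s => partial 0 g (s, y.2)) (x.1 - r) (x.1 + r)).
  - by move=> s; exact: smooth2_is_derive_fst.
  - by move=> s hs'; apply: h; split => //=; exact: B hs'.
  - exact: Bi.
  - exact: cc.
have e2 : g (x.1, y.2) = g (x.1, x.2).
  apply: (@is_derive0_interval (fun s => g (x.1, s)) (fun s => partial 1 g (x.1, s)) (x.2 - r) (x.2 + r)).
  - by move=> s; exact: smooth2_is_derive_snd.
  - by move=> s hs'; apply: h; split => /=; [rewrite /ball/= subrr normr0|exact: B hs'].
  - exact: Bi.
  - exact: cc.
by rewrite (surjective_pairing y) e1 e2 -surjective_pairing.
Qed.

Lemma reg_continuous z x (e : R) : reg z -> Om x -> 0 < e ->
  exists2 r : R, 0 < r & forall y, Om y -> ball x r y -> `|z x - z y| <= e.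
Proof.
move=> [_ [phi [sp [d [d0 cd hd]] _]]] Ox e0.
have e3 : 0 < e / 3 by rewrite divr_gt0.
have [N _ hN] := cvgr_lt _ cd _ e3; have dN := hN N (leqnn N).
have := @smooth2_continuous _ _ (sp N) x => /cvgrPdist_lt /(_ _ e3) /nbhs_ballP[r /= r0 hr].
exists r => // y Oy /hr hy.
have h1 := hd N x (OmC Ox); have h2 := hd N y (OmC Oy).
move: hy h1 h2 dN; rewrite !ler_norml ltr_norml => /andP[a1 a2] /andP[b1 b2] /andP[c1 c2] dN.
by apply/andP; split; lra.
Qed.

(** The kernel has mass 1 and lives where [z] differs from its value at [x] by at most [e]. *)
Lemma reg_avg_point z x : reg z -> Om x -> avg Om (seqpar n) z x @[n --> \oo] --> z x.
Proof.
move=> rz Ox; apply/cvgrPdist_le => e e0.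
have [r r0 hr] := reg_continuous rz Ox e0.
have : nbhs x Om by exact: open_nbhs_nbhs.
move=> /nbhs_ballP[r' /= r'0 xr].
pose s := Num.min r r'; have s0 : 0 < s by rewrite lt_min r0.
have : \forall n \near \oo, rad (@seqpar R n) < s by exact: (cvgr_lt 0 (@rad_seqpar R)).
apply: filterS => n hn; have okn := @ok_seqpar R n.
have bs y : ball x s y -> ball x r y /\ ball x r' y.
  by move=> by'; split; apply: le_ball by'; rewrite /s ge_min lexx ?orbT.
have a1 := @avg_cst1 R Om _ x s okn hn (fun y h => xr y (bs y h).2).
have L1 := L2_cst mOm fOm (1 : R); have Lm := @L2_moll R Om oOm fOm _ x okn.
have Lc c : L2 (fun=> c) by exact: (L2_cst mOm fOm).
have ac c : ip (fun=> c) (fun y => moll (seqpar n) (x - y)) = c.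
  have -> : (fun=> c) = (fun y : R * R => c * (fun=> 1 : R) y) by rewrite funeqE => y; rewrite mulr1.
  by rewrite (ipZl mOm c L1 Lm) -[ip _ _]/(avg Om (seqpar n) (fun=> 1) x) a1 mulr1.
have m0 y := moll_ge0 (x - y) okn.
have le1 : avg Om (seqpar n) z x <= z x + e.
  rewrite -[leRHS]ac; apply: (le_ip mOm (reg_L2 rz) Lm (Lc _) Lm) => y Oy.
  have [->|nz] := eqVneq (moll (seqpar n) (x - y)) 0; first by rewrite !mulr0.
  apply: (@ler_wpM2r R _ (m0 y)); have := hr y Oy (bs y (moll_near okn hn nz)).1.
  by rewrite ler_norml => /andP[]; lra.
have le2 : z x - e <= avg Om (seqpar n) z x.
  rewrite -[leLHS]ac; apply: (le_ip mOm (Lc _) Lm (reg_L2 rz) Lm) => y Oy.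
  have [->|nz] := eqVneq (moll (seqpar n) (x - y)) 0; first by rewrite !mulr0.
  apply: (@ler_wpM2r R _ (m0 y)); have := hr y Oy (bs y (moll_near okn hn nz)).1.
  by rewrite ler_norml => /andP[]; lra.
by rewrite ler_norml; apply/andP; split; lra.
Qed.

(** Near [x] the kernels are test functions of [Om], so the averages have zero partial derivatives
    and are constant there; they converge to [z] at each point. *)
Lemma reg_locally_cst z x : reg z -> (forall i, aeq (wD i z) (fun=> 0)) -> Om x ->
  exists2 r : R, 0 < r & forall y, ball x r y -> Om y /\ z y = z x.
Proof.
move=> rz wz Ox.
have : nbhs x Om by exact: open_nbhs_nbhs.
move=> /nbhs_ballP[r' /= r'0 xr]; pose r := r' / 2; have r0 : 0 < r by rewrite divr_gt0.
exists r => // y xy.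
have sub w : ball x r w -> ball w r `<=` Om.
  by move=> xw v wv; apply: xr; rewrite (splitr r'); exact: ball_triangle xw wv.
have Oy : Om y by apply: xr; apply: le_ball xy; rewrite /r; lra.
split => //.
have : \forall n \near \oo, rad (@seqpar R n) < r by exact: (cvgr_lt 0 (@rad_seqpar R)).
move=> [N _ hN]; have Lz := reg_L2 rz.
have eqn n : (N <= n)%N -> avg Om (seqpar n) z y = avg Om (seqpar n) z x.
  move=> Nn; have okn := @ok_seqpar R n; have [p1 p2] := okn.
  apply: (smooth2_locally_cst _ _ xy); first exact: (smooth2_avg oOm fOm okn Lz).
  move=> i w xw; rewrite /avg (partial_conv mOm fOm i w (bump1_kern _ p1) (bump1_kern _ p2) Lz).
  have t := test_moll okn (hN n Nn) (sub w xw).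
  have [L0 /(_ _ t)] := H1_wder i (reg_H1 rz).
  rewrite -[(fun z0 => tensor _ _ (w - z0))]/(fun z0 => moll (seqpar n) (w - z0)) => ->.
  rewrite opprK (aeq_ip mOm L0 (L2_test oOm bOm t) (L2_cst mOm fOm 0) (L2_test oOm bOm t) (wz i) (aeq_refl _ _ _)).
  by rewrite /Defs.ip; under eq_Rintegral do rewrite mul0r; rewrite Rintegral_cst// mul0r.
have cy := reg_avg_point rz Oy; have cx := reg_avg_point rz Ox.
exact: (eventually_eq_lim cy cx eqn).
Qed.

(** The points of [Om] where [z] takes the value [z x] form an open set, and so do the others; [Om]
    is connected. *)
Lemma reg_cst z x y : reg z -> (forall i, aeq (wD i z) (fun=> 0)) -> Om x -> Om y -> z y = z x.
Proof.
move=> rz wz Ox Oy; have [_ cOm _ _] := hOm.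
pose B := [set v | Om v /\ z v = z x]; pose B' := [set v | Om v /\ z v <> z x].
have oB : open B.
  rewrite openE => v [Ov zv]; have [r r0 hr] := reg_locally_cst rz wz Ov.
  by apply/nbhs_ballP; exists r => // w /hr[Ow zw]; split; rewrite ?zw.
have oB' : open B'.
  rewrite openE => v [Ov zv]; have [r r0 hr] := reg_locally_cst rz wz Ov.
  by apply/nbhs_ballP; exists r => // w /hr[Ow zw]; split; rewrite ?zw.
have BO : B = Om.
  apply: cOm; first by exists x.
  - by exists B => //; rewrite eqEsubset; split => v; [move=> [? ?]; do !split|move=> []].
  - exists (~` B'); first exact: open_closedC.
    rewrite eqEsubset; split => v.
      by move=> [Ov zv]; split => // -[].
    by move=> [Ov nv]; split => //; apply: contrapT => zv; apply: nv.
by move: Oy; rewrite -BO => -[].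
Qed.

Lemma aeq0_ip f g : L2 f -> L2 g -> aeq f (fun=> 0) -> ip f g = 0.
Proof.
move=> Lf Lg f0; rewrite (aeq_ip mOm Lf Lg (L2_cst mOm fOm 0) Lg f0 (aeq_refl _ _ _)).
by rewrite /Defs.ip; under eq_Rintegral do rewrite mul0r; rewrite Rintegral_cst// mul0r.
Qed.

Lemma H1_grad0 d : Hm Om 1 d -> (forall i, aeq (wD i d) (fun=> 0)) -> \int[leb]_(x in Om) d x = 0 ->
  aeq d (fun=> 0).
Proof.
move=> Hd wd int0; have Ld := H1_L2 Hd.
have L0 : L2 (fun=> 0) by exact: (L2_cst mOm fOm 0).
have H0 : Hm Om 1 (fun=> 0) by apply: (H1_smooth2 oOm bOm); exact: smooth2_cst.
(* The vanishing gradient is itself in H^1, so [d] is in H^2 and has a continuous representative. *)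
have H2 : Hm Om 2 d.
  by apply: (H2P Hd) => i; apply: (Hm_aeq oOm bOm _ (aeq_sym (wd i))) H0; exact: H1_L2wD.
have [zb [rz dz]] := H2_reg hOm hs H2; have Lz := reg_L2 rz.
have wz i : aeq (wD i zb) (fun=> 0).
  by apply: aeq_trans (wd i); apply: aeq_sym; exact: (wD_congr hOm i Hd Lz dz).
apply: (aeq_trans dz).
have [Oe|/set0P[x Ox]] := eqVneq Om set0.
  by apply: aeW => x Ox; move: Ox; rewrite Oe.
have L1 : L2 (fun=> 1) by exact: (L2_cst mOm fOm 1).
apply: (nrm0_aeq mOm Lz); rewrite /Defs.nrm; apply/eqP; rewrite sqrtr_eq0.
have -> : ip zb zb = ip (fun y => zb x * (fun=> 1) y) zb.
  by apply: eq_Rintegral => y /set_mem Oy; rewrite mulr1 (reg_cst rz wz Ox Oy).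
rewrite (ipZl mOm _ L1 Lz) (aeq_ip mOm L1 Lz L1 Ld (aeq_refl _ _ _) (aeq_sym dz)).
by rewrite /Defs.ip; under eq_Rintegral do rewrite mul1r; rewrite int0 mulr0 lexx.
Qed.

End Connectedness.

Section SteadyState.
Context {R : realType} (Om : set (R * R)) (sigma : {measure set (plane R) -> \bar R}).
Hypothesis hOm : smooth_bounded_domain Om.
Hypothesis hs : arclength_measure Om sigma.
Notation leb := (leb2 R).
Notation L2 := (L2 leb Om).
Notation ip := (ip leb Om).
Notation nrm := (nrm leb Om).
Notation nrmb := (Defs.nrm sigma (bd Om)).
Notation aeqb := (aeq sigma (bd Om)).
Notation aeq := (aeq leb Om).
Notation wD := (wD Om).
Notation gip := (gip Om).
Notation gnrm := (gnrm Om).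
Notation Btri := (Btri Om).
Notation reg := (reg Om).

Let oOm : open Om. Proof. by case: hOm. Qed.
Let bOm : bounded_set Om. Proof. by case: hOm. Qed.
Let mOm : measurable (Om : set (plane R)). Proof. exact: measurable_dom. Qed.
Let fOm : (leb Om < +oo)%E. Proof. exact: finite_dom. Qed.

Local Opaque Defs.wD Defs.ip Defs.nrm.

Let mbd : measurable (bd Om : set (plane R)). Proof. exact: measurable_bd. Qed.

Lemma sum_sqr_eq0 (a b : R) : a ^+ 2 + b ^+ 2 = 0 -> a = 0 /\ b = 0.
Proof.
move=> /eqP; rewrite paddr_eq0 ?sqr_ge0// !sqrf_eq0 => /andP[/eqP -> /eqP ->].
by [].
Qed.

Lemma sqr_inj (a b : R) : 0 <= a -> 0 <= b -> a ^+ 2 = b ^+ 2 -> a = b.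
Proof. by move=> a0 b0; apply: pexpIrn. Qed.

Lemma sum_ord2 (F : 'I_2 -> R) : \sum_(i < 2) F i = F 0 + F 1.
Proof. by rewrite !big_ord_recl big_ord0 addr0; congr (_ + F _); exact: val_inj. Qed.

Lemma gipE u v : gip u v = ip (wD 0 u) (wD 0 v) + ip (wD 1 u) (wD 1 v).
Proof. exact: (sum_ord2 (fun i => ip (wD i u) (wD i v))). Qed.

Lemma gip_self_ge0 u : 0 <= gip u u.
Proof. by rewrite gipE; apply: addr_ge0; exact: ip_self_ge0. Qed.

Lemma sqr_gnrm u : gnrm u ^+ 2 = gip u u.
Proof. by rewrite /Defs.gnrm sqr_sqrtr// gip_self_ge0. Qed.

Lemma sqr_gnrmE u : gnrm u ^+ 2 = nrm (wD 0 u) ^+ 2 + nrm (wD 1 u) ^+ 2.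
Proof. exact: (etrans (sqr_gnrm u) (etrans (gipE u u) (congr2 +%R (esym (sqr_nrm _ _ _)) (esym (sqr_nrm _ _ _))))). Qed.

Lemma gip_aeq u v u' v' : Hm Om 1 u -> Hm Om 1 v -> Hm Om 1 u' -> Hm Om 1 v' -> aeq u u' -> aeq v v' ->
  gip u v = gip u' v'.
Proof.
move=> Hu Hv Hu' Hv' uu vv.
have h i : ip (wD i u) (wD i v) = ip (wD i u') (wD i v').
  apply: (aeq_ip mOm (H1_L2wD i Hu) (H1_L2wD i Hv) (H1_L2wD i Hu') (H1_L2wD i Hv')).
    exact: (wD_congr hOm i Hu (H1_L2 Hu') uu).
  exact: (wD_congr hOm i Hv (H1_L2 Hv') vv).
exact: (etrans (gipE u v) (etrans (congr2 +%R (h 0) (h 1)) (esym (gipE u' v')))).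
Qed.

Lemma gnrm_aeq u u' : Hm Om 1 u -> Hm Om 1 u' -> aeq u u' -> gnrm u = gnrm u'.
Proof. by move=> Hu Hu' uu; rewrite /Defs.gnrm (gip_aeq Hu Hu Hu' Hu' uu uu). Qed.

Lemma gnrm0_wD u : Hm Om 1 u -> gnrm u = 0 -> forall i, aeq (wD i u) (fun=> 0).
Proof.
move=> Hu g0 i; apply: (nrm0_aeq mOm (H1_L2wD i Hu)); apply/eqP.
have e : gnrm u ^+ 2 = 0 by rewrite g0 expr0n.
have [h0 h1] := sum_sqr_eq0 (etrans (esym (sqr_gnrmE u)) e).
by case: (ord2P i) => ->; [rewrite h0|rewrite h1].
Qed.

Notation gr z := (fun x => wD 0 z x + wD 1 z x).

Lemma L2_gr z : Hm Om 1 z -> L2 (gr z).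
Proof. by move=> Hz; exact: (L2D mOm (H1_L2wD 0 Hz) (H1_L2wD 1 Hz)). Qed.

Lemma gr_congr z z' : Hm Om 1 z -> L2 z' -> aeq z z' -> aeq (gr z) (gr z').
Proof.
move=> Hz Lz zz.
by apply: filterS2 (wD_congr hOm 0 Hz Lz zz) (wD_congr hOm 1 Hz Lz zz) => x h0 h1 Ox; rewrite h0// h1.
Qed.

Lemma gr_B z w : Hm Om 1 z -> Hm Om 1 w -> aeq (gr (fun x => z x - w x)) (fun x => gr z x - gr w x).
Proof.
move=> Hz Hw.
apply: filterS2 (wD_B oOm bOm 0 Hz Hw) (wD_B oOm bOm 1 Hz Hw) => x h0 h1 Ox.
by rewrite h0// h1// opprD addrACA.
Qed.

Lemma Btri_aeq v z f v' z' f' : L2 v -> L2 v' -> Hm Om 1 z -> Hm Om 1 z' -> L2 f -> L2 f' ->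
  aeq v v' -> aeq z z' -> aeq f f' -> Btri v z f = Btri v' z' f'.
Proof.
move=> Lv Lv' Hz Hz' Lf Lf' vv zz ff.
have m a b c : L2 a -> L2 b -> L2 c -> measurable_fun (Om : set (plane R)) (fun x => a x * b x * c x).
  by move=> [ma _] [mb _] [mc _]; apply: measurable_funM => //; exact: measurable_funM.
apply: (aeq_Rintegral mOm (m _ _ _ Lv (L2_gr Hz) Lf) (m _ _ _ Lv' (L2_gr Hz') Lf')).
have gg := gr_congr Hz (H1_L2 Hz') zz.
by apply: filterS3 vv gg ff => x h1 h2 h3 Ox; rewrite h1// h2// h3.
Qed.

Lemma RintegralB_L2 f g : L2 f -> L2 g ->
  \int[leb]_(x in Om) (f x - g x) = \int[leb]_(x in Om) f x - \int[leb]_(x in Om) g x.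
Proof. by move=> Lf Lg; apply: RintegralB => //; exact: (L2_integrable mOm fOm). Qed.

Lemma H1modR_aeq u u' : H1modR Om u -> Hm Om 1 u' -> aeq u u' -> H1modR Om u'.
Proof.
move=> [Hu u0] Hu' uu; split=> //; rewrite -u0; symmetry.
by apply: (aeq_Rintegral mOm _ _ uu); [case: (H1_L2 Hu)|case: (H1_L2 Hu')].
Qed.

Lemma H1modR_opp u : H1modR Om u -> H1modR Om (fun x => -1 * u x).
Proof.
move=> [Hu u0]; split; first exact: (H1Z oOm bOm (-1) Hu).
rewrite RintegralZl//; last exact: (L2_integrable mOm fOm (H1_L2 Hu)).
by rewrite u0 mulr0.
Qed.

Lemma gnrm_opp u : Hm Om 1 u -> gnrm (fun x => -1 * u x) = gnrm u.
Proof.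
move=> Hu; have H' := H1Z oOm bOm (-1) Hu.
have h i : nrm (wD i (fun x => -1 * u x)) = nrm (wD i u).
  rewrite (aeq_nrm mOm (H1_L2wD i H') (L2Z mOm (-1) (H1_L2wD i Hu)) (wD_Z oOm bOm i (-1) Hu)).
  by rewrite (nrmZ mOm (-1) (H1_L2wD i Hu)) normrN1 mul1r.
apply: (sqr_inj (sqrtr_ge0 _) (sqrtr_ge0 _)).
exact: (etrans (sqr_gnrmE _) (etrans (congr2 (fun a b : R => a ^+ 2 + b ^+ 2) (h 0) (h 1)) (esym (sqr_gnrmE _)))).
Qed.

Lemma steady_reg nu f u : steady_state Om nu f u -> Hm Om 2 u ->
  exists ub, [/\ reg ub, aeq u ub, steady_state Om nu f ub & gnrm ub = gnrm u].
Proof.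
move=> [Mu hu] H2u; have [ub [rb uub]] := H2_reg hOm hs H2u.
have Hu := H2_H1 H2u; have Hb := reg_H1 rb; have Lb := reg_L2 rb; have Lu := H1_L2 Hu.
have eg := gnrm_aeq Hu Hb uub; have Mb := H1modR_aeq Mu Hb uub.
exists ub; split; [exact: rb|exact: uub| |exact: esym eg].
split; first exact: Mb.
move=> v Mv; have Hv := Mv.1; have uub' := aeq_sym uub.
have e1 := gip_aeq Hb Hv Hu Hv uub' (aeq_refl _ _ _).
have e2 := Btri_aeq Lb Lu Hb Hu (H1_L2 Hv) (H1_L2 Hv) uub' uub' (aeq_refl _ _ _).
exact: (etrans (congr2 (fun a b : R => nu * a + b) e1 e2) (hu v Mv)).
Qed.

(* In \bar R, (+oo)^-1 = 0, 0^-1 = +oo and (-oo)^-1 = -oo, so the bound forces N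
   to be a nonnegative real number; it gives no information when N = 0. *)
Lemma le_inve4 (g nu : R) (N : \bar R) : 0 < nu -> 0 < g -> (g%:E <= nu%:E / (4%:E * N))%E ->
  exists r : R, [/\ 0 <= r, (N <= r%:E)%E & g * r <= nu / 4].
Proof.
move=> nu0 g0; case: N => [r| |].
- rewrite -EFinM => h; have [r0|r0|r0] := ltgtP r 0.
  + exfalso; move: h; rewrite inver mulf_eq0 (lt_eqF r0) orbF pnatr_eq0/= -EFinM lee_fin => h.
    have := lt_le_trans g0 h; rewrite pmulr_rgt0// invr_gt0 pmulr_rgt0//; lra.
  + exists r; split; [exact: ltW|by []|]; move: h.
    rewrite inver mulf_eq0 (gt_eqF r0) orbF pnatr_eq0/= -EFinM lee_fin ler_pdivlMr ?mulr_gt0//; lra.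
  + by exists 0; rewrite r0 mulr0 divr_ge0// ltW.
- rewrite gt0_muley ?lte_fin// invey mule0 lee_fin; lra.
- by rewrite gt0_muleNy ?lte_fin// inveNy gt0_muleNy ?lte_fin// leeNy_eq.
Qed.

Lemma le_scaled (b r g p nu : R) : 0 < g -> 0 < p -> b / (g * p) <= r -> g * r <= nu / 4 -> b <= nu / 4 * p.
Proof.
move=> g0 p0; rewrite ler_pdivrMr ?mulr_gt0// => h k.
apply: le_trans h _; rewrite mulrA; apply: ler_wpM2r; first exact: ltW.
by rewrite mulrC.
Qed.

Lemma gnrm_gt0 u : gnrm u != 0 -> 0 < gnrm u.
Proof. by rewrite lt0r => ->; rewrite sqrtr_ge0. Qed.

Lemma H1modR_gnrm0 u : H1modR Om u -> gnrm u = 0 -> aeq u (fun=> 0).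
Proof. by move=> [Hu u0] g0; exact: (H1_grad0 hOm hs Hu (gnrm0_wD Hu g0) u0). Qed.

Lemma Btri_arg1_0 v z f : reg v -> Hm Om 1 z -> reg f -> aeq v (fun=> 0) -> Btri v z f = 0.
Proof.
move=> rv Hz rf v0; rewrite (Btri_aeq (reg_L2 rv) (L2_cst mOm fOm 0) Hz Hz (reg_L2 rf) (reg_L2 rf) v0 (aeq_refl _ _ _) (aeq_refl _ _ _)).
by rewrite /Defs.Btri; under eq_Rintegral do rewrite !mul0r; rewrite Rintegral_cst// mul0r.
Qed.

Lemma Btri_arg2_0 v z f : reg v -> Hm Om 1 z -> reg f -> (forall i, aeq (wD i z) (fun=> 0)) -> Btri v z f = 0.
Proof.
move=> rv Hz rf z0; have Lz := L2_gr Hz.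
have e : Btri v z f = ip (gr z) (fun x => v x * f x).
  by apply: eq_Rintegral => x _; rewrite mulrCA mulrA.
rewrite e; apply: (aeq0_ip hOm Lz (reg_L2M hOm rv (reg_L2 rf))).
by apply: filterS2 (z0 0) (z0 1) => x h0 h1 Ox; rewrite h0// h1// addr0.
Qed.

(** The bound on the gradient of [u] gives nu/4 when multiplied by N2. The supremum runs over
    nonzero denominators only: if grad u = 0, then u = 0 by its zero mean, and if grad z = 0, the
    form vanishes. *)
Lemma steady_tri nu u z : 0 < nu -> reg u -> H1modR Om u ->
  ((gnrm u)%:E <= nu%:E / (4%:E * Nconst Om sigma))%E -> reg z ->
  Btri u z z <= nu / 4 * (gip z z + nrmb z ^+ 2).
Proof.
move=> nu0 ru Mu hN rz; have Hz := reg_H1 rz.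
have rhs0 : 0 <= nu / 4 * (gip z z + nrmb z ^+ 2).
  by rewrite mulr_ge0 ?addr_ge0 ?sqr_ge0 ?gip_self_ge0// divr_ge0// ltW.
have [gu0|gu] := eqVneq (gnrm u) 0.
  by rewrite (Btri_arg1_0 ru Hz rz (H1modR_gnrm0 Mu gu0)).
have [gz0|gz] := eqVneq (gnrm z) 0.
  by rewrite (Btri_arg2_0 ru Hz rz (gnrm0_wD Hz gz0)).
have [Lt tz] := tr_reg hOm hs Hz rz (aeq_refl _ _ _).
have te : tnrm Om sigma z ^+ 2 = gip z z + nrmb z ^+ 2.
  rewrite /tnrm sqr_sqrtr ?addr_ge0 ?sqr_ge0// sqr_gnrm.
  by rewrite (aeq_nrm mbd Lt (reg_L2b hOm hs rz) tz).
have t0 : 0 < tnrm Om sigma z.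
  rewrite sqrtr_gt0; apply: ltr_pwDl; last exact: sqr_ge0.
  by rewrite exprn_gt0// gnrm_gt0.
have [r [r0 Nr gr4]] := le_inve4 nu0 (gnrm_gt0 gu) hN.
rewrite -te expr2; apply: (le_scaled (gnrm_gt0 gu) (mulr_gt0 t0 t0) _ gr4).
rewrite -lee_fin; apply: le_trans Nr; rewrite /Nconst le_max; apply/orP; right.
apply: ereal_sup_ubound; exists u, z, z; split => //; split => //; first exact: lt0r_neq0.
  exact: lt0r_neq0.
by rewrite mulrA.
Qed.

(** The denominator is written as |grad u| times [p], so that [u] may occupy the first or the second
    argument of the form. *)
Lemma N1_bound nu u v z f : 0 < nu -> ((gnrm u)%:E <= nu%:E / (4%:E * Nconst Om sigma))%E ->
  H1modR Om v -> H1modR Om z -> H1modR Om f -> gnrm v != 0 -> gnrm z != 0 -> gnrm f != 0 -> gnrm u != 0 ->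
  forall p, gnrm v * gnrm z * gnrm f = gnrm u * p -> 0 < p -> Btri v z f <= nu / 4 * p.
Proof.
move=> nu0 hN Mv Mz Mf gv gz gf gu p ep p0.
have [r [r0 Nr gr4]] := le_inve4 nu0 (gnrm_gt0 gu) hN.
apply: (le_scaled (gnrm_gt0 gu) p0 _ gr4); rewrite -ep.
rewrite -lee_fin; apply: le_trans Nr; rewrite /Nconst le_max; apply/orP; left.
by apply: ereal_sup_ubound; exists v, z, f.
Qed.

Lemma BtriE v z f : Btri v z f = ip (fun x => v x * f x) (gr z).
Proof. by apply: eq_Rintegral => x _; rewrite mulrAC. Qed.

Lemma L2M2 v f : reg v -> reg f -> L2 (fun x => v x * f x).
Proof. by move=> rv rf; exact: (reg_L2M hOm rv (reg_L2 rf)). Qed.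

Lemma Btri_Br v z w f : reg v -> Hm Om 1 z -> Hm Om 1 w -> reg f ->
  Btri v (fun x => z x - w x) f = Btri v z f - Btri v w f.
Proof.
move=> rv Hz Hw rf; have Lvf := L2M2 rv rf; rewrite !BtriE -(ipBr mOm (L2_gr Hz) (L2_gr Hw) Lvf).
apply: (aeq_ip mOm Lvf (L2_gr (H1B oOm bOm Hz Hw)) Lvf (L2B mOm (L2_gr Hz) (L2_gr Hw)) (aeq_refl _ _ _)).
exact: gr_B.
Qed.

Lemma Btri_Bl v w z f : reg v -> reg w -> Hm Om 1 z -> reg f ->
  Btri (fun x => v x - w x) z f = Btri v z f - Btri w z f.
Proof.
move=> rv rw Hz rf; rewrite !BtriE -(ipBl mOm (L2M2 rv rf) (L2M2 rw rf) (L2_gr Hz)).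
by apply: eq_ip => // x _; rewrite mulrBl.
Qed.

Lemma Btri_Nl v z f : reg v -> Hm Om 1 z -> reg f -> Btri (fun x => -1 * v x) z f = - Btri v z f.
Proof.
move=> rv Hz rf; apply: etrans _ (mulN1r _); rewrite !BtriE -(ipZl mOm _ (L2M2 rv rf) (L2_gr Hz)).
by apply: eq_ip => // x _; rewrite mulrA.
Qed.

Lemma Btri_Nr v z f : reg v -> Hm Om 1 z -> reg f -> Btri v (fun x => -1 * z x) f = - Btri v z f.
Proof.
move=> rv Hz rf; have Lvf := L2M2 rv rf; have Lg := L2_gr Hz.
apply: etrans _ (mulN1r _); rewrite !BtriE -(ipZr mOm (-1) Lg Lvf).
apply: (aeq_ip mOm Lvf (L2_gr (H1Z oOm bOm (-1) Hz)) Lvf (L2Z mOm (-1) Lg) (aeq_refl _ _ _)).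
apply: filterS2 (wD_Z oOm bOm 0 (-1) Hz) (wD_Z oOm bOm 1 (-1) Hz) => x h0 h1 Ox.
by rewrite h0// h1// mulrDr.
Qed.

Lemma addrB_swap (a b c d : R) : a - b + (c - d) = a + c - (b + d).
Proof. by rewrite opprD addrACA. Qed.

Lemma gip_Bl u w v : Hm Om 1 u -> Hm Om 1 w -> Hm Om 1 v ->
  gip (fun x => u x - w x) v = gip u v - gip w v.
Proof.
move=> Hu Hw Hv.
have h i : ip (wD i (fun x => u x - w x)) (wD i v) = ip (wD i u) (wD i v) - ip (wD i w) (wD i v).
  have Lv := H1_L2wD i Hv; have Lu := H1_L2wD i Hu; have Lw := H1_L2wD i Hw.
  rewrite -(ipBl mOm Lu Lw Lv).
  exact: (aeq_ip mOm (H1_L2wD i (H1B oOm bOm Hu Hw)) Lv (L2B mOm Lu Lw) Lv (wD_B oOm bOm i Hu Hw) (aeq_refl _ _ _)).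
rewrite !gipE; exact: (etrans (congr2 +%R (h 0) (h 1)) (addrB_swap _ _ _ _)).
Qed.

Lemma mul_swap_mid (a b : R) : a * b * a = b * (a * a).
Proof. by rewrite (mulrC a) mulrA. Qed.

Lemma uniqueness_arith (nu g g1 g2 b1 b2 b3 b4 p f : R) : 0 < nu -> nu * g1 + b1 = f -> nu * g2 + b2 = f ->
  g = g1 - g2 -> b3 + b4 = b1 - b2 -> - b3 <= nu / 4 * p -> - b4 <= nu / 4 * p -> p = g -> 0 <= g -> g = 0.
Proof.
move=> nu0 e1 e2 eg eb h3 h4 ep g0; subst p.
have e : nu * g = - b3 - b4 by rewrite eg mulrBr; lra.
by have := mulr_ge0 (ltW nu0) g0 => h; apply/eqP; rewrite -(mulrI_eq0 _ (mulfI (lt0r_neq0 nu0))); apply/eqP; lra.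
Qed.

(** B(u1; u1, d) - B(u2; u2, d) = B(u1; d, d) + B(d; u2, d), and each of these terms costs nu/4
    |grad d|^2. *)
Lemma steady_unique nu f u1 u2 : 0 < nu -> reg u1 -> reg u2 -> steady_state Om nu f u1 -> steady_state Om nu f u2 ->
  ((gnrm u1)%:E <= nu%:E / (4%:E * Nconst Om sigma))%E ->
  ((gnrm u2)%:E <= nu%:E / (4%:E * Nconst Om sigma))%E -> aeq u1 u2.
Proof.
move=> nu0 r1 r2 [M1 h1] [M2 h2] N1' N2'; pose d x := u1 x - u2 x.
have rd : reg d by exact: (regB hOm r1 r2).
have Hd := reg_H1 rd; have H1' := reg_H1 r1; have H2' := reg_H1 r2.
have Md : H1modR Om d.
  by split => //; rewrite (RintegralB_L2 (H1_L2 H1') (H1_L2 H2')) M1.2 M2.2 subrr.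
suff gd : gnrm d = 0.
  by apply: filterS (H1modR_gnrm0 Md gd) => x h Ox; apply/eqP; rewrite -subr_eq0; apply/eqP; exact: h.
have [//|gd] := eqVneq (gnrm d) 0; have gd0 := gnrm_gt0 gd.
have p0 : 0 <= nu / 4 * (gnrm d * gnrm d) by rewrite !mulr_ge0 ?invr_ge0 ?ltW.
have k1 : - Btri u1 d d <= nu / 4 * (gnrm d * gnrm d).
  have [g0|g1] := eqVneq (gnrm u1) 0.
    by rewrite (Btri_arg1_0 r1 Hd rd (H1modR_gnrm0 M1 g0)) oppr0.
  (* N1 is a supremum without absolute values; a lower bound of the form is its upper bound at the
     opposite function. *)
  rewrite -(Btri_Nl r1 Hd rd).
  apply: (N1_bound nu0 N1' (H1modR_opp M1) Md Md _ gd gd g1 _ (mulr_gt0 gd0 gd0)); rewrite (gnrm_opp H1')//.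
  by rewrite mulrA.
have k2 : - Btri d u2 d <= nu / 4 * (gnrm d * gnrm d).
  have [g0|g2] := eqVneq (gnrm u2) 0.
    by rewrite (Btri_arg2_0 rd H2' rd (gnrm0_wD H2' g0)) oppr0.
  rewrite -(Btri_Nr rd H2' rd).
  apply: (N1_bound nu0 N2' Md (H1modR_opp M2) Md gd _ gd g2 _ (mulr_gt0 gd0 gd0)); rewrite (gnrm_opp H2')//.
  exact: mul_swap_mid.
have eB : Btri u1 d d + Btri d u2 d = Btri u1 u1 d - Btri u2 u2 d.
  by rewrite (Btri_Br r1 H1' H2' rd) (Btri_Bl r1 r2 H2' rd) addrA subrK.
have := uniqueness_arith nu0 (h1 d Md) (h2 d Md) (gip_Bl H1' H2' Hd) eB k1 k2 _ (gip_self_ge0 d).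
by rewrite -sqr_gnrm expr2 => /(_ erefl) => e; apply/eqP; rewrite -sqrf_eq0 expr2; apply/eqP.
Qed.

End SteadyState.

(** * Energy estimates *)

Section Nonlinear.
Context {R : realType} (Om : set (R * R)) (sigma : {measure set (plane R) -> \bar R}).
Hypothesis hOm : smooth_bounded_domain Om.
Hypothesis hs : arclength_measure Om sigma.
Notation leb := (leb2 R).
Notation L2 := (L2 leb Om).
Notation ip := (ip leb Om).
Notation nrm := (nrm leb Om).
Notation L2b := (Defs.L2 sigma (bd Om)).
Notation ipb := (Defs.ip sigma (bd Om)).
Notation nrmb := (Defs.nrm sigma (bd Om)).
Notation aeqb := (aeq sigma (bd Om)).
Notation aeq := (aeq leb Om).
Notation wD := (wD Om).
Notation gip := (gip Om).
Notation Btri := (Btri Om).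
Notation reg := (reg Om).
Notation gr z := (fun x => wD 0 z x + wD 1 z x).
Local Opaque Defs.wD Defs.ip Defs.nrm.

Let oOm : open Om. Proof. by case: hOm. Qed.
Let bOm : bounded_set Om. Proof. by case: hOm. Qed.
Let mOm : measurable (Om : set (plane R)). Proof. exact: measurable_dom. Qed.
Let fOm : (leb Om < +oo)%E. Proof. exact: finite_dom. Qed.
Let mbd : measurable (bd Om : set (plane R)). Proof. exact: measurable_bd. Qed.
Let fbd : (sigma (bd Om) < +oo)%E. Proof. exact: finite_bd. Qed.
Let bdC : bd Om `<=` closure Om. Proof. by move=> x []. Qed.
Let rL2b z : reg z -> L2b z. Proof. exact: reg_L2b. Qed.

Lemma L2b_absM v z : reg v -> reg z -> L2b (fun x => `|v x| * z x).
Proof.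
move=> rv rz; have [B B0 hB] := reg_bounded hOm rv.
have m : measurable_fun (bd Om : set (plane R)) (fun x => `|v x|).
  by apply: measurableT_comp => //; case: (rL2b rv).
by apply: (L2_mulr_bounded (M := B) mbd m _ (rL2b rz)) => x bx; rewrite normr_id; exact: hB (bdC bx).
Qed.

Lemma leibniz_sum (v z a b c d : R) : v * a + z * b + (v * c + z * d) = v * (a + c) + z * (b + d).
Proof. by ring. Qed.

Lemma leibniz_cube (v z a b X Y : R) : X = v * Y + z * z * b -> Y = z * a + z * a ->
  X = z * b * z + 2 * (v * a * z).
Proof. by move=> -> ->; ring. Qed.

Lemma gr_M v z : reg v -> reg z -> aeq (gr (fun x => v x * z x)) (fun x => v x * gr z x + z x * gr v x).
Proof.
move=> rv rz; have [_ d] := regM hOm rv rz.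
apply: filterS2 (d 0) (d 1) => x h0 h1 Ox.
exact: (etrans (congr2 +%R (h0 Ox) (h1 Ox)) (leibniz_sum _ _ _ _ _ _)).
Qed.

(** With div f the sum of both partial derivatives of f, div(v z^2) = z^2 div v + 2 v z div z, and
    the divergence theorem bounds its integral by sqrt 2 times the boundary integral of |v| z^2. *)
Lemma tri_div v z : reg v -> reg z ->
  `|Btri z v z + 2 * Btri v z z| <= Num.sqrt 2 * ipb (fun x => `|v x| * z x) z.
Proof.
move=> rv rz; have [rzz _] := regM hOm rz rz; have [rp _] := regM hOm rv rzz.
have := reg_div hOm hs rp.
have L1 := L2_cst mOm fOm (1 : R).
have Lgv := L2_gr hOm (reg_H1 rv); have Lgz := L2_gr hOm (reg_H1 rz).
have La : L2 (fun x => z x * gr v x * z x).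
  by apply: (L2_eq mOm _ (reg_L2M hOm rz (reg_L2M hOm rz Lgv))) => x _; rewrite mulrC.
have Lb : L2 (fun x => v x * gr z x * z x).
  by apply: (L2_eq mOm _ (reg_L2M hOm rz (reg_L2M hOm rv Lgz))) => x _; rewrite mulrC.
have e1 : ip (gr (fun x => v x * (z x * z x))) (fun=> 1) =
    ip (fun x => z x * gr v x * z x + 2 * (v x * gr z x * z x)) (fun=> 1).
  apply: (aeq_ip mOm (L2_gr hOm (reg_H1 rp)) L1 (L2D mOm La (L2Z mOm 2 Lb)) L1 _ (aeq_refl _ _ _)).
  apply: filterS2 (gr_M rv rzz) (gr_M rz rz) => x h1 h2 Ox.
  exact: (leibniz_cube (h1 Ox) (h2 Ox)).
have e2 a : L2 a -> ip a (fun=> 1) = \int[leb]_(x in Om) a x.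
  by move=> _; apply: eq_Rintegral => x _; rewrite mulr1.
have e3 : ip (gr (fun x => v x * (z x * z x))) (fun=> 1) = Btri z v z + 2 * Btri v z z.
  apply: (etrans e1); rewrite (ipDl mOm La (L2Z mOm 2 Lb) L1) (ipZl mOm 2 Lb L1).
  exact: (congr2 (fun a b : R => a + 2 * b) (e2 _ La) (e2 _ Lb)).
rewrite e3; have -> // : ipb (fun x => `|v x * (z x * z x)|) (fun=> 1) = ipb (fun x => `|v x| * z x) z.
apply: eq_Rintegral => x _; rewrite mulr1 normrM (ger0_norm (x := z x * z x)) ?mulrA//.
by rewrite -expr2 sqr_ge0.
Qed.

Lemma tri_le v z : reg v -> reg z ->
  `|Btri z v z| <= nrm (fun x => z x * z x) * (nrm (wD 0 v) + nrm (wD 1 v)).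
Proof.
move=> rv rz; rewrite BtriE; have [rzz _] := regM hOm rz rz.
have L0 := reg_L2wD 0 rv; have L1 := reg_L2wD 1 rv.
apply: le_trans (cauchy_schwarz mOm (reg_L2 rzz) (L2D mOm L0 L1)) _.
by apply: ler_wpM2l; [exact: nrm_ge0|exact: (ler_nrmD mOm L0 L1)].
Qed.

Variables (nu c0 : R) (u : R * R -> R).
Hypotheses (nu0 : 0 < nu) (c00 : 0 < c0) (ru : reg u).
Hypothesis Bu : forall z, reg z -> Btri u z z <= nu / 4 * (gip z z + nrmb z ^+ 2).

(** Minus nu times the feedback law, with regular representatives in place of traces. *)
Definition boundary_flux (z : R * R -> R) : R * R -> R :=
  fun x => (c0 + nu + 2 * `|u x|) * z x + 2 / (9 * c0) * z x ^+ 3.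

(** The equation at a fixed time, with [g] in the role of w_t. Only [reg] functions are tested, so
    that no [tr] occurs. *)
Definition weak_form (z g : R * R -> R) : Prop := forall v, reg v ->
  ip g v + nu * gip z v + Btri u z v + Btri z u v + Btri z z v + ipb (boundary_flux z) v = 0.

Lemma L2b_cube z : reg z -> L2b (fun x => z x * (z x * z x)).
Proof. by move=> rz; apply: rL2b; exact: (regM hOm rz (regM hOm rz rz).1).1. Qed.

Lemma flux_poly (a b t : R) :
  (c0 + nu) * t + 2 * (b * t) + a * (t * (t * t)) = (c0 + nu + 2 * b) * t + a * t ^+ 3.
Proof. by ring. Qed.

Lemma L2b_flux z : reg z -> L2b (boundary_flux z).
Proof.
move=> rz.
apply: (L2_eq mbd _ (L2D mbd (L2D mbd (L2Z mbd (c0 + nu) (rL2b rz)) (L2Z mbd 2 (L2b_absM ru rz)))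
  (L2Z mbd (2 / (9 * c0)) (L2b_cube rz)))) => x _.
exact: flux_poly.
Qed.

Lemma flux_ip z v : reg z -> reg v -> ipb (boundary_flux z) v =
  (c0 + nu) * ipb z v + 2 * ipb (fun x => `|u x| * z x) v + 2 / (9 * c0) * ipb (fun x => z x * (z x * z x)) v.
Proof.
move=> rz rv; have Lz := rL2b rz; have Lu := L2b_absM ru rz; have Lc := L2b_cube rz; have Lv := rL2b rv.
rewrite -(ipZl mbd _ Lz Lv) -(ipZl mbd 2 Lu Lv) -(ipZl mbd _ Lc Lv).
rewrite -(ipDl mbd (L2Z mbd _ Lz) (L2Z mbd 2 Lu) Lv).
rewrite -(ipDl mbd (L2D mbd (L2Z mbd _ Lz) (L2Z mbd 2 Lu)) (L2Z mbd _ Lc) Lv).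
by apply: eq_ip => // x _; rewrite /boundary_flux (exprS _ 2) expr2 mulrDl -!mulrA.
Qed.

Lemma sqrt2P : [/\ 0 <= Num.sqrt (2 : R), Num.sqrt (2 : R) * Num.sqrt 2 = 2 & Num.sqrt (2 : R) <= 3 / 2].
Proof.
have s0 := sqrtr_ge0 (2 : R); have ss : Num.sqrt (2 : R) * Num.sqrt 2 = 2 by rewrite -expr2 sqr_sqrtr.
by split => //; nra.
Qed.

(** With a = |t|, the difference of the two sides is (2 c_0)^(-1) (c_0 - (sqrt 2 / 3) a)^2 a^2. Thus
    half of c_0 and half of the cubic coefficient 2/(9 c_0) absorb the term exactly. *)
Lemma cubic_young (t : R) : Num.sqrt 2 / 3 * (`|t| * t * t) <= (c0 / 2 * t + (9 * c0)^-1 * (t * (t * t))) * t.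
Proof.
have [s0 ss s1] := sqrt2P; set s := Num.sqrt 2 in s0 ss s1 *; set a := `|t|.
have aa : a * a = t * t by rewrite -normrM ger0_norm// -expr2 sqr_ge0.
have e1 : (c0 / 2 * t + (9 * c0)^-1 * (t * (t * t))) * t = c0 / 2 * (a * a) + (9 * c0)^-1 * ((a * a) * (a * a)).
  by rewrite aa; ring.
have e2 : c0 / 2 * (a * a) + (9 * c0)^-1 * ((a * a) * (a * a)) - s / 3 * (a * (a * a)) =
   (2 * c0)^-1 * ((c0 - s / 3 * a) ^+ 2 * (a * a)).
  have -> : (c0 - s / 3 * a) ^+ 2 = c0 ^+ 2 - 2 * c0 * (s / 3 * a) + (s * s) * (a * a) / 9 by field.
  rewrite ss; field; exact: lt0r_neq0.
have e3 : a * t * t = a * (a * a) by rewrite -mulrA aa.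
rewrite e1 e3 -subr_ge0 e2; apply: mulr_ge0; first by rewrite invr_ge0 mulr_ge0// ltW.
by apply: mulr_ge0; [exact: sqr_ge0|rewrite aa -expr2; exact: sqr_ge0].
Qed.

Lemma energy_arith (G T U Q W B1 B2 B3 Ig s : R) : 0 <= s -> s <= 3 / 2 -> 0 <= U ->
  Ig + nu * G + B1 + B2 + B3 + ((c0 + nu) * T + 2 * U + 2 / (9 * c0) * Q) = 0 ->
  B1 <= nu / 4 * (G + T) -> `|B2 + 2 * B1| <= s * U -> `|B3 + 2 * B3| <= s * W ->
  s / 3 * W <= c0 / 2 * T + (9 * c0)^-1 * Q ->
  3 * nu / 4 * G + (c0 / 2 + 3 * nu / 4) * T + U / 2 + (9 * c0)^-1 * Q <= - Ig.
Proof.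
move=> s0 s1 U0 e h1; rewrite !ler_norml => /andP[h2 _] /andP[h3 _] h4.
have sU : s * U <= 3 / 2 * U by exact: ler_wpM2r.
have e9 : 2 / (9 * c0) * Q = 2 * ((9 * c0)^-1 * Q) by rewrite mulrA.
move: e h4; rewrite e9; set q := (9 * c0)^-1 * Q => e h4; lra.
Qed.

(** B(u; z, z) + B(z; u, z) is the integral of div(u z^2) minus B(u; z, z), and B(z; z, z) is a
    third of the integral of div(z^3). The former costs sqrt 2 <= 3/2 out of the 2 |u| z^2 on the
    boundary and nu/4 through [Bu]; the latter is absorbed by [cubic_young]. *)
Lemma energy z g : reg z -> weak_form z g ->
  3 * nu / 4 * gip z z + (c0 / 2 + 3 * nu / 4) * nrmb z ^+ 2 + ipb (fun x => `|u x| * z x) z / 2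
  + (9 * c0)^-1 * ipb (fun x => z x * (z x * z x)) z <= - ip g z.
Proof.
move=> rz wf; have [s0 _ s1] := sqrt2P.
have U0 : 0 <= ipb (fun x => `|u x| * z x) z.
  by apply: ip_ge0 => x _; rewrite -mulrA mulr_ge0// -expr2 sqr_ge0.
have h := wf z rz; rewrite (flux_ip rz rz) -(sqr_nrm sigma (bd Om) z) in h.
have Lz := rL2b rz; have Lc := L2b_cube rz.
apply: (energy_arith s0 s1 U0 h (Bu rz) (tri_div ru rz) (tri_div rz rz)).
rewrite -(ipZl mbd _ (L2b_absM rz rz) Lz) sqr_nrm -(ipZl mbd _ Lz Lz) -(ipZl mbd _ Lc Lz).
have LZ := L2Z mbd (c0 / 2) Lz; have LC := L2Z mbd (9 * c0)^-1 Lc.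
rewrite -(ipDl mbd LZ LC Lz).
apply: (le_ip mbd (L2Z mbd _ (L2b_absM rz rz)) Lz (L2D mbd LZ LC) Lz) => x _.
by rewrite -mulrA; exact: cubic_young.
Qed.

(* The cubic term of the feedback absorbs the boundary integral of |z2| (z1 - z2)^2. *)
Lemma flux_monotone (s b t1 t2 : R) : s * s = 2 ->
  ((c0 / 4 + nu) * (t1 - t2) + 2 * (b * (t1 - t2)) + s / 2 * (`|t2| * (t1 - t2))) * (t1 - t2) <=
  ((c0 + nu + 2 * b) * t1 + 2 / (9 * c0) * t1 ^+ 3 - ((c0 + nu + 2 * b) * t2 + 2 / (9 * c0) * t2 ^+ 3)) * (t1 - t2).
Proof.
move=> ss; set a := `|t2|; have aa : t2 * t2 = a * a by rewrite /a -normrM ger0_norm// -expr2 sqr_ge0.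
rewrite -subr_ge0.
have -> : ((c0 + nu + 2 * b) * t1 + 2 / (9 * c0) * t1 ^+ 3 - ((c0 + nu + 2 * b) * t2 + 2 / (9 * c0) * t2 ^+ 3)) * (t1 - t2) -
  ((c0 / 4 + nu) * (t1 - t2) + 2 * (b * (t1 - t2)) + s / 2 * (a * (t1 - t2))) * (t1 - t2) =
  (t1 - t2) ^+ 2 * (2 / (9 * c0) * (t1 + t2 / 2) ^+ 2 + ((6 * c0)^-1 * (t2 * t2) - s / 2 * a + 3 / 4 * c0)).
  by field; exact: lt0r_neq0.
apply: mulr_ge0; first exact: sqr_ge0.
apply: addr_ge0; first by rewrite mulr_ge0 ?sqr_ge0// divr_ge0// mulr_ge0// ltW.
have -> : (6 * c0)^-1 * (t2 * t2) - s / 2 * a + 3 / 4 * c0 = (6 * c0)^-1 * (a - 3 / 2 * s * c0) ^+ 2.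
  rewrite aa (_ : (a - 3 / 2 * s * c0) ^+ 2 = a * a - 3 * s * c0 * a + 9 / 4 * (s * s) * c0 ^+ 2); last by field.
  by rewrite ss; field; exact: lt0r_neq0.
by rewrite mulr_ge0 ?sqr_ge0// invr_ge0 mulr_ge0// ltW.
Qed.

Lemma flux_difference z1 z2 (D := (fun x => z1 x - z2 x)) : reg z1 -> reg z2 ->
  (c0 / 4 + nu) * nrmb D ^+ 2 + 2 * ipb (fun x => `|u x| * D x) D + Num.sqrt 2 / 2 * ipb (fun x => `|z2 x| * D x) D
  <= ipb (boundary_flux z1) D - ipb (boundary_flux z2) D.
Proof.
move=> r1 r2; have [_ ss _] := sqrt2P; have rD : reg D by exact: (regB hOm r1 r2).
have LD := rL2b rD; have LU := L2b_absM ru rD; have LV := L2b_absM r2 rD.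
have LD' := L2Z mbd (c0 / 4 + nu) LD; have LU' := L2Z mbd 2 LU; have LV' := L2Z mbd (Num.sqrt 2 / 2) LV.
rewrite sqr_nrm -(ipZl mbd _ LD LD) -(ipZl mbd 2 LU LD) -(ipZl mbd _ LV LD).
rewrite -(ipDl mbd LD' LU' LD) -(ipDl mbd (L2D mbd LD' LU') LV' LD) -(ipBl mbd (L2b_flux r1) (L2b_flux r2) LD).
apply: (le_ip mbd (L2D mbd (L2D mbd LD' LU') LV') LD (L2B mbd (L2b_flux r1) (L2b_flux r2)) LD) => x _.
exact: flux_monotone.
Qed.

Lemma difference_arith1 (G T U U' N p q I1 I2 G1 G2 b1 b2 c1 c2 d1 d2 f1 f2 b c e1 e2 e3 s : R) :
  0 <= U -> s <= 3 / 2 ->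
  I1 + nu * G1 + b1 + c1 + d1 + f1 = 0 -> I2 + nu * G2 + b2 + c2 + d2 + f2 = 0 ->
  G = G1 - G2 -> b = b1 - b2 -> c = c1 - c2 -> e1 + e2 = d1 - d2 ->
  (c0 / 4 + nu) * T + 2 * U + s / 2 * U' <= f1 - f2 ->
  b <= nu / 4 * (G + T) -> `|c + 2 * b| <= s * U -> `|e3 + 2 * e2| <= s * U' ->
  `|e1| <= N * p -> `|e3| <= N * q -> 
  I1 - I2 <= - (3 * nu / 4 * G + (c0 / 4 + 3 * nu / 4) * T) + N * p + N * q / 2.
Proof.
move=> U0 s1 E1 E2 EG Eb Ec Ee hf hb; rewrite !ler_norml => /andP[h1 _] /andP[h2 _] /andP[h3 _] /andP[_ h4].
have sU : s * U <= 3 / 2 * U by exact: ler_wpM2r.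
have En : nu * G = nu * G1 - nu * G2 by rewrite EG mulrBr.
move: hb hf; lra.
Qed.

(** B(z1; z1, D) - B(z2; z2, D) = B(D; z1, D) + B(z2; D, D). The last term is half the integral of
    div(z2 D^2) minus half of B(D; z2, D). The divergence leaves sqrt 2 / 2 times the integral of
    |z2| D^2 on the boundary, exactly what [flux_difference] supplies; the two remaining forms are
    bounded by |D^2| times gradients. *)
Lemma difference z1 z2 g1 g2 (D := (fun x => z1 x - z2 x)) : reg z1 -> reg z2 -> L2 g1 -> L2 g2 -> weak_form z1 g1 -> weak_form z2 g2 ->
  ip (fun x => g1 x - g2 x) D <= - (3 * nu / 4 * gip D D + (c0 / 4 + 3 * nu / 4) * nrmb D ^+ 2)
    + nrm (fun x => D x * D x) * (nrm (wD 0 z1) + nrm (wD 1 z1))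
    + nrm (fun x => D x * D x) * (nrm (wD 0 z2) + nrm (wD 1 z2)) / 2.
Proof.
move=> r1 r2 L1 L2' w1 w2; have [s0 _ s1] := sqrt2P; have rD : reg D by exact: (regB hOm r1 r2).
have H1 := reg_H1 r1; have H2 := reg_H1 r2; have HD := reg_H1 rD; have Hu := reg_H1 ru.
rewrite (ipBl mOm L1 L2' (reg_L2 rD)).
have U0 : 0 <= ipb (fun x => `|u x| * D x) D.
  by apply: ip_ge0 => x _; rewrite -mulrA mulr_ge0// -expr2 sqr_ge0.
have e3 : Btri D z1 D + Btri z2 D D = Btri z1 z1 D - Btri z2 z2 D.
  by rewrite (Btri_Br hOm r2 H1 H2 rD) (Btri_Bl hOm r1 r2 H1 rD) addrA subrK.
exact: (difference_arith1 U0 s1 (w1 D rD) (w2 D rD) (gip_Bl hOm H1 H2 HD) (Btri_Br hOm ru H1 H2 rD)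
  (Btri_Bl hOm r1 r2 Hu rD) e3 (flux_difference r1 r2) (Bu rD) (tri_div ru rD) (tri_div r2 rD)
  (tri_le r1 rD) (tri_le r2 rD)).
Qed.

Variable CF : R.
Hypothesis CF0 : 0 < CF.
Hypothesis friedrichs : forall z, reg z -> nrm z ^+ 2 <= CF * (gip z z + nrmb z ^+ 2).

Lemma young (e x y : R) : 0 < e -> x * y <= e * x ^+ 2 + (4 * e)^-1 * y ^+ 2.
Proof.
move=> e0; rewrite -subr_ge0.
have -> : e * x ^+ 2 + (4 * e)^-1 * y ^+ 2 - x * y = e * (x - (2 * e)^-1 * y) ^+ 2.
  by field; exact: lt0r_neq0.
by rewrite mulr_ge0 ?sqr_ge0// ltW.
Qed.

Lemma sqr_sum2_le (x y : R) : (x + y) ^+ 2 <= 2 * (x ^+ 2 + y ^+ 2).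
Proof. by have := sqr_ge0 (x - y); rewrite sqrrB sqrrD; lra. Qed.

Lemma difference_arith2 (C I a d0 d1 T N p0 p1 q0 q1 : R) :
  0 <= C -> 0 <= T -> 0 <= p0 -> 0 <= p1 -> 0 <= q0 -> 0 <= q1 ->
  I <= - (3 * nu / 4 * (d0 ^+ 2 + d1 ^+ 2) + (c0 / 4 + 3 * nu / 4) * T) + N * (p0 + p1) + N * (q0 + q1) / 2 ->
  N <= C * (a * a + 2 * a * d0 + 2 * a * d1) -> a ^+ 2 <= CF * (d0 ^+ 2 + d1 ^+ 2 + T) ->
  I <= - (nu / 2) * (d0 ^+ 2 + d1 ^+ 2 + T) +
    (2 * CF / nu + 16 / nu) * C ^+ 2 * (4 * ((p0 ^+ 2 + p1 ^+ 2) + (q0 ^+ 2 + q1 ^+ 2))) * a ^+ 2.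
Proof.
move=> C0 T0 p00 p10 q00 q10 hI hN ha.
pose X := (p0 + p1) + (q0 + q1) / 2; have X0 : 0 <= X by rewrite /X; lra.
have hX : X ^+ 2 <= 4 * ((p0 ^+ 2 + p1 ^+ 2) + (q0 ^+ 2 + q1 ^+ 2)).
  apply: le_trans (sqr_sum2_le _ _) _.
  have := sqr_sum2_le p0 p1; have := sqr_sum2_le q0 q1.
  rewrite expr_div_n; have := sqr_ge0 q0; have := sqr_ge0 q1; have := sqr_ge0 (q0 + q1); lra.
have hN' : N * X <= C * X * (a * a + 2 * a * d0 + 2 * a * d1).
  by rewrite (mulrAC C); exact: ler_wpM2r.
have eN : N * (p0 + p1) + N * (q0 + q1) / 2 = N * X by rewrite /X; field.
(* Weights in Young's inequality: nu/8 for each derivative of D, and for |D| a weight that costs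
   nu/8 after Friedrichs. Together they use nu/4 and leave nu/2 out of 3 nu/4. *)
have nu8 : 0 < nu / 8 by rewrite divr_gt0.
have CF8 : 0 < nu / (8 * CF) by rewrite divr_gt0// mulr_gt0.
have y1 := young a (C * X * a) CF8.
have y2 := young d0 (2 * C * X * a) nu8; have y3 := young d1 (2 * C * X * a) nu8.
have y4 : nu / (8 * CF) * a ^+ 2 <= nu / 8 * (d0 ^+ 2 + d1 ^+ 2 + T).
  have -> : nu / 8 * (d0 ^+ 2 + d1 ^+ 2 + T) = nu / (8 * CF) * (CF * (d0 ^+ 2 + d1 ^+ 2 + T)).
    by field; exact: lt0r_neq0.
  by apply: ler_wpM2l => //; exact: ltW.
have e1 : (4 * (nu / (8 * CF)))^-1 * (C * X * a) ^+ 2 = 2 * CF / nu * C ^+ 2 * (X ^+ 2) * a ^+ 2.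
  by field; rewrite !lt0r_neq0.
have e2 : (4 * (nu / 8))^-1 * (2 * C * X * a) ^+ 2 = 8 / nu * C ^+ 2 * X ^+ 2 * a ^+ 2.
  by field; rewrite !lt0r_neq0.
have hX' : (2 * CF / nu + 16 / nu) * C ^+ 2 * X ^+ 2 * a ^+ 2 <=
    (2 * CF / nu + 16 / nu) * C ^+ 2 * (4 * ((p0 ^+ 2 + p1 ^+ 2) + (q0 ^+ 2 + q1 ^+ 2))) * a ^+ 2.
  apply: ler_wpM2r; first exact: sqr_ge0.
  apply: ler_wpM2l => //; apply: mulr_ge0; last exact: sqr_ge0.
  by apply: addr_ge0; rewrite divr_ge0// ?mulr_ge0// ltW.
rewrite e1 in y1; rewrite e2 in y2 y3.
have e3 : (2 * CF / nu + 16 / nu) * C ^+ 2 * X ^+ 2 * a ^+ 2 =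
  2 * CF / nu * C ^+ 2 * X ^+ 2 * a ^+ 2 + (8 / nu * C ^+ 2 * X ^+ 2 * a ^+ 2 + 8 / nu * C ^+ 2 * X ^+ 2 * a ^+ 2).
  by field; exact: lt0r_neq0.
have e4 : C * X * (a * a + 2 * a * d0 + 2 * a * d1) = a * (C * X * a) + d0 * (2 * C * X * a) + d1 * (2 * C * X * a).
  by ring.
have cT : 0 <= c0 * T by rewrite mulr_ge0// ltW.
have nT : 0 <= nu * T by rewrite mulr_ge0// ltW.
rewrite e3 in hX'; rewrite e4 in hN'.
set A := 2 * CF / nu * C ^+ 2 * X ^+ 2 * a ^+ 2 in hX' y1.
set B := 8 / nu * C ^+ 2 * X ^+ 2 * a ^+ 2 in hX' y2 y3.
rewrite -addrA eN in hI.
move: hX' hN' y1 y2 y3 y4 hI; set Z := (_ + _) * _ * (4 * _) * _; set NX := N * X; set f1 := a * _; set f2 := d0 * _; set f3 := d1 * _; set f4 := _ * a ^+ 2.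
move: cT nT; move: (d0 ^+ 2) (d1 ^+ 2) => D0 D1; clearbody A B Z NX f1 f2 f3 f4; lra.
Qed.

(** [reg_sqr] and Young's inequality split the L^4 norm of [D]: its gradient goes into the
    dissipation, and the gradients of the two solutions remain as a factor of |D|^2. *)
Lemma difference_decay : exists2 C4 : R, 0 <= C4 & forall z1 z2 g1 g2 D,
  reg z1 -> reg z2 -> L2 g1 -> L2 g2 -> weak_form z1 g1 -> weak_form z2 g2 ->
  D = (fun x => z1 x - z2 x) ->
  ip (fun x => g1 x - g2 x) D <= - (nu / 2) * (gip D D + nrmb D ^+ 2) + C4 * (gip z1 z1 + gip z2 z2) * nrm D ^+ 2.
Proof.
have [C C0 hC] := reg_sqr hOm hs.
exists ((2 * CF / nu + 16 / nu) * C ^+ 2 * 4).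
  apply: mulr_ge0 => //; apply: mulr_ge0; last exact: sqr_ge0.
  by apply: addr_ge0; rewrite divr_ge0// ?mulr_ge0// ltW.
move=> z1 z2 g1 g2 D r1 r2 L1 L2' w1 w2 eD; have rD : reg D by rewrite eD; exact: (regB hOm r1 r2).
subst D.
have h := difference r1 r2 L1 L2' w1 w2; have F := friedrichs rD; have S := hC _ rD.
rewrite -(mulrA _ 4).
have E z : gip z z = nrm (wD 0 z) ^+ 2 + nrm (wD 1 z) ^+ 2.
  exact: (etrans (esym (sqr_gnrm _ _)) (sqr_gnrmE _ _)).
rewrite (E z1) (E z2) (E (fun x => z1 x - z2 x)); rewrite (E (fun x => z1 x - z2 x)) in F; rewrite (E (fun x => z1 x - z2 x)) in h.
exact: (difference_arith2 C0 (sqr_ge0 _) (nrm_ge0 _ _ _) (nrm_ge0 _ _ _) (nrm_ge0 _ _ _) (nrm_ge0 _ _ _) h S F).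
Qed.

End Nonlinear.

(** * The Laplacian and the traces *)

Section LaplacianBound.
Context {R : realType} (Om : set (R * R)) (sigma : {measure set (plane R) -> \bar R}).
Hypothesis hOm : smooth_bounded_domain Om.
Hypothesis hs : arclength_measure Om sigma.
Notation leb := (leb2 R).
Notation L2 := (L2 leb Om).
Notation ip := (ip leb Om).
Notation nrm := (nrm leb Om).
Notation L2b := (Defs.L2 sigma (bd Om)).
Notation ipb := (Defs.ip sigma (bd Om)).
Notation aeqb := (aeq sigma (bd Om)).
Notation aeq := (aeq leb Om).
Notation wD := (wD Om).
Notation gip := (gip Om).
Notation Btri := (Btri Om).
Notation reg := (reg Om).
Notation gr z := (fun x => wD 0 z x + wD 1 z x).
Local Opaque Defs.wD Defs.ip Defs.nrm.

Let oOm : open Om. Proof. by case: hOm. Qed.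
Let bOm : bounded_set Om. Proof. by case: hOm. Qed.
Let mOm : measurable (Om : set (plane R)). Proof. exact: measurable_dom. Qed.
Let fOm : (leb Om < +oo)%E. Proof. exact: finite_dom. Qed.
Let OmC : Om `<=` closure Om. Proof. exact: subset_closure. Qed.

Variables (nu c0 : R) (u : R * R -> R).
Hypotheses (nu0 : 0 < nu) (c00 : 0 < c0) (ru : reg u) (H2u : Hm Om 2 u).
Notation flux := (boundary_flux nu c0 u).
Notation weak_form := (weak_form Om sigma nu c0 u).

Definition convection (z : R * R -> R) : R * R -> R :=
  fun x => u x * gr z x + z x * gr u x + z x * gr z x.

(* Green's formula for z with Laplacian l and the feedback as normal derivative. *)
Definition green_form (z l : R * R -> R) : Prop := forall v, reg v ->
  gip z v + ip l v + nu^-1 * ipb (flux z) v = 0.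

Lemma L2_conv_parts z : reg z -> [/\ L2 (fun x => u x * gr z x), L2 (fun x => z x * gr u x) & L2 (fun x => z x * gr z x)].
Proof.
move=> rz; have Lz := L2_gr hOm (reg_H1 rz); have Lu := L2_gr hOm (reg_H1 ru).
by split; [exact: (reg_L2M hOm ru Lz)|exact: (reg_L2M hOm rz Lu)|exact: (reg_L2M hOm rz Lz)].
Qed.

Lemma L2_convection z : reg z -> L2 (convection z).
Proof. by move=> rz; have [L1 L2' L3] := L2_conv_parts rz; exact: (L2D mOm (L2D mOm L1 L2') L3). Qed.

Lemma convection_ip z v : reg z -> L2 v -> ip (convection z) v = Btri u z v + Btri z u v + Btri z z v.
Proof.
move=> rz Lv; have [L1 L2' L3] := L2_conv_parts rz.
exact: (etrans (ipDl mOm (L2D mOm L1 L2') L3 Lv) (congr1 (fun a => a + _) (ipDl mOm L1 L2' Lv))).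
Qed.

Lemma weak_green_arith (i g b1 b2 b3 f : R) : i + nu * g + b1 + b2 + b3 + f = 0 ->
  g + nu^-1 * (i + (b1 + b2 + b3)) + nu^-1 * f = 0.
Proof.
move=> h; have -> : g + nu^-1 * (i + (b1 + b2 + b3)) + nu^-1 * f = nu^-1 * (i + nu * g + b1 + b2 + b3 + f).
  by field; exact: lt0r_neq0.
by rewrite h mulr0.
Qed.

Lemma green_weak_arith (i g b1 b2 b3 f : R) : g + i + nu^-1 * f = 0 ->
  nu * i - (b1 + b2 + b3) + nu * g + b1 + b2 + b3 + f = 0.
Proof.
move=> h; have -> : nu * i - (b1 + b2 + b3) + nu * g + b1 + b2 + b3 + f = nu * (g + i + nu^-1 * f).
  by field; exact: lt0r_neq0.
by rewrite h mulr0.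
Qed.

Lemma weak_green z g : reg z -> L2 g -> weak_form z g ->
  green_form z (fun x => nu^-1 * (g x + convection z x)).
Proof.
move=> rz Lg wf v rv; have Lv := reg_L2 rv; have LF := L2_convection rz.
rewrite (ipZl mOm _ (L2D mOm Lg LF) Lv) (ipDl mOm Lg LF Lv) (convection_ip rz Lv).
exact: weak_green_arith (wf v rv).
Qed.

(** Used at time 0, where the compatibility condition provides the Laplacian and the force is
    defined from it. *)
Lemma green_weak z l : reg z -> L2 l -> green_form z l ->
  weak_form z (fun x => nu * l x - convection z x).
Proof.
move=> rz Ll gf v rv; have Lv := reg_L2 rv; have LF := L2_convection rz.
rewrite (ipBl mOm (L2Z mOm nu Ll) LF Lv) (ipZl mOm nu Ll Lv) (convection_ip rz Lv).
exact: green_weak_arith (gf v rv).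
Qed.

Lemma cube_ip (t a : R) : a * (3 * (t * t) * a) = 3 * ((t * a) * (t * a)).
Proof. by ring. Qed.

Lemma flux_cube_ge0 (b t : R) : 0 <= b -> 0 <= ((c0 + nu + 2 * b) * t + 2 / (9 * c0) * t ^+ 3) * (t * (t * t)).
Proof.
move=> b0.
have -> : ((c0 + nu + 2 * b) * t + 2 / (9 * c0) * t ^+ 3) * (t * (t * t)) =
  ((c0 + nu + 2 * b) + 2 / (9 * c0) * t ^+ 2) * (t ^+ 2) ^+ 2 by ring.
apply: mulr_ge0; last exact: sqr_ge0.
apply: addr_ge0; first by rewrite !addr_ge0 ?mulr_ge0// ltW.
by rewrite mulr_ge0 ?sqr_ge0// divr_ge0// mulr_ge0// ltW.
Qed.

Lemma wD_cube i z : reg z -> aeq (wD i (fun x => z x * (z x * z x))) (fun x => (3 * (z x * z x)) * wD i z x).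
Proof.
move=> rz; have [r2 d2] := regM hOm rz rz; have [_ d3] := regM hOm rz r2.
by apply: filterS2 (d2 i) (d3 i) => x h2 h3 Ox; rewrite h3// h2//; ring.
Qed.

Lemma cube_test_arith (q0 q1 i f n : R) : 3 * q0 + 3 * q1 + i + nu^-1 * f = 0 -> 0 <= f -> - i <= n ->
  3 * (q0 + q1) <= n.
Proof. move=> h f0 k; have : 0 <= nu^-1 * f by rewrite mulr_ge0// invr_ge0 ltW.
by move: (nu^-1 * f) h => X h X0; lra.
Qed.

(** Green's formula tested with z^3: the scalar product of the gradients is 3 |z grad z|^2, and the
    boundary term is nonnegative because the flux has the sign of z. *)
Lemma cube_test z l : reg z -> L2 l -> green_form z l ->
  3 * (nrm (fun x => z x * wD 0 z x) ^+ 2 + nrm (fun x => z x * wD 1 z x) ^+ 2) <=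
  nrm l * nrm (fun x => z x * (z x * z x)).
Proof.
move=> rz Ll gf; have [r2 _] := regM hOm rz rz; have [r3 _] := regM hOm rz r2.
have h := gf _ r3.
have e i : ip (wD i z) (wD i (fun x => z x * (z x * z x))) = 3 * nrm (fun x => z x * wD i z x) ^+ 2.
  have Li := reg_L2wD i rz; have Lq := reg_L2M hOm rz Li.
  have L' : L2 (fun x => (3 * (z x * z x)) * wD i z x) by exact: (reg_L2M hOm (regZ hOm 3 r2) Li).
  rewrite (aeq_ip mOm Li (reg_L2wD i r3) Li L' (aeq_refl _ _ _) (wD_cube i rz)) sqr_nrm -(ipZl mOm 3 Lq Lq).
  apply: eq_Rintegral => x _; rewrite cube_ip mulrA; by [].
have eg := etrans (gipE _ _ _) (congr2 +%R (e 0) (e 1)).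
rewrite eg in h.
have fl : 0 <= ipb (flux z) (fun x => z x * (z x * z x)).
  by apply: ip_ge0 => x _; exact: flux_cube_ge0.
have n3 : - ip l (fun x => z x * (z x * z x)) <= nrm l * nrm (fun x => z x * (z x * z x)).
  have := cauchy_schwarz mOm Ll (reg_L2 r3); rewrite ler_norml => /andP[k _].
  by rewrite lerNl.
exact: (cube_test_arith h fl n3).
Qed.

Definition size1 (z : R * R -> R) : R := nrm z + nrm (wD 0 z) + nrm (wD 1 z).

Lemma convection_arith (a h0 h1 k0 k1 q0 q1 l c s n M K0 K1 C1 C2 : R) : 
  0 <= a -> 0 <= h0 -> 0 <= h1 -> 0 <= k0 -> 0 <= k1 -> 0 <= q0 -> 0 <= q1 -> 0 <= l -> 0 <= c -> 0 <= s ->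
  0 <= M -> 0 <= K0 -> 0 <= K1 -> 0 <= C1 -> 0 <= C2 ->
  n <= M * (h0 + h1) + (k0 + k1) + (q0 + q1) -> k0 ^+ 2 <= K0 * s -> k1 ^+ 2 <= K1 * s ->
  3 * (q0 ^+ 2 + q1 ^+ 2) <= l * c ->
  s <= C1 * (a * a + 2 * a * h0 + 2 * a * h1) -> c <= C2 * (s * (a + 3 * h0 + 3 * h1)) ->
  n <= nu / 2 * l + (M + Num.sqrt (K0 * (2 * C1)) + Num.sqrt (K1 * (2 * C1)) + 2 * C1 * C2 / nu) *
    ((a + h0 + h1) + (a + h0 + h1) ^+ 3).
Proof.
move=> a0 h00 h10 k00 k10 q00 q10 l0 cc0 s0 M0 K00 K10 C10 C20 hn hk0 hk1 hq hs' hc.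
set H := a + h0 + h1; have H0 : 0 <= H by rewrite /H; lra.
have H30 : 0 <= H ^+ 3 by exact: exprn_ge0.
have sH : s <= 2 * C1 * H ^+ 2.
  apply: le_trans hs' _; have -> : 2 * C1 * H ^+ 2 = C1 * (2 * H ^+ 2) by ring.
  apply: ler_wpM2l => //.
  have := mulr_ge0 a0 h00; have := mulr_ge0 a0 h10; have := mulr_ge0 h00 h10.
  have := mulr_ge0 a0 a0; have := mulr_ge0 h00 h00; have := mulr_ge0 h10 h10.
  by rewrite /H; nra.
have cH : c <= 6 * C1 * C2 * H ^+ 3.
  apply: le_trans hc _; have -> : 6 * C1 * C2 * H ^+ 3 = C2 * ((2 * C1 * H ^+ 2) * (3 * H)) by ring.
  apply: ler_wpM2l => //; apply: ler_pM => //; first by lra.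
  by rewrite /H; lra.
have kH k K : 0 <= k -> 0 <= K -> k ^+ 2 <= K * s -> k <= Num.sqrt (K * (2 * C1)) * H.
  move=> k0' K0' hk; apply: le_sqrt_mul => //; first by rewrite !mulr_ge0.
  by apply: le_trans hk _; rewrite -mulrA; exact: ler_wpM2l.
have y0 := kH _ _ k00 K00 hk0; have y1 := kH _ _ k10 K10 hk1.
(* The test with z^3 gives (q0 + q1)^2 <= (2/3) l c. The weights leave nu/2 in front of [l], half of
   the coefficient of the Laplacian in the equation. *)
have qq : q0 + q1 <= nu / 2 * l + (3 * nu)^-1 * c.
  have rhs0 : 0 <= nu / 2 * l + (3 * nu)^-1 * c.
    by rewrite addr_ge0 ?mulr_ge0 ?invr_ge0 ?mulr_ge0// ltW.
  rewrite -ler_sqr ?nnegrE//; last exact: addr_ge0.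
  apply: le_trans (sqr_sum2_le _ _) _.
  have -> : (nu / 2 * l + (3 * nu)^-1 * c) ^+ 2 = 2 / 3 * (l * c) + (nu / 2 * l - (3 * nu)^-1 * c) ^+ 2.
    by field; exact: lt0r_neq0.
  by have := sqr_ge0 (nu / 2 * l - (3 * nu)^-1 * c); lra.
have cN : (3 * nu)^-1 * c <= 2 * C1 * C2 / nu * H ^+ 3.
  have -> : 2 * C1 * C2 / nu * H ^+ 3 = (3 * nu)^-1 * (6 * C1 * C2 * H ^+ 3) by field; exact: lt0r_neq0.
  by apply: ler_wpM2l => //; rewrite invr_ge0 mulr_ge0// ltW.
have MH : M * (h0 + h1) <= M * H by apply: ler_wpM2l => //; rewrite /H; lra.
have MH3 : 0 <= M * H ^+ 3 by exact: mulr_ge0.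
have K0H3 : 0 <= Num.sqrt (K0 * (2 * C1)) * H ^+ 3 by rewrite mulr_ge0// sqrtr_ge0.
have K1H3 : 0 <= Num.sqrt (K1 * (2 * C1)) * H ^+ 3 by rewrite mulr_ge0// sqrtr_ge0.
have cH1 : 0 <= 2 * C1 * C2 / nu * H by rewrite mulr_ge0// divr_ge0 ?mulr_ge0// ltW.
move: hn MH MH3 K0H3 K1H3 cH1 qq cN y0 y1; clear; clearbody H.
move: (Num.sqrt (K0 * (2 * C1))) (Num.sqrt (K1 * (2 * C1))) (2 * C1 * C2 / nu) (nu / 2 * l) ((3 * nu)^-1 * c) => r0 r1 r2 p q.
have -> : (M + r0 + r1 + r2) * (H + H ^+ 3) =
  M * H + M * H ^+ 3 + (r0 * H + r0 * H ^+ 3) + (r1 * H + r1 * H ^+ 3) + (r2 * H + r2 * H ^+ 3) by ring.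
move: (M * (h0 + h1)) (M * H) (M * H ^+ 3) (r0 * H) (r0 * H ^+ 3) (r1 * H) (r1 * H ^+ 3) (r2 * H) (r2 * H ^+ 3).
by move=> *; lra.
Qed.

(** u grad z is bounded by the sup of u, z grad u through L^4 norms because grad u is in H^1, and z
    grad z by [cube_test]. The last bound contains the Laplacian, with a factor small enough to be
    absorbed. *)
Lemma convection_bound : exists2 C : R, 0 <= C & forall z l, reg z -> L2 l -> green_form z l ->
  nrm (convection z) <= nu / 2 * nrm l + C * (size1 z + size1 z ^+ 3).
Proof.
have [C1 C10 hC1] := reg_sqr hOm hs; have [C2 C20 hC2] := reg_cube hOm hs.
have [K0 K00 hK0] := H1_mul_L4 hOm hs (H2_wD oOm bOm 0 H2u).
have [K1 K10 hK1] := H1_mul_L4 hOm hs (H2_wD oOm bOm 1 H2u).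
have [M M0 hM] := reg_bounded hOm ru.
exists (M + Num.sqrt (K0 * (2 * C1)) + Num.sqrt (K1 * (2 * C1)) + 2 * C1 * C2 / nu).
  by rewrite !addr_ge0 ?sqrtr_ge0// divr_ge0 ?mulr_ge0// ltW.
move=> z l rz Ll gf; have [L1 L2' L3] := L2_conv_parts rz.
have [r2 _] := regM hOm rz rz.
have two f : reg f -> forall g : 'I_2 -> R * R -> R, (forall i, L2 (g i)) ->
    nrm (fun x => f x * (g 0 x + g 1 x)) <= nrm (fun x => f x * g 0 x) + nrm (fun x => f x * g 1 x).
  move=> rf g Lg; apply: le_trans (ler_nrmD mOm (reg_L2M hOm rf (Lg 0)) (reg_L2M hOm rf (Lg 1))).
  by rewrite le_eqVlt; apply/orP; left; apply/eqP; apply: eq_nrm => x _; rewrite mulrDr.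
have n1 : nrm (fun x => u x * gr z x) <= M * (nrm (wD 0 z) + nrm (wD 1 z)).
  have [_ h] := L2_mul_bdd mOm (reg_measurable ru) (fun x Ox => hM x (OmC Ox)) M0 (L2_gr hOm (reg_H1 rz)).
  apply: le_trans h _; apply: ler_wpM2l => //.
  exact: (ler_nrmD mOm (reg_L2wD 0 rz) (reg_L2wD 1 rz)).
have n2 := two z rz (fun i => wD i u) (fun i => reg_L2wD i ru).
have n3 := two z rz (fun i => wD i z) (fun i => reg_L2wD i rz).
have n : nrm (convection z) <= M * (nrm (wD 0 z) + nrm (wD 1 z)) +
   (nrm (fun x => z x * wD 0 u x) + nrm (fun x => z x * wD 1 u x)) +
   (nrm (fun x => z x * wD 0 z x) + nrm (fun x => z x * wD 1 z x)).
  exact: (le_trans (ler_nrmD mOm (L2D mOm L1 L2') L3) (lerD (le_trans (ler_nrmD mOm L1 L2') (lerD n1 n2)) n3)).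
exact: (convection_arith (nrm_ge0 _ _ _) (nrm_ge0 _ _ _) (nrm_ge0 _ _ _) (nrm_ge0 _ _ _) (nrm_ge0 _ _ _) (nrm_ge0 _ _ _)
  (nrm_ge0 _ _ _) (nrm_ge0 _ _ _) (nrm_ge0 _ _ _) (nrm_ge0 _ _ _) M0 K00 K10 C10 C20 n (hK0 z rz) (hK1 z rz)
  (cube_test rz Ll gf) (hC1 z rz) (hC2 z rz)).
Qed.

End LaplacianBound.

Section Traces.
Context {R : realType} (Om : set (R * R)) (sigma : {measure set (plane R) -> \bar R}).
Hypothesis hOm : smooth_bounded_domain Om.
Hypothesis hs : arclength_measure Om sigma.
Notation leb := (leb2 R).
Notation L2 := (L2 leb Om).
Notation ip := (ip leb Om).
Notation nrm := (nrm leb Om).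
Notation L2b := (Defs.L2 sigma (bd Om)).
Notation ipb := (Defs.ip sigma (bd Om)).
Notation nrmb := (Defs.nrm sigma (bd Om)).
Notation aeqb := (aeq sigma (bd Om)).
Notation aeq := (aeq leb Om).
Notation wD := (wD Om).
Notation gip := (gip Om).
Notation Btri := (Btri Om).
Notation lap := (lap Om).
Notation reg := (reg Om).
Notation tr := (tr Om sigma).

Let oOm : open Om. Proof. by case: hOm. Qed.
Let bOm : bounded_set Om. Proof. by case: hOm. Qed.
Let mOm : measurable (Om : set (plane R)). Proof. exact: measurable_dom. Qed.
Let fOm : (leb Om < +oo)%E. Proof. exact: finite_dom. Qed.
Let mbd : measurable (bd Om : set (plane R)). Proof. exact: measurable_bd. Qed.

Lemma ip_EFin a b : L2b a -> L2b b -> (\int[sigma]_(x in bd Om) (a x * b x)%:E = (ipb a b)%:E)%E.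
Proof.
move=> La Lb; rewrite /Defs.ip /Rintegral fineK//; apply: integrable_fin_num => //.
exact: L2_mul_integrable.
Qed.

Lemma test_bd f phi : test_function Om phi -> ipb f phi = 0.
Proof.
move=> [_ [K [_ KO K0]]]; have -> : ipb f phi = ipb (fun=> 0) (fun=> 0).
  apply: eq_Rintegral => x /set_mem [_ nOx]; rewrite K0 ?mulr0// => /KO Ox.
  by apply: nOx; move: oOm; rewrite openE => /(_ x Ox).
by rewrite /Defs.ip; under eq_Rintegral do rewrite mul0r; rewrite Rintegral_cst// mul0r.
Qed.

Local Opaque Defs.wD Defs.ip Defs.nrm Defs.tr.

Lemma lapE f : lap f = (fun x => wD 0 (wD 0 f) x + wD 1 (wD 1 f) x).
Proof. by rewrite funeqE => x; exact: (sum_ord2 (fun i => wD i (wD i f) x)). Qed.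

Lemma L2_lap f : Hm Om 2 f -> L2 (lap f).
Proof.
move=> Hf; rewrite lapE; have L i : L2 (wD i (wD i f)) by apply: H1_L2wD; exact: H2_wD.
exact: (L2D mOm (L 0) (L 1)).
Qed.

Lemma lap_ip f phi : Hm Om 2 f -> test_function Om phi -> ip (lap f) phi = - gip f phi.
Proof.
move=> Hf tp; have Lp := L2_test oOm bOm tp; have H1f := H2_H1 Hf.
have L i : L2 (wD i (wD i f)) by apply: H1_L2wD; exact: H2_wD.
have e i : ip (wD i f) (wD i phi) = - ip (wD i (wD i f)) phi.
  have [_ h] := H1_wder i (H2_wD oOm bOm i Hf); rewrite -(h phi tp).
  have Hp := H1_smooth2 oOm bOm tp.1.
  exact: (aeq_ip mOm (H1_L2wD i H1f) (H1_L2wD i Hp) (H1_L2wD i H1f) (L2_test_partial oOm bOm i tp) (aeq_refl _ _ _) (wD_smooth2 oOm bOm i tp.1)).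
have eg := etrans (gipE _ _ _) (congr2 +%R (e 0) (e 1)).
by rewrite eg lapE (ipDl mOm (L 0) (L 1) Lp) -opprD opprK.
Qed.

(** Testing inside the domain determines the Laplacian, by du Bois-Reymond; the boundary term of
    Green's formula is invisible to test functions. *)
Lemma lap_green f z l : Hm Om 2 f -> reg z -> aeq f z -> L2 l ->
  (forall phi, test_function Om phi -> gip z phi + ip l phi = 0) -> aeq (lap f) l.
Proof.
move=> Hf rz fz Ll h; apply: (weq_of_ip oOm bOm (L2_lap Hf) Ll) => phi tp.
rewrite (lap_ip Hf tp); have Hp := H1_smooth2 oOm bOm tp.1.
rewrite (gip_aeq hOm (H2_H1 Hf) Hp (reg_H1 rz) Hp fz (aeq_refl _ _ _)).
by apply/eqP; rewrite eq_sym -addr_eq0 addrC; apply/eqP; exact: h.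
Qed.

Lemma lap_green_form nu c0 u f z l : Hm Om 2 f -> reg z -> aeq f z -> L2 l ->
  green_form Om sigma nu c0 u z l -> aeq (lap f) l.
Proof.
move=> Hf rz fz Ll gf; apply: (lap_green Hf rz fz Ll) => phi tp.
by have := gf phi (reg_smooth2 hOm tp.1); rewrite (test_bd _ tp) mulr0 addr0.
Qed.

Lemma measurable_flux (c nu c0 : R) (a b d : R * R -> R) : L2b a -> L2b b -> L2b d ->
  measurable_fun (bd Om : set (plane R)) (fun x => c * ((c0 + nu + 2 * `|a x|) * b x + 2 / (9 * c0) * b x ^+ 3) * d x).
Proof.
move=> [ma _] [mb _] [md _]; apply: measurable_funM => //; apply: measurable_funM => //.
apply: measurable_funD; apply: measurable_funM => //; last exact: measurable_funX.
apply: measurable_funD => //; apply: measurable_funM => //.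
exact: measurableT_comp.
Qed.

Section Flux.
Variables (nu c0 : R) (U u f z : R * R -> R).
Hypotheses (HU : Hm Om 1 U) (ru : reg u) (Uu : aeq U u) (Hf : Hm Om 1 f) (rz : reg z) (fz : aeq f z).

Lemma flux_trace (c : R) v : reg v ->
  ipb (fun x => c * ((c0 + nu + 2 * `|tr U x|) * tr f x + 2 / (9 * c0) * tr f x ^+ 3)) (tr v) =
  ipb (fun x => c * boundary_flux nu c0 u z x) v.
Proof.
move=> rv; have [LU eU] := tr_reg hOm hs HU ru Uu; have [Lf ef] := tr_reg hOm hs Hf rz fz.
have [Lv ev] := tr_reg hOm hs (reg_H1 rv) rv (aeq_refl _ _ _).
apply: (aeq_Rintegral mbd (measurable_flux c nu c0 LU Lf Lv)
  (measurable_flux c nu c0 (reg_L2b hOm hs ru) (reg_L2b hOm hs rz) (reg_L2b hOm hs rv))).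
by apply: filterS3 eU ef ev => x h1 h2 h3 bx; rewrite h1// h2// h3.
Qed.

(** Each term depends on classes only, so the equation passes to the regular representatives and the
    traces become restrictions. *)
Lemma weak_form_trace g : (forall v, Hm Om 1 v ->
    ip g v + nu * gip f v + Btri U f v + Btri f U v + Btri f f v
    + ipb (fun x => (c0 + nu + 2 * `|tr U x|) * tr f x + 2 / (9 * c0) * tr f x ^+ 3) (tr v) = 0) ->
  weak_form Om sigma nu c0 u z g.
Proof.
move=> h v rv; have Hv := reg_H1 rv; have Lv := reg_L2 rv; have Lu := reg_L2 ru; have Lz := reg_L2 rz.
have Hz := reg_H1 rz; have Hu := reg_H1 ru; have vv := aeq_refl leb Om v.
have e := flux_trace 1 rv.
have e1 k : ipb (fun x => 1 * k x) v = ipb k v by apply: eq_ip => // x _; rewrite mul1r.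
have e2 k : ipb (fun x => 1 * k x) (tr v) = ipb k (tr v) by apply: eq_ip => // x _; rewrite mul1r.
have eF := etrans (esym (e2 _)) (etrans e (e1 _)).
have := h v Hv; rewrite eF (gip_aeq hOm Hf Hv Hz Hv fz vv).
rewrite (Btri_aeq hOm (H1_L2 HU) Lu Hf Hz Lv Lv Uu fz vv).
rewrite (Btri_aeq hOm (H1_L2 Hf) Lz HU Hu Lv Lv fz Uu vv).
by rewrite (Btri_aeq hOm (H1_L2 Hf) Lz Hf Hz Lv Lv fz fz vv).
Qed.

(** The compatibility condition is already Green's formula. It stands in for the equation at t = 0,
    which is assumed for t > 0 only. *)
Lemma normal_derivative_green : normal_derivative Om sigma f (feedback Om sigma nu c0 U f) ->
  exists2 l, L2 l & green_form Om sigma nu c0 u z l.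
Proof.
move=> [_ _ [l [Ll h]]]; exists l => // v rv; have Hv := reg_H1 rv.
have := h v Hv; rewrite (gip_aeq hOm Hf Hv (reg_H1 rz) Hv fz (aeq_refl _ _ _)) => ->.
rewrite (flux_trace (- nu^-1) rv) (ipZl mbd _ (L2b_flux hOm hs nu c0 ru rz) (reg_L2b hOm hs rv)).
by rewrite mulNr addNr.
Qed.

Lemma integral_trace_sqr : (\int[sigma]_(x in bd Om) ((c0 + nu + 2 * `|tr U x|) / nu * tr f x ^+ 2)%:E =
  (((c0 + nu) / nu) * nrmb z ^+ 2 + 2 / nu * ipb (fun x => `|u x| * z x) z)%:E)%E.
Proof.
have [LU eU] := tr_reg hOm hs HU ru Uu; have [Lf ef] := tr_reg hOm hs Hf rz fz.
have Lz := reg_L2b hOm hs rz; have Luz := L2b_absM hOm hs ru rz; have Lub := reg_L2b hOm hs ru.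
have L1 := L2Z mbd ((c0 + nu) / nu) Lz; have L2' := L2Z mbd (2 / nu) Luz.
rewrite sqr_nrm -(ipZl mbd _ Lz Lz) -(ipZl mbd _ Luz Lz) -(ipDl mbd L1 L2' Lz) -(ip_EFin (L2D mbd L1 L2') Lz).
have m a b : L2b a -> L2b b -> measurable_fun (bd Om : set (plane R)) (fun x => ((c0 + nu + 2 * `|a x|) / nu * b x ^+ 2)%:E).
  move=> [ma _] [mb _]; apply/measurable_EFinP; apply: measurable_funM; last exact: measurable_funX.
  apply: measurable_funM => //; apply: measurable_funD => //; apply: measurable_funM => //.
  exact: measurableT_comp.
transitivity (\int[sigma]_(x in bd Om) ((c0 + nu + 2 * `|u x|) / nu * z x ^+ 2)%:E)%E.
  apply: ae_eq_integral => //; [exact: m|exact: m|].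
  by apply: filterS2 eU ef => x h1 h2 bx; rewrite h1// h2.
by apply: eq_integral => x _; congr EFin; ring.
Qed.

Lemma integral_trace_pow4 : (\int[sigma]_(x in bd Om) (tr f x ^+ 4)%:E =
  (ipb (fun x => z x * (z x * z x)) z)%:E)%E.
Proof.
have [Lf ef] := tr_reg hOm hs Hf rz fz.
have Lz := reg_L2b hOm hs rz; have Lc := L2b_cube hOm hs rz.
rewrite -(ip_EFin Lc Lz).
have m a : L2b a -> measurable_fun (bd Om : set (plane R)) (fun x => (a x ^+ 4)%:E).
  by move=> [ma _]; apply/measurable_EFinP; exact: measurable_funX.
transitivity (\int[sigma]_(x in bd Om) (z x ^+ 4)%:E)%E.
  apply: ae_eq_integral => //; [exact: m|exact: m|].
  by apply: filterS ef => x h bx; rewrite h.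
by apply: eq_integral => x _; congr EFin; ring.
Qed.

End Flux.

Lemma friedrichs_reg CF z : friedrichs_constant Om sigma CF -> reg z ->
  nrm z ^+ 2 <= CF * (gip z z + nrmb z ^+ 2).
Proof.
move=> [_ h] rz; have := h z (reg_H1 rz); rewrite sqr_gnrm.
have [Lt tz] := tr_reg hOm hs (reg_H1 rz) rz (aeq_refl _ _ _).
by rewrite (aeq_nrm mbd Lt (reg_L2b hOm hs rz) tz).
Qed.

End Traces.

(** * Decay in time *)

Section RealODE.
Context {R : realType}.

(** The mean value theorem. At 0 continuity from the right is enough, as the derivatives in time are
    one-sided there. *)
Lemma nonincreasing_from0 (f f' : R -> R) (T : R) : 0 < T ->
  (forall t : R, 0 < t <= T -> is_derive t 1 f (f' t)) ->
  (forall t, 0 < t < T -> f' t <= 0) -> f x @[x --> 0^'+] --> f 0 -> f T <= f 0.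
Proof.
move=> T0 df f0 cf.
have ct (t : R) : 0 < t <= T -> {for t, continuous f}.
  by move=> /df h; apply: differentiable_continuous; apply/derivable1_diffP; case: h.
have cF : {within `[0, T], continuous f}.
  apply/continuous_within_itvP => //; split => //.
    by move=> t; rewrite in_itv/= => /andP[h1 h2]; apply: ct; rewrite h1 ltW.
  by apply: cvg_at_left_filter; apply: ct; rewrite T0 lexx.
have dF t : t \in `]0, T[%R -> is_derive t 1 f (f' t).
  by rewrite in_itv/= => /andP[h1 h2]; apply: df; rewrite h1 ltW.
have [c] := MVT T0 dF cF; rewrite in_itv/= => hc e.
rewrite -subr_le0 e subr0; apply: mulr_le0_ge0; [exact: f0|exact: ltW].
Qed.

(** Z e^Q - c t has nonpositive derivative. The exponent is an arbitrary function of time, so that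
    it can contain a multiple of the energy. *)
Lemma exp_gronwall (Z Z' Q Q' : R -> R) (c T : R) : 0 < T ->
  (forall t : R, 0 < t <= T -> is_derive t 1 Z (Z' t)) ->
  (forall t : R, 0 < t <= T -> is_derive t 1 Q (Q' t)) ->
  Z x @[x --> 0^'+] --> Z 0 -> Q x @[x --> 0^'+] --> Q 0 ->
  (forall t, 0 < t < T -> expR (Q t) * (Z' t + Q' t * Z t) <= c) ->
  Z T * expR (Q T) <= Z 0 * expR (Q 0) + c * T.
Proof.
move=> T0 dZ dQ cZ cQ h.
pose V t := Z t * expR (Q t) - c * t.
pose V' t := expR (Q t) * (Z' t + Q' t * Z t) - c.
have dV (t : R) : 0 < t <= T -> is_derive t 1 V (V' t).
  move=> ht; have := dZ t ht; have := dQ t ht => dQt dZt.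
  have de : is_derive t 1 (expR \o Q) (expR (Q t) * Q' t) by exact: is_derive1_comp.
  apply: is_derive_eq; rewrite /V' /= /GRing.scale/=; ring.
have cV : V x @[x --> 0^'+] --> V 0.
  apply: cvgB; first by apply: cvgM => //; apply: continuous_cvg => //; exact: continuous_expR.
  by apply: cvgM; [exact: cvg_cst|apply: cvg_at_right_filter; exact: cvg_id].
have := nonincreasing_from0 T0 dV _ cV; rewrite /V mulr0 subr0 lerBlDr.
by apply=> t ht; rewrite subr_le0; exact: h.
Qed.

End RealODE.

(** * Differentiating the squared norm along a curve in L^2 *)

Section Curves.
Context {R : realType} (Om : set (R * R)).
Notation leb := (leb2 R).
Hypothesis mOm : measurable (Om : set (plane R)).
Notation L2 := (L2 leb Om).
Notation ip := (ip leb Om).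
Notation nrm := (nrm leb Om).

Lemma time_derivative_shift (f f' : R -> R * R -> R) (h : R) : 0 <= h -> time_derivative Om f f' ->
  time_derivative Om (fun t => f (t + h)) (fun t => f' (t + h)).
Proof.
move=> h0 d t t0 e e0; have th : 0 <= t + h by exact: addr_ge0.
apply: filterS (d _ th _ e0) => k hk tk.
by rewrite addrAC; apply: hk; rewrite addrAC addr_ge0.
Qed.

Lemma time_derivativeB (f f' g g' : R -> R * R -> R) : (forall t, 0 <= t -> L2 (f t) /\ L2 (f' t)) ->
  (forall t, 0 <= t -> L2 (g t) /\ L2 (g' t)) -> time_derivative Om f f' -> time_derivative Om g g' ->
  time_derivative Om (fun t x => f t x - g t x) (fun t x => f' t x - g' t x).
Proof.
move=> Lf Lg df dg t t0 e e0; have e2 : 0 < e / 2 by rewrite divr_gt0.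
apply: filterS2 (df t t0 _ e2) (dg t t0 _ e2) => h h1 h2 th.
have [Lft Lf't] := Lf t t0; have [Lgt Lg't] := Lg t t0; have [Lfh _] := Lf _ th; have [Lgh _] := Lg _ th.
have L1 := L2B mOm (L2Z mOm h^-1 (L2B mOm Lfh Lft)) Lf't.
have L2' := L2B mOm (L2Z mOm h^-1 (L2B mOm Lgh Lgt)) Lg't.
rewrite (splitr e); apply: le_lt_trans (ltrD (h1 th) (h2 th)).
apply: le_trans _ (ler_nrmB mOm L1 L2'); rewrite le_eqVlt; apply/orP; left; apply/eqP.
by apply: eq_nrm => x _; ring.
Qed.

Lemma time_derivative_cst (g : R * R -> R) : time_derivative Om (fun=> g) (fun=> fun=> 0).
Proof.
move=> t t0 e e0; near=> h => _.
rewrite (_ : nrm _ = 0)//; rewrite -[RHS](nrm0 leb mOm); apply: eq_nrm => x _.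
by rewrite subrr mulr0 subr0.
Unshelve. all: by end_near. Qed.

Section SquaredNorm.
Variables (f f' : R -> R * R -> R).
Hypothesis Lf : forall t, 0 <= t -> L2 (f t) /\ L2 (f' t).
Hypothesis df : time_derivative Om f f'.

(** With q the difference quotient, |f(t + h)|^2 = |f(t)|^2 + 2 h (q, f(t)) + h^2 |q|^2, and q is
    within [e] of the derivative. Stated before any limit, it serves for differentiability at t > 0
    and for continuity at 0. *)
Lemma difference_quotient t (e : R) : 0 <= t -> 0 < e ->
  \forall h \near (0 : R)^', 0 <= t + h ->
    `|h^-1 * (nrm (f (t + h)) ^+ 2 - nrm (f t) ^+ 2) - 2 * ip (f' t) (f t)| <=
      2 * e * nrm (f t) + `|h| * (nrm (f' t) + e) ^+ 2.
Proof.
move=> t0 e0; apply: filterS2 (nbhs_dnbhs_neq (0 : R)) (df t0 e0) => h h0 qe0 th; have qe1 := qe0 th.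
have [Lt L't] := Lf t0; have [Lh _] := Lf th.
pose q x := h^-1 * (f (t + h) x - f t x); have Lq : L2 q by exact: (L2Z mOm _ (L2B mOm Lh Lt)).
have qe : nrm (fun x => q x - f' t x) < e.
  exact: qe1.
have eh : nrm (f (t + h)) ^+ 2 = nrm (fun x => f t x + h * q x) ^+ 2.
  congr (_ ^+ 2); apply: eq_nrm => x _; by rewrite /q mulrA mulfV// mul1r subrKC.
have Lhq := L2Z mOm h Lq.
have e1 : nrm (fun x => f t x + h * q x) ^+ 2 = nrm (f t) ^+ 2 + 2 * h * ip q (f t) + h ^+ 2 * nrm q ^+ 2.
  rewrite !sqr_nrm (ipDl mOm Lt Lhq (L2D mOm Lt Lhq)) (ipDr mOm Lt Lhq Lt) (ipDr mOm Lt Lhq Lhq).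
  rewrite (ipZl mOm h Lq Lt) (ipZr mOm h Lq Lt) (ipZr mOm h Lq Lhq) (ipZl mOm h Lq Lq) (ipC leb Om (f t) q).
  by ring.
have e2 : h^-1 * (nrm (f (t + h)) ^+ 2 - nrm (f t) ^+ 2) - 2 * ip (f' t) (f t) =
   2 * ip (fun x => q x - f' t x) (f t) + h * nrm q ^+ 2.
  rewrite eh e1 (ipBl mOm Lq L't Lt); field; exact: h0.
rewrite e2; apply: le_trans (ler_normD _ _) _; apply: lerD.
  rewrite normrM ger0_norm// -mulrA; apply: ler_wpM2l => //.
  apply: le_trans (cauchy_schwarz mOm (L2B mOm Lq L't) Lt) _.
  by apply: ler_wpM2r; [exact: nrm_ge0|exact: ltW].
rewrite normrM (ger0_norm (sqr_ge0 _)); apply: ler_wpM2l => //.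
apply: lerXn2r; rewrite ?nnegrE ?addr_ge0 ?nrm_ge0// ?ltW//.
have := ler_nrm_dist mOm Lq L't; have := ler_norm (nrm q - nrm (f' t)); move: qe.
by move: (nrm q) (nrm (f' t)) (nrm (fun x => q x - f' t x)) `|_| => a b c d; lra.
Qed.

Lemma is_derive_sqr_nrm (t : R) : 0 < t -> is_derive t 1 (fun t => nrm (f t) ^+ 2) (2 * ip (f' t) (f t)).
Proof.
move=> t0; set N := fun t => nrm (f t) ^+ 2; set d := 2 * _.
have c : (fun h => h^-1 *: (N (h *: 1 + t) - N t)) @ (0 : R)^' --> d.
  apply/cvgrPdist_le => e e0.
  pose a := nrm (f t); pose b := nrm (f' t).
  have a0 : 0 <= a by exact: nrm_ge0.
  have b0 : 0 <= b by exact: nrm_ge0.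
  (* [e1] and, below, [r] make each of the two error terms of [difference_quotient] at most e/2. *)
  pose e1 := Num.min 1 (e / (4 * (a + 1))).
  have e10 : 0 < e1 by rewrite lt_min ltr01 divr_gt0// mulr_gt0//; lra.
  have e1a : 2 * e1 * a <= e / 2.
    have : e1 <= e / (4 * (a + 1)) by rewrite ge_min lexx orbT.
    rewrite ler_pdivlMr; last by rewrite mulr_gt0//; lra.
    by move=> h; nra.
  have e11 : e1 <= 1 by rewrite ge_min lexx.
  pose r := Num.min t (e / (2 * (b + 1) ^+ 2)).
  have b10 : 0 < (b + 1) ^+ 2 by rewrite exprn_gt0//; lra.
  have r0 : 0 < r by rewrite lt_min t0 divr_gt0// mulr_gt0.
  have hr : \forall h \near (0 : R)^', `|h| < r.
    exact: dnbhs0_lt.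
  apply: filterS2 hr (difference_quotient (ltW t0) e10) => h hr hq.
  have ht : `|h| < t by apply: lt_le_trans hr _; rewrite ge_min lexx.
  have th : 0 <= t + h by move: ht; rewrite ltr_norml => /andP[]; lra.
  rewrite distrC /GRing.scale/= mulr1 (addrC h).
  apply: le_trans (hq th) _; rewrite -/a -/b (splitr e); apply: lerD => //.
  have hb : `|h| <= e / (2 * (b + 1) ^+ 2) by apply/ltW; apply: lt_le_trans hr _; rewrite ge_min lexx orbT.
  move: hb; rewrite (ler_pdivlMr _ _ (mulr_gt0 (ltr0Sn R 1) b10)) => hb.
  have : `|h| * (b + e1) ^+ 2 <= `|h| * (b + 1) ^+ 2.
    apply: ler_wpM2l => //; apply: lerXn2r; rewrite ?nnegrE ?addr_ge0//; first exact: ltW.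
    by rewrite lerD2l.
  by move: hb; move: `|h| ((b + 1) ^+ 2) (_ ^+ 2) => x y z; lra.
by apply: DeriveDef; [exact: cvgP c|exact: cvg_lim c].
Qed.

Lemma quotient_bound (h N i a b : R) : 0 < h -> h <= 1 ->
  `|h^-1 * N - 2 * i| <= 2 * 1 * a + h * (b + 1) ^+ 2 -> `|N| <= h * (2 * a + (b + 1) ^+ 2 + 2 * `|i| + 1).
Proof.
move=> h0 h1 hD; have eN : N = h * ((h^-1 * N - 2 * i) + 2 * i) by field; exact: lt0r_neq0.
rewrite [X in `|X|]eN normrM (gtr0_norm h0); apply: ler_wpM2l; first exact: ltW.
apply: le_trans (ler_normD _ _) _.
have e2 : `|2 * i| = 2 * `|i| by rewrite normrM ger0_norm.
have hb : h * (b + 1) ^+ 2 <= (b + 1) ^+ 2 by rewrite ler_piMl// sqr_ge0.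
rewrite e2; move: hD hb; move: `|_ - _| `|i| ((b + 1) ^+ 2) => x y z; move: (h * z) => v; lra.
Qed.

Lemma sqr_nrm_right_continuous : nrm (f x) ^+ 2 @[x --> 0^'+] --> nrm (f 0) ^+ 2.
Proof.
apply/cvgrPdist_le => e e0.
pose a := nrm (f 0); pose b := nrm (f' 0); pose i := ip (f' 0) (f 0).
have a0 : 0 <= a by exact: nrm_ge0.
have b0 : 0 <= b by exact: nrm_ge0.
have i0 : 0 <= `|i| by [].
pose M := 2 * a + (b + 1) ^+ 2 + 2 * `|i| + 1.
have M0 : 0 < M by rewrite /M; have := sqr_ge0 (b + 1); lra.
pose r := Num.min 1 (e / M).
have r0 : 0 < r by rewrite lt_min ltr01 divr_gt0.
have hr : \forall h \near (0 : R)^'+, h < r by exact: nbhs_right_lt.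
have hp : \forall h \near (0 : R)^'+, 0 < h by exact: nbhs_right_gt.
have hd : \forall h \near (0 : R)^'+, 0 <= 0 + h ->
    `|h^-1 * (nrm (f (0 + h)) ^+ 2 - nrm (f 0) ^+ 2) - 2 * ip (f' 0) (f 0)| <=
      2 * 1 * nrm (f 0) + `|h| * (nrm (f' 0) + 1) ^+ 2.
  have := @difference_quotient 0 1 (lexx _) ltr01.
  rewrite !near_withinE; apply: filterS => x hx x0; apply: hx; exact: lt0r_neq0.
apply: filterS3 hr hp hd => h h1 h2; rewrite add0r => /(_ (ltW h2)).
rewrite -/a -/b -/i (gtr0_norm h2).
have hM : h * M <= e.
  by rewrite -ler_pdivlMr//; apply/ltW; apply: lt_le_trans h1 _; rewrite ge_min lexx orbT.
have hh : h <= 1 by apply/ltW; apply: lt_le_trans h1 _; rewrite ge_min lexx.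
move=> hD; rewrite distrC; exact: le_trans (quotient_bound h2 hh hD) hM.
Qed.

End SquaredNorm.
End Curves.

(** * Exponential decay of the time derivative *)

Section Decay.
Context {R : realType} (Om : set (R * R)) (sigma : {measure set (plane R) -> \bar R}).
Hypothesis hOm : smooth_bounded_domain Om.
Hypothesis hs : arclength_measure Om sigma.
Notation leb := (leb2 R).
Notation L2 := (L2 leb Om).
Notation ip := (ip leb Om).
Notation nrm := (nrm leb Om).
Notation ipb := (Defs.ip sigma (bd Om)).
Notation nrmb := (Defs.nrm sigma (bd Om)).
Notation gip := (gip Om).
Notation Btri := (Btri Om).
Notation reg := (reg Om).

Let oOm : open Om. Proof. by case: hOm. Qed.
Let bOm : bounded_set Om. Proof. by case: hOm. Qed.
Let mOm : measurable (Om : set (plane R)). Proof. exact: measurable_dom. Qed.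
Let fOm : (leb Om < +oo)%E. Proof. exact: finite_dom. Qed.

Lemma sqr_nrm_diff0 (f : R * R -> R) : nrm (fun x => f x - f x) ^+ 2 = 0.
Proof.
have -> : nrm (fun x => f x - f x) = nrm (fun=> 0) by apply: eq_nrm => x _; rewrite subrr.
by rewrite (nrm0 leb mOm) expr0n.
Qed.

Local Opaque Defs.wD Defs.ip Defs.nrm.

Variables (nu c0 lam C4 : R) (u : R * R -> R).
Hypotheses (nu0 : 0 < nu) (c00 : 0 < c0) (ru : reg u) (lam0 : 0 <= lam) (C40 : 0 <= C4).
Hypothesis Bu : forall z, reg z -> Btri u z z <= nu / 4 * (gip z z + nrmb z ^+ 2).
Hypothesis coercive : forall z, reg z -> lam * nrm z ^+ 2 <= nu * (gip z z + nrmb z ^+ 2).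
Notation weak_form := (weak_form Om sigma nu c0 u).
Hypothesis contraction : forall z1 z2 g1 g2 D,
  reg z1 -> reg z2 -> L2 g1 -> L2 g2 -> weak_form z1 g1 -> weak_form z2 g2 ->
  D = (fun x => z1 x - z2 x) ->
  ip (fun x => g1 x - g2 x) D <= - (nu / 2) * (gip D D + nrmb D ^+ 2) + C4 * (gip z1 z1 + gip z2 z2) * nrm D ^+ 2.

Variables (z zt : R -> R * R -> R) (g0 : R * R -> R).
Hypothesis rz : forall t, 0 <= t -> reg (z t).
Hypothesis Lzt : forall t, 0 <= t -> L2 (zt t).
Hypothesis dz : time_derivative Om z zt.
Hypothesis wf : forall t, 0 < t -> weak_form (z t) (zt t).
(** [g0] is the value that the equation, assumed for t > 0 only, would give to the time derivative
    at 0. *)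
Hypotheses (Lg0 : L2 g0) (wf0 : weak_form (z 0) g0).

Let Y t := nrm (z t) ^+ 2.
Let Y' t := 2 * ip (zt t) (z t).
Let G t := gip (z t) (z t).
(** As Y' <= - (nu/2) G, the derivative of k Y is at most - 2 C4 G: the factor exp(k Y) cancels a
    gradient that [contraction] puts in front of |D|^2. *)
Let k := 4 * C4 / nu.

Let Lz t : 0 <= t -> L2 (z t) /\ L2 (zt t).
Proof. by move=> t0; split; [exact: reg_L2 (rz t0)|exact: Lzt]. Qed.

Let k0 : 0 <= k.
Proof. by rewrite /k divr_ge0 ?mulr_ge0// ltW. Qed.

Let Y0 t : 0 <= Y t. Proof. exact: sqr_ge0. Qed.

Let G0 t : 0 <= G t. Proof. exact: gip_self_ge0. Qed.

Lemma energy_weak_arith (a b c d e : R) : 0 <= a -> 0 <= b -> 0 <= c -> 0 <= d ->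
  3 * nu / 4 * a + (c0 / 2 + 3 * nu / 4) * b + c / 2 + (9 * c0)^-1 * d <= e -> nu / 4 * a <= e.
Proof.
move=> a0 b0 cc d0; apply: le_trans.
have h1 : 0 <= nu * a by rewrite mulr_ge0// ltW.
have h2 : 0 <= (c0 / 2 + 3 * nu / 4) * b.
  by rewrite mulr_ge0// addr_ge0// divr_ge0// ?mulr_ge0// ltW.
have h3 : 0 <= (9 * c0)^-1 * d by rewrite mulr_ge0// invr_ge0 mulr_ge0// ltW.
have e1 : 3 * nu / 4 * a = 3 / 4 * (nu * a) by field.
have e2 : nu / 4 * a = 1 / 4 * (nu * a) by field.
by rewrite e1 e2; move: (nu * a) (_ * b) (_ * d) h1 h2 h3 => x y w; lra.
Qed.

Lemma pow4_ge0 (t : R) : 0 <= t * (t * t) * t.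
Proof. by have -> : t * (t * t) * t = (t ^+ 2) ^+ 2 by [ring]; exact: sqr_ge0. Qed.

Lemma flux_parts_ge0 v : 0 <= ipb (fun x => `|u x| * v x) v /\ 0 <= ipb (fun x => v x * (v x * v x)) v.
Proof.
split; apply: ip_ge0 => x _; first by rewrite -mulrA mulr_ge0// -expr2 sqr_ge0.
exact: pow4_ge0.
Qed.

Lemma energy_derivative t : 0 < t -> Y' t <= - (nu / 2) * G t.
Proof.
move=> t0; have rt := rz (ltW t0); have [u0 q0] := flux_parts_ge0 (z t).
have := energy_weak_arith (G0 t) (sqr_ge0 _) u0 q0 (energy hOm hs c00 ru Bu rt (wf t0)).
by rewrite /Y' -/(G t); move: (G t) (ip (zt t) (z t)) => a b h; lra.
Qed.

Let dY (t : R) : 0 < t -> is_derive t 1 Y (Y' t).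
Proof. exact: (is_derive_sqr_nrm mOm Lz dz). Qed.

Let cY : Y x @[x --> 0^'+] --> Y 0.
Proof. exact: (sqr_nrm_right_continuous mOm Lz dz). Qed.

Let Y'0 t : 0 < t -> Y' t <= 0.
Proof.
move=> t0; apply: le_trans (energy_derivative t0) _.
by rewrite mulNr oppr_le0 mulr_ge0// divr_ge0// ltW.
Qed.

Lemma energy_le t : 0 <= t -> Y t <= Y 0.
Proof.
rewrite le_eqVlt => /orP[/eqP <-//|t0].
apply: (nonincreasing_from0 t0 (f' := Y')) cY.
  by move=> s /andP[s0 _]; exact: dY.
by move=> s /andP[s0 _]; exact: Y'0.
Qed.

(* The weight h in Young's inequality avoids differentiating the norm at its zero. *)
Lemma initial_rate_arith (c0' n G' g kk y' E E' I J D h : R) : 0 < h -> 0 <= E -> 0 <= c0' ->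
  E' = 2 * (I + J) -> I <= - (nu / 2) * D + c0' * (G' + g) * E -> 0 <= D -> J <= n * Num.sqrt E ->
  kk = 4 * c0' / nu -> y' <= - (nu / 2) * G' -> 0 <= kk ->
  E' + (kk * y' - (2 * c0' * g + h^-1)) * E <= h * n ^+ 2.
Proof.
move=> h0 E0 c'0 -> hI D0 hJ ek hy kk0.
have y1 : 2 * (n * Num.sqrt E) <= h * n ^+ 2 + h^-1 * E.
  have := sqr_ge0 (h * n - Num.sqrt E); rewrite sqrrB sqr_sqrtr// => hh.
  rewrite -(ler_pM2l h0) mulrDr mulVKf ?lt0r_neq0//.
  by move: hh; rewrite !expr2; lra.
have y2 : kk * y' * E <= - (2 * c0' * G') * E.
  apply: ler_wpM2r => //; apply: le_trans (ler_wpM2l kk0 hy) _.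
  by rewrite ek le_eqVlt; apply/orP; left; apply/eqP; field; exact: lt0r_neq0.
have nD : 0 <= nu / 2 * D by rewrite mulr_ge0// divr_ge0// ltW.
have e1 : (kk * y' - (2 * c0' * g + h^-1)) * E = kk * y' * E - 2 * (c0' * g * E) - h^-1 * E by ring.
have e2 : - (2 * c0' * G') * E = - 2 * (c0' * G' * E) by ring.
have e3 : c0' * (G' + g) * E = c0' * G' * E + c0' * g * E by ring.
rewrite e1; rewrite e2 in y2; rewrite e3 mulNr in hI.
move: nD hI hJ y1 y2; move: (nu / 2 * D) (c0' * G' * E) (c0' * g * E) (n * Num.sqrt E) (h * n ^+ 2) (h^-1 * E) (kk * y' * E).
by move=> *; lra.
Qed.

Let A1 := nrm g0 ^+ 2 * expR (k * Y 0 + 2 * C4 * G 0 + 1).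

Lemma exp_split (a c h n : R) :
  expR a * (h * n) * h * expR (c + 1) = h ^+ 2 * (n * expR (a + c + 1)).
Proof. by rewrite -(addrA a) (expRD a); ring. Qed.

(** The constant curve [z 0] satisfies the weak form with [g0] in place of its time derivative 0, so
    (g0, D) appears as a source for D = z - z 0. The Young weight h puts h^-1 into the exponent,
    which over [0, h] contributes only a factor e, while the source integrates to h^2 |g0|^2 times a
    constant. *)
Lemma initial_increment h : 0 < h -> h <= 1 -> nrm (fun x => z h x - z 0 x) ^+ 2 <= h ^+ 2 * A1.
Proof.
move=> h0 h1.
pose f t x := z t x - z 0 x; pose f' t x := zt t x - (fun=> 0 : R) x.
have L00 : L2 (fun=> 0) by exact: (L2_cst mOm fOm 0).
have Lc (t : R) : 0 <= t -> L2 (z 0) /\ L2 (fun=> 0) by move=> _; split; [exact: reg_L2 (rz (lexx 0))|].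
have Lf t : 0 <= t -> L2 (f t) /\ L2 (f' t).
  move=> t0; have [La Lb] := Lz t0; have [Lc0 _] := Lc _ (lexx 0).
  by split; [exact: (L2B mOm La Lc0)|exact: (L2B mOm Lb L00)].
have df : time_derivative Om f f'.
  exact: (time_derivativeB mOm Lz Lc dz (time_derivative_cst mOm (z 0))).
pose E t := nrm (f t) ^+ 2; pose E' t := 2 * ip (f' t) (f t).
pose b := 2 * C4 * G 0 + h^-1.
pose Q t := k * Y t - b * t; pose Q' t := k * Y' t - b.
have b0 : 0 <= b by rewrite /b addr_ge0 ?mulr_ge0// invr_ge0 ltW.
have dE (t : R) : 0 < t <= h -> is_derive t 1 E (E' t).
  by move=> /andP[t0 _]; exact: (is_derive_sqr_nrm mOm Lf df).
have dQ (t : R) : 0 < t <= h -> is_derive t 1 Q (Q' t).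
  move=> /andP[t0 _]; have dYt := dY t0.
  by apply: is_derive_eq; rewrite /Q' /GRing.scale/= mulr1.
have cE : E x @[x --> 0^'+] --> E 0 by exact: (sqr_nrm_right_continuous mOm Lf df).
have cQ : Q x @[x --> 0^'+] --> Q 0.
  apply: cvgB; first by apply: cvgM => //; exact: cvg_cst.
  by apply: cvgM; [exact: cvg_cst|apply: cvg_at_right_filter; exact: cvg_id].
have h2 t : 0 < t < h -> expR (Q t) * (E' t + Q' t * E t) <= expR (k * Y 0) * (h * nrm g0 ^+ 2).
  move=> /andP[t0 th]; have rt := rz (ltW t0); have rz0 := rz (lexx 0).
  have Lft := (Lf t (ltW t0)).1; have Lt := Lzt (ltW t0).
  have rD : reg (f t) by exact: (regB hOm rt rz0).
  have eE : E' t = 2 * (ip (fun x => zt t x - g0 x) (f t) + ip g0 (f t)).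
    rewrite /E' -(ipDl mOm (L2B mOm Lt Lg0) Lg0 Lft); congr (2 * _).
    by apply: eq_ip => // x _; rewrite /f' subr0 subrK.
  have hI := contraction rt rz0 Lt Lg0 (wf t0) wf0 (erefl (f t)).
  have hJ : ip g0 (f t) <= nrm g0 * Num.sqrt (E t).
    by rewrite /E sqrtr_sqr ger0_norm ?nrm_ge0//; exact: (le_ip_nrm mOm Lg0 Lft).
  have D0 : 0 <= gip (f t) (f t) + nrmb (f t) ^+ 2 by rewrite addr_ge0 ?sqr_ge0 ?gip_self_ge0.
  have := initial_rate_arith h0 (sqr_ge0 _) C40 eE hI D0 hJ (erefl k) (energy_derivative t0) k0.
  rewrite -/b -/(Q' t) -/(E t) => hh.
  apply: le_trans (ler_wpM2l (expR_ge0 _) hh) _.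
  apply: ler_wpM2r; first by rewrite mulr_ge0 ?sqr_ge0// ltW.
  rewrite ler_expR /Q.
  by rewrite lerBlDr; apply: le_trans (ler_wpM2l k0 (energy_le (ltW t0))) _; rewrite lerDl mulr_ge0// ltW.
have := exp_gronwall h0 dE dQ cE cQ h2.
rewrite {2}/E /f sqr_nrm_diff0 mul0r add0r => hE.
have e1 : 1 <= expR (Q h) * expR (2 * C4 * G 0 + 1).
  rewrite -expRD -[leLHS]expR0 ler_expR /Q /b mulrDl mulVf ?lt0r_neq0//.
  have a1 : 0 <= k * Y h by exact: mulr_ge0.
  have a2 : 2 * C4 * G 0 * h <= 2 * C4 * G 0 by rewrite ler_piMr// !mulr_ge0.
  by move: (k * Y h) (2 * C4 * G 0 * h) (2 * C4 * G 0) a1 a2 => x y v; lra.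
have Eh : 0 <= E h by exact: sqr_ge0.
apply: (@le_trans _ _ (E h * expR (Q h) * expR (2 * C4 * G 0 + 1))).
  by rewrite -mulrA ler_peMr.
apply: le_trans (ler_wpM2r (expR_ge0 _) hE) _.
by rewrite exp_split.
Qed.

Lemma decay_rate_arith (c0' Ga Gb kk ya yb D E I : R) : 0 <= E -> 0 <= kk ->
  I <= - (nu / 2) * D + c0' * (Ga + Gb) * E -> lam * E <= nu * D ->
  kk = 4 * c0' / nu -> ya <= - (nu / 2) * Ga -> yb <= - (nu / 2) * Gb ->
  2 * I + (lam + kk * (ya + yb)) * E <= 0.
Proof.
move=> E0 kk0 hI hl ek ha hb.
have y2 : kk * (ya + yb) * E <= - (2 * c0' * (Ga + Gb)) * E.
  apply: ler_wpM2r => //; apply: le_trans (ler_wpM2l kk0 (lerD ha hb)) _.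
  by rewrite ek le_eqVlt; apply/orP; left; apply/eqP; field; exact: lt0r_neq0.
have e1 : - (nu / 2) * D = - (1 / 2) * (nu * D) by field.
have e2 : - (2 * c0' * (Ga + Gb)) * E = - 2 * (c0' * (Ga + Gb) * E) by ring.
rewrite e2 in y2; rewrite e1 in hI; rewrite (mulrDl lam).
move: hI hl y2; move: (nu * D) (c0' * (Ga + Gb) * E) (lam * E) (kk * (ya + yb) * E) => *; lra.
Qed.

Let A := A1 * expR (2 * (k * Y 0)).

Lemma le_double (a b : R) : b <= a -> a + b <= 2 * a.
Proof. by move=> h; lra. Qed.

(** The exponent lam s + k (Y(s) + Y(s + h)) cancels the gradients of both solutions, and coercivity
    provides the rate lam. At s = 0 the energy part of the exponent is at most 2 k Y(0), because Y
    does not increase. *)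
Lemma increment_decay t h : 0 < t -> 0 < h -> h <= 1 ->
  nrm (fun x => z (t + h) x - z t x) ^+ 2 <= h ^+ 2 * (A * expR (- (lam * t))).
Proof.
move=> t0 h0 h1.
pose f s x := z (s + h) x - z s x; pose f' s x := zt (s + h) x - zt s x.
have Lh s : 0 <= s -> L2 (z (s + h)) /\ L2 (zt (s + h)) by move=> s0; apply: Lz; rewrite addr_ge0// ltW.
have Lf s : 0 <= s -> L2 (f s) /\ L2 (f' s).
  move=> s0; have [La Lb] := Lz s0; have [Lc Ld] := Lh s s0.
  by split; [exact: (L2B mOm Lc La)|exact: (L2B mOm Ld Lb)].
have dzh := time_derivative_shift (ltW h0) dz.
have df : time_derivative Om f f' by exact: (time_derivativeB mOm Lh Lz dzh dz).
pose E s := nrm (f s) ^+ 2; pose E' s := 2 * ip (f' s) (f s).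
pose Yh s := nrm (z (s + h)) ^+ 2; pose Yh' s := 2 * ip (zt (s + h)) (z (s + h)).
pose Q s := lam * s + k * (Y s + Yh s); pose Q' s := lam + k * (Y' s + Yh' s).
have dE (s : R) : 0 < s <= t -> is_derive s 1 E (E' s).
  by move=> /andP[s0 _]; exact: (is_derive_sqr_nrm mOm Lf df).
have dQ (s : R) : 0 < s <= t -> is_derive s 1 Q (Q' s).
  move=> /andP[s0 _]; have dYs := dY s0.
  have dYh : is_derive s 1 Yh (Yh' s) by exact: (is_derive_sqr_nrm mOm Lh dzh).
  by apply: is_derive_eq; rewrite /Q' /GRing.scale/= mulr1.
have cE : E x @[x --> 0^'+] --> E 0 by exact: (sqr_nrm_right_continuous mOm Lf df).
have cYh : Yh x @[x --> 0^'+] --> Yh 0 by exact: (sqr_nrm_right_continuous mOm Lh dzh).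
have cQ : Q x @[x --> 0^'+] --> Q 0.
  apply: cvgD; first by apply: cvgM; [exact: cvg_cst|apply: cvg_at_right_filter; exact: cvg_id].
  by apply: cvgM; [exact: cvg_cst|exact: cvgD].
have h2 s : 0 < s < t -> expR (Q s) * (E' s + Q' s * E s) <= 0.
  move=> /andP[s0 st]; have sh0 : 0 < s + h by exact: addr_gt0.
  have rs := rz (ltW s0); have rsh := rz (ltW sh0).
  have rD : reg (f s) by exact: (regB hOm rsh rs).
  have hI := contraction rsh rs (Lzt (ltW sh0)) (Lzt (ltW s0)) (wf sh0) (wf s0) (erefl (f s)).
  have := decay_rate_arith (sqr_ge0 _) k0 hI (coercive rD) (erefl k) (energy_derivative sh0) (energy_derivative s0).
  rewrite (addrC (Y' (s + h))) -[Y' (s + h)]/(Yh' s) -/(Q' s) -/(E s) -/(E' s) => hh.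
  by rewrite mulr_ge0_le0// expR_ge0.
have := exp_gronwall t0 dE dQ cE cQ h2; rewrite mul0r addr0 => hE.
have E0 : E 0 <= h ^+ 2 * A1 by rewrite /E /f add0r; exact: initial_increment.
have Q0 : Q 0 <= 2 * (k * Y 0).
  have := ler_wpM2l k0 (energy_le (ltW h0)); rewrite /Q /Yh mulr0 add0r add0r -/(Y h) mulrDr.
  exact: le_double.
have Qt : lam * t <= Q t by rewrite /Q lerDl mulr_ge0// addr_ge0// sqr_ge0.
have hE2 : E t * expR (lam * t) <= h ^+ 2 * A.
  apply: le_trans (ler_wpM2l (sqr_ge0 _) _) (le_trans hE _); first by rewrite ler_expR.
  by rewrite /A (mulrA (h ^+ 2)); apply: (ler_pM (sqr_ge0 _) (expR_ge0 _) E0); rewrite ler_expR.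
rewrite mulrA expRN -[leLHS]/(E t) ler_pdivlMr ?expR_gt0//.
Qed.

Lemma le_of_le_eps (x y : R) : (forall e, 0 < e -> x <= y + e) -> x <= y.
Proof. by move=> h; apply/ler_addgt0Pr => e e0; exact: h. Qed.

Lemma quotient_le_sqrt (h n b : R) : 0 < h -> 0 <= n -> 0 <= b -> n ^+ 2 <= h ^+ 2 * b -> `|h^-1| * n <= Num.sqrt b.
Proof.
move=> h0 n0 b0; rewrite (mulrC (h ^+ 2)) => /(le_sqrt_mul n0 (ltW h0) b0) hn.
rewrite ger0_norm; last by rewrite invr_ge0 ltW.
by rewrite -(ler_pM2l h0) mulVKf ?lt0r_neq0// (mulrC h).
Qed.

(** For small h the increment divided by h is within [e] of [zt t] in L^2, and the bound for it does
    not depend on h. *)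
Lemma rate_decay t : 0 < t -> nrm (zt t) ^+ 2 <= A * expR (- (lam * t)).
Proof.
move=> t0; set B := A * _.
have A10 : 0 <= A1 by rewrite mulr_ge0 ?sqr_ge0 ?expR_ge0.
have B0 : 0 <= B by exact: (mulr_ge0 (mulr_ge0 A10 (expR_ge0 _)) (expR_ge0 _)).
suff h : nrm (zt t) <= Num.sqrt B.
  by rewrite -(sqr_sqrtr B0); apply: lerXn2r; rewrite ?nnegrE ?nrm_ge0 ?sqrtr_ge0.
apply: le_of_le_eps => e e0.
have hp : \forall h \near (0 : R)^'+, 0 < h by exact: nbhs_right_gt.
have h1 : \forall h \near (0 : R)^'+, h < 1 by exact: nbhs_right_lt.
have hd : \forall h \near (0 : R)^'+, 0 <= t + h ->
  nrm (fun x => h^-1 * (z (t + h) x - z t x) - zt t x) < e.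
  have := dz (ltW t0) e0.
  by rewrite !near_withinE; apply: filterS => x hx x0; apply: hx; exact: lt0r_neq0.
have [h [h0 hh1 hh]] : exists h, [/\ 0 < h, h < 1 & 0 <= t + h ->
  nrm (fun x => h^-1 * (z (t + h) x - z t x) - zt t x) < e].
  have : \forall h \near (0 : R)^'+, [/\ 0 < h, h < 1 & 0 <= t + h ->
    nrm (fun x => h^-1 * (z (t + h) x - z t x) - zt t x) < e].
    by apply: filterS3 hp h1 hd => h a b c; split.
  by move=> /filter_ex.
have th : 0 <= t + h by rewrite addr_ge0// ltW.
have [La Lb] := Lz (ltW t0); have [Lc _] := Lz th.
have LD := L2B mOm Lc La; have Lq := L2Z mOm h^-1 LD.
have hq := hh th.
have hn : nrm (fun x => h^-1 * (z (t + h) x - z t x)) <= Num.sqrt B.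
  rewrite (nrmZ mOm h^-1 LD); apply: (quotient_le_sqrt h0 (nrm_ge0 _ _ _) B0).
  exact: (increment_decay t0 h0 (ltW hh1)).
have := ler_nrm_dist mOm Lq Lb; have := ler_norm (nrm (zt t) - nrm (fun x => h^-1 * (z (t + h) x - z t x))).
rewrite distrC; move: hq hn; move: (nrm _) (nrm _) (nrm _) => a b c.
by move=> *; lra.
Qed.

End Decay.

(* No measurability of f: s |-> |lap (w s)| is not known to be measurable. *)
Lemma ge0_le_integral_pointwise d (T : measurableType d) (R : realType)
    (mu : {measure set T -> \bar R}) (D : set T) (f g : T -> \bar R) :
  (forall x, D x -> (0 <= f x)%E) -> (forall x, D x -> (f x <= g x)%E) ->
  (\int[mu]_(x in D) f x <= \int[mu]_(x in D) g x)%E.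
Proof.
move=> f0 fg; have g0 x : D x -> (0 <= g x)%E by move=> Dx; exact: le_trans (f0 x Dx) (fg x Dx).
rewrite !ge0_integralE//; apply: le_ereal_sup => _ [h hf <-]; exists h => // x.
by apply: le_trans (hf x) _; apply: lee_restrict.
Qed.

(** * Constants of the final estimate *)

Section FinalEstimates.
Context {R : realType}.
Variables (nu c0 CF C3 C4 : R).
Hypotheses (nu0 : 0 < nu) (c00 : 0 < c0) (CF0 : 0 < CF) (C30 : 0 <= C3) (C40 : 0 <= C4).

(** The ratio between |z| + |d_0 z| + |d_1 z| and |w_t|; the factor 3 comes from squaring a sum of
    three terms. *)
Definition size_const : R := Num.sqrt (3 * ((2 * CF / nu) ^+ 2 + 8 * CF / nu ^+ 2)).

(** A bound for e^(lam t) |w_t|^2 in terms of the H^3 norm [m] of the initial value: the squared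
    norm of the initial force times the exponentials of [initial_increment] and
    [increment_decay]. *)
Definition rate_const (m : R) : R := (3 * nu * m + C3 * (3 * m + (3 * m) ^+ 3)) ^+ 2 *
  expR (4 * C4 / nu * m ^+ 2 + 2 * C4 * (2 * m ^+ 2) + 1) * expR (2 * (4 * C4 / nu * m ^+ 2)).

(** The summand 4 m^2 covers s = 0, where the Laplacian is bounded by the initial value and not
    through w_t. *)
Definition laplacian_const (m : R) : R :=
  (2 / nu * (1 + C3 * size_const * (1 + size_const ^+ 2 * rate_const m))) ^+ 2 * rate_const m + 4 * m ^+ 2.

Definition decay_const (m : R) : R :=
  8 * CF / nu ^+ 2 * rate_const m + nu * (laplacian_const m * (2 * CF / nu)).

Lemma rate_const_ge0 m : 0 <= rate_const m.
Proof. exact: (mulr_ge0 (mulr_ge0 (sqr_ge0 _) (expR_ge0 _)) (expR_ge0 _)). Qed.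

Lemma laplacian_const_ge0 m : 0 <= laplacian_const m.
Proof. exact: (addr_ge0 (mulr_ge0 (sqr_ge0 _) (rate_const_ge0 _)) (mulr_ge0 (ler0n _ 4) (sqr_ge0 _))). Qed.

(** lam y^2 <= nu (G + T) <= 2 a y makes [y] linear in [a]. Put back into the energy inequality,
    this makes the remaining terms quadratic in [a], so that they decay like |w_t|^2. *)
Lemma energy_bound (lam G T U Q a y e : R) : 0 <= G -> 0 <= T -> 0 <= U -> 0 <= Q -> 0 <= a -> 0 <= y ->
  3 * nu / 4 * G + (c0 / 2 + 3 * nu / 4) * T + U / 2 + (9 * c0)^-1 * Q <= e -> e <= a * y ->
  lam * y ^+ 2 <= nu * (G + T) -> nu / CF <= lam ->
  y <= 2 * CF / nu * a /\
  G + ((c0 + nu) / nu * T + 2 / nu * U) + (9 * nu * c0)^-1 * Q <= 8 * CF / nu ^+ 2 * a ^+ 2.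
Proof.
move=> G0 T0 U0 Q0 a0 y0 h1 h2 h3 h4.
have nG : 0 <= nu * G by rewrite mulr_ge0// ltW.
have nT : 0 <= nu * T by rewrite mulr_ge0// ltW.
have cT : 0 <= c0 * T by rewrite mulr_ge0// ltW.
have q0 : 0 <= (9 * c0)^-1 * Q by rewrite mulr_ge0// invr_ge0 mulr_ge0// ltW.
have h : 3 / 4 * (nu * G) + (1 / 2 * (c0 * T) + 3 / 4 * (nu * T)) + U / 2 + (9 * c0)^-1 * Q <= a * y.
  apply: le_trans h2; apply: le_trans h1; rewrite le_eqVlt; apply/orP; left; apply/eqP; field; exact: lt0r_neq0.
have l1 : nu / CF * y ^+ 2 <= 2 * (a * y).
  apply: le_trans (ler_wpM2r (sqr_ge0 _) h4) _; apply: le_trans h3 _; rewrite mulrDr.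
  by move: (nu * G) (nu * T) (c0 * T) ((9 * c0)^-1 * Q) (a * y) nG nT cT q0 h => *; lra.
have hy : y <= 2 * CF / nu * a.
  have [->|yn] := eqVneq y 0; first by rewrite mulr_ge0// divr_ge0 ?mulr_ge0// ltW.
  have yp : 0 < y by rewrite lt0r yn.
  rewrite -(ler_pM2r yp) -(ler_pM2l (divr_gt0 nu0 CF0)) -expr2; apply: le_trans l1 _.
  rewrite le_eqVlt; apply/orP; left; apply/eqP; field; by rewrite !lt0r_neq0.
split => //.
have s1 : nu * (G + ((c0 + nu) / nu * T + 2 / nu * U) + (9 * nu * c0)^-1 * Q) <= 4 * (a * y).
  have -> : nu * (G + ((c0 + nu) / nu * T + 2 / nu * U) + (9 * nu * c0)^-1 * Q) =
    nu * G + (c0 * T + nu * T) + 2 * U + (9 * c0)^-1 * Q by field; rewrite !lt0r_neq0.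
  by move: (nu * G) (nu * T) (c0 * T) ((9 * c0)^-1 * Q) (a * y) nG nT cT q0 h => *; lra.
rewrite -(ler_pM2l nu0); apply: le_trans s1 _.
have -> : nu * (8 * CF / nu ^+ 2 * a ^+ 2) = 4 * (a * (2 * CF / nu * a)) by field; exact: lt0r_neq0.
by rewrite ler_pM2l//; exact: ler_wpM2l.
Qed.

Lemma size_bound (y h0 h1 a : R) : 0 <= y -> 0 <= h0 -> 0 <= h1 -> 0 <= a -> y <= 2 * CF / nu * a ->
  h0 ^+ 2 + h1 ^+ 2 <= 8 * CF / nu ^+ 2 * a ^+ 2 -> y + h0 + h1 <= size_const * a.
Proof.
move=> y0 h00 h10 a0 hy hh; apply: le_sqrt_mul; rewrite ?addr_ge0//.
  by rewrite mulr_ge0// addr_ge0 ?sqr_ge0// divr_ge0 ?sqr_ge0// mulr_ge0// ltW.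
have h3 : (y + h0 + h1) ^+ 2 <= 3 * (y ^+ 2 + (h0 ^+ 2 + h1 ^+ 2)).
  rewrite -subr_ge0 (_ : _ - _ = (y - h0) ^+ 2 + (y - h1) ^+ 2 + (h0 - h1) ^+ 2); last by ring.
  by rewrite !addr_ge0 ?sqr_ge0.
apply: le_trans h3 _; rewrite -mulrA ler_pM2l// mulrDl; apply: lerD => //.
by rewrite -exprMn; apply: lerXn2r => //; rewrite nnegrE ?mulr_ge0 ?invr_ge0 ?mulr_ge0// ltW.
Qed.

(** The uniform bound [A] of a^2 turns the cube of [H] into a term linear in [a], so that the
    Laplacian inherits the decay rate of w_t. *)
Lemma laplacian_bound (n a H A : R) : 0 <= n -> 0 <= a -> 0 <= H -> H <= size_const * a -> a ^+ 2 <= A ->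
  nu / 2 * n <= a + C3 * (H + H ^+ 3) ->
  n ^+ 2 <= (2 / nu * (1 + C3 * size_const * (1 + size_const ^+ 2 * A))) ^+ 2 * a ^+ 2.
Proof.
move=> n0 a0 H0 hH hA hn; have p0 : 0 <= size_const by exact: sqrtr_ge0.
have H3 : H ^+ 3 <= size_const * a * (size_const ^+ 2 * A).
  rewrite exprS; apply: ler_pM => //; first exact: sqr_ge0.
  apply: (@le_trans _ _ ((size_const * a) ^+ 2)).
    by apply: lerXn2r; rewrite ?nnegrE ?mulr_ge0.
  by rewrite exprMn; apply: ler_wpM2l => //; exact: sqr_ge0.
have A0 : 0 <= A by apply: le_trans hA; exact: sqr_ge0.
rewrite -exprMn; apply: lerXn2r; rewrite ?nnegrE//.
  by rewrite !mulr_ge0 ?invr_ge0 ?addr_ge0 ?mulr_ge0 ?sqr_ge0// ?addr_ge0 ?mulr_ge0 ?sqr_ge0// ltW.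
have n2 : 0 < nu / 2 by rewrite divr_gt0.
rewrite -(ler_pM2l n2); apply: le_trans hn _.
have -> : nu / 2 * (2 / nu * (1 + C3 * size_const * (1 + size_const ^+ 2 * A)) * a) =
  a + C3 * (size_const * a + size_const * a * (size_const ^+ 2 * A)) by field; exact: lt0r_neq0.
by rewrite lerD2l; apply: ler_wpM2l => //; exact: lerD.
Qed.

Lemma rate_bound (m g y G l H : R) : 0 <= m -> 0 <= g -> 0 <= y -> 0 <= l -> 0 <= H ->
  g <= 3 / 2 * nu * l + C3 * (H + H ^+ 3) -> l <= 2 * m -> H <= 3 * m -> y <= m -> G <= 2 * m ^+ 2 ->
  g ^+ 2 * expR (4 * C4 / nu * y ^+ 2 + 2 * C4 * G + 1) * expR (2 * (4 * C4 / nu * y ^+ 2)) <= rate_const m.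
Proof.
move=> m0 g0 y0 l0 H0 hg hl hH hy hG.
have k0 : 0 <= 4 * C4 / nu by rewrite divr_ge0 ?mulr_ge0// ltW.
have y2 : 4 * C4 / nu * y ^+ 2 <= 4 * C4 / nu * m ^+ 2.
  by apply: ler_wpM2l => //; apply: lerXn2r; rewrite ?nnegrE.
have G2 : 2 * C4 * G <= 2 * C4 * (2 * m ^+ 2) by apply: ler_wpM2l; rewrite ?mulr_ge0.
have g2 : g ^+ 2 <= (3 * nu * m + C3 * (3 * m + (3 * m) ^+ 3)) ^+ 2.
  apply: lerXn2r; rewrite ?nnegrE//.
    by rewrite !addr_ge0 ?mulr_ge0 ?addr_ge0 ?exprn_ge0 ?mulr_ge0// ltW.
  apply: le_trans hg _; apply: lerD.
    have -> : 3 * nu * m = 3 / 2 * nu * (2 * m) by field.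
    by apply: ler_wpM2l => //; rewrite mulr_ge0// ltW.
  by apply: ler_wpM2l => //; apply: lerD => //; apply: lerXn2r; rewrite ?nnegrE ?mulr_ge0.
apply: ler_pM; rewrite ?expR_ge0 ?mulr_ge0 ?sqr_ge0 ?expR_ge0//.
  by apply: ler_pM; rewrite ?expR_ge0 ?sqr_ge0// ler_expR lerD2r; exact: lerD.
by rewrite ler_expR ler_pM2l.
Qed.

(** The gap between lam and 2 alpha leaves an exponential that is integrable over all times, so the
    time integral of the weighted Laplacian is bounded uniformly in t. *)
Lemma exp_rate (lam alpha s : R) : 0 <= s -> 2 * alpha + nu / (2 * CF) <= lam ->
  expR (alpha * s) ^+ 2 * expR (- (lam * s)) <= expR (- (nu / (2 * CF) * s)).
Proof.
move=> s0 h; rewrite expr2 -!expRD ler_expR.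
move: (nu / (2 * CF)) h => k h; have := ler_wpM2r s0 h.
have -> : (2 * alpha + k) * s = 2 * (alpha * s) + k * s by ring.
by move: (alpha * s) (k * s) (lam * s) => x y z; lra.
Qed.

Lemma exp_integral_le (k t M : R) : 0 < k -> 0 < t -> 0 <= M ->
  (\int[lebesgue_measure]_(s in `[0%R, t]) (M * expR (- (k * s)))%:E <= (M * k^-1)%:E)%E.
Proof.
move=> k0 t0 M0.
pose F s := - (M * k^-1) * expR (- (k * s)).
have dF (s : R) : is_derive s 1 F (M * expR (- (k * s))).
  have de : is_derive s 1 (expR \o (fun s => - (k * s))) (expR (- (k * s)) * - k).
    by apply: is_derive1_comp; apply: is_derive_eq; rewrite /GRing.scale/= mulr1.
  by apply: is_derive_eq; rewrite /GRing.scale/=; field; exact: lt0r_neq0.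
have cf : continuous (fun s => M * expR (- (k * s))).
  move=> s; apply: cvgM; first exact: cvg_cst.
  apply: (@continuous_comp _ _ _ (fun s => - (k * s)) expR); last exact: continuous_expR.
  by apply: cvgN; apply: cvgM; [exact: cvg_cst|exact: cvg_id].
rewrite (FTC_itv t0 dF cf) lee_fin /F mulr0 oppr0 expR0 mulr1 opprK mulNr.
by rewrite gerDr oppr_le0 !mulr_ge0 ?expR_ge0// invr_ge0 ltW.
Qed.

End FinalEstimates.

Section HNorm.
Context {R : realType} (Om : set (R * R)).
Notation nrm := (nrm (leb2 R) Om).
Notation wD := (wD Om).
Local Opaque Defs.wD Defs.ip Defs.nrm.

Lemma le_sum_multi_index (F : nat -> nat -> R) m k j : (forall k j, 0 <= F k j) -> (k < m)%N -> (j < k.+1)%N ->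
  F k j <= \sum_(k < m) \sum_(j < k.+1) F k j.
Proof.
move=> F0 hk hj; rewrite (bigD1 (Ordinal hk))//= (bigD1 (Ordinal hj))//= -addrA lerDl.
by rewrite addr_ge0// ?sumr_ge0// => i _; rewrite ?sumr_ge0.
Qed.

Lemma nrm_le_hnorm m k j f : (k < m.+1)%N -> (j < k.+1)%N ->
  nrm (iter j (wD 0) (iter (k - j) (wD 1) f)) <= hnorm Om m f.
Proof.
move=> hk hj; rewrite -[leLHS]ger0_norm ?nrm_ge0// -sqrtr_sqr ler_wsqrtr//.
exact: (@le_sum_multi_index (fun k j => nrm (iter j (wD 0) (iter (k - j) (wD 1) f)) ^+ 2) _ _ _ (fun _ _ => sqr_ge0 _) hk hj).
Qed.

End HNorm.

(** * The closed-loop solution *)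

Section ClosedLoop.
Context {R : realType} (Om : set (R * R)) (sigma : {measure set (plane R) -> \bar R}).
Hypothesis hOm : smooth_bounded_domain Om.
Hypothesis hs : arclength_measure Om sigma.
Notation leb := (leb2 R).
Notation L2 := (L2 leb Om).
Notation ip := (ip leb Om).
Notation nrm := (nrm leb Om).
Notation ipb := (Defs.ip sigma (bd Om)).
Notation nrmb := (Defs.nrm sigma (bd Om)).
Notation aeq := (aeq leb Om).
Notation wD := (wD Om).
Notation gip := (gip Om).
Notation gnrm := (gnrm Om).
Notation Btri := (Btri Om).
Notation lap := (lap Om).
Notation reg := (reg Om).
Local Opaque Defs.wD Defs.ip Defs.nrm.

Let oOm : open Om. Proof. by case: hOm. Qed.
Let bOm : bounded_set Om. Proof. by case: hOm. Qed.
Let mOm : measurable (Om : set (plane R)). Proof. exact: measurable_dom. Qed.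
Let fOm : (leb Om < +oo)%E. Proof. exact: finite_dom. Qed.

Variables (nu c0 CF0 C3 C4 : R) (u : R * R -> R).
Hypotheses (nu0 : 0 < nu) (c00 : 0 < c0) (ru : reg u) (C30 : 0 <= C3) (C40 : 0 <= C4).
Hypothesis Bu : forall z, reg z -> Btri u z z <= nu / 4 * (gip z z + nrmb z ^+ 2).
Hypothesis hCF0 : friedrichs_constant Om sigma CF0.
Notation weak_form := (weak_form Om sigma nu c0 u).
Notation green_form := (green_form Om sigma nu c0 u).
Notation convection := (convection Om u).
Hypothesis convection_le : forall z l, reg z -> L2 l -> green_form z l ->
  nrm (convection z) <= nu / 2 * nrm l + C3 * (size1 Om z + size1 Om z ^+ 3).
Hypothesis contraction : forall z1 z2 g1 g2 D,
  reg z1 -> reg z2 -> L2 g1 -> L2 g2 -> weak_form z1 g1 -> weak_form z2 g2 ->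
  D = (fun x => z1 x - z2 x) ->
  ip (fun x => g1 x - g2 x) D <= - (nu / 2) * (gip D D + nrmb D ^+ 2) + C4 * (gip z1 z1 + gip z2 z2) * nrm D ^+ 2.

Variables (U w0 : R * R -> R) (CF alpha : R) (w wt z : R -> R * R -> R).
Hypotheses (HU : Hm Om 1 U) (Uu : aeq U u) (hCF : friedrichs_constant Om sigma CF).
Hypotheses (H2w0 : Hm Om 2 w0) (hn : normal_derivative Om sigma w0 (feedback Om sigma nu c0 U w0)).
Hypotheses (hw : weak_solution Om sigma nu c0 U w0 w wt) (H2w : forall t, 0 <= t -> Hm Om 2 (w t)).
Hypotheses (al : alpha <= (2 * CF)^-1 * (nu / 2)).
Hypothesis rz : forall t, 0 <= t -> reg (z t).
Hypothesis wz : forall t, 0 <= t -> aeq (w t) (z t).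

(* The final constant may not depend on CF, hence the fixed Friedrichs constant CF0. *)
Let lam := nu / Num.min CF CF0.
Let m := hnorm Om 3 w0.
Let CF00 : 0 < CF0. Proof. by case: hCF0. Qed.
Let CFp : 0 < CF. Proof. by case: hCF. Qed.
Let minp : 0 < Num.min CF CF0. Proof. by rewrite lt_min CFp CF00. Qed.
Let m0 : 0 <= m. Proof. exact: sqrtr_ge0. Qed.

Let Lwt t : 0 <= t -> L2 (wt t).
Proof. by move=> t0; have [h _ _ _] := hw; exact: (h t t0).2. Qed.

Let dz : time_derivative Om z wt.
Proof.
have [_ dw _ _] := hw; move=> t t0 e e0; apply: filterS (dw t t0 e e0) => h hh th.
have Lz s (s0 : 0 <= s) := reg_L2 (rz s0); have Lw s (s0 : 0 <= s) := H1_L2 (H2_H1 (H2w s0)).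
have -> : nrm (fun x => h^-1 * (z (t + h) x - z t x) - wt t x) = nrm (fun x => h^-1 * (w (t + h) x - w t x) - wt t x).
  apply: (aeq_nrm mOm).
  - exact: (L2B mOm (L2Z mOm _ (L2B mOm (Lz _ th) (Lz _ t0))) (Lwt t0)).
  - exact: (L2B mOm (L2Z mOm _ (L2B mOm (Lw _ th) (Lw _ t0))) (Lwt t0)).
  - by apply: filterS2 (wz th) (wz t0) => x h1 h2 Ox; rewrite h1// h2.
exact: hh.
Qed.

Let wf t : 0 < t -> weak_form (z t) (wt t).
Proof.
move=> t0; have [_ _ _ h] := hw.
exact: (weak_form_trace hOm hs HU ru Uu (H2_H1 (H2w (ltW t0))) (rz (ltW t0)) (wz (ltW t0)) (h t t0)).
Qed.

Let w0z : aeq w0 (z 0).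
Proof.
have [_ _ h _] := hw.
by apply: filterS2 h (wz (lexx 0)) => x h1 h2 Ox; rewrite -h1// h2.
Qed.

Let lam_ge : nu / CF0 <= lam.
Proof. by apply: ler_wpM2l; [exact: ltW|rewrite lef_pV2 ?posrE// ge_min lexx orbT]. Qed.

(** The bound on alpha gives 2 alpha <= nu/(2 CF). Both this quantity and nu/(2 CF0) are at most
    lam/2, because lam is built on the smaller of the two constants. *)
Let lam_alpha : 2 * alpha + nu / (2 * CF0) <= lam.
Proof.
have h1 : 2 * alpha <= nu / (2 * CF).
  apply: le_trans (ler_wpM2l _ al) _ => //.
  by rewrite le_eqVlt; apply/orP; left; apply/eqP; field; exact: lt0r_neq0.
have half (c : R) : 0 < c -> Num.min CF CF0 <= c -> nu / (2 * c) <= lam / 2.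
  move=> cp hc; have -> : nu / (2 * c) = nu / c / 2 by field; exact: lt0r_neq0.
  by rewrite ler_pM2r// /lam ler_pM2l// lef_pV2.
have h2 := half CF CFp (_ : _ <= _); have h3 := half CF0 CF00 (_ : _ <= _).
rewrite (splitr lam); apply: lerD.
  by apply: le_trans h1 (h2 _); rewrite ge_min lexx.
by apply: h3; rewrite ge_min lexx orbT.
Qed.

Let coercive v : reg v -> lam * nrm v ^+ 2 <= nu * (gip v v + nrmb v ^+ 2).
Proof.
move=> rv; rewrite /lam -mulrA ler_pM2l// mulrC ler_pdivrMr// mulrC.
by rewrite /Num.min; case: ifP => _; exact: friedrichs_reg.
Qed.

Let gE v : gip v v = nrm (wD 0 v) ^+ 2 + nrm (wD 1 v) ^+ 2.
Proof. exact: (etrans (esym (sqr_gnrm _ _)) (sqr_gnrmE _ _)). Qed.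

Lemma sum2_le (a b d : R) : a <= d -> b <= d -> a + b <= 2 * d.
Proof. by move=> *; lra. Qed.

Lemma initial_norms : [/\ nrm (z 0) <= m, nrm (wD 0 (z 0)) <= m, nrm (wD 1 (z 0)) <= m & nrm (lap w0) <= 2 * m].
Proof.
have Hw0 := H2_H1 H2w0; have Lz := reg_L2 (rz (lexx 0)).
have e i : nrm (wD i (z 0)) = nrm (wD i w0).
  apply: (aeq_nrm mOm (reg_L2wD i (rz (lexx 0))) (H1_L2wD i Hw0)).
  exact: (aeq_sym (wD_congr hOm i Hw0 Lz w0z)).
have e' : nrm (z 0) = nrm w0 by exact: (aeq_nrm mOm Lz (H1_L2 Hw0) (aeq_sym w0z)).
have L i : L2 (wD i (wD i w0)) by apply: H1_L2wD; exact: H2_wD.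
split; [rewrite e'|rewrite (e 0)|rewrite (e 1)|].
- exact: (@nrm_le_hnorm R Om 3 0 0 w0).
- exact: (@nrm_le_hnorm R Om 3 1 1 w0).
- exact: (@nrm_le_hnorm R Om 3 1 0 w0).
- rewrite lapE; apply: le_trans (ler_nrmD mOm (L 0) (L 1)) _.
  have h0 : nrm (wD 0 (wD 0 w0)) <= m by exact: (@nrm_le_hnorm R Om 3 2 2 w0).
  have h1 : nrm (wD 1 (wD 1 w0)) <= m by exact: (@nrm_le_hnorm R Om 3 2 0 w0).
  exact: sum2_le.
Qed.

Lemma sqr_sum_le_double (a b c : R) : 0 <= a -> 0 <= b -> a <= c -> b <= c -> a ^+ 2 + b ^+ 2 <= 2 * c ^+ 2.
Proof.
move=> a0 b0 ac bc; have c0' := le_trans a0 ac; rewrite mulr_natl mulr2n.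
by apply: lerD; apply: lerXn2r; rewrite ?nnegrE.
Qed.

Lemma sum3_le (a b c d : R) : a <= d -> b <= d -> c <= d -> a + b + c <= 3 * d.
Proof. by move=> *; lra. Qed.

Lemma split_rate (g a b p : R) : g <= nu * a + b -> b <= nu / 2 * a + p -> g <= 3 / 2 * nu * a + p.
Proof.
move=> h1 h2; apply: le_trans h1 _; have -> : 3 / 2 * nu * a + p = nu * a + (nu / 2 * a + p) by field.
by rewrite lerD2l.
Qed.

(** The initial force is nu l0 minus the convection, with l0 the Laplacian of [w0] in the
    compatibility condition. [convection_le] bounds it by norms of [w0]. *)
Lemma rate_le : exists2 l0, L2 l0 & green_form (z 0) l0 /\
  forall t, 0 < t -> nrm (wt t) ^+ 2 <= rate_const nu C3 C4 m * expR (- (lam * t)).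
Proof.
have Hw0 := H2_H1 H2w0; have rz0 := rz (lexx 0).
have [l0 Ll0 gf] := normal_derivative_green hOm hs HU ru Uu Hw0 rz0 w0z hn.
exists l0 => //; split => // t t0.
have Lc := L2_convection hOm ru rz0.
pose g0 x := nu * l0 x - convection (z 0) x.
have Lg0 : L2 g0 by exact: (L2B mOm (L2Z mOm nu Ll0) Lc).
have wf0 : weak_form (z 0) g0 by exact: (green_weak hOm nu0 ru rz0 Ll0 gf).
have [n1 n2 n3 n4] := initial_norms.
have el : nrm l0 = nrm (lap w0).
  exact: (aeq_nrm mOm Ll0 (L2_lap hOm H2w0) (aeq_sym (lap_green_form hOm H2w0 rz0 w0z Ll0 gf))).
have hg : nrm g0 <= nu * nrm l0 + nrm (convection (z 0)).
  apply: le_trans (ler_nrmB mOm (L2Z mOm nu Ll0) Lc) _.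
  by rewrite (nrmZ mOm nu Ll0) (gtr0_norm nu0).
have hg' := split_rate hg (convection_le rz0 Ll0 gf).
have hl : nrm l0 <= 2 * m by rewrite el.
have hG : gip (z 0) (z 0) <= 2 * m ^+ 2.
  rewrite gE; exact: (sqr_sum_le_double (nrm_ge0 _ _ _) (nrm_ge0 _ _ _) n2 n3).
have s0 : 0 <= size1 Om (z 0) by exact: (addr_ge0 (addr_ge0 (nrm_ge0 _ _ _) (nrm_ge0 _ _ _)) (nrm_ge0 _ _ _)).
apply: le_trans (rate_decay hOm hs nu0 c00 ru C40 Bu coercive contraction rz Lwt dz wf Lg0 wf0 t0) _.
apply: ler_wpM2r; first exact: expR_ge0.
exact: (rate_bound nu0 C30 C40 m0 (nrm_ge0 _ _ _) (nrm_ge0 _ _ _) (nrm_ge0 _ _ _) s0 hg' hl (sum3_le n1 n2 n3) n1 hG).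
Qed.

Lemma decay_bounds t : 0 < t ->
  gip (z t) (z t) + ((c0 + nu) / nu * nrmb (z t) ^+ 2 + 2 / nu * ipb (fun x => `|u x| * z t x) (z t))
    + (9 * nu * c0)^-1 * ipb (fun x => z t x * (z t x * z t x)) (z t) <= 8 * CF0 / nu ^+ 2 * nrm (wt t) ^+ 2 /\
  size1 Om (z t) <= size_const nu CF0 * nrm (wt t).
Proof.
move=> t0; have rt := rz (ltW t0); have [u0 q0] := flux_parts_ge0 Om sigma u (z t).
have e1 := energy hOm hs c00 ru Bu rt (wf t0).
have e2 : - ip (wt t) (z t) <= nrm (wt t) * nrm (z t).
  have := cauchy_schwarz mOm (Lwt (ltW t0)) (reg_L2 rt); rewrite ler_norml => /andP[k _].
  by rewrite lerNl.
have [h1 h2] := energy_bound nu0 c00 CF00 (gip_self_ge0 _ _) (sqr_ge0 _) u0 q0 (nrm_ge0 _ _ _) (nrm_ge0 _ _ _) e1 e2 (coercive rt) lam_ge.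
split => //; apply: (size_bound nu0 CF00 (nrm_ge0 _ _ _) (nrm_ge0 _ _ _) (nrm_ge0 _ _ _) (nrm_ge0 _ _ _) h1).
rewrite -gE; apply: le_trans h2; rewrite -addrA lerDl.
have p1 : 0 <= (c0 + nu) / nu by rewrite divr_ge0// ?addr_ge0// ltW.
have p2 : 0 <= 2 / nu by rewrite divr_ge0// ltW.
have p3 : 0 <= (9 * nu * c0)^-1 by rewrite invr_ge0 !mulr_ge0// ltW.
exact: (addr_ge0 (addr_ge0 (mulr_ge0 p1 (sqr_ge0 _)) (mulr_ge0 p2 u0)) (mulr_ge0 p3 q0)).
Qed.

(** The bound of the convection contains nu/2 times the Laplacian, half of what stands on the
    left. *)
Lemma half_bound (n a b h : R) : n = nu^-1 * b -> b <= a + (nu / 2 * n + h) -> nu / 2 * n <= a + h.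
Proof.
move=> en hb; have e : nu / 2 * n + nu / 2 * n = b by rewrite en; field; exact: lt0r_neq0.
by move: e hb; move: (nu / 2 * n) => x; lra.
Qed.

Lemma laplacian_decay s : 0 <= s ->
  expR (alpha * s) ^+ 2 * nrm (lap (w s)) ^+ 2 <=
    laplacian_const nu CF0 C3 C4 m * expR (- (nu / (2 * CF0) * s)).
Proof.
have [l0 Ll0 [gf hr]] := rate_le; have [n1 n2 n3 n4] := initial_norms.
(* The equation is assumed for t > 0 only; at time 0 the Laplacian is that of [w0]. *)
rewrite le_eqVlt => /orP[/eqP <-|s0].
  rewrite !mulr0 oppr0 expR0 mulr1 expr1n mul1r.
  have rz0 := rz (lexx 0).
  have e1 := lap_green_form hOm (H2w (lexx 0)) rz0 (wz (lexx 0)) Ll0 gf.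
  have e2 := lap_green_form hOm H2w0 rz0 w0z Ll0 gf.
  rewrite (aeq_nrm mOm (L2_lap hOm (H2w (lexx 0))) (L2_lap hOm H2w0) (aeq_trans e1 (aeq_sym e2))).
  apply: (@le_trans _ _ ((2 * m) ^+ 2)); first by apply: lerXn2r; rewrite ?nnegrE ?nrm_ge0 ?mulr_ge0.
  rewrite /laplacian_const exprMn -(natrX _ 2 2) lerDr.
  exact: (mulr_ge0 (sqr_ge0 _) (rate_const_ge0 _ _ _ _)).
have rs := rz (ltW s0); have Ls := Lwt (ltW s0); have Lc := L2_convection hOm ru rs.
have gs := weak_green hOm nu0 ru rs Ls (wf s0); set l := (fun x => _) in gs.
have Ll : L2 l by exact: (L2Z mOm _ (L2D mOm Ls Lc)).
rewrite (aeq_nrm mOm (L2_lap hOm (H2w (ltW s0))) Ll (lap_green_form hOm (H2w (ltW s0)) rs (wz (ltW s0)) Ll gs)).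
have el : nrm l = nu^-1 * nrm (fun x => wt s x + convection (z s) x).
  by rewrite (nrmZ mOm nu^-1 (L2D mOm Ls Lc)) ger0_norm// invr_ge0 ltW.
have hb : nrm (fun x => wt s x + convection (z s) x) <=
    nrm (wt s) + (nu / 2 * nrm l + C3 * (size1 Om (z s) + size1 Om (z s) ^+ 3)).
  exact: (le_trans (ler_nrmD mOm Ls Lc) (lerD (lexx _) (convection_le rs Ll gs))).
have h := half_bound el hb; have hrs := hr s s0; have [_ hsz] := decay_bounds s0.
have s1 : 0 <= size1 Om (z s) by exact: (addr_ge0 (addr_ge0 (nrm_ge0 _ _ _) (nrm_ge0 _ _ _)) (nrm_ge0 _ _ _)).
have lam0 : 0 <= lam by rewrite divr_ge0// ltW.
have hA : nrm (wt s) ^+ 2 <= rate_const nu C3 C4 m.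
  apply: le_trans hrs _; rewrite -[leRHS]mulr1; apply: ler_wpM2l; first exact: rate_const_ge0.
  by rewrite -[leRHS]expR0 ler_expR oppr_le0; exact: (mulr_ge0 lam0 (ltW s0)).
have hl := laplacian_bound nu0 C30 (nrm_ge0 _ _ _) (nrm_ge0 _ _ _) s1 hsz hA h.
have hl' : nrm l ^+ 2 <= laplacian_const nu CF0 C3 C4 m * expR (- (lam * s)).
  apply: le_trans hl _; apply: le_trans (ler_wpM2l (sqr_ge0 _) hrs) _.
  by rewrite mulrA; apply: ler_wpM2r; [exact: expR_ge0|rewrite /laplacian_const lerDl mulr_ge0// sqr_ge0].
apply: le_trans (ler_wpM2l (sqr_ge0 _) hl') _; rewrite mulrCA.
by apply: ler_wpM2l; [exact: laplacian_const_ge0|exact: (exp_rate (ltW s0) lam_alpha)].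
Qed.

Lemma closed_loop_decay t : 0 < t ->
  ((gnrm (w t) ^+ 2)%:E
   + \int[sigma]_(x in bd Om) ((c0 + nu + 2 * `|tr Om sigma U x|) / nu * tr Om sigma (w t) x ^+ 2)%:E
   + ((9 * nu * c0)^-1)%:E * \int[sigma]_(x in bd Om) (tr Om sigma (w t) x ^+ 4)%:E
   + (nu * expR (- (2 * alpha * t)))%:E
     * \int[lebesgue_measure]_(s in `[0%R, t]) (nrm (fun x => expR (alpha * s) * lap (w s) x) ^+ 2)%:E
   <= (decay_const nu CF0 C3 C4 m * expR (- (2 * alpha * t)))%:E)%E.
Proof.
move=> t0; have Hw := H2_H1 (H2w (ltW t0)); have rt := rz (ltW t0); have wzt := wz (ltW t0).
have [l0 _ [_ hr]] := rate_le; have [hS _] := decay_bounds t0.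
rewrite (integral_trace_sqr hOm hs nu c0 HU ru Uu Hw rt wzt) (integral_trace_pow4 hOm hs Hw rt wzt).
rewrite (gnrm_aeq hOm Hw (reg_H1 rt) wzt) sqr_gnrm.
have k0 : 0 < nu / (2 * CF0) by rewrite divr_gt0// mulr_gt0.
have M0 := laplacian_const_ge0 nu CF0 C3 C4 m.
have hI : (\int[lebesgue_measure]_(s in `[0%R, t]) (nrm (fun x => expR (alpha * s) * lap (w s) x) ^+ 2)%:E
    <= (laplacian_const nu CF0 C3 C4 m * (2 * CF0 / nu))%:E)%E.
  rewrite -(invf_div nu (2 * CF0)).
  apply: le_trans _ (exp_integral_le k0 t0 M0).
  apply: ge0_le_integral_pointwise => s; first by rewrite lee_fin sqr_ge0.
  rewrite /= in_itv/= => /andP[s0 _]; rewrite lee_fin.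
  by rewrite (nrmZ mOm _ (L2_lap hOm (H2w s0))) (ger0_norm (expR_ge0 _)) exprMn; exact: laplacian_decay.
have e0 : 0 <= nu * expR (- (2 * alpha * t)) by rewrite mulr_ge0 ?expR_ge0// ltW.
have lea : 2 * alpha <= lam.
  by apply: le_trans lam_alpha; rewrite lerDl ltW.
have hwt : nrm (wt t) ^+ 2 <= rate_const nu C3 C4 m * expR (- (2 * alpha * t)).
  apply: le_trans (hr t t0) _; apply: ler_wpM2l; first exact: rate_const_ge0.
  by rewrite ler_expR lerN2; apply: ler_wpM2r; [exact: ltW|exact: lea].
have cf : 0 <= 8 * CF0 / nu ^+ 2 by rewrite divr_ge0 ?sqr_ge0// mulr_ge0// ltW.
have hS' := le_trans hS (ler_wpM2l cf hwt).
apply: (@le_trans _ _ (((8 * CF0 / nu ^+ 2) * (rate_const nu C3 C4 m * expR (- (2 * alpha * t))))%:E +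
  (nu * expR (- (2 * alpha * t)))%:E * (laplacian_const nu CF0 C3 C4 m * (2 * CF0 / nu))%:E)%E).
  by apply: leeD; [exact: hS'|apply: lee_wpmul2l; [rewrite lee_fin|exact: hI]].
rewrite -EFinM -EFinD lee_fin le_eqVlt; apply/orP; left; apply/eqP; rewrite /decay_const.
by move: (rate_const _ _ _ _) (laplacian_const _ _ _ _ _) (expR _) => a b c; ring.
Qed.

End ClosedLoop.

(** * Independence of the constant from the steady state and from Friedrichs's constant *)

Lemma H3_H2 (R : realType) (Om : set (R * R)) v : Hm Om 3 v -> Hm Om 2 v.
Proof.
move=> [Lv h]; split => // i; have [g [wg Hg]] := h i.
by exists g; split => //; exact: H2_H1.
Qed.

(** The constants obtained so far depend on a steady state and a Friedrichs constant. By excluded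
    middle both are fixed once for the given [nu] and [f]; any admissible steady state equals the
    fixed one almost everywhere, and another Friedrichs constant changes only the rate lam. *)
Lemma closed_loop_constant (R : realType) (Om : set (R * R))
    (sigma : {measure set (plane R) -> \bar R}) (c0 nu : R) (f : R * R -> R) :
  smooth_bounded_domain Om -> arclength_measure Om sigma -> 0 < c0 ->
  exists K : R -> R, forall (CF : R) (u w0 : R * R -> R) (w wt : R -> R * R -> R) (alpha : R),
      0 < nu ->
      friedrichs_constant Om sigma CF ->
      steady_state Om nu f u ->
      ((gnrm Om u)%:E <= nu%:E / (4%:E * Nconst Om sigma))%E ->
      Hm Om 3 w0 ->
      assumption_A2 Om sigma nu c0 f u w0 w wt ->
      alpha <= (2 * CF)^-1 * (nu / 2) ->
      forall t, 0 < t ->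
        ((gnrm Om (w t) ^+ 2)%:E
         + \int[sigma]_(x in bd Om)
             ((c0 + nu + 2 * `|tr Om sigma u x|) / nu
              * tr Om sigma (w t) x ^+ 2)%:E
         + ((9 * nu * c0)^-1)%:E
           * \int[sigma]_(x in bd Om) (tr Om sigma (w t) x ^+ 4)%:E
         + (nu * expR (- (2 * alpha * t)))%:E
           * \int[lebesgue_measure]_(s in `[0%R, t])
               (nrm (leb2 R) Om (fun x => expR (alpha * s) * lap Om (w s) x) ^+ 2)%:E
         <= (K (hnorm Om 3 w0) * expR (- (2 * alpha * t)))%:E)%E.
Proof.
move=> hOm hs c00; have [oOm _ bOm _] := hOm.
pose P (p : (R * R -> R) * R) := [/\ 0 < nu, steady_state Om nu f p.1, Hm Om 2 p.1,
  ((gnrm Om p.1)%:E <= nu%:E / (4%:E * Nconst Om sigma))%E & friedrichs_constant Om sigma p.2].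
have [[[u0 CF0] [nu0 S0 H0 N0 F0]]|nP] := pselect (exists p, P p); last first.
  (* No admissible data exist, so any function will do. *)
  exists (fun=> 0) => CF u w0 w wt alpha nu0 hCF hS hN H3 [[H2u _] _ _ _ _].
  by exfalso; apply: nP; exists (u, CF).
have [ub [rb eb Sb gb]] := steady_reg hOm hs S0 H0.
have H2b : Hm Om 2 ub by exact: (Hm_aeq oOm bOm (reg_L2 rb) eb H0).
have Nb : ((gnrm Om ub)%:E <= nu%:E / (4%:E * Nconst Om sigma))%E by rewrite gb.
have Bu z (rz : reg Om z) := steady_tri hOm hs nu0 rb Sb.1 Nb rz.
have [C3 C30 h3] := convection_bound hOm hs nu0 c00 rb H2b.
have [C4 C40 h4] := difference_decay hOm hs nu0 c00 rb Bu F0.1 (fun z rz => friedrichs_reg hOm hs F0 rz).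
exists (decay_const nu CF0 C3 C4) => CF u w0 w wt alpha _ hCF hS hN H3 [[H2u _] hn _ [hw _] [H2w _ _]] al t t0.
have [u' [ru' eu' Su' gu']] := steady_reg hOm hs hS H2u.
have Nu' : ((gnrm Om u')%:E <= nu%:E / (4%:E * Nconst Om sigma))%E by rewrite gu'.
(* Uniqueness replaces the given steady state by the reference one, on which the constants were
   built. *)
have Uu := aeq_trans eu' (steady_unique hOm hs nu0 ru' rb Su' Sb Nu' Nb).
have [z hz] : exists z : R -> R * R -> R, forall t, 0 <= t -> reg Om (z t) /\ aeq (leb2 R) Om (w t) (z t).
  suff /choice[z hz] : forall t : R, exists zb, 0 <= t -> reg Om zb /\ aeq (leb2 R) Om (w t) zb by exists z.
  move=> s; case: (leP 0 s) => [s0|_]; last by exists (fun=> 0).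
  have [zb [rz ez]] := H2_reg hOm hs (H2w s s0).1.
  by exists zb => _; exact: (conj rz ez).
exact: (closed_loop_decay hOm hs nu0 c00 rb C30 C40 Bu F0 h3 h4 (H2_H1 H2u) Uu hCF (H3_H2 H3) hn hw
  (fun t t0 => (H2w t t0).1) al (fun t t0 => (hz t t0).1) (fun t t0 => (hz t t0).2) t0).
Qed.

Theorem lemma3p2 (R : realType) (Om : set (R * R))
    (sigma : {measure set (plane R) -> \bar R}) (c0 : R)
    (hOm : smooth_bounded_domain Om) (hsigma : arclength_measure Om sigma)
    (hc0 : 0 < c0) :
  exists C : R -> R -> (R * R -> R) -> R,
    (forall m nu f, 0 < C m nu f) /\
    forall (nu CF : R) (f u w0 : R * R -> R) (w wt : R -> R * R -> R) (alpha : R),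
      0 < nu ->
      friedrichs_constant Om sigma CF ->
      assumption_A1 Om sigma nu f ->
      steady_state Om nu f u ->
      ((gnrm Om u)%:E <= nu%:E / (4%:E * Nconst Om sigma))%E ->
      Hm Om 1 w0 -> Hm Om 3 w0 ->
      assumption_A2 Om sigma nu c0 f u w0 w wt ->
      0 <= alpha -> alpha <= (2 * CF)^-1 * Num.min (nu / 2) (c0 + 7 * nu / 4) ->
      forall t, 0 < t ->
        ((gnrm Om (w t) ^+ 2)%:E
         + \int[sigma]_(x in bd Om)
             ((c0 + nu + 2 * `|tr Om sigma u x|) / nu
              * tr Om sigma (w t) x ^+ 2)%:E
         + ((9 * nu * c0)^-1)%:E
           * \int[sigma]_(x in bd Om) (tr Om sigma (w t) x ^+ 4)%:E
         + (nu * expR (- (2 * alpha * t)))%:E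
           * \int[lebesgue_measure]_(s in `[0%R, t])
               (nrm (leb2 R) Om (fun x => expR (alpha * s) * lap Om (w s) x) ^+ 2)%:E
         <= (C (hnorm Om 3 w0) nu f * expR (C (hnorm Om 3 w0) nu f)
             * expR (- (2 * alpha * t)))%:E)%E.
Proof.
(* One function of the norm of the initial value for each pair (nu, f). Positivity of nu is a
   premise behind the existential, so the choice can range over all pairs. *)
have [K hK] := choice (fun p : R * (R * R -> R) => closed_loop_constant p.1 p.2 hOm hsigma hc0).
have C0 m nu f : 0 < `|K (nu, f) m| + 1 by rewrite ltr_wpDl.
exists (fun m nu f => `|K (nu, f) m| + 1); split => // nu CF f u w0 w wt alpha nu0 hCF _ hS hN _ H3 A2 _ al t t0.
have al' : alpha <= (2 * CF)^-1 * (nu / 2).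
  apply: le_trans al _; apply: ler_wpM2l; last by rewrite ge_min lexx.
  by rewrite invr_ge0 mulr_ge0// ltW//; case: hCF.
apply: le_trans (hK (nu, f) CF u w0 w wt alpha nu0 hCF hS hN H3 A2 al' t t0) _.
rewrite lee_fin ler_wpM2r ?expR_ge0//.
set c := K _ _; have cp : 0 < `|c| + 1 by rewrite ltr_wpDl.
(* With C = |c| + 1, positive by construction: c <= C <= C e^C, as e^C > 1. *)
apply: le_trans (ler_norm c) _; apply: (@le_trans _ _ (`|c| + 1)); first by rewrite lerDl.
by rewrite ler_peMr ?ltW// expR_gt1.
Qed.
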